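(* Let $(A,\mathfrak{m})$ be an unmixed Noetherian local ring of dimension $d$ and let $M$ be a finitely generated $A$-module. Assume that $\operatorname{rank} M = r \geq 1$. If $\mu_n(\mathfrak{m}, M) \leq 1$ for some $n \geq d$, then $\operatorname{injdim}_A M < \infty$, $A$ is Cohen-Macaulay, and $A_P$ is Gorenstein for all $P \in \operatorname{Min}(A)$.
   Context: A Noetherian local ring $A$ is unmixed if $\dim \widehat{A}/Q = \dim \widehat{A}$ for all associated primes $Q$ of the completion $\widehat{A}$ of $A$. The $n$-th Bass number of $M$ with respect to $\mathfrak{m}$ is $\mu_n(\mathfrak{m},M) = \dim_{A/\mathfrak{m}} \operatorname{Ext}^n_A(A/\mathfrak{m}, M)$. A finitely generated $A$-module $M$ has rank $r$ if $M_P \cong A_P^r$ for every $P \in \operatorname{Ass}(A)$. $\operatorname{Min}(A)$ is the set of minimal primes of $A$, and $\operatorname{injdim}$ denotes injective dimension. *)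

(* Defs.v *)
From HB Require Import structures.
From mathcomp Require Import all_boot all_order all_algebra.
From mathcomp Require Import boolp classical_sets functions.
From mathcomp.multinomials Require Import freeg.
From mathcomp Require Import ring.

Set Implicit Arguments.
Unset Strict Implicit.
Unset Printing Implicit Defensive.

Import GRing.Theory.
Local Open Scope ring_scope.
Local Open Scope quotient_scope.

Local Notation "{ 'quot' I }" := (@Quotient.quot _ I).

(* The structures [idealr] and [prime_idealr] of ring_quotient.v, used for
   ideals and prime ideals below, only contain proper ideals. *)

Section Submodule.
Variables (R : comNzRingType) (V : lmodType R) (W : submodClosed V).

Record submod := Submod { submod_val : V; submod_valP : submod_val \in W }.

HB.instance Definition _ := [isSub for submod_val].
HB.instance Definition _ := [Choice of submod by <:].
HB.instance Definition _ := [SubChoice_isSubLmodule of submod by <:].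

Definition quot_pred : {pred V} := fun x => x \in W.

Fact quot_pred_closed : zmod_closed quot_pred.
Proof. exact: GRing.submod_closedB (submodClosedP W). Qed.
HB.instance Definition _ := GRing.isZmodClosed.Build V quot_pred quot_pred_closed.

Definition quotmod := {quot quot_pred}.

HB.instance Definition _ := GRing.Zmodule.on quotmod.

Definition pi_quot (x : V) : quotmod := \pi_({quot quot_pred}) x.

Lemma pi_quot_repr (x : quotmod) : pi_quot (repr x) = x.
Proof. exact: reprK. Qed.

Lemma pi_quotD : {morph pi_quot : x y / x + y}.
Proof. by move=> x y; rewrite /pi_quot raddfD. Qed.

Lemma pi_quot_eq (x y : V) : pi_quot x = pi_quot y <-> x - y \in W.
Proof.
rewrite -[x - y \in W]/(x - y \in quot_pred) Quotient.idealrBE.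
by split=> /eqP.
Qed.

Definition quotmod_scale (a : R) (x : quotmod) : quotmod :=
  pi_quot (a *: repr x).

Lemma quotmod_scale_pi a x : quotmod_scale a (pi_quot x) = pi_quot (a *: x).
Proof.
apply/pi_quot_eq; rewrite -scalerBr rpredZ //.
by apply/pi_quot_eq; rewrite pi_quot_repr.
Qed.

Fact quotmod_scaleA a b x :
  quotmod_scale a (quotmod_scale b x) = quotmod_scale (a * b) x.
Proof. by rewrite -[x]pi_quot_repr !quotmod_scale_pi scalerA. Qed.

Fact quotmod_scale1 : left_id 1 quotmod_scale.
Proof.
by move=> x; rewrite -[x]pi_quot_repr quotmod_scale_pi scale1r.
Qed.

Fact quotmod_scaleDr : right_distributive quotmod_scale +%R.
Proof.
move=> a x y; rewrite -[x]pi_quot_repr -[y]pi_quot_repr.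
by rewrite -pi_quotD !quotmod_scale_pi scalerDr pi_quotD.
Qed.

Fact quotmod_scaleDl x : {morph quotmod_scale^~ x : a b / a + b}.
Proof.
move=> a b; rewrite -[x]pi_quot_repr !quotmod_scale_pi scalerDl.
by rewrite pi_quotD.
Qed.

HB.instance Definition _ := GRing.Zmodule_isLmodule.Build R quotmod
  quotmod_scaleA quotmod_scale1 quotmod_scaleDr quotmod_scaleDl.

End Submodule.

Section Kernel.
Variables (R : comNzRingType) (U V : lmodType R) (f : {linear U -> V}).

Definition kernel : {pred U} := fun x => f x == 0.

Fact kernel_submod : submod_closed kernel.
Proof.
split=> [|a x y]; rewrite !unfold_in ?linear0 //.
by move=> /eqP fx /eqP fy; rewrite linearP fx fy scaler0 addr0.
Qed.
HB.instance Definition _ := GRing.isSubmodClosed.Build R U kernel kernel_submod.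
End Kernel.

Section IdealModule.
Variables (R : comNzRingType) (I : idealr R).

Definition ideal_submod : {pred R^o} := fun x => x \in I.

Fact ideal_submod_closed : submod_closed ideal_submod.
Proof.
split=> [|a x y xI yI]; first exact: idealr0.
by apply: (rpredD (S := I)) => //; apply: idealMr.
Qed.
HB.instance Definition _ :=
  GRing.isSubmodClosed.Build R R^o ideal_submod ideal_submod_closed.

Definition residue_module : lmodType R := quotmod ideal_submod.
End IdealModule.

Definition spans (R : comNzRingType) (V : lmodType R) n (v : 'I_n -> V) (x : V) :=
  exists c : 'I_n -> R, x = \sum_i c i *: v i.

Definition fin_gen (R : comNzRingType) (V : lmodType R) :=
  exists n (v : 'I_n -> V), forall x, spans v x.

(* Only proper ideals are quantified over; the unit ideal is generated by 1. *)
Definition noetherian (R : comNzRingType) :=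
  forall I : idealr R,
    exists n (v : 'I_n -> R^o), forall x : R, x \in I <-> spans v x.

Definition maximal_ideal (R : comNzRingType) (I : idealr R) :=
  forall J : idealr R, {subset I <= J} -> {subset J <= I}.

Definition local_ring (R : comNzRingType) (m : idealr R) :=
  forall I : idealr R, maximal_ideal I <-> I =i m.

Definition minimal_prime (R : comNzRingType) (P : prime_idealr R) :=
  forall Q : prime_idealr R, {subset Q <= P} -> {subset P <= Q}.

Definition associated_prime (R : comNzRingType) (P : prime_idealr R) :=
  exists x : R, forall a : R, a \in P <-> a * x = 0.

Definition is_greatest (S : set nat) (n : nat) :=
  S n /\ forall k, S k -> (k <= n)%N.

(* None stands for infinity; only used for nonempty sets. *)
Definition nat_sup (S : set nat) : option nat :=
  if pselect (exists n, is_greatest S n) is left ex then Some (projT1 (cid ex))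
  else None.

Definition prime_chain (R : comNzRingType) (n : nat) :=
  exists P : nat -> prime_idealr R, forall i, (i < n)%N ->
    {subset P i <= P i.+1} /\ ~ {subset P i.+1 <= P i}.

Definition krull_dim (R : comNzRingType) : option nat :=
  nat_sup (prime_chain R).

(* [a 0], ..., [a n.-1] is a regular sequence of elements of [m]; as [m] is
   proper, R / (a 0, ..., a n.-1) is automatically nonzero. *)
Definition regular_sequence (R : comNzRingType) (m : idealr R) n (a : nat -> R) :=
  forall i, (i < n)%N -> a i \in m /\
    forall x : R, spans (fun j : 'I_i => a j : R^o) (a i * x) ->
      spans (fun j : 'I_i => a j : R^o) x.

Definition depth (R : comNzRingType) (m : idealr R) : option nat :=
  nat_sup (fun n => exists a, regular_sequence m n a).

Definition cohen_macaulay (R : comNzRingType) :=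
  exists m : idealr R,
    [/\ noetherian R, local_ring m & depth m = krull_dim R].

Definition injective_module (R : comNzRingType) (E : lmodType R) :=
  forall (U V : lmodType R) (i : {linear U -> V}) (f : {linear U -> E}),
    injective i -> exists g : {linear V -> E}, forall x, g (i x) = f x.

(* An injective resolution 0 -> V -> E 0 -> ... -> E n -> 0 *)
Definition injdim_le (R : comNzRingType) (V : lmodType R) (n : nat) :=
  exists (E : nat -> lmodType R) (d : forall i, {linear E i -> E i.+1})
         (eta : {linear V -> E 0}),
  [/\ forall i, injective_module (E i),
      forall i, (n < i)%N -> forall x : E i, x = 0,
      injective eta,
      forall x : E 0, d 0 x = 0 <-> exists y, x = eta y &
      forall i (x : E i.+1), d i.+1 x = 0 <-> exists y, x = d i y].

Definition finite_injdim (R : comNzRingType) (V : lmodType R) :=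
  exists n, injdim_le V n.

Definition gorenstein (R : comNzRingType) :=
  exists m : idealr R, [/\ noetherian R, local_ring m & finite_injdim R^o].

Section Completion.
Variables (R : comNzRingType) (I : idealr R).

Fixpoint ideal_pow (n : nat) (x : R) : Prop :=
  if n is n'.+1 then
    exists k (a b : 'I_k -> R),
      [/\ forall i, a i \in I, forall i, ideal_pow n' (b i)
        & x = \sum_i a i * b i]
  else True.

Lemma ideal_pow0 n : ideal_pow n 0.
Proof.
case: n => //= n; exists 0%N, (fun=> 0), (fun=> 0).
by split; [case|case|rewrite big_ord0].
Qed.

Lemma ideal_powM n c x : ideal_pow n x -> ideal_pow n (c * x).
Proof.
case: n => //= n [k [a [b [aI bI ->]]]].
exists k, (fun i => c * a i), b; split=> // [i|]; first exact: idealMr.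
by rewrite mulr_sumr; apply: eq_bigr => i _; rewrite mulrA.
Qed.

Lemma ideal_powD n x y : ideal_pow n x -> ideal_pow n y -> ideal_pow n (x + y).
Proof.
case: n => //= n [k [a [b [aI bI ->]]]] [l [a' [b' [aI' bI' ->]]]].
exists (k + l)%N,
  (fun i : 'I_(k + l) => match fintype.split i with inl j => a j | inr j => a' j end),
  (fun i : 'I_(k + l) => match fintype.split i with inl j => b j | inr j => b' j end).
split=> [i|i|]; [by case: (fintype.split i)|by case: (fintype.split i)|].
rewrite big_split_ord /=; congr (_ + _); apply: eq_bigr => i _.
  by rewrite -[lshift l i]/(unsplit (inl i)) unsplitK.
by rewrite -[rshift k i]/(unsplit (inr i)) unsplitK.
Qed.

Lemma ideal_powB n x y : ideal_pow n x -> ideal_pow n y -> ideal_pow n (x - y).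
Proof. by move=> xI yI; rewrite -mulN1r; apply/ideal_powD/ideal_powM. Qed.

Lemma ideal_pow1 x : ideal_pow 1 x -> x \in I.
Proof.
move=> [k [a [b [aI _ ->]]]]; apply: rpred_sum => i _.
by rewrite mulrC idealMr.
Qed.

(* The completion is the inverse limit of the R / I ^ n. Its elements are
   represented by sequences (u n) of lifts: u n is a lift of the component in
   R / I ^ n, and two sequences are identified when all components agree. *)
Definition coherent : {pred nat -> R} :=
  fun u => `[< forall n, ideal_pow n (u n.+1 - u n) >].

Fact coherent_subring : subring_closed coherent.
Proof.
split=> [|u v|u v]; rewrite !unfold_in.
- by apply/asboolP => n; rewrite subrr; apply: ideal_pow0.
- move=> /asboolP uc /asboolP vc; apply/asboolP => n /=.
  rewrite [X in ideal_pow _ X](_ : _ = (u n.+1 - u n) - (v n.+1 - v n)).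
    exact: ideal_powB.
  by rewrite !fctE; ring.
- move=> /asboolP uc /asboolP vc; apply/asboolP => n /=.
  rewrite [X in ideal_pow _ X](_ : _ =
    u n.+1 * (v n.+1 - v n) + v n * (u n.+1 - u n)).
    by apply: ideal_powD; apply: ideal_powM.
  by rewrite !fctE; ring.
Qed.
HB.instance Definition _ :=
  GRing.isSubringClosed.Build (nat -> R) coherent coherent_subring.

Record coherent_seq :=
  CoherentSeq { seq_val : nat -> R; _ : seq_val \in coherent }.

HB.instance Definition _ := [isSub for seq_val].
HB.instance Definition _ := [Choice of coherent_seq by <:].
HB.instance Definition _ := [SubChoice_isSubComNzRing of coherent_seq by <:].

Definition null_seq : {pred coherent_seq} :=
  fun u => `[< forall n, ideal_pow n (val u n) >].

Fact null_seq_ideal : idealr_closed null_seq.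
Proof.
split=> [||c u v]; rewrite !unfold_in.
- by apply/asboolP => n; rewrite raddf0; apply: ideal_pow0.
- apply/negP => /asboolP /(_ 1%N) /ideal_pow1.
  by rewrite rmorph1 idealr1.
- move=> /asboolP u0 /asboolP v0; apply/asboolP => n.
  by rewrite rmorphD rmorphM; apply: ideal_powD => //; apply: ideal_powM.
Qed.
HB.instance Definition _ :=
  isIdealr.Build coherent_seq null_seq null_seq_ideal.

Definition completion : comNzRingType := {ideal_quot null_seq}.
End Completion.

Definition unmixed (R : comNzRingType) (m : idealr R) :=
  forall Q : prime_idealr (completion m), associated_prime Q ->
    krull_dim {ideal_quot Q} = krull_dim (completion m).

Section Ext.
Variable R : comNzRingType.

Definition freemod (N : lmodType R) : lmodType R := {freeg N / R}.

Definition augmentation (N : lmodType R) (x : freemod N) : N := fglift id x.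

Fact augmentation_additive N : zmod_morphism (@augmentation N).
Proof. exact: lift_is_additive. Qed.
HB.instance Definition _ N :=
  GRing.isZmodMorphism.Build (freemod N) N (@augmentation N)
    (@augmentation_additive N).

Fact augmentation_scalable N : scalable (@augmentation N).
Proof.
move=> a x; rewrite -[in RHS](freeg_sumE x) -[a *: x]/(fgscale a x) /fgscale.
rewrite !raddf_sum /=.
by apply: eq_bigr => k _; rewrite /augmentation !liftU scalerA.
Qed.
HB.instance Definition _ N :=
  GRing.isScalable.Build R (freemod N) N *:%R (@augmentation N)
    (@augmentation_scalable N).

(* The standard free resolution of N:
   syzygy 0 = N, and 0 -> syzygy n.+1 -> freemod (syzygy n) -> syzygy n -> 0. *)
Fixpoint syzygy (N : lmodType R) (n : nat) : lmodType R :=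
  if n is n'.+1 then submod (kernel (@augmentation (syzygy N n'))) else N.

Definition resol (N : lmodType R) (n : nat) : lmodType R :=
  freemod (syzygy N n).

Definition resol_diff (N : lmodType R) (n : nat) (x : resol N n.+1) :
  resol N n := submod_val (augmentation x).

Variables (N M : lmodType R).

(* Kernel and image in degree n of the complex Hom (resol N _, M) *)
Definition cocycle (n : nat) : {pred resol N n -> M} :=
  fun f => `[< linear f /\ f \o @resol_diff N n = 0 >].

Fact cocycle_submod n : submod_closed (@cocycle n).
Proof.
split=> [|a f g]; rewrite !unfold_in.
  apply/asboolP; split=> //.
  by move=> a x y; rewrite -[LHS]/(0 : M) -[RHS]/(a *: 0 + 0 : M) scaler0 addr0.
move=> /asboolP[fl fd] /asboolP[gl gd]; apply/asboolP.
have E z : (a *: f + g) z = a *: f z + g z by [].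
split=> [b x y|].
  by rewrite !E fl gl !scalerDr !scalerA [b * a]mulrC addrACA.
apply/funext => x; rewrite [LHS]E.
move/(congr1 (@^~ x)): fd => /= ->; move/(congr1 (@^~ x)): gd => /= ->.
exact: (etrans (addr0 _) (scaler0 _ _)).
Qed.
HB.instance Definition _ n :=
  GRing.isSubmodClosed.Build R (resol N n -> M) (@cocycle n) (cocycle_submod n).

Definition coboundary (n : nat) : {pred submod (@cocycle n)} :=
  match n return {pred submod (@cocycle n)} with
  | 0 => fun f => f == 0
  | n'.+1 => fun f =>
      `[< exists g : {linear resol N n' -> M},
            submod_val f = g \o @resol_diff N n' >]
  end.

Fact coboundary_submod n : submod_closed (@coboundary n).
Proof.
case: n => [|n]; split=> [|a f g]; rewrite !unfold_in //=.
- by move=> /eqP-> /eqP->; rewrite scaler0 addr0.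
- apply/asboolP; exists \0; exact/funext.
- move=> /asboolP[u fu] /asboolP[v gv]; apply/asboolP.
  exists (a \*: u \+ v); apply/funext => x.
  by rewrite [LHS](_ : _ = (a *: submod_val f + submod_val g) x) ?fu ?gv.
Qed.
HB.instance Definition _ n :=
  GRing.isSubmodClosed.Build R (submod (@cocycle n)) (@coboundary n)
    (coboundary_submod n).

Definition Ext (n : nat) : lmodType R := quotmod (@coboundary n).
End Ext.

(* [e] is a basis of V over R / m, where V is a module annihilated by m; the
   scalars are written by means of representatives in R. *)
Definition residue_basis (R : comNzRingType) (m : idealr R) (V : lmodType R) t
    (e : 'I_t -> V) :=
  (forall x, spans e x) /\
  (forall c : 'I_t -> R, \sum_i c i *: e i = 0 <-> forall i, c i \in m).

(* [bass_number m M n t]: the n-th Bass number of M with respect to m is t *)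
Definition bass_number (R : comNzRingType) (m : idealr R) (M : lmodType R)
    (n t : nat) :=
  exists e : 'I_t -> Ext (residue_module m) M n, residue_basis m e.

Section Localization.
Variables (R : comNzRingType) (P : prime_idealr R).

Record denom := Denom { denom_val : R; denomP : denom_val \notin P }.

HB.instance Definition _ := [isSub for denom_val].
HB.instance Definition _ := [Choice of denom by <:].

Local Coercion denom_val : denom >-> GRing.ComNzRing.sort.

Fact denom1_subproof : 1 \notin P. Proof. by rewrite idealr1. Qed.
Definition denom1 := Denom denom1_subproof.

Fact denomM_subproof (s t : denom) : denom_val s * denom_val t \notin P.
Proof. by rewrite prime_idealrM negb_or !denomP. Qed.
Definition denomM s t := Denom (denomM_subproof s t).

Lemma denomME s t :
  denom_val (denomM s t) = denom_val s * denom_val t.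
Proof. by []. Qed.

Lemma denom_neq0 s : denom_val s != 0.
Proof. by apply: contraNneq (denomP s) => ->; rewrite rpred0. Qed.

Section LocModule.
Variable V : lmodType R.

(* x / s = y / t iff u (t x) = u (s y) for some u outside P *)
Definition frac_eq (p q : V * denom) : bool :=
  `[< exists u : denom,
        denom_val u *: (denom_val q.2 *: p.1)
        = denom_val u *: (denom_val p.2 *: q.1) >].

Fact frac_eq_equiv : equiv_class_of frac_eq.
Proof.
split=> [[x s]|[x s] [y t]|[y t] [x s] [z r]]; rewrite /frac_eq /=.
- by apply/asboolP; exists denom1.
- by apply/asboolP/asboolP => -[u e]; exists u.
- move=> /asboolP[u e] /asboolP[v f]; apply/asboolP.
  exists (denomM (denomM u v) t) => /=.
  have -> : denom_val u * denom_val v * denom_val t *: (denom_val r *: x) =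
    (denom_val v * denom_val r) *: (denom_val u *: (denom_val t *: x)).
    by rewrite !scalerA; congr (_ *: _); ring.
  rewrite e.
  have -> : (denom_val v * denom_val r) *: (denom_val u *: (denom_val s *: y))
    = (denom_val u * denom_val s) *: (denom_val v *: (denom_val r *: y)).
    by rewrite !scalerA; congr (_ *: _); ring.
  by rewrite f !scalerA; congr (_ *: _); ring.
Qed.

Canonical frac_equiv := EquivRelPack frac_eq_equiv.
Canonical frac_encModRel := defaultEncModRel frac_eq.

Definition loc_module := {eq_quot frac_eq}.

HB.instance Definition _ : EqQuotient _ frac_eq loc_module :=
  EqQuotient.on loc_module.
HB.instance Definition _ := Choice.on loc_module.

Definition frac (x : V) (s : denom) : loc_module := \pi_(loc_module) (x, s).

Lemma fracP a : {xs : V * denom | a = frac xs.1 xs.2}.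
Proof. by exists (repr a); rewrite /frac -surjective_pairing reprK. Qed.

Lemma frac_eqP x s y t : frac x s = frac y t <->
  exists u : denom, denom_val u *: (denom_val t *: x)
                    = denom_val u *: (denom_val s *: y).
Proof.
by split=> [/eqmodP/asboolP|?] //; apply/eqmodP/asboolP.
Qed.

Definition loc_add (a b : loc_module) : loc_module :=
  let: (x, s) := repr a in let: (y, t) := repr b in
  frac (denom_val t *: x + denom_val s *: y) (denomM s t).

Definition loc_opp (a : loc_module) : loc_module :=
  let: (x, s) := repr a in frac (- x) s.

Lemma loc_addE x s y t : loc_add (frac x s) (frac y t)
  = frac (denom_val t *: x + denom_val s *: y) (denomM s t).
Proof.
rewrite /loc_add; case E: (repr (frac x s)) => [x' s'].
case F: (repr (frac y t)) => [y' t'].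
have /frac_eqP[u e] : frac x s = frac x' s' by rewrite -[LHS]reprK E.
have /frac_eqP[v f] : frac y t = frac y' t' by rewrite -[LHS]reprK F.
apply/esym/frac_eqP; exists (denomM u v) => /=.
rewrite !scalerDr; congr (_ + _).
  transitivity ((denom_val v * denom_val t * denom_val t') *:
    (denom_val u *: (denom_val s' *: x))).
    by rewrite !scalerA; congr (_ *: _); ring.
  by rewrite e !scalerA; congr (_ *: _); ring.
transitivity ((denom_val u * denom_val s * denom_val s') *:
  (denom_val v *: (denom_val t' *: y))).
  by rewrite !scalerA; congr (_ *: _); ring.
by rewrite f !scalerA; congr (_ *: _); ring.
Qed.

Lemma loc_oppE x s : loc_opp (frac x s) = frac (- x) s.
Proof.
rewrite /loc_opp; case E: (repr (frac x s)) => [x' s'].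
have /frac_eqP[u e] : frac x s = frac x' s' by rewrite -[LHS]reprK E.
by apply/esym/frac_eqP; exists u; rewrite !scalerN e.
Qed.

Lemma frac_ext x s y t : denom_val t *: x = denom_val s *: y ->
  frac x s = frac y t.
Proof. by move=> e; apply/frac_eqP; exists denom1; rewrite e. Qed.

Fact loc_addA : associative loc_add.
Proof.
move=> a b c; have [[x s] ->] := fracP a; have [[y t] ->] := fracP b.
have [[z r] ->] := fracP c; rewrite !loc_addE; apply: frac_ext => /=.
rewrite !(scalerDr, scalerA) !addrA.
by congr (_ *: _ + _ *: _ + _ *: _); ring.
Qed.

Fact loc_addC : commutative loc_add.
Proof.
move=> a b; have [[x s] ->] := fracP a; have [[y t] ->] := fracP b.
rewrite !loc_addE; apply: frac_ext => /=.
by rewrite !(scalerDr, scalerA) addrC; congr (_ *: _ + _ *: _); ring.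
Qed.

Fact loc_add0 : left_id (frac 0 denom1) loc_add.
Proof.
move=> a; have [[x s] ->] := fracP a; rewrite loc_addE; apply: frac_ext => /=.
by rewrite scaler0 add0r scale1r mul1r.
Qed.

Fact loc_addN : left_inverse (frac 0 denom1) loc_opp loc_add.
Proof.
move=> a; have [[x s] ->] := fracP a; rewrite loc_oppE loc_addE.
by apply: frac_ext => /=; rewrite scalerN addNr !scaler0.
Qed.

HB.instance Definition _ :=
  GRing.isZmodule.Build loc_module loc_addA loc_addC loc_add0 loc_addN.

Lemma fracD x s y t : frac x s + frac y t
  = frac (denom_val t *: x + denom_val s *: y) (denomM s t).
Proof. exact: loc_addE. Qed.

End LocModule.

(* (a / s) . (x / t) = (a . x) / (s t) *)
Definition loc_scale (V : lmodType R) (a : loc_module R^o) (b : loc_module V) :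
    loc_module V :=
  let: (c, s) := repr a in let: (x, t) := repr b in
  frac ((c : R) *: x) (denomM s t).

Lemma loc_scaleE (V : lmodType R) (c : R) s (x : V) t :
  loc_scale (frac (c : R^o) s) (frac x t) = frac (c *: x) (denomM s t).
Proof.
rewrite /loc_scale; case E: (repr (frac (c : R^o) s)) => [c' s'].
case F: (repr (frac x t)) => [x' t'].
have /frac_eqP[u e] : frac (c : R^o) s = frac c' s' by rewrite -[LHS]reprK E.
have /frac_eqP[v f] : frac x t = frac x' t' by rewrite -[LHS]reprK F.
apply/esym/frac_eqP; exists (denomM u v) => /=.
transitivity (((denom_val u : R) *: ((denom_val s' : R) *: (c : R^o)) : R) *:
   (denom_val v *: (denom_val t' *: x))).
  by rewrite !scalerA; congr (_ *: _); rewrite /GRing.scale /=; ring.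
by rewrite e f !scalerA; congr (_ *: _); rewrite /GRing.scale /=; ring.
Qed.

Fact loc_scaleA (V : lmodType R) a b (x : loc_module V) :
  loc_scale a (loc_scale b x) = loc_scale (loc_scale a b) x.
Proof.
have [[c s] ->] := fracP a; have [[c' s'] ->] := fracP b.
have [[y t] ->] := fracP x; rewrite !loc_scaleE; apply: frac_ext => /=.
by rewrite !scalerA; congr (_ *: _); rewrite /GRing.scale /=; ring.
Qed.

Fact loc_scale1 (V : lmodType R) :
  left_id (frac (1 : R^o) denom1) (@loc_scale V).
Proof.
move=> x; have [[y t] ->] := fracP x; rewrite loc_scaleE; apply: frac_ext => /=.
by rewrite scale1r mul1r.
Qed.

Fact loc_scaleDr (V : lmodType R) : right_distributive (@loc_scale V) +%R.
Proof.
move=> a x y; have [[c s] ->] := fracP a; have [[x' t] ->] := fracP x.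
have [[y' r] ->] := fracP y; rewrite !(fracD, loc_scaleE).
apply: frac_ext; rewrite !denomME !(scalerDr, scalerA).
by congr (_ *: _ + _ *: _); rewrite /GRing.scale /=; ring.
Qed.

Lemma fracDr (c c' : R) s t : frac (c : R^o) s + frac (c' : R^o) t
  = frac (denom_val t * c + denom_val s * c' : R^o) (denomM s t).
Proof. exact: fracD. Qed.

Fact loc_scaleDl (V : lmodType R) (x : loc_module V) :
  {morph (@loc_scale V)^~ x : a b / a + b}.
Proof.
move=> a b; have [[c s] ->] := fracP a; have [[c' s'] ->] := fracP b.
have [[y t] ->] := fracP x; rewrite fracDr !loc_scaleE fracD.
apply: frac_ext; rewrite !denomME /= scalerDr !scalerA -scalerDl.
by congr (_ *: _); ring.
Qed.

Definition loc_ring := loc_module R^o.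

HB.instance Definition _ := GRing.Zmodule.on loc_ring.

Definition loc_mul (a b : loc_ring) : loc_ring := loc_scale a b.

Fact loc_mulA : associative loc_mul.
Proof. exact: loc_scaleA. Qed.

Fact loc_mulC : commutative loc_mul.
Proof.
move=> a b; have [[c s] ->] := fracP a; have [[c' s'] ->] := fracP b.
rewrite /loc_mul !loc_scaleE; apply: frac_ext => /=.
by rewrite /GRing.scale /=; ring.
Qed.

Fact loc_mul1 : left_id (frac (1 : R^o) denom1 : loc_ring) loc_mul.
Proof. exact: loc_scale1. Qed.

Fact loc_mulDl : left_distributive loc_mul +%R.
Proof. by move=> a b x; apply: loc_scaleDl. Qed.

Fact loc_1neq0 : (frac (1 : R^o) denom1 : loc_ring) != 0.
Proof.
apply/eqP => /frac_eqP[u /=]; rewrite !scaler0 scale1r.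
by rewrite -[_ *: _]/(denom_val u * 1) mulr1; apply/eqP/denom_neq0.
Qed.

HB.instance Definition _ := GRing.Zmodule_isComNzRing.Build loc_ring
  loc_mulA loc_mulC loc_mul1 loc_mulDl loc_1neq0.

HB.instance Definition _ (V : lmodType R) :=
  GRing.Zmodule_isLmodule.Build loc_ring (loc_module V)
    (@loc_scaleA V) (@loc_scale1 V) (@loc_scaleDr V) (@loc_scaleDl V).

End Localization.

Definition has_rank (R : comNzRingType) (V : lmodType R) (r : nat) :=
  forall P : prime_idealr R, associated_prime P ->
    exists f : {linear loc_module P V -> 'rV[loc_ring P]_r}, bijective f.

(* Main.v *)
From HB Require Import structures.
From mathcomp Require Import all_boot all_order all_algebra.
From mathcomp Require Import boolp classical_sets functions.
From mathcomp.multinomials Require Import freeg.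
From mathcomp Require Import ring zify.
Require Import Defs.

(* Let I be the minimal injective resolution of M, E the injective hull of the residue
   field and J = Gamma_m(I), so that J^i is a sum of mu_i copies of E. For a system of
   parameters s of A that is filter-regular on M, the multiplicity symbol mul s kills
   H^i(J) for i <> d, and its value at i = d is (-1)^d mul s M = r e', where
   e' = mul s E = (-1)^d mul s A > 0. With b_i = mul s (d J^(i-1)) additivity gives
   b_(i+1) + b_i = mu_i e' for i <> d and b_(d+1) + b_d + r e' = mu_d e', hence all b_i
   are nonnegative multiples of e'. If mu_n <= 1 with n >= d, then b_(n+1) = 0, or n > d
   and b_n = 0. The endomorphisms of E are the elements of the completion, whose
   associated primes Q have coheight at least d because A is unmixed; therefore mul s is
   positive on every nonzero image of E, and the differential of J vanishes in degree n
   or n - 1. As H^i(J) = 0 for i > d and the socle of J^i consists of cycles, J^i = 0 for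
   i > n, and then I^i = 0 for i > n because Ext^i(-, M) vanishes on all cyclic modules.
   Since J^d <> 0, Ext against A / (x) for a maximal regular sequence x shows that its
   length is d, so A is Cohen-Macaulay. At a minimal prime P the module M_P is free of
   rank r >= 1 and has finite injective dimension over a local ring of depth zero, so M_P
   and its summand A_P are injective. *)

Set Implicit Arguments.
Unset Strict Implicit.
Unset Printing Implicit Defensive.

Import GRing.Theory Num.Theory Order.TTheory.
Local Open Scope classical_set_scope.
Local Open Scope ring_scope.

(** * Submodules and length *)

(** The obstacle is that local cohomology modules are Artinian but seldom of finite length, so
    lengths cannot be compared along [J]. The symbol [mul] repairs this: it is additive once
    subquotients killed by [s] have finite length, and its sign is known on Artinian and on
    Noetherian modules. However, it only sees the part of maximal dimension: an image of E coming
    from an associated prime of the completion of smaller coheight would have [mul] zero without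
    being zero. Unmixedness excludes exactly this, and so lets the equality b_i = 0 say that a
    differential vanishes. The rank makes e' the common unit of the count: E, the J^i and, up to
    sign, M are all measured by multiples of e', and mu_n <= 1 leaves room for a single e' in degree
    n. Subquotients are pairs of nested subsets, so that kernels and cokernels stay inside one
    ambient module. Ext is read off cosyzygies in the same spirit: Ext^(i+1)(A/c, M) consists of the
    elements killed by c in the cosyzygy of index i+1, modulo those that lift to elements killed by
    c in the injective hull of the cosyzygy of index i. *)

Section Submodules.
Variables (R : comNzRingType) (V : lmodType R).
Implicit Types (S T U W X : set V) (x y v : V) (a : R).

Definition submodule S := S 0 /\ forall a x y, S x -> S y -> S (a *: x + y).

Lemma submod0 S : submodule S -> S 0. Proof. by case. Qed.
Lemma submodD S x y : submodule S -> S x -> S y -> S (x + y).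
Proof. by move=> [_ h] Sx Sy; rewrite -[x]scale1r; apply: h. Qed.
Lemma submodZ S a x : submodule S -> S x -> S (a *: x).
Proof. by move=> [h0 h] Sx; rewrite -[_ *: _]addr0; apply: h. Qed.
Lemma submodN S x : submodule S -> S x -> S (- x).
Proof. by move=> h Sx; rewrite -scaleN1r; apply: submodZ. Qed.
Lemma submodB S x y : submodule S -> S x -> S y -> S (x - y).
Proof. by move=> h Sx Sy; apply: submodD => //; apply: submodN. Qed.
Lemma submod_subl S x y : submodule S -> S (x - y) -> S y -> S x.
Proof. by move=> h Sxy Sy; rewrite -(subrK y x); apply: submodD. Qed.
Lemma submod_subr S x y : submodule S -> S (x - y) -> S x -> S y.
Proof. by move=> h Sxy Sx; rewrite -(subKr x y); apply: submodB. Qed.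
Lemma submod_sum S (I : Type) (r : seq I) (P : pred I) (F : I -> V) :
  submodule S -> (forall i, P i -> S (F i)) -> S (\sum_(i <- r | P i) F i).
Proof.
move=> h hF; elim/big_ind: _ => //; first exact: submod0.
by move=> x y; apply: submodD.
Qed.

Lemma submodule0 : submodule [set 0].
Proof. by split=> // a x y -> ->; rewrite scaler0 addr0. Qed.
Lemma submoduleT : submodule [set: V]. Proof. by split. Qed.
Lemma submoduleI S T : submodule S -> submodule T -> submodule (S `&` T).
Proof.
move=> [s0 s] [t0 t]; split=> // a x y [? ?] [? ?].
by split; [apply: s|apply: t].
Qed.

Definition addm S T : set V := fun x => exists s t, [/\ S s, T t & x = s + t].
Lemma submodule_add S T : submodule S -> submodule T -> submodule (addm S T).
Proof.
move=> [s0 s] [t0 t]; split; first by exists 0, 0; rewrite addr0.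
move=> a _ _ [x [y [Sx Ty ->]]] [x' [y' [Sx' Ty' ->]]].
exists (a *: x + x'), (a *: y + y'); split; [exact: s|exact: t|].
by rewrite scalerDr addrACA.
Qed.
Lemma addml S T : submodule T -> S `<=` addm S T.
Proof. by move=> [t0 _] x Sx; exists x, 0; rewrite addr0. Qed.
Lemma addmr S T : submodule S -> T `<=` addm S T.
Proof. by move=> [t0 _] x Sx; exists 0, x; rewrite add0r. Qed.
Lemma addm_sub S T U : submodule U -> S `<=` U -> T `<=` U -> addm S T `<=` U.
Proof.
by move=> sU SU TU _ [s [t [/SU ? /TU ? ->]]]; apply: submodD.
Qed.

(* [wspan W vs] is W + R v_1 + ... + R v_k. *)
Fixpoint wspan W (vs : seq V) : set V :=
  if vs is v :: vs' then fun x => exists a, wspan W vs' (x - a *: v) else W.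

Lemma submodule_wspan W vs : submodule W -> submodule (wspan W vs).
Proof.
move=> sW; elim: vs => //= v vs [h0 h]; split.
  by exists 0; rewrite scale0r subr0.
move=> a x y [b hx] [c hy]; exists (a * b + c).
rewrite [X in wspan _ _ X](_ : _ = a *: (x - b *: v) + (y - c *: v)).
  exact: h.
by rewrite scalerBr scalerDl scalerA opprD addrACA.
Qed.
Lemma wspan_sub W vs : W `<=` wspan W vs.
Proof.
elim: vs => //= v vs IH x Wx; exists 0.
by rewrite scale0r subr0; apply: IH.
Qed.
Lemma wspan_mem W vs v : submodule W -> v \in vs -> wspan W vs v.
Proof.
move=> sW; elim: vs => //= w vs IH; rewrite inE => /orP[/eqP->|/IH h].
  by exists 1; rewrite scale1r subrr; apply: submod0; apply: submodule_wspan.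
by exists 0; rewrite scale0r subr0.
Qed.
Lemma wspan_min W vs X : submodule X -> W `<=` X -> (forall v, v \in vs -> X v) ->
  wspan W vs `<=` X.
Proof.
move=> sX WX; elim: vs => //= v vs IH h x [a hx].
apply: (@submod_subl _ _ (a *: v)) => //; last first.
  by apply: submodZ => //; apply: h; rewrite inE eqxx.
by apply: IH hx => w ws; apply: h; rewrite inE ws orbT.
Qed.
Lemma wspan_mono W W' vs : W `<=` W' -> wspan W vs `<=` wspan W' vs.
Proof. by move=> h; elim: vs => //= v vs IH x [a /IH]; exists a. Qed.
Lemma wspan_cat W vs ws : wspan W (vs ++ ws) = wspan (wspan W ws) vs.
Proof. by elim: vs => //= v vs ->. Qed.
Lemma wspan_sum W (I : finType) (v : I -> V) x : submodule W ->
  wspan W [seq v i | i <- enum I] x <->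
  exists c : I -> R, W (x - \sum_i c i *: v i).
Proof.
move=> sW; split; last first.
  move=> [c hc]; apply: (@submod_subl _ _ (\sum_i c i *: v i)).
  - exact: submodule_wspan.
  - exact: wspan_sub.
  apply: submod_sum; first exact: submodule_wspan.
  move=> i _; apply: submodZ; first exact: submodule_wspan.
  by apply: wspan_mem => //; apply: map_f; rewrite mem_enum.
suff h (l : seq I) : wspan W (map v l) x ->
    exists c : I -> R, W (x - \sum_i c i *: v i) by exact: h.
elim: l x => [|i l IH] x /=.
  by move=> Wx; exists (fun=> 0); rewrite big1 ?subr0 // => ? _; rewrite scale0r.
move=> [a /IH[c hc]]; exists (fun j => c j + (if j == i then a else 0)).
rewrite [X in W X](_ : _ = x - a *: v i - \sum_i c i *: v i) //.
rewrite -addrA -opprD; congr (_ - _); rewrite addrC.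
under eq_bigr do rewrite scalerDl.
rewrite big_split /=; congr (_ + _); rewrite (bigD1 i) //= eqxx big1 ?addr0 //.
by move=> j /negbTE->; rewrite scale0r.
Qed.

Definition chain U W k := exists c : nat -> set V,
  [/\ forall i, submodule (c i), W `<=` c 0, c k `<=` U &
      forall i, (i < k)%N -> c i `<=` c i.+1 /\ ~ c i.+1 `<=` c i].

Lemma chain_mono U U' W k : U `<=` U' -> chain U W k -> chain U' W k.
Proof.
move=> UU' [c [h1 h2 h3 h4]]; exists c; split=> //.
exact: subset_trans h3 UU'.
Qed.

Lemma chain_le U W k l : (l <= k)%N -> chain U W k -> chain U W l.
Proof.
move=> lk [c [h1 h2 h3 h4]]; exists c; split=> //.
  suff h i : (i <= k - l)%N -> c l `<=` c (l + i)%N.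
    by apply: subset_trans (h _ (leqnn _)) _; rewrite subnKC.
  elim: i => [|i IH] ik; first by rewrite addn0.
  apply: subset_trans (IH (ltnW ik)) _; rewrite addnS.
  by apply: (h4 _ _).1; lia.
by move=> i il; apply: h4; apply: leq_trans lk.
Qed.

Lemma chain0 U W : submodule W -> W `<=` U -> chain U W 0.
Proof. by move=> sW WU; exists (fun=> W); split. Qed.

Lemma chain_ext U W T k : submodule T -> U `<=` T -> ~ T `<=` U ->
  chain U W k -> chain T W k.+1.
Proof.
move=> sT UT TU [c [h1 h2 h3 h4]].
exists (fun i => if (i <= k)%N then c i else T); split=> //=.
- by move=> i; case: ifP.
- by rewrite ltnn.
move=> i ik1; have : (i == k) || (i < k)%N by lia.
move=> /orP[/eqP->|ik].
  rewrite leqnn ltnn; split; first exact: subset_trans h3 UT.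
  by move=> Tc; apply: TU; apply: subset_trans Tc h3.
by rewrite ik (ltnW ik); apply: h4.
Qed.

Definition flen U W := exists n, forall k, chain U W k -> (k <= n)%N.
(** The default 0 also stands for infinite length; [len] is meaningful under [flen]. *)
Definition len U W : nat := odflt 0%N (nat_sup (chain U W)).

Lemma is_greatest_uniq (S : set nat) n n' :
  is_greatest S n -> is_greatest S n' -> n = n'.
Proof. by move=> [S1 h1] [S2 h2]; apply/eqP; rewrite eqn_leq h1 ?h2. Qed.

Lemma nat_supE (S : set nat) n : is_greatest S n -> nat_sup S = Some n.
Proof.
move=> h; rewrite /nat_sup; case: pselect => [ex|[]]; last by exists n.
by congr Some; case: (cid ex) => n' h' /=; apply: is_greatest_uniq h' h.
Qed.

Lemma greatest_exists (S : set nat) n : S 0%N -> (forall k, S k -> (k <= n)%N) ->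
  exists m, is_greatest S m.
Proof.
move=> S0 hn.
have e : exists k, `[<S k>] by exists 0%N; apply/asboolP.
have b k : `[<S k>] -> (k <= n)%N by move/asboolP; apply: hn.
case: (ex_maxnP e b) => m /asboolP Sm hm; exists m; split=> // k Sk.
exact/hm/asboolP.
Qed.

Lemma lenP U W : submodule W -> W `<=` U -> flen U W ->
  is_greatest (chain U W) (len U W).
Proof.
move=> sW WU [n hn].
have [m hm] := greatest_exists (chain0 sW WU) hn.
by rewrite /len (nat_supE hm).
Qed.

Lemma lenE U W n : is_greatest (chain U W) n -> len U W = n.
Proof. by move=> h; rewrite /len (nat_supE h). Qed.

Lemma chain_cat U X W k l : chain U X k -> chain X W l -> chain U W (l + k).
Proof.
move=> [c [h1 h2 h3 h4]] [c' [h1' h2' h3' h4']].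
elim: k U h3 h4 => [|k IH] U h3 h4.
  rewrite addn0; apply: (@chain_mono X); first exact: subset_trans h2 h3.
  by exists c'.
apply: chain_mono h3 _; rewrite addnS.
have [ck1 ck2] := h4 k (ltnSn _).
apply: (chain_ext (U := c k)) => //; apply: IH => //.
by move=> i ik; apply/h4/ltnW.
Qed.

(** By the modular law, each strict step of the chain stays strict after adding X or after
    intersecting with X; the two kinds of steps are counted separately. *)
Lemma chain_split U X W k : submodule X -> submodule W -> W `<=` X -> X `<=` U ->
  submodule U ->
  chain U W k -> exists k1 k2, [/\ chain U X k1, chain X W k2 & (k <= k1 + k2)%N].
Proof.
move=> sX sW WX XU sU [c [h1 h2 h3 h4]].
suff [k1 [k2 [p1 p2 p3]]] : exists k1 k2, [/\ chain (addm (c k) X) X k1,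
    chain (c k `&` X) W k2 & (k <= k1 + k2)%N].
  exists k1, k2; split=> //; last by apply: chain_mono p2 => x [].
  by apply: chain_mono p1; apply: addm_sub.
elim: k {h3} h4 => [|k IH] h4.
  exists 0%N, 0%N; split=> //.
    by apply: chain0 => //; apply: addmr.
  by apply: chain0 => // x Wx; split; [apply: h2|apply: WX].
have [i ik|k1 [k2 [p1 p2 p3]]] := IH; first by apply/h4/ltnW.
have [ck1 ck2] := h4 k (ltnSn _).
have s1 : addm (c k) X `<=` addm (c k.+1) X.
  by move=> _ [s [t [/ck1 ? ? ->]]]; exists s, t.
have s2 : c k `&` X `<=` c k.+1 `&` X by move=> x [/ck1].
have [e1|n1] := pselect (addm (c k.+1) X `<=` addm (c k) X).
  exists k1, k2.+1; split; rewrite ?addnS //; first exact: chain_mono p1.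
  apply: chain_ext p2 => //; first exact: submoduleI.
  move=> e2; apply: ck2 => x cx.
  have /e1[s [t [cs Xt xE]]] : addm (c k.+1) X x by apply: addml.
  rewrite xE; apply: submodD => //.
  have /e2[] // : (c k.+1 `&` X) t.
  have -> : t = x - s by rewrite xE addrC addKr.
  by split; [apply: submodB => //; apply: ck1|rewrite xE addrC addKr].
exists k1.+1, k2; split=> //; last by apply: chain_mono p2.
by apply: chain_ext p1 => //; apply: submodule_add.
Qed.

Section Additivity.
Variables U X W : set V.
Hypotheses (sU : submodule U) (sX : submodule X) (sW : submodule W).
Hypotheses (WX : W `<=` X) (XU : X `<=` U).

Lemma flen_ext : flen U X -> flen X W -> flen U W.
Proof.
move=> [n hn] [m hm]; exists (n + m)%N => k.
move=> /(chain_split sX sW WX XU sU)[k1 [k2 [/hn ? /hm ? ?]]]; lia.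
Qed.
Lemma flen_quo : flen U W -> flen U X.
Proof.
move=> [n hn]; exists n => k h.
by apply: hn; have := chain_cat h (chain0 sW WX).
Qed.
Lemma flen_sub : flen U W -> flen X W.
Proof. by move=> [n hn]; exists n => k h; apply: hn; apply: chain_mono h. Qed.
Lemma len_add : flen U W -> len U W = (len U X + len X W)%N.
Proof.
move=> f; have [p1 q1] := lenP sX XU (flen_quo f).
have [p2 q2] := lenP sW WX (flen_sub f).
apply: lenE; split; first by rewrite addnC; apply: chain_cat p2.
move=> k /(chain_split sX sW WX XU sU)[k1 [k2 [/q1 ? /q2 ? ?]]]; lia.
Qed.
End Additivity.

Lemma flenxx U : submodule U -> flen U U.
Proof.
move=> sU; exists 0%N => -[//|k] /(chain_le (l := 1) (ltn0Sn _)).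
move=> [c [h1 h2 h3 h4]]; have [c1 c2] := h4 0%N isT.
by exfalso; apply: c2; apply: subset_trans h3 h2.
Qed.
Lemma lenxx U : submodule U -> len U U = 0%N.
Proof.
move=> sU; apply: lenE; split; first exact: chain0.
case=> // k /(chain_le (l := 1) (ltn0Sn _)).
move=> [c [h1 h2 h3 h4]]; have [c1 c2] := h4 0%N isT.
by exfalso; apply: c2; apply: subset_trans h3 h2.
Qed.
Lemma len_eq0 U W : submodule U -> submodule W -> W `<=` U -> flen U W ->
  len U W = 0%N -> U `<=` W.
Proof.
move=> sU sW WU f e; apply: contrapT => UW.
have [_ /(_ 1%N)] := lenP sW WU f; rewrite e.
by move/(_ (chain_ext sU WU UW (chain0 sW (@subset_refl _ W)))).
Qed.

End Submodules.

Section LengthIso.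
Variables (R : comNzRingType) (V V' : lmodType R) (f : V -> V').
Hypothesis f_lin : linear f.

Lemma linfun0 : f 0 = 0.
Proof. by have := f_lin (-1) 0 0; rewrite scaler0 addr0 scaleN1r addNr. Qed.
Lemma linfunD x y : f (x + y) = f x + f y.
Proof. by have := f_lin 1 x y; rewrite !scale1r. Qed.
Lemma linfunZ a x : f (a *: x) = a *: f x.
Proof. by have := f_lin a x 0; rewrite linfun0 !addr0. Qed.
Lemma linfunN x : f (- x) = - f x.
Proof. by rewrite -scaleN1r linfunZ scaleN1r. Qed.
Lemma linfunB x y : f (x - y) = f x - f y.
Proof. by rewrite linfunD linfunN. Qed.
Lemma linfun_sum (I : Type) (r : seq I) (P : pred I) (F : I -> V) :
  f (\sum_(i <- r | P i) F i) = \sum_(i <- r | P i) f (F i).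
Proof. exact: (big_morph f linfunD linfun0). Qed.

Lemma submodule_preim (S : set V') : submodule S -> submodule (f @^-1` S).
Proof.
move=> sS; split; first by rewrite /preimage /= linfun0; apply: submod0.
by move=> a x y Sx Sy; rewrite /preimage /= f_lin; apply: sS.2.
Qed.
Lemma submodule_im (S : set V) : submodule S -> submodule (f @` S).
Proof.
move=> sS; split; first by exists 0; [apply: submod0|apply: linfun0].
move=> a _ _ [x Sx <-] [y Sy <-]; exists (a *: x + y); last exact: f_lin.
exact: sS.2.
Qed.

(* f induces an isomorphism U / W -> U' / W' *)
Definition qiso (U W : set V) (U' W' : set V') :=
  [/\ f @` U `<=` U', f @` W `<=` W', (forall u, U u -> W' (f u) -> W u) &
      forall u', U' u' -> exists2 u, U u & W' (u' - f u)].

Variables (U W : set V) (U' W' : set V').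
Hypotheses (sU : submodule U) (sW : submodule W) (WU : W `<=` U).
Hypotheses (sU' : submodule U') (sW' : submodule W') (WU' : W' `<=` U').
Hypothesis iso : qiso U W U' W'.

Lemma chain_iso1 k : chain U' W' k -> chain U W k.
Proof.
case: iso => h1 h2 h3 h4 [c [p1 p2 p3 p4]].
have Wc i : (i <= k)%N -> W' `<=` c i.
  elim: i => // i IH ik; apply: subset_trans (IH (ltnW ik)) _.
  exact: (p4 _ ik).1.
have cU i : (i <= k)%N -> c i `<=` U'.
  move=> ik; rewrite -(subKn ik); elim: (k - i)%N => [|j IH]; first by rewrite subn0.
  have [jk|kj] := ltnP j k; last first.
    by have -> : (k - j.+1 = k - j)%N by lia.
  apply: subset_trans IH; have -> : (k - j = (k - j.+1).+1)%N by lia.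
  by apply: (p4 _ _).1; lia.
exists (fun i => U `&` (f @^-1` c i)); split.
- by move=> i; apply: submoduleI => //; apply: submodule_preim.
- by move=> x Wx; split; [apply: WU|apply/p2/h2; exists x].
- by move=> x [].
move=> i ik; have [q1 q2] := p4 _ ik; split; first by move=> x [Ux /q1].
move=> e; apply: q2 => y cy.
have [u Uu Wyu] := h4 _ (cU _ ik _ cy).
apply: (@submod_subl _ _ _ _ (f u)) => //; first by apply: Wc => //; exact: ltnW.
have /e[] // : (U `&` (f @^-1` c i.+1)) u.
by split=> //; apply: submod_subr cy => //; apply: (Wc i.+1).
Qed.

Lemma chain_iso2 k : chain U W k -> chain U' W' k.
Proof.
case: iso => h1 h2 h3 h4 [c [p1 p2 p3 p4]].
have Wc i : (i <= k)%N -> W `<=` c i.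
  elim: i => // i IH ik; apply: subset_trans (IH (ltnW ik)) _.
  exact: (p4 _ ik).1.
have cU i : (i <= k)%N -> c i `<=` U.
  move=> ik; rewrite -(subKn ik); elim: (k - i)%N => [|j IH]; first by rewrite subn0.
  have [jk|kj] := ltnP j k; last first.
    by have -> : (k - j.+1 = k - j)%N by lia.
  apply: subset_trans IH; have -> : (k - j = (k - j.+1).+1)%N by lia.
  by apply: (p4 _ _).1; lia.
exists (fun i => addm (f @` c i) W'); split.
- by move=> i; apply: submodule_add => //; apply: submodule_im.
- by apply: addmr; apply: submodule_im.
- apply: addm_sub => //; apply: subset_trans h1; exact: image_subset.
move=> i ik; have [q1 q2] := p4 _ ik; split.
  move=> _ [_ [w [[u cu <-] Ww ->]]]; exists (f u), w; split=> //.
  by exists u => //; apply: q1.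
move=> e; apply: q2 => y cy.
have /e[_ [w [[u cu <-] Ww e']]] : addm (f @` c i.+1) W' (f y).
  by apply: addml => //; exists y.
apply: (@submod_subl _ _ _ _ u) => //.
apply: (Wc i (ltnW ik)); apply: h3.
  by apply: submodB => //; [apply: (cU i.+1)|apply: (cU i); first exact: ltnW].
by rewrite linfunB e' addrC addKr.
Qed.

Lemma chain_iso : chain U W = chain U' W'.
Proof. by apply/seteqP; split=> k; [apply: chain_iso2|apply: chain_iso1]. Qed.

Lemma len_iso : len U W = len U' W'.
Proof. by rewrite /len chain_iso. Qed.
Lemma flen_iso : flen U W <-> flen U' W'.
Proof. by rewrite /flen chain_iso. Qed.
End LengthIso.

(** * Subquotients and multiplicities *)

Section Multiplicity.
Variable R : comNzRingType.

Section Defs.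
Variable V : lmodType R.
Implicit Types (U W X : set V) (s : seq R).

(* The pair (U, W) stands for the subquotient U / W. *)
Definition pair U W := [/\ submodule U, submodule W & W `<=` U].
(** On the subquotient U / W, the kernel of x is [tor x U W] over W and the cokernel of x is U over
    [simg x U W]. *)
Definition tor (x : R) U W : set V := [set u | U u /\ W (x *: u)].
Definition simg (x : R) U W : set V := addm ( *:%R x @` U) W.

Lemma submodule_tor x U W : submodule U -> submodule W -> submodule (tor x U W).
Proof.
move=> sU sW; apply: (submoduleI (T := [set u | W (x *: u)])) => //.
split; first by rewrite /= scaler0; apply: submod0.
move=> a u v /= hu hv; rewrite scalerDr scalerA mulrC -scalerA.
exact: sW.2.
Qed.
Lemma submodule_simg x U W : submodule U -> submodule W -> submodule (simg x U W).
Proof.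
move=> sU sW; apply: submodule_add => //; apply: submodule_im => // a u v.
by rewrite scalerDr !scalerA mulrC.
Qed.
Lemma tor_sub x U W : tor x U W `<=` U. Proof. by move=> u []. Qed.
Lemma sub_tor x U W : pair U W -> W `<=` tor x U W.
Proof. by move=> [_ sW WU] u Wu; split; [apply: WU|apply: submodZ]. Qed.
Lemma sub_simg x U W : pair U W -> W `<=` simg x U W.
Proof.
move=> [sU _ _]; apply: addmr; apply: submodule_im => // a u v.
by rewrite scalerDr !scalerA mulrC.
Qed.
Lemma simg_sub x U W : pair U W -> simg x U W `<=` U.
Proof.
by move=> [sU _ WU]; apply: addm_sub => // _ [u Uu <-]; apply: submodZ.
Qed.
Lemma mem_simg x U W u : submodule W -> U u -> simg x U W (x *: u).
Proof. by move=> sW Uu; exists (x *: u), 0; rewrite addr0; split=> //; apply: submod0. Qed.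
Lemma simgP x U W v : simg x U W v <-> exists u w, [/\ U u, W w & v = x *: u + w].
Proof.
split=> [[_ [w [[u Uu <-] Ww ->]]]|[u [w [Uu Ww ->]]]]; first by exists u, w.
by exists (x *: u), w; split=> //; exists u.
Qed.

Lemma pairxx U : submodule U -> pair U U. Proof. by move=> sU; split. Qed.
Lemma pair_tor x U W : pair U W -> pair (tor x U W) W.
Proof.
by move=> p; have [sU sW WU] := p; split=> //; [apply: submodule_tor|apply: sub_tor].
Qed.
Lemma pair_tor' x U W : pair U W -> pair U (tor x U W).
Proof.
by move=> p; have [sU sW WU] := p; split=> //; [apply: submodule_tor|apply: tor_sub].
Qed.
Lemma pair_simg x U W : pair U W -> pair U (simg x U W).
Proof.
by move=> p; have [sU sW WU] := p; split=> //; [apply: submodule_simg|apply: simg_sub].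
Qed.
Lemma pair_simg' x U W : pair U W -> pair (simg x U W) W.
Proof.
by move=> p; have [sU sW WU] := p; split=> //; [apply: submodule_simg|apply: sub_simg].
Qed.

(* Northcott's multiplicity symbol: the Euler characteristic of the Koszul homology
   of s on U / W. It is meaningful when [good s U W] holds. *)
Fixpoint mul s U W : int :=
  if s is x :: s' then mul s' (tor x U W) W - mul s' U (simg x U W)
  else (len U W)%:Z.

Definition kill s U W := forall x u, x \in s -> U u -> W (x *: u).

Definition good s U W := forall U' W', pair U' W' -> W `<=` W' -> U' `<=` U ->
  kill s U' W' -> flen U' W'.

Lemma good_sub s U W U' W' : W `<=` W' -> U' `<=` U -> good s U W -> good s U' W'.
Proof.
move=> h1 h2 g U'' W'' p h3 h4; apply: g => //.
  exact: subset_trans h3.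
exact: subset_trans h2.
Qed.

Lemma good_cons x s U W : good (x :: s) U W -> (forall u, U u -> W (x *: u)) ->
  good s U W.
Proof.
move=> g h U' W' p h1 h2 k; apply: g => // y u; rewrite inE => /orP[/eqP-> Uu|].
  by apply/h1/h/h2.
exact: k.
Qed.

Lemma good_tor x s U W : pair U W -> good (x :: s) U W -> good s (tor x U W) W.
Proof.
move=> p g; apply: (@good_cons x); last by move=> u [].
by apply: good_sub g => //; apply: tor_sub.
Qed.
Lemma good_simg x s U W : pair U W -> good (x :: s) U W -> good s U (simg x U W).
Proof.
move=> p g; apply: (@good_cons x); last by case: p => _ sW _ u; apply: mem_simg.
by apply: good_sub g => //; apply: sub_simg.
Qed.

Lemma id_linear : linear (@id V). Proof. by []. Qed.

Lemma qiso_id U W U' W' : U `<=` U' -> W `<=` W' -> U `&` W' `<=` W ->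
  U' `<=` addm U W' -> qiso id U W U' W'.
Proof.
move=> h1 h2 h3 h4; split=> //.
- by move=> _ [u /h1 ? <-].
- by move=> _ [u /h2 ? <-].
- by move=> u Uu Wu; apply: h3.
by move=> u /h4[v [w [Uv Ww ->]]]; exists v; rewrite // addrC addKr.
Qed.
End Defs.

Section Iso.
Variables (V V' : lmodType R) (f : V -> V').
Hypothesis f_lin : linear f.
Implicit Types (U W : set V).

Lemma qiso_preim U W (U' W' U'' W'' : set V') : pair U W -> pair U' W' -> qiso f U W U' W' ->
  pair U'' W'' -> W' `<=` W'' -> U'' `<=` U' ->
  [/\ qiso f (U `&` f @^-1` U'') (U `&` f @^-1` W'') U'' W'',
      pair (U `&` f @^-1` U'') (U `&` f @^-1` W''),
      W `<=` U `&` f @^-1` W'' & U `&` f @^-1` U'' `<=` U].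
Proof.
move=> [sU sW WU] [sU' sW' WU'] [h1 h2 h3 h4] [sU2 sW2 WU2] p1 p2; split.
- split.
  + by move=> _ [u [_ ?] <-].
  + by move=> _ [u [_ ?] <-].
  + by move=> u [Uu _] ?; split.
  move=> u' uU; have [u Uu hu] := h4 _ (p2 _ uU).
  exists u; last exact: p1.
  by split=> //; apply: submod_subr uU => //; apply/WU2/p1.
- split; [apply: submoduleI => //; exact: submodule_preim| |].
    by apply: submoduleI => //; exact: submodule_preim.
  by move=> u [? /WU2].
- by move=> w Ww; split; [apply: WU|apply/p1/h2; exists w].
by move=> u [].
Qed.

Lemma qiso_im U W (U' W' : set V') (U'' W'' : set V) : pair U W -> pair U' W' -> qiso f U W U' W' ->
  pair U'' W'' -> W `<=` W'' -> U'' `<=` U ->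
  [/\ qiso f U'' W'' (addm (f @` U'') W') (addm (f @` W'') W'),
      pair (addm (f @` U'') W') (addm (f @` W'') W'),
      W' `<=` addm (f @` W'') W' & addm (f @` U'') W' `<=` U'].
Proof.
move=> [sU sW WU] [sU' sW' WU'] [h1 h2 h3 h4] [sU2 sW2 WU2] p1 p2.
have fU u : U'' u -> U' (f u) by move=> /p2 ?; apply: h1; exists u.
split.
- split.
  + by move=> _ [u ? <-]; apply: addml => //; exists u.
  + by move=> _ [u ? <-]; apply: addml => //; exists u.
  + move=> u Uu [_ [w [[v Wv <-] Ww e]]].
    apply: (@submod_subl _ _ _ _ v) => //; apply/p1/h3.
      by apply: submodB => //; [apply: p2|apply/p2/WU2].
    by rewrite linfunB // e addrC addKr.
  move=> _ [_ [w [[u Uu <-] Ww ->]]]; exists u => //.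
  by rewrite addrC addKr; apply: addmr => //; apply: submodule_im.
- split; try by apply: submodule_add => //; apply: submodule_im.
  by move=> _ [_ [w [[u /WU2 Wu <-] Ww ->]]]; exists (f u), w; split=> //; exists u.
- by apply: addmr; apply: submodule_im.
by apply: addm_sub => // _ [u /fU ? <-].
Qed.

Lemma qiso_kill s U W (U' W' : set V') : pair U W -> pair U' W' -> qiso f U W U' W' ->
  kill s U W <-> kill s U' W'.
Proof.
move=> [sU sW WU] [sU' sW' WU'] [h1 h2 h3 h4]; split=> k x u xs Uu.
  have [v Uv e] := h4 _ Uu.
  apply: (@submod_subl _ _ _ _ (x *: f v)) => //.
    by rewrite -scalerBr; apply: submodZ.
  by rewrite -linfunZ //; apply: h2; exists (x *: v) => //; apply: k.
apply: h3; first exact: submodZ.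
by rewrite linfunZ //; apply: k => //; apply: h1; exists u.
Qed.

Lemma good_iso s U W (U' W' : set V') : pair U W -> pair U' W' -> qiso f U W U' W' ->
  good s U W <-> good s U' W'.
Proof.
move=> p p' i; split=> g U2 W2 p2 h1 h2 k.
  have [q1 q2 q3 q4] := qiso_preim p p' i p2 h1 h2.
  have [a1 a2 a3] := q2; have [b1 b2 b3] := p2.
  by apply: (flen_iso f_lin a1 a3 b1 b2 b3 q1).1; apply: g => //; apply: (qiso_kill _ q2 p2 q1).2.
have [q1 q2 q3 q4] := qiso_im p p' i p2 h1 h2.
have [a1 a2 a3] := q2; have [b1 b2 b3] := p2.
by apply: (flen_iso f_lin b1 b3 a1 a2 a3 q1).2; apply: g => //; apply: (qiso_kill _ p2 q2 q1).1.
Qed.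

Lemma qiso_tor x U W (U' W' : set V') : pair U W -> pair U' W' -> qiso f U W U' W' ->
  qiso f (tor x U W) W (tor x U' W') W'.
Proof.
move=> [sU sW WU] [sU' sW' WU'] [h1 h2 h3 h4]; split=> //.
- move=> _ [u [Uu Wu] <-]; split; first by apply: h1; exists u.
  by rewrite -linfunZ //; apply: h2; exists (x *: u).
- by move=> u [Uu _]; apply: h3.
move=> u' [Uu' Wu']; have [u Uu e] := h4 _ Uu'; exists u => //; split=> //.
apply: h3; first exact: submodZ.
rewrite linfunZ //; apply: submod_subr Wu' => //.
by rewrite -scalerBr; apply: submodZ.
Qed.

Lemma qiso_simg x U W (U' W' : set V') : pair U W -> pair U' W' -> qiso f U W U' W' ->
  qiso f U (simg x U W) U' (simg x U' W').
Proof.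
move=> [sU sW WU] [sU' sW' WU'] [h1 h2 h3 h4]; split=> //.
- move=> _ [v /simgP[u [w [Uu Ww ->]]] <-]; apply/simgP; exists (f u), (f w).
  by rewrite linfunD // linfunZ //; split=> //; [apply: h1; exists u|apply: h2; exists w].
- move=> u Uu /simgP[u' [w' [Uu' Ww' e]]]; apply/simgP.
  have [v Uv ev] := h4 _ Uu'; exists v, (u - x *: v).
  split=> //; last by rewrite addrC subrK.
  apply: h3; first by apply: submodB => //; apply: submodZ.
  rewrite linfunB // linfunZ // e addrAC; apply: submodD => //.
  by rewrite -scalerBr; apply: submodZ.
move=> u' /h4[u Uu e]; exists u => //; apply: sub_simg e => //; split=> //.
Qed.

Lemma mul_iso s U W (U' W' : set V') : pair U W -> pair U' W' -> qiso f U W U' W' ->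
  mul s U W = mul s U' W'.
Proof.
elim: s U W U' W' => [|x s IH] U W U' W' p p' i /=.
  by case: p => ? ? ?; case: p' => ? ? ?; congr Posz; apply: len_iso i.
congr (_ - _); apply: IH; try exact: pair_tor; try exact: pair_simg.
  exact: qiso_tor.
exact: qiso_simg.
Qed.

Definition artP (V : lmodType R) (U W : set V) := forall c : nat -> set V,
  (forall i, [/\ submodule (c i), W `<=` c i & c i `<=` U]) ->
  (forall i, c i.+1 `<=` c i) -> exists N, forall i, (N <= i)%N -> c N `<=` c i.

(** Noetherianity in the form of finite generation modulo W, with generators inside X so that their
    images and preimages can be controlled. *)
Definition noeP (V : lmodType R) (U W : set V) := forall X, submodule X ->
  W `<=` X -> X `<=` U ->
  exists vs, X `<=` wspan W vs /\ forall v, v \in vs -> X v.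

Lemma artP_iso U W (U' W' : set V') : pair U W -> pair U' W' -> qiso f U W U' W' ->
  artP U W -> artP U' W'.
Proof.
move=> p p' i a c hc dc; have [sU sW WU] := p; have [sU' sW' WU'] := p'.
have [h1 h2 h3 h4] := i.
have [j|j u [Uu cu]|N hN] := a (fun j => U `&` f @^-1` c j).
- have [c1 c2 c3] := hc j; split; last by move=> u [].
    by apply: submoduleI => //; apply: submodule_preim.
  by move=> w Ww; split; [apply: WU|apply/c2/h2; exists w].
- by split=> //; apply: dc cu.
exists N => j Nj u cu; have [c1 c2 c3] := hc N; have [d1 d2 d3] := hc j.
have [v Uv e] := h4 _ (c3 _ cu).
apply: (@submod_subl _ _ _ _ (f v)) => //; first exact: d2.
suff [] : (U `&` f @^-1` c j) v by [].
by apply: hN => //; split=> //; apply: submod_subr cu => //; apply: c2.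
Qed.

Lemma noeP_iso U W (U' W' : set V') : pair U W -> pair U' W' -> qiso f U W U' W' ->
  noeP U W -> noeP U' W'.
Proof.
move=> p p' i a X sX WX XU; have [sU sW WU] := p; have [sU' sW' WU'] := p'.
have [h1 h2 h3 h4] := i.
have [||u []//|vs [v1 v2]] := a (U `&` f @^-1` X).
- by apply: submoduleI => //; apply: submodule_preim.
- by move=> w Ww; split; [apply: WU|apply/WX/h2; exists w].
exists (map f vs); split; last by move=> _ /mapP[v /v2[_ ?] ->].
move=> x Xx; have [u Uu e] := h4 _ (XU _ Xx).
have Xfu : X (f u) by apply: submod_subr Xx => //; apply: WX.
have sp : submodule (wspan W' (map f vs)) by apply: submodule_wspan.
apply: (@submod_subl _ _ _ _ (f u)) => //; first exact: wspan_sub.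
have /v1 : (U `&` f @^-1` X) u by [].
elim: vs u {v1 v2 e Xfu sp Uu Xx} => [|v vs IH] u /=; first by move=> ?; apply: h2; exists u.
by move=> [b /IH]; rewrite linfunB // linfunZ // => ?; exists b.
Qed.
End Iso.

Section Additive.
Variable V : lmodType R.
Implicit Types (U W X : set V) (s : seq R).

(** The subquotient U' / W' is cut at (U' \cap X) + W'. The upper piece is isomorphic to (U' + X) /
    (W' + X), the lower one to (U' \cap X) / (W' \cap X). *)
Lemma good_ext s U X W : submodule U -> submodule X -> submodule W ->
  W `<=` X -> X `<=` U -> good s U X -> good s X W -> good s U W.
Proof.
move=> sU sX sW WX XU g1 g2 U' W' [sU' sW' WU'] h1 h2 k.
have sI : submodule (U' `&` X) by apply: submoduleI.
have sJ : submodule (W' `&` X) by apply: submoduleI.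
have sA : submodule (addm (U' `&` X) W') by apply: submodule_add.
have sB : submodule (addm U' X) by apply: submodule_add.
have sC : submodule (addm W' X) by apply: submodule_add.
have AU : addm (U' `&` X) W' `<=` U' by apply: addm_sub => // x [].
have WA : W' `<=` addm (U' `&` X) W' by apply: addmr.
apply: (flen_ext _ sA sW' WA AU) => //.
  have CB : addm W' X `<=` addm U' X.
    by move=> _ [w [x [Ww Xx ->]]]; exists w, x; split=> //; apply: WU'.
  apply: (flen_iso (@id_linear V) sU' AU sB sC CB _).2.
    apply: qiso_id.
    - exact: addml.
    - by move=> _ [y [w [[_ Xy] Ww ->]]]; exists w, y; rewrite addrC.
    - move=> u [Uu [w [x [Ww Xx e]]]]; exists x, w; rewrite addrC; split=> //.
      split=> //; have -> : x = u - w by rewrite e addrC addKr.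
      by apply: submodB => //; apply: WU'.
    - move=> _ [u [x [Uu Xx ->]]]; exists u, x; split=> //.
      by apply: addmr.
  apply: g1 => //; [by apply: addmr|by apply: addm_sub|].
  move=> y _ ys [u [x [Uu Xx ->]]]; rewrite scalerDr; exists (y *: u), (y *: x).
  by split=> //; [apply: k|apply: submodZ].
have JI : W' `&` X `<=` U' `&` X by move=> x [/WU'].
apply: (flen_iso (@id_linear V) sI JI sA sW' WA _).1.
  apply: qiso_id.
  - exact: addml.
  - by move=> x [].
  - by move=> x [[_ ?] ?].
  - by [].
apply: g2 => //.
  by move=> w Ww; split; [apply: h1|apply: WX].
move=> y u ys [Uu Xu]; split; [exact: k|exact: submodZ].
Qed.

Lemma goodxx s U : submodule U -> good s U U.
Proof.
move=> sU U' W' [sU' sW' WU'] h1 h2 _.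
have -> : U' = W' by apply/seteqP; split=> // u /h2/h1.
exact: flenxx.
Qed.

(** Induction on s along the snake sequence of multiplication by x on X / W, U / W and U / X. Its
    six terms are cut into isomorphic pieces, which cancel in the alternating sum. *)
Lemma mul_add s U X W : submodule U -> submodule X -> submodule W ->
  W `<=` X -> X `<=` U -> good s U W -> mul s U W = mul s U X + mul s X W.
Proof.
elim: s U X W => [|x s IH] U X W sU sX sW WX XU g /=.
  rewrite (len_add sU sX sW WX XU) ?PoszD //.
  apply: g => //; split=> //; exact: subset_trans XU.
have WU : W `<=` U by apply: subset_trans XU.
have pUW : pair U W by [].
have pUX : pair U X by [].
have pXW : pair X W by [].
set T := tor x U W; set T1 := tor x X W; set T2 := tor x U X.
set I := simg x U W; set I1 := simg x X W; set I2 := simg x U X.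
have sT : submodule T by apply: submodule_tor.
have sT1 : submodule T1 by apply: submodule_tor.
have sT2 : submodule T2 by apply: submodule_tor.
have sI : submodule I by apply: submodule_simg.
have sI1 : submodule I1 by apply: submodule_simg.
have sI2 : submodule I2 by apply: submodule_simg.
have sTX : submodule (addm T X) by apply: submodule_add.
have sXI : submodule (X `&` I) by apply: submoduleI.
have gT : good s T W by apply: good_tor.
have gT2 : good s T2 X by apply: good_tor => //; apply: good_sub g.
have gI : good s U I by apply: good_simg.
have gI1 : good s X I1 by apply: good_simg => //; apply: good_sub g.
have T1T : T1 `<=` T by move=> u [/XU].
have WT1 : W `<=` T1 by apply: sub_tor.
have TXT2 : addm T X `<=` T2.
  by apply: addm_sub => //; [move=> u [? /WX]|apply: sub_tor].
have XTX : X `<=` addm T X by apply: addmr.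
have I1I : I1 `<=` X `&` I.
  move=> u h; split; first exact: (simg_sub pXW h).
  by case/simgP: h => v [w [/XU ? ? ->]]; apply/simgP; exists v, w.
have XII : X `&` I `<=` X by move=> u [].
have II2 : I `<=` I2.
  by move=> u /simgP[v [w [? /WX ? ->]]]; apply/simgP; exists v, w.
have I2U : I2 `<=` U by apply: simg_sub.
rewrite (IH T T1 W) // (IH T2 (addm T X) X) // (IH U I2 I) // (IH X (X `&` I) I1) //.
have -> : mul s T T1 = mul s (addm T X) X.
  apply: (mul_iso (@id_linear V)) => //; apply: qiso_id => //.
  - exact: addml.
  - by move=> u [].
  - by move=> u [[_ ?] Xu].
have -> : mul s X (X `&` I) = mul s I2 I.
  apply: (mul_iso (@id_linear V)) => //; apply: qiso_id => //.
  - exact: (sub_simg x pUX).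
  move=> u /simgP[v [w [Uv Xw ->]]]; exists w, (x *: v); rewrite addrC.
  by split=> //; apply: mem_simg.
(* The connecting map of the snake lemma is multiplication by x. *)
have -> : mul s T2 (addm T X) = mul s (X `&` I) I1.
  have xl : linear (fun u : V => x *: u).
    by move=> a u v; rewrite scalerDr !scalerA mulrC.
  apply: (mul_iso xl) => //; split.
  - by move=> _ [u [Uu Xu] <-]; split=> //; apply: mem_simg.
  - move=> _ [_ [t [y [[_ Wt] Xy ->]]] <-]; apply/simgP; exists y, (x *: t).
    by rewrite scalerDr addrC.
  - move=> u [Uu Xu] /simgP[y [w [Xy Ww e]]]; exists (u - y), y; rewrite subrK.
    split=> //; split; first by apply: submodB => //; apply: XU.
    by rewrite scalerBr e addrC addKr.
  move=> z [Xz /simgP[u [w [Uu Ww e]]]]; have e' : x *: u = z - w by rewrite e addrK.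
  exists u; first by split=> //; rewrite e'; apply: submodB => //; apply: WX.
  by rewrite e' opprB addrC subrK; apply: sub_simg.
ring.
Qed.

Lemma mulxx s U : submodule U -> mul s U U = 0.
Proof.
move=> sU; have := mul_add sU sU sU (@subset_refl _ U) (@subset_refl _ U) (goodxx (s := s) sU).
lia.
Qed.

Lemma mul_kill x s U W : pair U W -> (forall u, U u -> W (x *: u)) ->
  mul (x :: s) U W = 0.
Proof.
move=> p k /=; have [sU sW WU] := p.
have -> : tor x U W = U by apply/seteqP; split=> u; [case|move=> Uu; split; last exact: k].
have -> : simg x U W = W; last by rewrite subrr.
apply/seteqP; split; last exact: sub_simg.
by move=> _ /simgP[u [w [Uu Ww ->]]]; apply: submodD => //; apply: k.
Qed.

(** U / (xU + W) is killed by x and (xU + W) / W by one power of x less; a module killed by x has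
    equal kernel and cokernel for x. *)
Lemma mul_kill_pow N x s U W : pair U W -> good (x :: s) U W ->
  (forall u, U u -> W (x ^+ N *: u)) -> mul (x :: s) U W = 0.
Proof.
elim: N U W => [|N IH] U W p g k; have [sU sW WU] := p.
  have -> : U = W by apply/seteqP; split=> // u /k; rewrite expr0 scale1r.
  exact: mulxx.
have q1 := pair_simg x p; have q2 := pair_simg' x p; have [_ sI IU] := q1.
have [_ _ WI] := q2.
rewrite (mul_add sU sI sW WI IU) //.
rewrite mul_kill // ?add0r; last by move=> u; apply: mem_simg.
apply: IH => //; first by apply: good_sub g.
move=> _ /simgP[u [w [Uu Ww ->]]]; rewrite scalerDr scalerA -exprSr.
by apply: submodD => //; [apply: k|apply: submodZ].
Qed.

Lemma artP_sub U W U' W' : W `<=` W' -> U' `<=` U -> artP U W -> artP U' W'.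
Proof.
move=> h1 h2 a c hc dc; apply: a => // i; have [? ? ?] := hc i.
by split=> //; [apply: subset_trans h1 _|apply: subset_trans h2].
Qed.

Lemma noeP_sub U W U' W' : W `<=` W' -> U' `<=` U -> noeP U W -> noeP U' W'.
Proof.
move=> h1 h2 a X sX WX XU.
have [//|||vs [v1 v2]] := a X; [exact: subset_trans WX|exact: subset_trans h2|].
by exists vs; split=> //; apply: subset_trans v1 _; apply: wspan_mono.
Qed.

Lemma desc_le (c : nat -> set V) i j : (forall i, c i.+1 `<=` c i) -> (i <= j)%N ->
  c j `<=` c i.
Proof.
move=> dc ij; rewrite -(subnKC ij); elim: (j - i)%N => [|k IH]; first by rewrite addn0.
by rewrite addnS; apply: subset_trans IH.
Qed.

Lemma asc_le (c : nat -> set V) i j : (forall i, c i `<=` c i.+1) -> (i <= j)%N ->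
  c i `<=` c j.
Proof.
move=> dc ij; rewrite -(subnKC ij); elim: (j - i)%N => [|k IH]; first by rewrite addn0.
by rewrite addnS; apply: subset_trans (dc _).
Qed.

Lemma artP_ext U X W : submodule U -> submodule X -> submodule W ->
  W `<=` X -> X `<=` U -> artP U X -> artP X W -> artP U W.
Proof.
move=> sU sX sW WX XU a1 a2 c hc dc.
have [i|i _ [u [x [cu Xx ->]]]|N1 h1] := a1 (fun i => addm (c i) X).
- have [c1 c2 c3] := hc i; split; [exact: submodule_add|exact: addmr|].
  by apply: addm_sub.
- by exists u, x; split=> //; apply: dc.
have [i|i u [cu Xu]|N2 h2] := a2 (fun i => c i `&` X).
- have [c1 c2 c3] := hc i; split; [exact: submoduleI| |by move=> u []].
  by move=> w Ww; split; [apply: c2|apply: WX].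
- by split=> //; apply: dc.
exists (maxn N1 N2) => i Ni u cu.
have [c1 c2 c3] := hc i; have [d1 d2 d3] := hc (maxn N1 N2).
have /h1 : addm (c N1) X u.
  by apply: addml => //; apply: desc_le cu => //; apply: leq_maxl.
case/(_ i); first by apply: leq_trans (leq_maxl _ _) Ni.
move=> v [x [cv Xx e]]; rewrite e; apply: submodD => //.
have /h2 : (c N2 `&` X) x.
  split=> //; apply: desc_le (leq_maxr N1 N2) _ _ => //.
  have -> : x = u - v by rewrite e addrC addKr.
  by apply: submodB => //; apply: desc_le cv.
by case/(_ i) => //; apply: leq_trans (leq_maxr _ _) Ni.
Qed.

Lemma noeP_ext U X W : submodule U -> submodule X -> submodule W ->
  W `<=` X -> X `<=` U -> noeP U X -> noeP X W -> noeP U W.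
Proof.
move=> sU sX sW WX XU a1 a2 Y sY WY YU.
have [|||vs [v1 v2]] := a1 (addm Y X); [exact: submodule_add|exact: addmr|exact: addm_sub|].
have [|||ws [w1 w2]] := a2 (Y `&` X); [exact: submoduleI| |by move=> u []|].
  by move=> w Ww; split; [apply: WY|apply: WX].
have v3 v : v \in vs -> exists y, Y y /\ X (v - y).
  by move=> /v2[y [x [Yy Xx ->]]]; exists y; rewrite addrC addKr.
(* Generators of Y + X modulo X can be corrected by elements of X so that they lie in Y. *)
have [ys [y1 y2]] : exists ys, (forall y, y \in ys -> Y y) /\ wspan X vs `<=` wspan X ys.
  elim: vs v3 {v1 v2} => [|v vs IH] h; first by exists [::]; split.
  have [|ys [y1 y2]] := IH; first by move=> w ws'; apply: h; rewrite inE ws' orbT.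
  have [y [Yy Xy]] := h v (mem_head _ _).
  exists (y :: ys); split; first by move=> z; rewrite inE => /orP[/eqP->|/y1].
  move=> u /= [b /y2 hb]; exists b.
  rewrite [X in wspan _ _ X](_ : _ = (u - b *: v) + b *: (v - y)).
    apply: submodD => //; first exact: submodule_wspan.
    by apply: wspan_sub; apply: submodZ.
  by rewrite scalerBr addrA subrK.
exists (ys ++ ws); split; last first.
  by move=> v; rewrite mem_cat => /orP[/y1|/w2[]].
move=> y Yy; rewrite wspan_cat.
have : wspan X ys y by apply/y2/v1/addml.
elim: ys y Yy y1 {y2} => [|z ys IH] y Yy y1 /=.
  by move=> Xy; apply: w1.
move=> [b h]; exists b; apply: IH => //.
  by apply: submodB => //; apply: submodZ => //; apply: y1; rewrite mem_head.
by move=> w ws'; apply: y1; rewrite inE ws' orbT.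
Qed.

Lemma noeP_stab U W (c : nat -> set V) : submodule W -> noeP U W ->
  (forall i, [/\ submodule (c i), W `<=` c i & c i `<=` U]) ->
  (forall i, c i `<=` c i.+1) -> exists N, forall i, c i `<=` c N.
Proof.
move=> sW a hc ac.
have [|||vs [v1 v2]] := a (\bigcup_(i in [set: nat]) c i).
- split; first by exists 0%N => //; have [h _ _] := hc 0%N; apply: submod0.
  move=> b x y [i _ ci] [j _ cj]; exists (maxn i j) => //.
  have [h _ _] := hc (maxn i j); apply: h.2.
    by apply: asc_le ci => //; apply: leq_maxl.
  by apply: asc_le cj => //; apply: leq_maxr.
- by move=> w Ww; exists 0%N => //; have [_ h _] := hc 0%N; apply: h.
- by move=> w [i _ ci]; have [_ _ h] := hc i; apply: h.
have [N hN] : exists N, forall v, v \in vs -> c N v.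
  elim: vs v2 {v1} => [|v vs IH] h; first by exists 0%N.
  have [|N hN] := IH; first by move=> w ws; apply: h; rewrite inE ws orbT.
  have [M _ hM] := h v (mem_head _ _); exists (maxn N M) => w.
  rewrite inE => /orP[/eqP->|/hN ?].
    by apply: asc_le hM => //; apply: leq_maxr.
  by apply: asc_le (leq_maxl _ _) _ _ => //.
exists N => i x cx; have [h1 h2 h3] := hc N.
by apply: (wspan_min h1 h2 hN); apply: v1; exists i.
Qed.

(** The chain of the x^i U + W becomes stationary, and its layers, being killed by x, do not count.
    On the stable term x is surjective, so only its kernel contributes, with a plus sign. *)
Lemma art_mul_ge0 s U W : pair U W -> artP U W -> good s U W -> 0 <= mul s U W.
Proof.
elim: s U W => [|x s IH] U W p a g //.
pose c := fix c i := if i is j.+1 then simg x (c j) W else U.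
have hc i : pair (c i) W /\ c i `<=` U.
  elim: i => [|i [IH1 IH2]]; first by split.
  split; first exact: (pair_simg' x IH1).
  by apply: subset_trans IH2; apply: (simg_sub IH1).
have dc i : c i.+1 `<=` c i by apply: simg_sub; have [] := hc i.
have [|//|N hN] := a c.
  by move=> i; have [[? ? ?] ?] := hc i.
have e i : mul (x :: s) U W = mul (x :: s) (c i) W.
  have [sU sW WU] := p.
  elim: i => // i IHi; have [[h1 _ h3] h4] := hc i; have [[h1' _ h3'] h4'] := hc i.+1.
  rewrite IHi (mul_add h1 h1' sW h3' (dc i)); last by apply: good_sub g.
  by rewrite mul_kill ?add0r // => u; apply: mem_simg.
rewrite (e N) /=; have [q1 q2] := hc N; have [h1 h2 h3] := q1.
have -> : simg x (c N) W = c N by apply/seteqP; split; [exact: dc|exact: (hN N.+1)].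
rewrite mulxx // subr0; apply: IH; first exact: pair_tor.
  by apply: artP_sub a => //; apply: subset_trans q2; apply: tor_sub.
by apply: good_tor => //; apply: good_sub g.
Qed.

(** Dual to the Artinian case: modulo the x-power torsion, x is injective, so only the cokernel
    remains and each element of s contributes a factor -1. *)
Lemma noe_mul_ge0 s U W : pair U W -> noeP U W -> good s U W ->
  0 <= (-1) ^+ size s * mul s U W.
Proof.
elim: s U W => [|x s IH] U W p a g; first by rewrite mul1r.
pose c := fix c i := if i is j.+1 then tor x U (c j) else W.
have hc i : pair U (c i) /\ W `<=` c i.
  elim: i => [|i [IH1 IH2]]; first by split.
  split; first exact: (pair_tor' x IH1).
  by apply: subset_trans IH2 _; apply: (sub_tor x IH1).
have dc i : c i `<=` c i.+1 by apply: sub_tor; have [] := hc i.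
have [sU sW WU] := p.
have [|//|N hN] := noeP_stab (c := c) sW a.
  by move=> i; have [[? ? ?] ?] := hc i.
have e i : mul (x :: s) U W = mul (x :: s) U (c i).
  elim: i => // i IHi; have [[_ h2 h3] h4] := hc i; have [[_ h2' h3'] h4'] := hc i.+1.
  rewrite IHi (mul_add sU h2' h2 (dc i) h3'); last by apply: good_sub g.
  by rewrite [X in _ + X]mul_kill ?addr0 //; move=> u [].
rewrite (e N) /=; have [q1 q2] := hc N; have [h1 h2 h3] := q1.
have -> : tor x U (c N) = c N by apply/seteqP; split; [exact: (hN N.+1)|exact: dc].
rewrite mulxx // sub0r mulrN exprS mulN1r mulNr opprK.
apply: IH; first exact: pair_simg.
  by apply: noeP_sub a => //; apply: subset_trans q2 _; apply: sub_simg.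
by apply: good_simg => //; apply: good_sub g.
Qed.
End Additive.
End Multiplicity.

(** * Baer's criterion *)

Section MkLinear.
Variables (R : comNzRingType) (U V : lmodType R) (f : U -> V) (f_lin : linear f).
Let g := f.
HB.instance Definition _ := GRing.isLinear.Build R U V *:%R g f_lin.
Definition mk_linear : {linear U -> V} := g.
End MkLinear.

Section Packing.
Variables (R : comNzRingType) (V : lmodType R) (S : set V).
Definition smod_of (H : submodule S) : {pred V} := fun x => `[<S x>].
Variable H : submodule S.
Fact smod_of_closed : submod_closed (smod_of H).
Proof.
split; first by apply/asboolP; apply: submod0.
by move=> a x y /asboolP Sx /asboolP Sy; apply/asboolP; apply: H.2.
Qed.
HB.instance Definition _ :=
  GRing.isSubmodClosed.Build R V (smod_of H) smod_of_closed.

Definition subT : lmodType R := submod (smod_of H).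
Definition quoT : lmodType R := quotmod (smod_of H).
Definition sub_val (x : subT) : V := submod_val x.
Definition sub_in x (Sx : S x) : subT := Submod (asboolT Sx : x \in smod_of H).
Definition quo_pi (x : V) : quoT := pi_quot (smod_of H) x.

Lemma sub_valP (x : subT) : S (sub_val x).
Proof. by apply/asboolP; exact: (submod_valP x). Qed.
Lemma sub_inK x (Sx : S x) : sub_val (sub_in Sx) = x. Proof. by []. Qed.
Lemma sub_val_lin : linear sub_val.
Proof. by move=> a x y; apply: (linearP (\val : subT -> V)). Qed.
Lemma sub_val_inj : injective sub_val.
Proof. exact: val_inj. Qed.
Lemma quo_pi_lin : linear quo_pi.
Proof.
by move=> a x y; rewrite /quo_pi pi_quotD -quotmod_scale_pi.
Qed.
Lemma quo_pi_surj (y : quoT) : exists x, y = quo_pi x.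
Proof. by exists (repr y); rewrite /quo_pi pi_quot_repr. Qed.
Lemma quo_piE x y : quo_pi x = quo_pi y <-> S (x - y).
Proof.
apply: iff_trans (pi_quot_eq _ _ _) _.
by split=> [/asboolP//|?]; apply/asboolP.
Qed.
Lemma quo_pi0 x : quo_pi x = 0 <-> S x.
Proof. by rewrite -(linfun0 quo_pi_lin) quo_piE subr0. Qed.
End Packing.

(** Zorn's lemma above a given set, for families closed under unions of nonempty chains only.
    Joining [A0] to every set takes care of the empty chain. *)
Lemma zorn_above (T : Type) (P : set (set T)) (A0 : set T) : P A0 ->
  (forall F : set (set T), F `<=` P -> total_on F subset ->
     (exists X, F X) -> P (\bigcup_(X in F) X)) ->
  exists A, [/\ A0 `<=` A, P A & forall B, A `<=` B -> P B -> B `<=` A].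
Proof.
move=> PA0 hP; pose Q X := P (X `|` A0).
have [F FQ tF|A [QA hA]] := @Zorn_bigcup T Q.
  have [[X0 FX0]|n] := pselect (exists X, F X); last first.
    rewrite /Q (_ : \bigcup_(X in F) X `|` A0 = A0) //.
    by apply/seteqP; split=> x; [case=> // -[X FX]; case: n; exists X|right].
  rewrite /Q (_ : _ `|` _ = \bigcup_(X in [set Y `|` A0 | Y in F]) X).
    apply: hP; last by exists (X0 `|` A0); exists X0.
      by move=> _ [Y /FQ ? <-].
    move=> _ _ [X FX <-] [Y FY <-]; have [h|h] := tF _ _ FX FY; [left|right];
      by apply: setSU.
  apply/seteqP; split=> x.
    move=> [[X FX Xx]|Ax].
      by exists (X `|` A0); [exists X|left].
    by exists (X0 `|` A0); [exists X0|right].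
  by move=> [_ [X FX <-] [Xx|]]; [left; exists X|right].
exists (A `|` A0); split=> // B AB PB.
apply: contrapT => BA; apply: (hA B); last first.
  rewrite /Q (_ : B `|` A0 = B) //; apply/seteqP; split=> x; last by left.
  by case=> // Ax; apply: AB; right.
split; first by move=> x Ax; apply: AB; left.
by move=> BA'; apply: BA => x /BA'; left.
Qed.

Section Baer.
Variable R : comNzRingType.

(** The graph of a partial homomorphism; a relation spares a type for its domain, and unions of
    graphs are immediate. *)
Definition linrel (V V' : lmodType R) (G : V -> V' -> Prop) :=
  [/\ G 0 0, forall a x y x' y', G x x' -> G y y' ->
        G (a *: x + y) (a *: x' + y') & forall y, G 0 y -> y = 0].

(* Baer's criterion relative to a submodule U: every partial homomorphism
   from an ideal of R to U, given by its graph, is a multiplication. *)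
Definition baer (V : lmodType R) (U : set V) := forall G : R^o -> V -> Prop,
  linrel G -> (forall a y, G a y -> U y) ->
  exists v, U v /\ forall a y, G a y -> y = (a : R) *: v.

Section Ext.
Variables (V V' : lmodType R) (U : set V') (G : V -> V' -> Prop).
Hypotheses (sU : submodule U) (bU : baer U) (lG : linrel G).
Hypothesis GU : forall x y, G x y -> U y.

Lemma linrel_eq (H : V -> V' -> Prop) x y z : linrel H -> H x y -> H x z -> y = z.
Proof.
move=> [h1 h2 h3] hy hz; apply/eqP; rewrite -subr_eq0; apply/eqP/h3.
rewrite -[0](subrr x) -!scaleN1r [x + _]addrC [y + _]addrC.
exact: h2.
Qed.

(** A maximal single-valued extension X of G with values in U is total: for v in V, the multiples of
    v in its domain define a partial map on an ideal, and Baer's criterion supplies a value w that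
    can be adjoined at v. *)
Lemma baer_ext : exists h : V -> V',
  [/\ linear h, forall v, U (h v) & forall v y, G v y -> y = h v].
Proof.
pose P (X : set (V * V')) := linrel (fun x y => X (x, y)) /\
  forall p, X p -> U p.2.
have [|F FP tF [X0 FX0]|X [GX [lX XU] mX]] := @zorn_above _ P [set p | G p.1 p.2].
- by split=> // -[x y] /=; apply: GU.
- split; last by move=> p [X /FP[_ h] Xp]; apply: h.
  split.
  + by exists X0 => //; have [[]] := FP _ FX0.
  + move=> a x y x' y' [X FX Xx] [Y FY Yy].
    have [h|h] := tF _ _ FX FY.
      by exists Y => //; have [[_ q _] _] := FP _ FY; apply: q => //; apply: h.
    by exists X => //; have [[_ q _] _] := FP _ FX; apply: q => //; apply: h.
  + by move=> y [X FX Xy]; have [[_ _ q] _] := FP _ FX; apply: q.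
have [x0 xl xf] := lX.
have tot v : exists w, X (v, w).
  have [||w [Uw hw]] := bU (G := fun a y => X (a *: v, y)).
  - split; first by rewrite scale0r.
      move=> a b c b' c' hb hc.
      have -> : (a *: b + c : R^o) *: v = a *: ((b : R) *: v) + (c : R) *: v.
        by rewrite scalerDl scalerA.
      exact: xl.
    by move=> y; rewrite scale0r; apply: xf.
  - by move=> a y /XU.
  exists w; pose Y := [set p | exists x x' a,
    [/\ X (x, x'), p.1 = x + a *: v & p.2 = x' + a *: w]].
  apply: (mX Y); last 1 first.
  - by exists 0, 0, 1; rewrite !add0r !scale1r.
  - by move=> [x x'] h; exists x, x', 0; rewrite !scale0r !addr0.
  split; last first.
    move=> _ [x [x' [a [h _ ->]]]]; apply: submodD => //; first exact: (XU _ h).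
    exact: submodZ.
  split.
  - by exists 0, 0, 0; rewrite !scale0r !addr0.
  - move=> a _ _ _ _ [x1 [x1' [a1 [/= h1 -> ->]]]] [x2 [x2' [a2 [/= h2 -> ->]]]].
    exists (a *: x1 + x2), (a *: x1' + x2'), (a * a1 + a2); split; first exact: xl.
      by rewrite scalerDr scalerDl !scalerA addrACA.
    by rewrite /= scalerDr scalerDl !scalerA addrACA.
  move=> _ [x [x' [a [/= h e ->]]]].
  have : X (a *: v, - x').
    have -> : a *: v = -1 *: x + 0.
      by rewrite addr0 scaleN1r; apply/eqP; rewrite -addr_eq0 addrC -e.
    by rewrite -scaleN1r -[_ *: x']addr0; apply: xl.
  by move=> /hw <-; rewrite subrr.
have [h hh] := choice tot; exists h; split.
- move=> a x y; apply: (linrel_eq lX (hh _)); exact: xl.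
- by move=> v; apply: (XU _ (hh v)).
by move=> v y /(GX (v, y)) Gvy; apply: (linrel_eq lX Gvy).
Qed.
End Ext.

Lemma baer_injective (E : lmodType R) : baer [set: E] -> injective_module E.
Proof.
move=> bE U V i f inj_i.
pose G v y := exists2 u, v = i u & y = f u.
have [|//|h [hl _ hG]] := @baer_ext V E setT G (submoduleT E) bE.
  split; first by exists 0; rewrite linear0.
    by move=> a _ _ _ _ [u -> ->] [v -> ->]; exists (a *: u + v); rewrite linearP.
  by move=> _ [u e ->]; rewrite -(linear0 i) in e; rewrite -(inj_i _ _ e) linear0.
exists (mk_linear hl) => x; apply/esym; apply: hG; by exists x.
Qed.

(* the graph that sends a generator [x] of an ideal modulo [c] to [v] *)
Lemma baer_solve (V : lmodType R) (U : set V) (c : set R^o) (x : R) v :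
  submodule U -> baer U -> submodule c -> U v ->
  (forall b, c (b * x) -> b *: v = 0) ->
  exists w, [/\ U w, x *: w = v & forall a, c a -> (a : R) *: w = 0].
Proof.
move=> sU bU sc Uv h.
have [|a y [b [d [cd _ ->]]]|w [Uw hw]] := bU (fun a y => exists b d : R,
    [/\ c d, a = b * x + d & y = b *: v]).
- split.
  + by exists 0, 0; rewrite mul0r addr0 scale0r; split=> //; exact: sc.1.
  + move=> a _ _ _ _ [b [d [cd -> ->]]] [b' [d' [cd' -> ->]]].
    exists (a * b + b'), (a * d + d'); split; first exact: sc.2.
      by rewrite /GRing.scale /=; ring.
    by rewrite scalerDl scalerA.
  move=> _ [b [d [cd e ->]]]; apply: h.
  have -> : b * x = - d by apply/eqP; rewrite -addr_eq0 -e.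
  exact: (submodN sc cd).
- exact: submodZ.
exists w; split=> //.
  apply/esym; apply: hw; exists 1, 0; rewrite mul1r addr0 scale1r; split=> //.
  exact: sc.1.
move=> a ca; apply/esym/hw; exists 0, a; rewrite mul0r add0r scale0r.
by split.
Qed.

Lemma baer_retract (V V' : lmodType R) (U : set V) (U' : set V') (f : V -> V')
    (g : V' -> V) : linear f -> linear g -> baer U -> (forall v, U' v -> U (g v)) ->
  (forall u, U u -> U' (f u)) -> (forall v, U' v -> f (g v) = v) -> baer U'.
Proof.
move=> fl gl bU gU fU fg G [g0 g1 g2] GU.
have [||v [Uv hv]] := bU (fun a y => exists2 y', G a y' & y = g y').
- split; first by exists 0; rewrite ?linfun0.
    move=> a x y _ _ [x' Gx ->] [y' Gy ->]; exists (a *: x' + y'); first exact: g1.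
    by rewrite gl.
  by move=> _ [y /g2-> ->]; rewrite linfun0.
- by move=> a _ [y /GU ? ->]; apply: gU.
exists (f v); split; first exact: fU.
move=> a y Gay; rewrite -linfunZ // -(hv a (g y)); last by exists y.
by rewrite fg //; apply: GU Gay.
Qed.

End Baer.

Section Divisible.
Variable D : lmodType int.
Hypothesis div : forall (n : int) (y : D), n != 0 -> exists z, n *: z = y.

(** The domain of G is a subgroup of the integers. Its least positive element n generates it by
    division with remainder, so dividing the value at n by n settles all values. *)
Lemma baer_divisible : baer [set: D].
Proof.
move=> G [g0 g1 g2] _.
have gN a y : G a y -> G (- a) (- y).
  by move=> h; have := g1 (-1) a 0 y 0 h g0; rewrite !scaleN1r !addr0.
have [ex|nex] := pselect (exists n : nat, (0 < n)%N /\ exists y, G n%:Z y); last first.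
  have z a y : G a y -> a = 0.
    move=> h; apply/eqP; apply: contra_notT nex => a0.
    exists `|a|%N; rewrite absz_gt0 a0; split=> //.
    have [p|p] := leP 0 a; first by exists y; rewrite gez0_abs.
    by exists (- y); rewrite ltz0_abs //; apply: gN.
  exists 0; split=> // a y h; rewrite scaler0; apply: g2.
  by rewrite -(z _ _ h).
have ex' : exists n : nat, `[<(0 < n)%N /\ exists y, G n%:Z y>].
  by case: ex => n h; exists n; apply/asboolP.
case: (ex_minnP ex') => n /asboolP[n0 [yn hn]] min.
have nz : n%:Z != 0 by rewrite eqz_nat -lt0n.
have [e en] := div yn nz; exists e; split=> // a y h.
have hr : G (a %% n)%Z (y - (a %/ n)%Z *: yn).
  have -> : (a %% n)%Z = (- (a %/ n)%Z) *: (n%:Z : int^o) + a.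
    by rewrite {3}(divz_eq a n) /GRing.scale /=; ring.
  by rewrite [y - _]addrC -scaleNr; apply: g1.
have r0 : (a %% n)%Z = 0.
  apply/eqP; apply: contraT => r0.
  have rp : (0 <= a %% n)%Z by apply: modz_ge0.
  have : `[<(0 < `|(a %% n)%Z|)%N /\ exists y, G `|(a %% n)%Z|%:Z y>].
    apply/asboolP; rewrite absz_gt0 r0; split=> //.
    by exists (y - (a %/ n)%Z *: yn); rewrite gez0_abs.
  move/min; have := ltz_mod a nz; lia.
move: hr; rewrite r0 => /g2/eqP; rewrite subr_eq0 => /eqP->.
by rewrite -en scalerA -[X in _ = X *: _](_ : (a %/ n)%Z * n%:Z = a) // {2}(divz_eq a n) r0 addr0.
Qed.
End Divisible.

(** * Embedding an abelian group into a divisible group *)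

Section DivisibleHull.
Variable V : zmodType.
Let F : lmodType int := zmodule (V -> rat).

Definition combi (l : seq (int * V)) : F :=
  fun w => \sum_(p <- l) (if p.2 == w then p.1%:~R else 0).

(* the integral relations of V inside the rational functions on V *)
Definition relations : set F :=
  [set f | exists2 l, f = combi l & \sum_(p <- l) p.2 *~ p.1 = 0].

Lemma relations_submod : submodule relations.
Proof.
split.
  exists [::]; last by rewrite big_nil.
  by apply/funext => w; rewrite /combi big_nil.
move=> a _ _ [l1 -> h1] [l2 -> h2].
exists ([seq (a * p.1, p.2) | p <- l1] ++ l2).
  apply/funext => w; rewrite /combi big_cat big_map /=.
  transitivity ((\sum_(p <- l1) (if p.2 == w then p.1%:~R else 0 : rat)) *~ a
     + \sum_(p <- l2) (if p.2 == w then p.1%:~R else 0)); last first.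
    congr (_ + _); rewrite -mulrzl mulr_sumr; apply: eq_bigr => p _.
    by case: ifP; rewrite ?mulr0 // -intrM.
  rewrite [LHS](_ : _ = (a *: combi l1) w + combi l2 w) //; congr (_ + _).
  elim/int_rec: a => [|n IH|n IH]; first by rewrite scale0r mulr0z.
    by rewrite -add1n PoszD scalerDl mulrzDr -IH scale1r.
  by rewrite -addn1 PoszD opprD scalerDl mulrzDr -IH scaleN1r.
rewrite big_cat big_map /= h2 addr0.
transitivity ((\sum_(p <- l1) p.2 *~ p.1) *~ a); last by rewrite h1 mul0rz.
by rewrite mulrz_suml; apply: eq_bigr => p _; rewrite -mulrzA mulrC.
Qed.

(** V is the free abelian group on V modulo relations. The free group sits in a rational vector
    space of functions, whose quotient by the same relations is divisible. *)
Definition div_hull : lmodType int := quoT relations_submod.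

Lemma div_hull_div (n : int) (y : div_hull) : n != 0 -> exists z, n *: z = y.
Proof.
move=> n0; have [f ->] := quo_pi_surj y.
pose g : F := fun w => n%:~R^-1 * f w.
exists (quo_pi relations_submod g); rewrite -(linfunZ (quo_pi_lin _)).
congr quo_pi; apply/funext => w.
have E (k : int) : (k *: g) w = (k%:~R : rat) * g w.
  elim/int_rec: k => [|m IH|m IH]; first by rewrite scale0r mul0r.
    by rewrite -add1n PoszD scalerDl scale1r rmorphD /= mulrDl mul1r -IH.
  by rewrite -addn1 PoszD opprD scalerDl scaleN1r rmorphD /= mulrDl mulN1r -IH.
by rewrite E /g mulrA divff ?mul1r // intr_eq0.
Qed.

Definition div_in (v : V) : div_hull := quo_pi relations_submod (combi [:: (1, v)]).

Lemma div_inD v w : div_in (v + w) = div_in v + div_in w.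
Proof.
rewrite /div_in -(linfunD (quo_pi_lin _)); apply/quo_piE.
exists [:: (1, v + w); (-1, v); (-1, w)].
  apply/funext => u; rewrite /combi !big_cons big_nil /=.
  rewrite [LHS](_ : _ = combi [:: (1, v + w)] u - (combi [:: (1, v)] u + combi [:: (1, w)] u)) //.
  rewrite /combi !big_seq1 /=.
  by case: ifP => _; case: ifP => _; case: ifP => _.
by rewrite !big_cons big_nil /= !mulrNz !mulr1z addr0 -opprD subrr.
Qed.

(** If the basis function of v equals a combination l of value 0, their coefficients agree over the
    rationals, hence over the integers; summing by distinct elements of V gives v = 0. *)
Lemma div_in_inj v : div_in v = 0 -> v = 0.
Proof.
move=> /quo_pi0[l e h].
have partition (m : seq (int * V)) (s : seq V) : uniq s ->
    (forall p, p \in m -> p.2 \in s) ->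
    \sum_(p <- m) p.2 *~ p.1 =
    \sum_(w <- s) w *~ (\sum_(p <- m) (if p.2 == w then p.1 else 0)).
  move=> us ms; under [RHS]eq_bigr do rewrite mulrz_sumr.
  rewrite exchange_big /= big_seq [RHS]big_seq; apply: eq_bigr => p pm.
  rewrite (bigD1_seq p.2) ?ms //= eqxx big1 ?addr0 // => w /negbTE nw.
  by rewrite eq_sym nw mulr0z.
pose s := undup (v :: map snd l).
have e' w : \sum_(p <- [:: (1, v)]) (if p.2 == w then p.1 else 0) =
            \sum_(p <- l) (if p.2 == w then p.1 else 0) :> int.
  apply: (@intr_inj rat); rewrite !rmorph_sum /=.
  have := congr1 (@^~ w) e; rewrite /combi /= => e1.
  by etransitivity; [etransitivity; [|exact: e1]|]; apply: eq_bigr => p _; case: ifP.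
have : \sum_(p <- [:: (1, v)]) p.2 *~ p.1 = \sum_(p <- l) p.2 *~ p.1.
  have us : uniq s by apply: undup_uniq.
  have s1 (p : int * V) : p \in [:: (1, v)] -> p.2 \in s.
    by rewrite mem_seq1 => /eqP->; rewrite mem_undup mem_head.
  have s2 p : p \in l -> p.2 \in s.
    by move=> pl; rewrite mem_undup inE map_f ?orbT.
  rewrite (partition _ s us s1) (partition _ s us s2).
  by apply: eq_bigr => w _; rewrite e'.
by rewrite h big_seq1 mulr1z.
Qed.
End DivisibleHull.

(** * Injective hulls *)

Section Coinduced.
Variables (R : comNzRingType) (D : lmodType int).

Definition zmor : {pred R -> D} := fun f => `[< forall x y, f (x - y) = f x - f y >].

Fact zmor_closed : zmod_closed zmor.
Proof.
split; first by apply/asboolP => x y; rewrite -[LHS]/(0 : D) -[RHS]/(0 - 0 : D) subrr.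
move=> f g /asboolP fh /asboolP gh; apply/asboolP => x y.
rewrite -[LHS]/(f (x - y) - g (x - y)) -[RHS]/((f x - g x) - (f y - g y)).
by rewrite fh gh !opprD !opprK addrACA.
Qed.
HB.instance Definition _ := GRing.isZmodClosed.Build (R -> D) zmor zmor_closed.

(** The coinduced module Hom_Z(R, D), on which R acts through the argument. *)
Record coind := Coind { coind_val : R -> D; _ : coind_val \in zmor }.
HB.instance Definition _ := [isSub for coind_val].
HB.instance Definition _ := [Choice of coind by <:].
HB.instance Definition _ := [SubChoice_isSubZmodule of coind by <:].

Lemma coindB (f : coind) x y : coind_val f (x - y) = coind_val f x - coind_val f y.
Proof. by case: f => f /asboolP /=. Qed.
Lemma coind0 (f : coind) : coind_val f 0 = 0.
Proof. by rewrite -(subrr 0) coindB subrr. Qed.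
Lemma coindD (f : coind) x y : coind_val f (x + y) = coind_val f x + coind_val f y.
Proof. by rewrite -{1}(opprK y) coindB -[- y]add0r coindB coind0 sub0r opprK. Qed.
Lemma coindZ (f : coind) (n : int) x : coind_val f (x *~ n) = n *: coind_val f x.
Proof.
elim/int_rec: n => [|m IH|m IH]; first by rewrite mulr0z scale0r coind0.
  by rewrite intS mulrzDr mulr1z coindD IH scalerDl scale1r.
by rewrite intS opprD addrC mulrzDr mulrN1z coindB IH scalerDl scaleN1r.
Qed.

Fact coind_scale_subproof (a : R) (f : coind) :
  (fun x => coind_val f (a * x)) \in zmor.
Proof. by apply/asboolP => x y; rewrite mulrBr coindB. Qed.
Definition coind_scale a f := Coind (coind_scale_subproof a f).

Lemma coindP (f g : coind) : coind_val f =1 coind_val g -> f = g.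
Proof. by move=> h; apply/val_inj/funext. Qed.

Fact coind_scaleA a b x : coind_scale a (coind_scale b x) = coind_scale (a * b) x.
Proof. by apply: coindP => y /=; rewrite mulrA [b * a]mulrC. Qed.
Fact coind_scale1 : left_id 1 coind_scale.
Proof. by move=> x; apply: coindP => y /=; rewrite mul1r. Qed.
Fact coind_scaleDr : right_distributive coind_scale +%R.
Proof. by move=> a x y; apply: coindP. Qed.
Fact coind_scaleDl x : {morph coind_scale^~ x : a b / a + b}.
Proof.
move=> a b; apply: coindP => y.
rewrite [RHS](_ : _ = coind_val x (a * y) + coind_val x (b * y)) //.
by rewrite -coindD -mulrDl.
Qed.
HB.instance Definition _ := GRing.Zmodule_isLmodule.Build R coind
  coind_scaleA coind_scale1 coind_scaleDr coind_scaleDl.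

Lemma coindZE (a : R) (f : coind) x : coind_val (a *: f) x = coind_val f (a * x).
Proof. by []. Qed.
Lemma coindDE (f g : coind) x : coind_val (f + g) x = coind_val f x + coind_val g x.
Proof. by []. Qed.

(** Adjunction: composing a partial map into Hom_Z(R, D) with evaluation at 1 gives a partial
    additive map R -> D, and an additive extension of it to R is the required element. *)
Lemma baer_coind : baer [set: D] -> baer [set: coind].
Proof.
move=> bD G [g0 g1 g2] _.
pose G' (a : zmodule R) (y : D) := exists2 f, G a f & y = coind_val f 1.
have [||h [hl _ hG]] := @baer_ext int (zmodule R) D setT G' (submoduleT D) bD.
- split; first by exists 0.
    move=> n x y _ _ [f Gf ->] [g Gg ->]; exists (n%:~R *: f + g).
      rewrite [X in G X _](_ : _ = n%:~R *: (x : R^o) + y); first exact: g1.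
      by congr (_ + _); rewrite /GRing.scale /= mulrzl.
    by rewrite coindDE coindZE mulr1 -coindZ.
  by move=> _ [f /g2-> ->].
- by [].
have hm : (h : R -> D) \in zmor.
  by apply/asboolP => x y; apply: (linfunB hl).
exists (Coind hm); split=> // a f Gaf; apply: coindP => x; rewrite coindZE /=.
apply/esym/esym; rewrite -[x in LHS]mulr1 -coindZE; apply: hG.
exists (x *: f) => //; rewrite -[x *: f]addr0 [X in G X _](_ : _ = x *: (a : R^o) + 0).
  exact: g1.
by rewrite addr0 mulrC.
Qed.
End Coinduced.

Section Hull.
Variable R : comNzRingType.

Lemma enough_baer (V : lmodType R) : exists (E : lmodType R) (i : V -> E),
  [/\ linear i, forall v, i v = 0 -> v = 0 & baer [set: E]].
Proof.
pose D := div_hull V.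
have im v : (fun a : R => div_in (a *: v)) \in @zmor R D.
  apply/asboolP => x y; rewrite scalerBl; apply/eqP.
  by rewrite eq_sym subr_eq -div_inD subrK.
exists (coind R D), (fun v => Coind (im v)); split.
- move=> a v w; apply: coindP => x; rewrite coindDE coindZE /=.
  by rewrite scalerDr scalerA div_inD mulrC.
- move=> v /(congr1 (fun f => coind_val f 1)) /=; rewrite scale1r => h.
  by apply: div_in_inj; rewrite h.
by apply: baer_coind; apply: baer_divisible => n y; apply: div_hull_div.
Qed.

Definition ess (V : lmodType R) (S U : set V) :=
  forall u, U u -> u <> 0 -> exists a : R, S (a *: u) /\ a *: u <> 0.

(** Inside an injective I, let U be a maximal essential extension of V and W a maximal complement of
    U. The projection of U + W onto U extends to an endomorphism g of I, and g turns out to retract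
    I onto U. *)
Lemma hull_exists (V : lmodType R) : exists (E : lmodType R) (i : V -> E),
  [/\ linear i, forall v, i v = 0 -> v = 0, baer [set: E] & ess (range i) [set: E]].
Proof.
have [I [i [il ii bI]]] := enough_baer V.
have sim : submodule (range i) by apply: submodule_im.
have [||U [iU [sU eU] mU]] := @zorn_above _ [set X | submodule X /\ ess (range i) X] (range i).
- by split=> // u iu u0; exists 1; rewrite scale1r.
- move=> F FP tF [X0 FX0]; split; last by move=> u [X /FP[_ h] Xu]; apply: h.
  split; first by exists X0 => //; have [[]] := FP _ FX0.
  move=> a x y [X FX Xx] [Y FY Yy].
  have [h|h] := tF _ _ FX FY.
    by exists Y => //; have [q _] := FP _ FY; apply: q.2 => //; apply: h.
  by exists X => //; have [q _] := FP _ FX; apply: q.2 => //; apply: h.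
have [||W [_ [sW WU] mW]] := @zorn_above _
   [set X | submodule X /\ X `&` U `<=` [set 0]] [set 0].
- by split; [exact: submodule0|move=> u []].
- move=> F FP tF [X0 FX0]; split; last first.
    by move=> u [[X /FP[_ h] Xu] Uu]; apply: h.
  split; first by exists X0 => //; have [[]] := FP _ FX0.
  move=> a x y [X FX Xx] [Y FY Yy].
  have [h|h] := tF _ _ FX FY.
    by exists Y => //; have [q _] := FP _ FY; apply: q.2 => //; apply: h.
  by exists X => //; have [q _] := FP _ FX; apply: q.2 => //; apply: h.
have [||g [gl _ hg]] := @baer_ext _ I I setT (fun x y => exists w, [/\ U y, W w & x = y + w])
    (submoduleT I) bI.
- split; first by exists 0; rewrite addr0; split=> //; apply: submod0.
    move=> a _ _ x y [w [Ux Ww ->]] [w' [Uy Ww' ->]]; exists (a *: w + w').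
    by split; [exact: sU.2|exact: sW.2|rewrite scalerDr addrACA].
  move=> y [w [Uy Ww e]]; apply: WU; split=> //.
  have -> : y = - w by apply/eqP; rewrite -addr_eq0 -e.
  exact: submodN.
- by [].
have gU u : U u -> g u = u.
  by move=> Uu; apply/esym/hg; exists 0; rewrite addr0; split=> //; apply: submod0.
have gW w : W w -> g w = 0.
  by move=> Ww; apply/esym/hg; exists w; rewrite add0r; split=> //; apply: submod0.
(* The kernel of g contains W and meets U in 0. *)
have kerW : g @^-1` [set 0] `<=` W.
  apply: mW; first by move=> w /gW.
  split; first by apply: submodule_preim => //; apply: submodule0.
  by move=> u [/= g0 /gU e]; rewrite -e g0.
(* The image of g is still essential over V: if g v <> 0 then W + Rv meets U, so a multiple of g v
   is a nonzero element of U. Maximality of U then applies. *)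
have gIU v : U (g v).
  apply: (mU (range g)); last by exists v.
    by move=> u Uu; exists u => //; apply: gU.
  split; first exact: submodule_im.
  move=> _ [{}v _ <-] gv0.
  have nW : ~ W v by move=> /gW.
  have [h|] := pselect (wspan W [:: v] `&` U `<=` [set 0]).
    exfalso; apply: nW; apply: (mW (wspan W [:: v])); [exact: wspan_sub| |].
      by split=> //; apply: submodule_wspan.
    by apply: wspan_mem; rewrite // inE.
  move/existsNP => [u /not_implyP[[[a Wu] Uu] u0]].
  have gu : a *: g v = u.
    have := gW _ Wu; rewrite linfunB // linfunZ // gU // => /eqP.
    by rewrite subr_eq0 => /eqP.
  have [b [ib b0]] := eU _ Uu u0; exists (b * a).
  by rewrite -scalerA gu.
exists (subT sU), (fun v => sub_in sU (iU _ (imageT i v))); split.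
- by move=> a v w; apply: sub_val_inj; rewrite sub_val_lin !sub_inK il.
- by move=> v /(congr1 (@sub_val _ _ _ sU)); rewrite sub_inK => /ii.
- apply: (@baer_retract _ I (subT sU) setT setT (fun v => sub_in sU (gIU v))
    (@sub_val _ _ _ sU)) => //.
  + by move=> a v w; apply: sub_val_inj; rewrite sub_val_lin !sub_inK gl.
  + by move=> u _; apply: sub_val_inj; rewrite sub_inK gU //; apply: sub_valP.
move=> u _ u0; have [||a [[v _ iv] a0]] := eU (sub_val u).
- exact: sub_valP.
- by move=> h; apply: u0; apply: sub_val_inj; rewrite h (linfun0 (@sub_val_lin _ _ _ _)).
exists a; split.
  by exists v => //; apply: sub_val_inj; rewrite sub_inK iv (linfunZ (@sub_val_lin _ _ _ _)).
by move=> h; apply: a0; rewrite -(linfunZ (@sub_val_lin _ _ _ _)) h (linfun0 (@sub_val_lin _ _ _ _)).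
Qed.

Definition hullT (V : lmodType R) : lmodType R := projT1 (cid (hull_exists V)).
Definition hull_in (V : lmodType R) : V -> hullT V :=
  projT1 (cid (projT2 (cid (hull_exists V)))).
Lemma hullP (V : lmodType R) : [/\ linear (@hull_in V),
  forall v, @hull_in V v = 0 -> v = 0, baer [set: hullT V] &
  ess (range (@hull_in V)) [set: hullT V]].
Proof. exact: (projT2 (cid (projT2 (cid (hull_exists V))))). Qed.
End Hull.

(** * Torsion submodules of injective modules over a Noetherian ring *)

Section Gamma.
Variable R : comNzRingType.
Definition noeth := @noeP R R^o [set: R^o] [set 0].
Hypothesis nR : noeth.

Lemma ideal_stab (c : nat -> set R^o) : (forall i, submodule (c i)) ->
  (forall i, c i `<=` c i.+1) -> exists N, forall i, c i `<=` c N.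
Proof.
move=> sc; apply: (noeP_stab (@submodule0 R R^o) nR) => i.
by split=> // x ->; apply: submod0.
Qed.

Lemma noeth_fg (I : set R^o) : submodule I -> exists vs : seq R^o,
  (forall v, v \in vs -> I v) /\ I `<=` wspan [set 0] vs.
Proof.
move=> sI; have [|//|vs [h1 h2]] := nR sI; last by exists vs.
by move=> _ ->; apply: submod0.
Qed.

Lemma colon_submod (I : set R^o) (x : R) : submodule I ->
  submodule [set a : R^o | I (a * x : R)].
Proof.
move=> sI; split; first by rewrite /= mul0r; apply: sI.1.
move=> a b c /= hb hc; rewrite mulrDl [X in I (X + _)](_ : _ = a *: (b * x : R^o)).
  exact: sI.2.
by rewrite /GRing.scale /= mulrA.
Qed.

Lemma colon_stab (I : set R^o) (x : R) : submodule I ->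
  exists N, forall i (a : R), I (a * x ^+ i) -> I (a * x ^+ N).
Proof.
move=> sI; have [||N hN] := ideal_stab (c := fun i => [set a : R^o | I (a * x ^+ i : R)]).
- by move=> i; apply: colon_submod.
- move=> i a /= h; rewrite exprS mulrCA; exact: (submodZ x sI h).
by exists N => i a h; apply: (hN i).
Qed.

Variable V : lmodType R.
Implicit Types (U : set V) (x : R).

Definition gam x U : set V := [set u | U u /\ exists k, x ^+ k *: u = 0].

Lemma submodule_gam x U : submodule U -> submodule (gam x U).
Proof.
move=> sU; split; first by split; [apply: submod0|exists 0%N; rewrite scaler0].
move=> a u v [Uu [k hk]] [Uv [l hl]]; split; first exact: sU.2.
exists (k + l)%N; rewrite scalerDr exprD -[X in _ + X]scalerA hl scaler0 addr0.
rewrite scalerA (_ : _ * a = a * x ^+ l * x ^+ k); last by ring.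
by rewrite -scalerA hk scaler0.
Qed.

(** A substitute for Artin-Rees: with t and N as below, a partial map into the x-torsion vanishes on
    the multiples of x^(N+t) in its domain I. It therefore extends by 0 to I + (x^(N+t)), and an
    element representing this extension is x-torsion. *)
Lemma baer_gam x U : submodule U -> baer U -> baer (gam x U).
Proof.
move=> sU bU G lG GU; have [g0 g1 g2] := lG.
pose I : set R^o := [set a | exists y, G a y].
have sI : submodule I.
  by split; [exists 0|move=> a b c [y hy] [z hz]; exists (a *: y + z); apply: g1].
have [vs [vI Iv]] := noeth_fg sI.
pose J t : set R^o := [set a | exists y, G a y /\ x ^+ t *: y = 0].
have sJ t : submodule (J t).
  split; first by exists 0; rewrite scaler0.
  move=> a b c [y [hy y0]] [z [hz z0]]; exists (a *: y + z); split; first exact: g1.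
  by rewrite scalerDr scalerA mulrC -scalerA y0 z0 scaler0 addr0.
have Jle t t' : (t <= t')%N -> J t `<=` J t'.
  move=> tt' a [y [hy y0]]; exists y; split=> //.
  by rewrite -(subnK tt') exprD -scalerA y0 scaler0.
have [t ht] : exists t, forall v, v \in vs -> J t v.
  elim: vs vI {Iv} => [|v vs IH] vI; first by exists 0%N.
  have [|t ht] := IH; first by move=> w ws; apply: vI; rewrite inE ws orbT.
  have [y Gy] := vI _ (mem_head _ _); have [_ [k hk]] := GU _ _ Gy.
  exists (maxn t k) => w; rewrite inE => /orP[/eqP->|/ht]; last first.
    by apply: Jle; apply: leq_maxl.
  by apply: (Jle k); [apply: leq_maxr|exists y].
have IJ : I `<=` J t.
  by move=> a /Iv; apply: wspan_min => // _ ->; apply: submod0.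
have [N hN] := colon_stab x sI.
have [||v [Uv hv]] := bU (fun a y => exists b c : R, G b y /\ a = b + c * x ^+ (N + t)).
- split.
  + by exists 0, 0; rewrite mul0r addr0.
  + move=> a _ _ y z [b [c [h ->]]] [b' [c' [h' ->]]].
    exists (a *: (b : R^o) + b'), (a * c + c'); split; first exact: g1.
    by rewrite /GRing.scale /=; ring.
  move=> y [b [c [h e]]]; apply: (linrel_eq lG h).
  have hb : b = (- c) * x ^+ (N + t).
    by apply/eqP; rewrite mulNr -addr_eq0 -e.
  (* If c x^(N+t) lies in I, so does c x^N by the choice of N, and x^t kills its value. *)
  have /hN/IJ[z [hz z0]] : I ((- c) * x ^+ (N + t)) by exists y; rewrite -hb.
  rewrite hb exprD mulrA -z0 -[x ^+ t *: z]addr0 mulrC.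
  rewrite [X in G X _](_ : _ = x ^+ t *: ((- c) * x ^+ N : R^o) + 0) ?addr0 //.
  by rewrite -[X in G X _]addr0 -[X in G _ X]addr0; apply: g1.
- by move=> a y [b [c [/GU[? _] _]]].
exists v; split; last by move=> a y h; apply: hv; exists a, 0; rewrite mul0r addr0.
split=> //; exists (N + t)%N; apply/esym/hv; exists 0, 1.
by rewrite mul1r add0r.
Qed.

(* multiplication by a power of x is surjective on U modulo the x-torsion *)
Lemma baer_gam_div x U k e : submodule U -> baer U -> U e ->
  exists y, U y /\ gam x U (x ^+ k *: y - e).
Proof.
move=> sU bU Ue; have [N hN] := colon_stab x (@submodule0 R R^o).
have [||w [Uw hw _]] := @baer_solve R V U [set 0] (x ^+ (N + k)) (x ^+ N *: e) sU bU (@submodule0 _ _).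
- exact: submodZ.
- by move=> b /= /hN; rewrite scalerA => ->; rewrite scale0r.
exists w; split=> //; split; first by apply: submodB => //; apply: submodZ.
by exists N; rewrite scalerBr scalerA -exprD hw subrr.
Qed.
End Gamma.

(** * Primes, systems of parameters and chain conditions *)

Fixpoint ins (T : Type) (x : T) (s : seq T) : Prop :=
  if s is y :: s' then x = y \/ ins x s' else False.

Lemma ins_cat (T : Type) (x : T) s t : ins x (s ++ t) <-> ins x s \/ ins x t.
Proof. by elim: s => [|y s IH] /=; [split; [right|case]|rewrite IH; tauto]. Qed.

Lemma ins_split (T : Type) (x : T) s : ins x s -> exists s1 s2, s = s1 ++ x :: s2.
Proof.
elim: s => //= y s IH [->|/IH[s1 [s2 ->]]]; first by exists [::], s.
by exists (y :: s1), s2.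
Qed.

Section ChainConditions.
Variables (R : comNzRingType) (V : lmodType R).
Implicit Types (U W X : set V).

Lemma art_min U W (F : set (set V)) X0 : artP U W -> F X0 ->
  (forall X, F X -> [/\ submodule X, W `<=` X & X `<=` U]) ->
  exists X, F X /\ forall Y, F Y -> Y `<=` X -> X `<=` Y.
Proof.
move=> a FX0 hF; apply: contrapT => n.
have step X : exists Y, F X -> [/\ F Y, Y `<=` X & ~ X `<=` Y].
  have [FX|nF] := pselect (F X); last by exists X.
  apply: contrapT => h; apply: n; exists X; split=> // Y FY YX.
  by apply: contrapT => XY; apply: h; exists Y.
have [g hg] := choice step.
have Fi i : F (iter i g X0) by elim: i => // i IH; have [] := hg _ IH.
have [i|i|N hN] := a (fun i => iter i g X0); first exact/hF.
  by have [] := hg _ (Fi i).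
by have [_ _] := hg _ (Fi N); apply; apply: (hN N.+1).
Qed.

Lemma noe_max U W (F : set (set V)) X0 : submodule W -> noeP U W -> F X0 ->
  (forall X, F X -> [/\ submodule X, W `<=` X & X `<=` U]) ->
  exists X, F X /\ forall Y, F Y -> X `<=` Y -> Y `<=` X.
Proof.
move=> sW a FX0 hF; apply: contrapT => n.
have step X : exists Y, F X -> [/\ F Y, X `<=` Y & ~ Y `<=` X].
  have [FX|nF] := pselect (F X); last by exists X.
  apply: contrapT => h; apply: n; exists X; split=> // Y FY YX.
  by apply: contrapT => XY; apply: h; exists Y.
have [g hg] := choice step.
have Fi i : F (iter i g X0) by elim: i => // i IH; have [] := hg _ IH.
have [i|i|N hN] := noeP_stab sW a (c := fun i => iter i g X0); first exact/hF.
  by have [] := hg _ (Fi i).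
by have [_ _] := hg _ (Fi N); apply; apply: (hN N.+1).
Qed.

Lemma flen_art U W : submodule U -> submodule W -> flen U W -> artP U W.
Proof.
move=> sU sW f c hc dc.
have cU i : W `<=` c i by have [] := hc i.
have fi i : flen (c i) W by have [h1 h2 h3] := hc i; apply: flen_sub f.
have ex : exists n, `[<exists i, len (c i) W = n>].
  by exists (len (c 0%N) W); apply/asboolP; exists 0%N.
case: (ex_minnP ex) => n /asboolP[N hN] min; exists N => i Ni.
have [h1 h2 h3] := hc N; have [h1' h2' h3'] := hc i.
have ci := desc_le dc Ni.
have := len_add h1 h1' sW h2' ci (fi N).
have : (n <= len (c i) W)%N by apply: min; apply/asboolP; exists i.
move=> le e; apply: len_eq0 => //; last by lia.
by apply: flen_quo (fi N).
Qed.
End ChainConditions.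

Section NoethRing.
Variable R : comNzRingType.
Hypothesis nR : noeth R.

Lemma noeth_ind (Q : set R^o -> Prop) :
  (forall I, submodule I -> (forall J, submodule J -> I `<=` J -> ~ J `<=` I -> Q J) ->
    Q I) -> forall I, submodule I -> Q I.
Proof.
move=> h I0 sI0; apply: contrapT => nQ.
have [//||I [[sI nI] mI]] := @noe_max _ _ _ _ [set I | submodule I /\ ~ Q I] I0
  (@submodule0 R R^o) nR.
  by move=> X [sX _]; split=> // x ->; apply: submod0.
apply: nI; apply: h => // J sJ IJ JI; apply: contrapT => nJ.
by apply: JI; apply: mI.
Qed.
End NoethRing.

Section Primes.
Variable R : comNzRingType.
Implicit Types (a b I J n P Q : set R^o) (x y : R) (Ps : seq (set R^o)).

Definition is_prime P := [/\ submodule P, ~ P 1 &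
  forall x y, P (x * y : R) -> P x \/ P y].

Lemma idealM P x y : submodule P -> P y -> P (x * y : R).
Proof. by move=> sP Py; apply: (submodZ x sP Py). Qed.
Lemma idealMl P x y : submodule P -> P x -> P (x * y : R).
Proof. by rewrite mulrC; apply: idealM. Qed.

Lemma prime_prod P (I : Type) (r : seq I) (F : I -> R) : is_prime P ->
  (forall i, ~ P (F i)) -> ~ P (\prod_(i <- r) F i : R).
Proof.
move=> [_ P1 hP] hF; elim: r => [|i r IH]; first by rewrite big_nil.
by rewrite big_cons => /hP[/hF|].
Qed.

Lemma prime_exp P x k : is_prime P -> P (x ^+ k : R) -> P x.
Proof.
move=> [_ P1 hP]; elim: k => [|k IH]; first by rewrite expr0.
by rewrite exprS => /hP[|/IH].
Qed.

Lemma prime_avoid n Ps : submodule n -> (forall P, ins P Ps -> is_prime P) ->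
  exists x, n x /\ forall P, ins P Ps -> ~ n `<=` P -> ~ P x.
Proof.
move=> sn; have [k] := ubnP (size Ps); elim: k Ps => // k IH [|P Ps] /= sz hP.
  by exists 0; split=> //; apply: sn.1.
have hPs Q : ins Q Ps -> is_prime Q by move=> h; apply: hP; right.
have pP : is_prime P by apply: hP; left.
have [nP|nP] := pselect (n `<=` P).
  have [x [nx hx]] := IH _ sz hPs; exists x; split=> // Q [->|/hx//].
  by move=> /(_ nP).
have [[Q [QPs QP]]|nQ] := pselect (exists Q, ins Q Ps /\ Q `<=` P).
  have [s1 [s2 e]] := ins_split QPs.
  have [||x [nx hx]] := IH (P :: s1 ++ s2).
  - by move: sz; rewrite e /= !size_cat /=; lia.
  - move=> T /= [->//|/ins_cat h]; apply: hPs; rewrite e; apply/ins_cat.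
    by case: h => h; [left|right; right].
  exists x; split=> // T h nT; case: h => [->|]; first by apply: hx => //; left.
  rewrite e => /ins_cat[h|[->|h]].
  + by apply: hx => //; right; apply/ins_cat; left.
  + by move=> Qx; apply: (hx P) => //=; [left|apply: QP].
  + by apply: hx => //; right; apply/ins_cat; right.
have [x [nx hx]] := IH _ sz hPs.
have [Px|nPx] := pselect (P x); last first.
  by exists x; split=> // T [-> _ //|/hx//].
have [sP P1 hP'] := pP.
have [y [ny Py]] : exists y, n y /\ ~ P y.
  by move/existsNP: nP => [y /not_implyP[? ?]]; exists y.
(* If x falls into P, it is corrected by an element z of n and of all other primes that is outside
   P. *)
have [z [nz Pz hz]] : exists z, [/\ n z, ~ P z & forall Q, ins Q Ps -> Q z].
  elim: Ps hPs nQ {IH sz hP hx} => [|Q Ps IH] hPs nQ; first by exists y.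
  have [||z [nz Pz hz]] := IH.
  - by move=> T h; apply: hPs; right.
  - by move=> [T [h1 h2]]; apply: nQ; exists T; split=> //; right.
  have : ~ Q `<=` P by move=> h; apply: nQ; exists Q; split=> //; left.
  move/existsNP => [q /not_implyP[Qq Pq]]; exists (q * z); split.
  - exact: idealM.
  - by move=> /hP'[].
  move=> T [->|h].
    by apply: idealMl => //; have [] := hPs Q (or_introl erefl).
  by apply: idealM; [have [] := hPs T (or_intror h)|apply: hz].
exists (x + z); split; first exact: (submodD sn nx nz).
move=> T [->|h] nT Txz.
  by apply: Pz; have := submodB sP Txz Px; rewrite addrC addKr.
have [sT _ _] := hPs _ h.
by apply: (hx T h nT); have := submodB sT Txz (hz T h); rewrite addrK.
Qed.

(* [prodset Ps a 1] says that a contains the product of the ideals in Ps. *)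
Fixpoint prodset Ps a : set R :=
  if Ps is P :: Ps' then fun y => forall p : R, P p -> prodset Ps' a (p * y) else a.

Lemma prodset_cat Ps Qs a : prodset (Ps ++ Qs) a = prodset Ps (prodset Qs a).
Proof. by elim: Ps => //= P Ps ->. Qed.
Lemma prodset_mono Ps a b : a `<=` b -> prodset Ps a `<=` prodset Ps b.
Proof. by move=> ab; elim: Ps => //= P Ps IH y h p /h /IH. Qed.
Lemma prodset_submod Ps a : submodule a -> submodule (prodset Ps a : set R^o).
Proof.
move=> sa; elim: Ps => //= P Ps IH; split=> [p Pp|c x y hx hy p Pp].
  by rewrite mulr0; apply: IH.1.
rewrite [X in prodset _ _ X](_ : _ = c *: (p * x : R^o) + p * y).
  by apply: IH.2; [apply: hx|apply: hy].
by rewrite /GRing.scale /=; ring.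
Qed.
Lemma prodset_scale Ps a b x y : (forall z, b z -> a (z * x : R)) ->
  prodset Ps b y -> prodset Ps a (y * x).
Proof.
move=> h; elim: Ps y => [|P Ps IH] y /=; first exact: h.
by move=> hy p Pp; rewrite mulrA; apply/IH/hy.
Qed.
Lemma prodset_prime Ps Q y : is_prime Q -> prodset Ps Q y -> ~ Q y ->
  exists P, ins P Ps /\ P `<=` Q.
Proof.
move=> pQ; elim: Ps y => //= P Ps IH y h Qy.
have [PQ|] := pselect (P `<=` Q); first by exists P; split=> //; left.
move/existsNP => [p /not_implyP[Pp Qp]].
have [|T [T1 T2]] := IH _ (h _ Pp); last by exists T; split=> //; right.
by case: pQ => _ _ hQ /hQ[].
Qed.

(** If x y is in a with x and y outside a, the primes found for a + (x) and for a + (y) are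
    concatenated, since the product of these two ideals lies in a. *)
Lemma primes_above (nR : noeth R) a : submodule a -> exists Ps,
  (forall P, ins P Ps -> is_prime P /\ a `<=` P) /\ prodset Ps a 1.
Proof.
move: a; apply: (noeth_ind nR) => a sa IH.
have [a1|a1] := pselect (a 1); first by exists [::].
have [pa|npa] := pselect (is_prime a).
  exists [:: a]; split; first by move=> P /= [->|//]; split.
  by move=> p ap /=; rewrite mulr1.
have [x [y [axy ax ay]]] : exists x y : R, [/\ a (x * y : R), ~ a x & ~ a y].
  apply: contrapT => h; apply: npa; split=> // x y axy.
  apply: contrapT => /not_orP[? ?]; apply: h; by exists x, y.
have sx : submodule (wspan a [:: (x : R^o)]) by apply: submodule_wspan.
have sy : submodule (wspan a [:: (y : R^o)]) by apply: submodule_wspan.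
have mx (z : R^o) : wspan a [:: z] z by apply: wspan_mem; rewrite // mem_head.
have [||Ps [h1 h2]] := IH _ sx; [exact: wspan_sub|by move=> h; apply/ax/h|].
have [||Qs [k1 k2]] := IH _ sy; [exact: wspan_sub|by move=> h; apply/ay/h|].
exists (Ps ++ Qs); split.
  move=> P /ins_cat[/h1[? h]|/k1[? h]]; split=> //;
    by apply: subset_trans h; apply: wspan_sub.
rewrite prodset_cat; apply: prodset_mono h2.
apply: wspan_min.
- exact: prodset_submod.
- move=> z az; have := @prodset_scale Qs a (wspan a [:: (y : R^o)]) z 1.
  by rewrite mul1r; apply=> // t _; apply: idealM.
move=> t; rewrite inE => /eqP->; rewrite -[x]mul1r.
apply: prodset_scale k2 => z [b] h /=.
rewrite (_ : z * x = (z - b * y) * x + b * (x * y)); last by ring.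
by apply: (submodD sa); [apply: idealMl|apply: idealM].
Qed.

(** Locality through units, which is what computations use; [locring_of] and [local_of] connect it
    with maximal ideals. *)
Definition locring n := [/\ submodule n, ~ n 1 & forall x, ~ n x -> exists y, y * x = 1 :> R].

Lemma locring_prime n : locring n -> is_prime n.
Proof.
move=> [sn n1 hn]; split=> // x y nxy; apply: contrapT => /not_orP[/hn[x' ex] /hn[y' ey]].
apply: n1; rewrite (_ : 1 = x' * y' * (x * y)); first exact: idealM.
by rewrite (_ : _ * _ = (x' * x) * (y' * y)); [rewrite ex ey mulr1|ring].
Qed.

Lemma proper_sub n I : locring n -> submodule I -> ~ I 1 -> I `<=` n.
Proof.
move=> [sn n1 hn] sI I1 x Ix; apply: contrapT => /hn[y e]; apply: I1.
by rewrite -e; apply: idealM.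
Qed.

Lemma locring1 n t : locring n -> n t -> exists y, y * (1 - t) = 1 :> R.
Proof.
move=> [sn n1 hn] nt; apply: hn => h; apply: n1.
by rewrite -(subrK t 1); apply: (submodD sn h nt).
Qed.

(** Dimension of R / a at least k; the negation of [pchain j.+1 a] serves as dim R / a <= j. *)
Definition pchain k a := exists Q : nat -> set R^o, [/\ forall i, is_prime (Q i),
  a `<=` Q 0%N & forall i, (i < k)%N -> Q i `<=` Q i.+1 /\ ~ Q i.+1 `<=` Q i].

(* If n is the maximal ideal: the ideal a is the unit ideal or n-primary. *)
Definition prim n a := exists k, forall l : seq R, size l = k ->
  (forall x, x \in l -> n x) -> a (\prod_(x <- l) x : R).

Lemma prim_mono n a b : a `<=` b -> prim n a -> prim n b.
Proof. by move=> ab [k h]; exists k => l sl nl; apply/ab/h. Qed.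

Lemma pchain_cons a k P (Q : nat -> set R^o) : is_prime P -> a `<=` P ->
  (forall i, is_prime (Q i)) -> P `<=` Q 0%N -> ~ Q 0%N `<=` P ->
  (forall i, (i < k)%N -> Q i `<=` Q i.+1 /\ ~ Q i.+1 `<=` Q i) -> pchain k.+1 a.
Proof.
move=> pP aP pQ PQ QP h; exists (fun i => if i is j.+1 then Q j else P).
by split=> // -[|i] //= ik; apply: h.
Qed.

Lemma prodset_prod n a Ts (l : seq R) y : (forall P, ins P Ts -> n `<=` P) -> prodset Ts a y ->
  size l = size Ts -> (forall x, x \in l -> n x) -> a (\prod_(x <- l) x * y : R).
Proof.
elim: Ts l y => [|P Ts IH] [|x l] y hT //=.
  by move=> ay _ _; rewrite big_nil mul1r.
move=> hy [sz] nl; rewrite big_cons [x * _]mulrC -mulrA; apply: IH => //.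
- by move=> Q h; apply: hT; right.
- by apply: hy; apply: (hT P); [left|apply: nl; rewrite mem_head].
- by move=> z zl; apply: nl; rewrite inE zl orbT.
Qed.

Lemma prim_of_primes n (nR : noeth R) a : submodule a ->
  (forall P, is_prime P -> a `<=` P -> n `<=` P) -> prim n a.
Proof.
move=> sa h; have [Ps [hPs p1]] := primes_above nR sa; exists (size Ps) => l sz nl.
rewrite -[\prod_(x <- l) x]mulr1; apply: prodset_prod p1 sz nl => P /hPs[pP aP].
exact: h.
Qed.

Section SystemsOfParameters.
Variables (n : set R^o) (nR : noeth R) (lR : locring n).

Lemma sop_base a : submodule a -> ~ pchain 1 a -> prim n a.
Proof.
move=> sa nc; apply: prim_of_primes => // P pP aP; apply: contrapT => nP; apply: nc.
apply: (pchain_cons (P := P) (Q := fun=> n)) => //; first by move=> _; apply: locring_prime.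
by have [sP P1 _] := pP; apply: proper_sub.
Qed.

(** Outside the finitely many primes P of [primes_above] other than n, x lowers the dimension: a
    chain above a + (x) starts above some such P, which lacks x, so P can be put in front. The extra
    primes [Ts] serve filter-regularity. *)
Lemma sop_step j a Ts : submodule a -> ~ pchain j.+2 a -> (forall P, ins P Ts -> is_prime P) ->
  exists x, [/\ n x, forall P, ins P Ts -> ~ n `<=` P -> ~ P x &
    ~ pchain j.+1 (wspan a [:: (x : R^o)])].
Proof.
move=> sa nc pT; have [sn n1 hn] := lR; have [Ps [hPs p1]] := primes_above nR sa.
have [|x [nx hx]] := prime_avoid (Ps := Ps ++ Ts) sn.
  by move=> P /ins_cat[/hPs[]|/pT].
exists x; split=> // [P PT|]; first by apply: hx; apply/ins_cat; right.
move=> [Q [pQ aQ hQ]]; have Qx : Q 0%N x.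
  by apply: aQ; apply: wspan_mem; rewrite // mem_head.
have {}aQ : a `<=` Q 0%N by apply: subset_trans aQ; apply: wspan_sub.
have p1' : prodset Ps (Q 0%N) 1 by apply: prodset_mono p1.
have [_ Q1 _] := pQ 0%N; have [P [PPs PQ]] := prodset_prime (pQ 0%N) p1' Q1.
have [pP aP] := hPs _ PPs.
apply: nc; apply: (pchain_cons pP aP pQ) => // QP.
apply: (hx P) => [|nP|]; [by apply/ins_cat; left| |exact: QP].
(* The chain has at least one step, so Q 0 is strictly smaller than n; hence P, which lies in Q 0,
   does not contain n and avoidance applies to it. *)
have [_ h] := hQ 0%N isT; apply: h; apply: (@subset_trans _ n).
  by have [q1 q2 _] := pQ 1%N; apply: proper_sub.
exact: subset_trans nP PQ.
Qed.

Lemma sop_exists j a : submodule a -> a `<=` n -> ~ pchain j.+1 a ->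
  exists s : seq R, [/\ size s = j, forall x, x \in s -> n x & prim n (wspan a (s : seq R^o))].
Proof.
elim: j a => [|j IH] a sa an nc; first by exists [::]; split=> //; apply: sop_base.
have [//|x [nx _ nc']] := sop_step (Ts := [::]) sa nc.
have sx : submodule (wspan a [:: (x : R^o)]) by apply: submodule_wspan.
have xn : wspan a [:: (x : R^o)] `<=` n.
  by apply: wspan_min; [have [] := lR| |move=> t; rewrite inE => /eqP->].
have [s [sz ns ps]] := IH _ sx xn nc'.
exists (s ++ [:: x]); split; first by rewrite size_cat sz addn1.
  by move=> z; rewrite mem_cat inE => /orP[/ns|/eqP->].
by rewrite wspan_cat.
Qed.
End SystemsOfParameters.

End Primes.

(** * Finite length from chain conditions *)

Section FiniteLength.
Variables (R : comNzRingType) (n : set R^o) (lR : locring n) (V : lmodType R).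
Implicit Types (U W X : set V).

Definition nkill U W := forall a u, n a -> U u -> W (a *: u).

Lemma simple_len W v : submodule W -> (forall a : R, n a -> W (a *: v)) -> ~ W v ->
  is_greatest (chain (wspan W [:: v]) W) 1.
Proof.
move=> sW nv Wv; split.
  apply: (chain_ext (U := W)); [exact: submodule_wspan|exact: wspan_sub| |exact: chain0].
  by move=> h; apply: Wv; apply: h; apply: wspan_mem; rewrite // mem_head.
case=> [|[|k]] // /(@chain_le _ _ _ _ k.+2 2 isT)[c [h1 h2 h3 h4]].
have [c1 c2] := h4 0%N isT; have [c3 c4] := h4 1%N isT.
exfalso; apply: c4; apply: (subset_trans h3); apply: wspan_min => //.
  exact: subset_trans h2 c1.
move=> w; rewrite inE => /eqP->.
move/existsNP: c2 => [y /not_implyP[cy ny]].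
have [a Wya] := h3 _ (c3 _ cy).
have [na|na] := pselect (n a).
  exfalso; apply/ny/h2; apply: (submod_subl sW Wya); exact: nv.
have [_ _ hn] := lR; have [b e] := hn _ na.
rewrite -[v]scale1r -e -scalerA; apply: submodZ => //.
by apply: submod_subr cy => //; apply/c1/h2.
Qed.

Lemma flen_step W v : submodule W -> (forall a : R, n a -> W (a *: v)) ->
  flen (wspan W [:: v]) W.
Proof.
move=> sW nv; have [Wv|Wv] := pselect (W v).
  have -> : wspan W [:: v] = W; last exact: flenxx.
  apply/seteqP; split; last exact: wspan_sub.
  by apply: wspan_min => // w; rewrite inE => /eqP->.
by exists 1%N; have [] := simple_len sW nv Wv.
Qed.

Lemma noe_kill_flen U W : pair U W -> noeP U W -> nkill U W -> flen U W.
Proof.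
move=> [sU sW WU] a k; have [//|//|//|vs [v1 v2]] := a U.
have : flen (wspan W vs) W.
  elim: vs {v1} v2 => [|v vs IH] h; first exact: flenxx.
  have h' w : w \in vs -> U w by move=> ws; apply: h; rewrite inE ws orbT.
  have svs : submodule (wspan W vs) by apply: submodule_wspan.
  have sv := submodule_wspan (v :: vs) sW.
  apply: (flen_ext sv svs sW); [exact: wspan_sub|exact: (@wspan_sub _ _ _ [:: v])| |exact: IH].
  apply: (@flen_step (wspan W vs) v) => // b nb; apply: wspan_sub.
  by apply: k => //; apply: h; rewrite mem_head.
by apply: flen_sub => //; apply: submodule_wspan.
Qed.

(** Take X minimal among the submodules of finite colength. If u is in X outside W, a submodule H of
    X maximal without u satisfies X = H + Ru, so X / H is simple and H contradicts minimality. *)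
Lemma art_kill_flen U W : pair U W -> artP U W -> nkill U W -> flen U W.
Proof.
move=> [sU sW WU] a k.
have [||X [[sX WX XU fX] mX]] := art_min (F := [set X | [/\ submodule X, W `<=` X, X `<=` U & flen U X]])
   (X0 := U) a.
- by split=> //; apply: flenxx.
- by move=> X [].
have [XW|] := pselect (X `<=` W).
  by have -> : W = X by apply/seteqP; split.
move/existsNP => [u /not_implyP[Xu Wu]]; exfalso.
have [||H [WH [sH HX Hu] mH]] := @zorn_above _ [set Y | [/\ submodule Y, Y `<=` X & ~ Y u]] W.
- by [].
- move=> F FP tF [X0 FX0]; split.
  + split; first by exists X0 => //; have [[]] := FP _ FX0.
    move=> b x y [Z FZ Zx] [Y FY Yy]; have [h|h] := tF _ _ FZ FY.
      by exists Y => //; have [q _ _] := FP _ FY; apply: q.2 => //; apply: h.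
    by exists Z => //; have [q _ _] := FP _ FZ; apply: q.2 => //; apply: h.
  + by move=> x [Y /FP[_ h _] Yx]; apply: h.
  + by move=> [Y /FP[_ _ h]].
have XHu : X `<=` wspan H [:: u].
  move=> v Xv; have [Hv|Hv] := pselect (H v); first exact: wspan_sub.
  have [b Hub] : wspan H [:: v] u.
    apply: contrapT => h; apply: Hv; apply: (mH (wspan H [:: v])).
    - exact: wspan_sub.
    - split=> //; first exact: submodule_wspan.
      by apply: wspan_min => // w; rewrite inE => /eqP->.
    by apply: wspan_mem; rewrite // mem_head.
  have nb : ~ n b.
    move=> nb; apply: Hu; apply: submod_subl Hub _ => //.
    by apply: WH; apply: k => //; apply: XU.
  have [_ _ hn] := lR; have [c e] := hn _ nb.
  exists c; rewrite -[v]scale1r -e -scalerA -scalerBr -opprB scalerN -scaleNr.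
  exact: submodZ.
apply: Hu; apply: (mX H) => //; split=> //; first exact: subset_trans HX XU.
apply: (flen_ext sU sX sH) => //.
have /flen_sub : flen (wspan H [:: u]) H.
  apply: flen_step => // b nb; apply: WH; apply: k => //; exact: XU.
by apply=> //; apply: submodule_wspan.
Qed.

Definition nilP k U W := forall l : seq R, size l = k ->
  (forall x, x \in l -> n x) -> forall u, U u -> W ((\prod_(x <- l) x) *: u).

(** The predicate P is abstract so that [artP] and [noeP] share the reduction from nilpotent action
    of n to trivial action. *)
Lemma nil_flen (P : set V -> set V -> Prop) :
  (forall U W U1 W1, W `<=` W1 -> U1 `<=` U -> P U W -> P U1 W1) ->
  (forall U W, pair U W -> P U W -> nkill U W -> flen U W) ->
  forall k U W, pair U W -> P U W -> nilP k U W -> flen U W.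
Proof.
move=> hP kP; elim=> [|k IH] U W p a nl; have [sU sW WU] := p.
  have -> : U = W; last exact: flenxx.
  apply/seteqP; split=> // u Uu.
  by have := nl [::] erefl _ u Uu; rewrite big_nil scale1r; apply.
pose X : set V := [set u | U u /\ forall b : R, n b -> W (b *: u)].
have sX : submodule X.
  apply: (submoduleI (T := [set u | forall b : R, n b -> W (b *: u)])) => //.
  split=> [b _|c x y hx hy b nb]; first by rewrite scaler0; apply: submod0.
  by rewrite scalerDr scalerA mulrC -scalerA; apply: sW.2; [apply: hx|apply: hy].
have WX : W `<=` X by move=> w Ww; split; [apply: WU|move=> b _; apply: submodZ].
have XU : X `<=` U by move=> u [].
apply: (flen_ext sU sX sW) => //.
  apply: IH => //; first exact: hP a.
  move=> l sz nl' u Uu; split; first exact: submodZ.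
  move=> b nb; rewrite scalerA; have := nl (b :: l); rewrite big_cons /= sz => h.
  by apply: h => // x; rewrite inE => /orP[/eqP->|/nl'].
apply: kP => //; first exact: hP a.
by move=> b u nb [_]; apply.
Qed.

Lemma good_of (P : set V -> set V -> Prop) (c : set R^o) (s : seq R) U W :
  (forall U W U1 W1, W `<=` W1 -> U1 `<=` U -> P U W -> P U1 W1) ->
  (forall U W, pair U W -> P U W -> nkill U W -> flen U W) ->
  P U W -> prim n (wspan c (s : seq R^o)) -> (forall b u, c b -> U u -> W (b *: u)) ->
  good s U W.
Proof.
move=> hP kP PUW [k hk] cU U' W' p h1 h2 ks; have [sU' sW' WU'] := p.
apply: (nil_flen hP kP (k := k)) => //; first exact: hP PUW.
move=> l sz nl u Uu.
have : wspan c (s : seq R^o) (\prod_(x <- l) x) by apply: hk.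
have sI : submodule [set b : R^o | W' ((b : R) *: u)].
  split; first by rewrite /= scale0r; apply: submod0.
  by move=> b x y /= hx hy; rewrite scalerDl -scalerA; apply: sW'.2.
apply: (wspan_min sI) => [b cb|b bs].
  by apply: h1; apply: cU => //; apply: h2.
exact: ks.
Qed.

Lemma good_art (c : set R^o) (s : seq R) U W : artP U W ->
  prim n (wspan c (s : seq R^o)) -> (forall b u, c b -> U u -> W (b *: u)) -> good s U W.
Proof. by move=> a; apply: good_of a => //; [apply: artP_sub|apply: art_kill_flen]. Qed.
Lemma good_noe (c : set R^o) (s : seq R) U W : noeP U W ->
  prim n (wspan c (s : seq R^o)) -> (forall b u, c b -> U u -> W (b *: u)) -> good s U W.
Proof. by move=> a; apply: good_of a => //; [apply: noeP_sub|apply: noe_kill_flen]. Qed.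

(* If U is x-torsion, then a submodule of U is determined by the submodules
   x ^ j U \cap U[x], so that the descending chain condition lifts from U[x]. *)
Lemma art_tor x U : submodule U -> (forall u, U u -> exists k, x ^+ k *: u = 0) ->
  artP (tor x U [set 0]) [set 0] -> artP U [set 0].
Proof.
move=> sU tU a c hc dc.
have s0 := @submodule0 R V.
pose L i j : set V := [set v | x *: v = 0 /\ exists2 u, c i u & v = x ^+ j *: u].
have sL i j : submodule (L i j).
  have [sc _ _] := hc i; split.
    by split; [rewrite scaler0|exists 0; [apply: submod0|rewrite scaler0]].
  move=> b p q [p0 [u cu up]] [q0 [v cv vq]]; split.
    by rewrite scalerDr q0 addr0 scalerA mulrC -scalerA p0 scaler0.
  exists (b *: u + v); first exact: sc.2.
  by rewrite up vq scalerDr !scalerA mulrC.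
have LU i j : L i j `<=` tor x U [set 0].
  move=> p [x0 [u cu up]]; split=> //; rewrite up; apply: submodZ => //.
  by have [_ _ h] := hc i; apply: h.
have L0 i j : [set 0] `<=` L i j by move=> _ ->; apply: submod0.
have Lmono i i' j j' : (i <= i')%N -> (j <= j')%N -> L i' j' `<=` L i j.
  move=> ii jj p [p0 [u cu up]]; split=> //.
  exists (x ^+ (j' - j) *: u); last by rewrite up scalerA -exprD subnKC.
  have [sc _ _] := hc i; apply: submodZ => //.
  exact: desc_le cu.
(* The diagonal sequence controls all j >= N at once; the finitely many j < N are stabilized one by
   one. *)
have [//|i|N hN] := a (fun i => L i i); first exact: Lmono.
have [M hM] : exists M, forall j i, (j < N)%N -> (M <= i)%N -> L M j `<=` L i j.
  elim: (N) => [|k [M hM]]; first by exists 0%N.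
  have [//|i|M' hM'] := a (fun i => L i k); first exact: Lmono.
  exists (maxn M M') => j i; rewrite ltnS leq_eqVlt => /orP[/eqP->|jk] Mi.
    apply: (@subset_trans _ (L M' k)); first by apply: Lmono; rewrite ?leq_maxr.
    by apply: hM'; apply: leq_trans Mi; apply: leq_maxr.
  apply: (@subset_trans _ (L M j)); first by apply: Lmono; rewrite ?leq_maxl.
  by apply: hM => //; apply: leq_trans Mi; apply: leq_maxl.
exists (maxn N M) => i Ni.
have key j : L (maxn N M) j `<=` L i j.
  have [jN|Nj] := ltnP j N.
    apply: (@subset_trans _ (L M j)); first by apply: Lmono; rewrite ?leq_maxr.
    by apply: hM => //; apply: leq_trans Ni; apply: leq_maxr.
  apply: (@subset_trans _ (L N N)); first by apply: Lmono; rewrite ?leq_maxl.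
  apply: (@subset_trans _ (L (maxn i j) (maxn i j))).
    by apply: hN; apply: leq_trans Nj _; apply: leq_maxr.
  by apply: Lmono; rewrite ?leq_maxl ?leq_maxr.
have ind k u : c (maxn N M) u -> x ^+ k *: u = 0 -> c i u.
  have [sc _ _] := hc i; have [scM _ _] := hc (maxn N M).
  elim: k u => [|k IH] u cu u0.
    by move: u0; rewrite expr0 scale1r => ->; apply: submod0.
  have [_ [v cv e]] : L i k (x ^+ k *: u).
    by apply: key; split; [rewrite scalerA -exprS|exists u].
  apply: (submod_subl sc (y := v)) => //; apply: IH.
    by apply: submodB => //; apply: desc_le cv.
  by rewrite scalerBr -e subrr.
move=> u cu; have [_ _ h] := hc (maxn N M).
by have [k uk] := tU _ (h _ cu); apply: ind cu uk.
Qed.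

Lemma art_gens (s : seq R) U : submodule U ->
  (forall x u, x \in s -> U u -> exists k, x ^+ k *: u = 0) ->
  artP [set u | U u /\ forall x, x \in s -> x *: u = 0] [set 0] -> artP U [set 0].
Proof.
elim: s U => [|x s IH] U sU tU a.
  by rewrite (_ : U = [set u | U u /\ forall x, x \in [::] -> x *: u = 0]) //;
    apply/seteqP; split=> u // [].
apply: (art_tor (x := x)) => //; first by move=> u; apply: tU; rewrite mem_head.
apply: IH; first by apply: submodule_tor => //; apply: submodule0.
  by move=> y u ys [Uu _]; apply: tU => //; rewrite inE ys orbT.
apply: artP_sub a => // u [[Uu xu] h]; split=> // y.
by rewrite inE => /orP[/eqP->|/h].
Qed.

End FiniteLength.

(** * Matlis duality *)

Section CompositionStep.
Variables (R : comNzRingType) (n : set R^o) (lR : locring n) (V : lmodType R).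

(** X is the last proper term of a longest chain, hence maximal in U. If t y were outside X, then y
    = b t y modulo X, and the unit 1 - b t would put y into X. *)
Lemma comp_step (U W : set V) : pair U W -> flen U W -> ~ U `<=` W ->
  exists X y, [/\ pair U X, W `<=` X, U `<=` wspan X [:: y], U y & ~ X y] /\
    forall t : R, n t -> X (t *: y).
Proof.
move=> [sU sW WU] f UW; have [c mx] := lenP sW WU f; move: c mx.
case E: (len U W) => [|k] [c [h1 h2 h3 h4]] mx.
  by case: UW; apply: len_eq0.
have [k1 k2] := h4 k (ltnSn _).
move/existsNP: (k2) => [y /not_implyP[cy ny]].
have Wc : W `<=` c k.
  by elim: k {E h3 mx k1 k2 cy ny} h4 => // k IH h4; have [q _] := h4 k (ltnW (ltnSn _));
    apply: subset_trans (IH _) q => i ik; apply: h4; apply: ltnW.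
have chk : chain (c k) W k by exists c; split=> // i ik; apply/h4/ltnW.
have Uy : U y by apply: h3.
have XU : c k `<=` U by apply: subset_trans h3.
have sup v : U v -> ~ c k v -> U `<=` wspan (c k) [:: v].
  move=> Uv nv; apply: contrapT => h.
  have sw : submodule (wspan (c k) [:: v]) by apply: submodule_wspan.
  have ch1 : chain (wspan (c k) [:: v]) W k.+1.
    apply: (chain_ext sw _ _ chk); first exact: wspan_sub.
    by move=> q; apply: nv; apply: q; apply: wspan_mem; rewrite // mem_head.
  have /mx : chain U W k.+2.
    apply: (chain_ext sU _ h ch1); apply: wspan_min => // w.
    by rewrite inE => /eqP->.
  by rewrite ltnn.
exists (c k), y; split; first by split=> //; exact: sup.
move=> t nt; apply: contrapT => nty.
have [b /= hb] := sup _ (submodZ t sU Uy) nty y Uy.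
have [sn _ _] := lR; have [d e] := locring1 lR (idealM b sn nt).
apply: ny; rewrite -[y]scale1r -e -scalerA scalerBl scale1r -scalerA.
exact: submodZ.
Qed.
End CompositionStep.

Section Matlis.
Variables (R : comNzRingType) (n : set R^o).

Definition ntorsion (E : lmodType R) := forall e : E, exists k,
  forall l : seq R, size l = k -> (forall x, x \in l -> n x) -> \prod_(x <- l) x *: e = 0.

(* E is an injective hull of the residue field *)
Definition matlis (E : lmodType R) := [/\ baer [set: E], ntorsion E &
  exists s0 : E, [/\ s0 <> 0, forall a : R, n a -> a *: s0 = 0 &
    forall e : E, (forall a : R, n a -> a *: e = 0) -> exists a : R, e = a *: s0]].

(** E[c] = Hom(R / c, E) is the Matlis dual of R / c; for a inside b, the pair E[a] over E[b] is the
    dual of b / a. *)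
Definition Eann (E : lmodType R) (c : set R^o) : set E :=
  [set e | forall a : R, c a -> a *: e = 0].

Hypotheses (lR : locring n) (nR : noeth R).
Variable E : lmodType R.
Hypothesis mE : matlis E.
Implicit Types (a b c : set R^o).
Local Notation Ea := (@Eann E).
Local Notation z0 := ([set 0] : set E).

Lemma Eann_submod c : submodule (Ea c).
Proof.
split=> [a _|b x y hx hy a ca]; first by rewrite scaler0.
by rewrite scalerDr scalerA mulrC -scalerA hx // hy // scaler0 addr0.
Qed.
Lemma Eann_mono a b : a `<=` b -> Ea b `<=` Ea a.
Proof. by move=> ab e h x /ab /h. Qed.
Lemma Eann0 c : z0 `<=` Ea c.
Proof. by move=> _ -> a _; rewrite scaler0. Qed.
Lemma pairE0 c : pair (Ea c) z0.
Proof. by split; [exact: Eann_submod|exact: submodule0|exact: Eann0]. Qed.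

Lemma Eann_surj c (x : R) v : submodule c -> (forall b : R, c (b * x : R) -> b *: v = 0) ->
  exists w, x *: w = v /\ Ea c w.
Proof.
have [bE _ _] := mE; move=> sc h.
by have [w [_ hw hc]] := baer_solve (v := v) (submoduleT E) bE sc I h; exists w.
Qed.

(** The map b y -> b s0 is well defined modulo c because nonmembers of n are units. Thus E[c]
    determines c. *)
Lemma Eann_sep c (y : R) : submodule c -> ~ c y -> exists2 e, Ea c e &
  exists2 s0, y *: e = s0 & [/\ s0 <> 0, forall a : R, n a -> a *: s0 = 0 &
    forall e : E, (forall a : R, n a -> a *: e = 0) -> exists a : R, e = a *: s0].
Proof.
move=> sc cy; have [_ _ [s0 [h1 h2 h3]]] := mE.
have [|w [w1 w2]] := @Eann_surj c y s0 sc; last by exists w => //; exists s0.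
move=> b cb; apply: h2; apply: contrapT => nb; apply: cy.
have [_ _ hn] := lR; have [d e] := hn _ nb.
rewrite -[y]mul1r -e -mulrA; exact: (submodZ d sc cb).
Qed.

Lemma tor_Eann (x : R) a b : submodule a -> submodule b -> tor x (Ea a) (Ea b) = Ea (simg x b a).
Proof.
move=> sa sb; apply/seteqP; split=> e.
  move=> [h1 h2] _ /simgP[u [w [bu aw ->]]].
  by rewrite scalerDl (h1 _ aw) addr0 -[x *: u]/(x * u : R) mulrC -scalerA (h2 _ bu).
move=> h; split=> u hu; last by rewrite scalerA mulrC; apply: h; apply: mem_simg.
by apply: h; apply/simgP; exists 0, u; rewrite scaler0 add0r; split=> //; exact: sb.1.
Qed.

(** Duality exchanges kernels and cokernels of x. For e in the right-hand side, x u + w -> u e is a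
    well defined map on x b + a, and injectivity of E represents it by some [e1]. *)
Lemma simg_Eann (x : R) a b : submodule a -> submodule b ->
  simg x (Ea a) (Ea b) = Ea (tor x b a).
Proof.
move=> sa sb; apply/seteqP; split=> e.
  move=> /simgP[e1 [e2 [h1 h2 ->]]] u [bu au].
  by rewrite scalerDr (h2 _ bu) addr0 scalerA mulrC; apply: h1.
move=> h; have [bE _ _] := mE.
have [||e1 [_ h1]] := bE (fun z y => exists u w : R, [/\ b u, a w, z = x * u + w & y = u *: e]).
- split.
  + by exists 0, 0; rewrite mulr0 addr0 scale0r; split=> //; [exact: sb.1|exact: sa.1].
  + move=> t _ _ _ _ [u [w [bu aw -> ->]]] [u' [w' [bu' aw' -> ->]]].
    exists (t * u + u'), (t * w + w'); split; [exact: sb.2|exact: sa.2| |].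
      by rewrite /GRing.scale /=; ring.
    by rewrite scalerDl scalerA.
  + move=> _ [u [w [bu aw e0 ->]]]; apply: h; split=> //.
    rewrite [X in a X](_ : _ = - w); first exact: (submodN sa aw).
    by apply/eqP; rewrite -addr_eq0 -e0.
- by [].
apply/simgP; exists e1, (e - x *: e1); split.
- move=> w aw; apply/esym/h1; exists 0, w; rewrite mulr0 add0r scale0r.
  by split=> //; exact: sb.1.
- move=> u bu; rewrite scalerBr scalerA mulrC.
  by rewrite -(h1 (x * u) (u *: e)) ?subrr //; exists u, 0; rewrite addr0; split=> //; exact: sa.1.
by rewrite addrC subrK.
Qed.

Lemma prod_nseq (x : R) k : \prod_(y <- nseq k x) y = x ^+ k.
Proof. by elim: k => [|k IH] /=; rewrite ?big_nil ?big_cons ?IH ?exprS ?expr0. Qed.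

(** E is torsion for the finitely many generators of n, and the part killed by all of them is its
    simple socle. *)
Lemma matlis_art : artP [set: E] z0.
Proof.
have [_ tE [s0 [s1 s2 s3]]] := mE; have [sn _ _] := lR.
have [vs [v1 v2]] := noeth_fg nR sn.
apply: (art_gens (s := vs)) => //.
  move=> x u xs _; have [k hk] := tE u; exists k; rewrite -prod_nseq.
  apply: hk; first by rewrite size_nseq.
  by move=> y; rewrite mem_nseq => /andP[_ /eqP->]; apply: v1.
have sA := @submodule_wspan _ _ z0 [:: s0] (@submodule0 _ _).
apply: (@artP_sub _ _ (wspan z0 [:: s0]) z0) => //.
  move=> e [_ he]; have [t nt|a ->] := s3 e.
    have sI : submodule [set b : R^o | (b : R) *: e = 0].
      split; first by rewrite /= scale0r.
      by move=> b x y /= hx hy; rewrite scalerDl -scalerA hx hy scaler0 addr0.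
    by apply: (wspan_min sI _ he (v2 _ nt)) => _ ->; rewrite /= scale0r.
  by exists a; rewrite subrr.
apply: flen_art => //; first exact: submodule0.
apply: (flen_step lR); first exact: submodule0.
by move=> a na; apply: s2.
Qed.

(** Induction along composition factors: multiplication by y identifies the dual of the simple
    quotient b / X with the socle of E. *)
Lemma dual_len b a : pair b a -> flen b a ->
  flen (Ea a) (Ea b) /\ len (Ea a) (Ea b) = len b a.
Proof.
have [k] := ubnP (len b a); elim: k b a => // k IH b a lk p f.
have [sb sa ab] := p; have [ba|nba] := pselect (b `<=` a).
  have -> : b = a by apply/seteqP.
  by rewrite !lenxx //; [split=> //; apply: flenxx|]; apply: Eann_submod.
have [X [y [[pX aX bX by_ Xy] nX]]] := comp_step lR p f nba; have [_ sX Xb] := pX.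
have eb : b = wspan X [:: y].
  apply/seteqP; split=> //; apply: wspan_min => // w.
  by rewrite inE => /eqP->.
have l1 : len b X = 1%N by apply: lenE; rewrite eb; apply: (simple_len lR).
have lb := len_add sb sX sa aX Xb f.
have lX : (len X a < k)%N by lia.
have fX : flen X a by apply: flen_sub f.
have pXa : pair X a by [].
have [f1 e1] := IH X a lX pXa fX.
have [e Xe [s0 ye [s1 s2 s3]]] := Eann_sep sX Xy.
have iso : qiso ( *:%R y) (Ea X) (Ea b) (wspan z0 [:: s0]) z0.
  split.
  - move=> _ [u Xu <-]; have [t nt|c ->] := s3 (y *: u); last by exists c; rewrite subrr.
    by rewrite scalerA; apply: Xu; apply: nX.
  - by move=> _ [u bu <-]; apply: bu.
  - move=> u Xu /= yu t; rewrite eb => -[c hc].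
    by rewrite -[t](subrK (c * y)) scalerDl Xu // add0r -scalerA yu scaler0.
  - move=> u [c /= hc]; exists (c *: e); first by apply: submodZ Xe; exact: Eann_submod.
    by rewrite scalerA mulrC -scalerA ye.
have yl : linear ( *:%R y : E -> E) by move=> c u v; rewrite scalerDr !scalerA mulrC.
have sz := @submodule0 R E; have sws := submodule_wspan [:: s0] sz.
have fw : flen (wspan z0 [:: s0]) z0 by apply: (flen_step lR).
have lw : len (wspan z0 [:: s0]) z0 = 1%N by apply: lenE; apply: (simple_len lR).
have f2 : flen (Ea X) (Ea b).
  apply/(flen_iso yl (Eann_submod _) (Eann_mono Xb) sws sz (wspan_sub _) iso) => //.
have l2 : len (Ea X) (Ea b) = 1%N.
  by rewrite (len_iso yl (Eann_submod _) (Eann_mono Xb) sws sz (wspan_sub _) iso).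
have f3 : flen (Ea a) (Ea b).
  by apply: flen_ext f1 f2; try exact: Eann_submod; exact: Eann_mono.
split=> //; rewrite (len_add (X := Ea X)) //; try exact: Eann_submod; try exact: Eann_mono.
by rewrite lb e1 l1 l2 addnC.
Qed.

(** Each element of s exchanges the two terms of the difference that defines [mul], whence one sign
    per element. *)
Lemma dual_mul (s : seq R) b a : pair b a -> good s b a ->
  mul s (Ea a) (Ea b) = (-1) ^+ size s * mul s b a.
Proof.
elim: s b a => [|x s IH] b a p g; have [sb sa ab] := p.
  have [|_ /= ->] := dual_len p; last by rewrite mul1r.
  exact: g.
rewrite [LHS]/= tor_Eann // simg_Eann //.
rewrite (IH _ _ (pair_simg x p) (good_simg p g)) (IH _ _ (pair_tor x p) (good_tor p g)).
by rewrite /= exprS; ring.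
Qed.

Lemma mul_mono (s : seq R) (U1 U : set E) : submodule U1 -> submodule U -> U1 `<=` U -> good s U z0 ->
  mul s U1 z0 <= mul s U z0.
Proof.
move=> s1 sU UU g; have sz := @submodule0 R E.
have zU : z0 `<=` U1 by move=> _ ->; apply: submod0.
rewrite (mul_add sU s1 sz zU UU g) lerDr; apply: art_mul_ge0 => //.
  by apply: artP_sub matlis_art.
by apply: good_sub g.
Qed.

Lemma prim_good (s : seq R) c : prim n (wspan c (s : seq R^o)) -> good s (Ea c) z0.
Proof.
move=> pc; apply: (good_art lR (c := c)) => //; first by apply: artP_sub matlis_art.
by move=> b u cb /(_ _ cb).
Qed.

(* Dimension theory through mul: a chain of d+1 primes above Q 0 forces a system
   of parameters to have at least d elements, and positivity in case of equality. *)
Lemma chain_mul d (Q : nat -> set R^o) (s : seq R) : (forall i, is_prime (Q i)) ->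
  (forall i, (i < d)%N -> Q i `<=` Q i.+1 /\ ~ Q i.+1 `<=` Q i) ->
  (forall x, x \in s -> n x) -> prim n (wspan (Q 0%N) (s : seq R^o)) ->
  (d <= size s)%N /\ (size s = d -> 0 < mul s (Ea (Q 0%N)) z0).
Proof.
have [sn n1 hn] := lR; have sz := @submodule0 R E.
elim: d Q s => [|d IH] Q s pQ hQ ns ps.
  split=> // /size0nil s0; rewrite s0 /= in ps *.
  have [q0 q1 q2] := pQ 0%N.
  have f : flen (Ea (Q 0%N)) z0 by apply: (prim_good (s := [::]) ps); [exact: pairE0| | |].
  rewrite ltz_nat lt0n; apply/eqP => l0.
  have /= h := len_eq0 (Eann_submod _) sz (@Eann0 _) f l0.
  have [_ _ [t0 [h1 h2 h3]]] := mE; apply: h1; apply: h => a Qa; apply: h2.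
  exact: (proper_sub lR q0 q1).
have [q0 q1 q2] := pQ 0%N.
have pt (x : R) : pair (tor x (Ea (Q 0%N)) z0) z0 by apply/pair_tor/pairE0.
have surj (x : R) : ~ Q 0%N x -> simg x (Ea (Q 0%N)) z0 = Ea (Q 0%N).
  move=> Qx; apply/seteqP; split; first exact: (simg_sub (pairE0 _)).
  move=> v Qv; have [|w [wx Qw]] := @Eann_surj (Q 0%N) x v q0.
    by move=> b /q2[/Qv|].
  by apply/simgP; exists w, 0; rewrite addr0.
(* An element z of Q 1 outside Q 0 is surjective on E[Q 0], so its kernel has [mul] zero by
   additivity. This kernel contains E[Q 1], whose [mul] would be positive by induction if t had only
   d elements. *)
have claim (t : seq R) : (forall x, x \in t -> n x) -> prim n (wspan (Q 0%N) (t : seq R^o)) ->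
    (d < size t)%N.
  move=> nt pt'; have [h1 h2] := hQ 0%N isT.
  move/existsNP: h2 => [z /not_implyP[Q1z Q0z]].
  have g := prim_good pt'.
  have hQ' i : (i < d)%N -> Q i.+1 `<=` Q i.+2 /\ ~ Q i.+2 `<=` Q i.+1.
    by move=> id; apply: hQ.
  have p' : prim n (wspan (Q 1%N) (t : seq R^o)).
    by apply: prim_mono pt'; apply: wspan_mono.
  have [dt dp] := IH (fun i => Q i.+1) t (fun i => pQ i.+1) hQ' nt p'.
  rewrite ltn_neqAle dt andbT; apply/eqP => /esym/dp; apply/negP; rewrite -leNgt.
  apply: (@le_trans _ _ (mul t (tor z (Ea (Q 0%N)) z0) z0)).
    apply: mul_mono; [exact: Eann_submod|by have [] := pt z| |].
      by move=> e he; split; [apply: Eann_mono he|apply: he].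
    by apply: good_sub g => //; apply: tor_sub.
  have [sT _ zT] := pt z.
  have zl : linear ( *:%R z : E -> E) by move=> c u v; rewrite scalerDr !scalerA mulrC.
  have e : mul t (Ea (Q 0%N)) (tor z (Ea (Q 0%N)) z0) = mul t (Ea (Q 0%N)) z0.
    apply: (mul_iso zl); [by apply/pair_tor'/pairE0|exact: pairE0|split].
    - by move=> _ [u Qu <-]; exact: (submodZ z (Eann_submod _) Qu).
    - by move=> _ [u [_ /= ->] <-].
    - by move=> u Qu /= zu; split.
    move=> v; rewrite -{1}(surj z) // => /simgP[u [w [Qu -> ->]]].
    by exists u => //; rewrite addr0 subrr.
  have := mul_add (Eann_submod (Q 0%N)) sT sz zT (@tor_sub _ _ _ _ _) g.
  move=> h; suff -> : mul t (tor z (Ea (Q 0%N)) z0) z0 = 0 by [].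
  apply: (@addrI _ (mul t (Ea (Q 0%N)) (tor z (Ea (Q 0%N)) z0))).
  by rewrite -h addr0; exact: esym e.
split; first exact: claim.
case: s ns ps => // x s ns ps [sd].
have nx : n x by apply: ns; rewrite mem_head.
have ns' y : y \in s -> n y by move=> ys; apply: ns; rewrite inE ys orbT.
(* If x lies in Q 0 then s alone, with d elements, is a system of parameters modulo Q 0, against
   [claim]. *)
have [Qx|Qx] := pselect (Q 0%N x).
  have : (d < size s)%N; last by rewrite sd ltnn.
  apply: claim => //; apply: prim_mono ps => t [c hc].
  have sws := submodule_wspan (s : seq R^o) q0.
  by apply: (submod_subl sws hc); apply: wspan_sub; exact: (submodZ c q0 Qx).
have g := prim_good ps.
rewrite /= surj // mulxx ?subr0; last exact: Eann_submod.
have [sT _ zT] := pt x.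
have gT : good s (tor x (Ea (Q 0%N)) z0) z0 by apply: good_tor g; exact: pairE0.
rewrite lt_def art_mul_ge0 //; last by apply: artP_sub matlis_art.
rewrite andbT; apply/eqP => m0.
have sJ : submodule (wspan (Q 0%N) [:: (x : R^o)]) by apply: submodule_wspan.
(* With [mul] zero, induction forbids a chain of length d above Q 0 + (x). For d > 0 that ideal then
   has d - 1 parameters, and adding x to them contradicts [claim]. *)
have nochain : ~ pchain d (wspan (Q 0%N) [:: (x : R^o)]).
  move=> [P [pP JP hP]].
  have [|_ /(_ sd)] := IH P s pP hP ns'.
    apply: prim_mono ps; have [sP _ _] := pP 0%N.
    have sw := submodule_wspan (s : seq R^o) sP.
    move=> t [c hc]; apply: (submod_subl sw (y := (c *: (x : R^o)))).
      apply: wspan_mono hc; apply: subset_trans JP; exact: wspan_sub.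
    have Px : P 0%N x by apply: JP; apply: wspan_mem; rewrite // mem_head.
    by apply: wspan_sub; exact: (submodZ c sP Px).
  apply/negP; rewrite -leNgt -m0; apply: mul_mono => //; first exact: Eann_submod.
  move=> e he; split; first by apply: Eann_mono he; apply: subset_trans JP; exact: wspan_sub.
  by apply: he; apply: JP; apply: wspan_mem; rewrite // mem_head.
case: d IH hQ claim sd nochain => [|d] IH hQ claim sd nochain.
  apply: nochain; exists (fun=> n); split=> //; first by move=> _; apply: locring_prime lR.
  apply: wspan_min => //; first exact: (proper_sub lR).
  by move=> y; rewrite inE => /eqP->.
have Jn : wspan (Q 0%N) [:: (x : R^o)] `<=` n.
  apply: wspan_min => //; first exact: (proper_sub lR).
  by move=> y; rewrite inE => /eqP->.
have [t [st nt pt']] := sop_exists nR lR sJ Jn nochain.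
have : (d.+1 < size (t ++ [:: x]))%N; last by rewrite size_cat st addn1 ltnn.
apply: claim; last by rewrite wspan_cat.
by move=> y; rewrite mem_cat inE => /orP[/nt|/eqP->].
Qed.

Lemma prim_soc c : submodule c -> ~ c 1 -> prim n c ->
  exists y : R, ~ c y /\ forall t : R, n t -> c (t * y : R).
Proof.
move=> sc c1 [k0 hk0].
have ex : exists k, `[<forall l : seq R, size l = k -> (forall x, x \in l -> n x) ->
   c (\prod_(x <- l) x : R)>] by exists k0; apply/asboolP.
case: (ex_minnP ex) => -[|k] /asboolP hk min.
  by case: c1; have := hk [::] erefl; rewrite big_nil; apply.
have : ~ forall l : seq R, size l = k -> (forall x, x \in l -> n x) -> c (\prod_(x <- l) x : R).
  by move=> h; have := min k; rewrite ltnn => /(_ (asboolT h)).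
move/existsNP => [l /not_implyP[sl /not_implyP[nl cl]]].
exists (\prod_(x <- l) x); split=> // t nt.
have := hk (t :: l); rewrite big_cons /= sl; apply=> //.
by move=> x; rewrite inE => /orP[/eqP->|/nl].
Qed.

(** Noetherian induction through c + (y), with y in the socle modulo c: f agrees with some a on
    E[c + (y)], and f - a maps E[c] to the socle, where a multiple of y accounts for it. *)
Lemma end_mult (f : E -> E) c : linear f -> submodule c -> prim n c ->
  exists a : R, forall e, Ea c e -> f e = a *: e.
Proof.
move=> fl sc; move: c sc; apply: (noeth_ind nR) => c sc IH pc.
have [c1|c1] := pselect (c 1).
  exists 0 => e he; rewrite scale0r; have := he 1 c1.
  by rewrite scale1r => ->; rewrite linfun0.
have [y [cy ny]] := prim_soc sc c1 pc.
have sy : submodule (wspan c [:: (y : R^o)]) by apply: submodule_wspan.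
have [|||a ha] := IH _ sy.
- exact: wspan_sub.
- by move=> h; apply/cy/h/wspan_mem; rewrite // mem_head.
- by apply: prim_mono pc; apply: wspan_sub.
have [e0 ce0 [s0 ye [s1 s2 s3]]] := Eann_sep sc cy.
have kill e : Ea c e -> y *: e = 0 -> f e = a *: e.
  move=> he hy; apply: ha => t [b hb].
  by rewrite -[t](subrK (b * y)) scalerDl he // add0r -scalerA hy scaler0.
have soc e : Ea c e -> exists l : R, f e - a *: e = l *: s0.
  move=> he; apply: s3 => t nt; rewrite scalerBr -linfunZ // kill.
  - by rewrite !scalerA mulrC subrr.
  - by move=> u cu; rewrite scalerA mulrC -scalerA he // scaler0.
  by rewrite scalerA; apply: he; rewrite mulrC; apply: ny.
have [l hl] := soc _ ce0; exists (a + l * y) => e he.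
have [m hm] : exists m : R, y *: e = m *: s0.
  by apply: s3 => t nt; rewrite scalerA; apply: he; apply: ny.
have ce : Ea c (e - m *: e0).
  move=> u cu; rewrite scalerBr he // sub0r scalerA mulrC -scalerA ce0 //.
  by rewrite scaler0 oppr0.
have := kill _ ce; rewrite scalerBr hm scalerA mulrC -scalerA ye subrr => /(_ erefl).
rewrite linfunB // linfunZ // => /eqP; rewrite subr_eq => /eqP->.
have -> : f e0 = a *: e0 + l *: s0 by rewrite -hl addrC subrK.
rewrite scalerDl -scalerA hm scalerBr scalerDr !scalerA [m * a]mulrC [m * l]mulrC.
by rewrite addrA subrK.
Qed.
End Matlis.

(** * Completion *)

Section IdealPowers.
Variables (A : comNzRingType) (m : idealr A).

Definition ideal_set : set A^o := [set x : A^o | (x : A) \in m].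
Definition ipow t : set A^o := [set x | @ideal_pow A m t x].

Lemma ideal_set_submod : submodule ideal_set.
Proof.
split=> [|a x y xm ym]; first exact: idealr0.
by apply: (rpredD (S := m)) => //; apply: idealMr.
Qed.
Lemma ipow_submod t : submodule (ipow t).
Proof.
split=> [|a x y xm ym]; first exact: ideal_pow0.
by apply: ideal_powD => //; apply: ideal_powM.
Qed.
Lemma ipowS t x : ipow t.+1 x -> ipow t x.
Proof.
elim: t x => // t IH x [k [a [b [aI bI ->]]]].
by exists k, a, b; split=> // i; apply: IH.
Qed.
Lemma ipow_le t t' x : (t <= t')%N -> ipow t' x -> ipow t x.
Proof.
move=> tt'; rewrite -(subnK tt'); elim: (t' - t)%N => // k IH h.
by apply: IH; apply: ipowS; rewrite -addSn.
Qed.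
Lemma ipow_prod (l : seq A) : (forall x, x \in l -> x \in m) ->
  ipow (size l) (\prod_(x <- l) x : A).
Proof.
elim: l => [|x l IH] h //=; rewrite big_cons.
exists 1%N, (fun=> x), (fun=> \prod_(y <- l) y); split.
- by move=> _; apply: h; rewrite mem_head.
- by move=> _; apply: IH => y yl; apply: h; rewrite inE yl orbT.
by rewrite big_ord1.
Qed.
Lemma ipow_min t (c : set A^o) : submodule c ->
  (forall l : seq A, size l = t -> (forall x, x \in l -> x \in m) -> c (\prod_(x <- l) x : A)) ->
  ipow t `<=` c.
Proof.
elim: t c => [|t IH] c sc hc x; rewrite /ipow /=.
  move=> _; have := hc [::] erefl; rewrite big_nil => /(_ _) c1.
  by rewrite -[x]mulr1; apply: (submodZ x sc); apply: c1.
move=> [k [a [b [aI bI ->]]]]; apply: (submod_sum _ sc) => i _.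
apply: (IH [set y : A^o | c (a i * y : A)]); last exact: bI.
  split; first by rewrite /= mulr0; apply: sc.1.
  move=> d y z hy hz; rewrite /= mulrDr [X in c (X + _)](_ : _ = d *: (a i * y : A^o)).
    exact: sc.2.
  by rewrite /GRing.scale /=; ring.
move=> l sl nl; have := hc (a i :: l); rewrite big_cons /= sl; apply=> //.
by move=> y; rewrite inE => /orP[/eqP->|/nl].
Qed.
Lemma prim_ipow t : prim ideal_set (ipow t).
Proof. by exists t => l <- /ipow_prod. Qed.
End IdealPowers.

Section Completion.
Variables (A : comNzRingType) (m : idealr A).
Local Notation B := (completion m).
Local Notation ipw := (ipow m).
Local Notation n := (ideal_set m).

Definition cpi (u : coherent_seq m) : B := (\pi_({ideal_quot (@null_seq A m)}) u)%qT.

Lemma cpi_surj (b : B) : exists u, b = cpi u.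
Proof. by exists (repr b); rewrite /cpi reprK. Qed.
Lemma cpi_eq u v : cpi u = cpi v <-> forall t, ipw t (seq_val u t - seq_val v t).
Proof.
rewrite /cpi; split.
  move=> /eqP; rewrite -Quotient.idealrBE => /asboolP h t.
  by have := h t; rewrite raddfB.
by move=> h; apply/eqP; rewrite -Quotient.idealrBE; apply/asboolP => t; rewrite raddfB; apply: h.
Qed.
Lemma seq_valM (u v : coherent_seq m) t : seq_val (u * v) t = seq_val u t * seq_val v t.
Proof. by rewrite -[seq_val (u * v)]/(val (u * v)) rmorphM. Qed.
Lemma seq_valD (u v : coherent_seq m) t : seq_val (u + v) t = seq_val u t + seq_val v t.
Proof. by rewrite -[seq_val (u + v)]/(val (u + v)) rmorphD. Qed.
Lemma seq_val1 t : seq_val (1 : coherent_seq m) t = 1.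
Proof. by rewrite -[seq_val 1]/(val (1 : coherent_seq m)) rmorph1. Qed.
Lemma cpiD u v : cpi (u + v) = cpi u + cpi v. Proof. by rewrite /cpi raddfD. Qed.
Lemma cpiM u v : cpi (u * v) = cpi u * cpi v. Proof. by rewrite /cpi rmorphM. Qed.
Lemma cpi1 : cpi 1 = 1. Proof. by rewrite /cpi rmorph1. Qed.

Lemma seq_coh (u : coherent_seq m) t : ipw t (seq_val u t.+1 - seq_val u t).
Proof. by case: u => u uc; exact: (elimT (asboolP _) uc t). Qed.
Lemma seq_coh_le (u : coherent_seq m) t t' : (t <= t')%N ->
  ipw t (seq_val u t' - seq_val u t).
Proof.
move=> tt'; rewrite -(subnK tt'); elim: (t' - t)%N => [|k IH].
  by rewrite subrr; apply: (ipow_submod m t).1.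
rewrite addSn -(subrK (seq_val u (k + t)) (seq_val u (k + t).+1)) -addrA.
apply: (submodD (ipow_submod m t)) IH.
by apply: (@ipow_le _ _ t (k + t)); [rewrite leq_addl|apply: seq_coh].
Qed.

Definition iota_seq (a : A) : coherent_seq m.
Proof.
apply: (@CoherentSeq A m (fun=> a)); apply/asboolP => t.
by rewrite subrr; apply: ideal_pow0.
Defined.
Definition iota (a : A) : B := cpi (iota_seq a).
Lemma iotaM a b : iota (a * b) = iota a * iota b.
Proof. by rewrite /iota -cpiM; congr cpi; apply: val_inj. Qed.
Lemma iota1 : iota 1 = 1.
Proof. by rewrite /iota -cpi1; congr cpi; apply: val_inj. Qed.
Lemma iotaD a b : iota (a + b) = iota a + iota b.
Proof. by rewrite /iota -cpiD; congr cpi; apply: val_inj. Qed.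
Lemma iota0 : iota 0 = 0.
Proof. by apply: (@addrI _ (iota 0)); rewrite -iotaD !addr0. Qed.

Variable E : lmodType A.
Hypothesis tE : ntorsion n E.

Lemma tors (e : E) : exists t, forall a : A, ipw t a -> a *: e = 0.
Proof.
have [t ht] := tE e; exists t.
apply: (@ipow_min _ _ t [set a : A^o | (a : A) *: e = 0]); last first.
  by move=> l sl nl; apply: ht.
split; first by rewrite /= scale0r.
by move=> b x y /= hx hy; rewrite scalerDl -scalerA hx hy scaler0 addr0.
Qed.

(** The vacuous [let] makes the type depend on the torsion hypothesis, so that a module structure
    over the completion can be attached to it without touching the one of E. *)
Definition Ehat : Type := let _ := tE in E.
HB.instance Definition _ := GRing.Zmodule.copy Ehat E.
(** A coherent sequence acts on e through any component t such that m^t kills e; [cactE] shows that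
    neither t nor the representative matters. *)
Definition cact (b : B) (e : Ehat) : Ehat :=
  (seq_val (repr b) (projT1 (cid (tors e))) *: (e : E) : E).

Lemma cactE u t (e : Ehat) : (forall a : A, ipw t a -> a *: (e : E) = 0) ->
  cact (cpi u) e = seq_val u t *: (e : E).
Proof.
move=> h; rewrite /cact; case: (cid _) => t' h' /=.
have /cpi_eq hr : cpi (repr (cpi u)) = cpi u by rewrite /cpi reprK.
apply/eqP; rewrite -subr_eq0 -scalerBl; apply/eqP.
have [tt'|t't] := leqP t t'.
  apply: h; rewrite -(subrK (seq_val u t') (seq_val _ t')) -addrA.
  apply: (submodD (ipow_submod m t)); last exact: seq_coh_le.
  exact: ipow_le tt' (hr _).
apply: h'; rewrite -(subrK (seq_val u t') (seq_val _ t')) -addrA.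
apply: (submodD (ipow_submod m t') (hr _)).
by rewrite -opprB; apply: (submodN (ipow_submod m t')); apply: seq_coh_le; apply: ltnW.
Qed.

Lemma tors_le t t' (e : E) : (t <= t')%N -> (forall a : A, ipw t a -> a *: e = 0) ->
  (forall a : A, ipw t' a -> a *: e = 0).
Proof. by move=> tt' h a /(ipow_le tt') /h. Qed.

Fact cactA a b x : cact a (cact b x) = cact (a * b) x.
Proof.
have [u ->] := cpi_surj a; have [v ->] := cpi_surj b; have [t ht] := tors x.
rewrite -cpiM (cactE v ht) (cactE (u * v) ht) (cactE u (t := t)).
  by rewrite scalerA seq_valM.
by move=> c hc; rewrite scalerA mulrC -scalerA ht // scaler0.
Qed.
Fact cact1 : left_id 1 cact.
Proof.
move=> x; have [t ht] := tors x.
by rewrite -cpi1 (cactE 1 ht) seq_val1 scale1r.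
Qed.
Fact cactDr : right_distributive cact +%R.
Proof.
move=> a x y; have [u ->] := cpi_surj a.
have [t1 h1] := tors x; have [t2 h2] := tors y.
have k1 := tors_le (leq_maxl t1 t2) h1; have k2 := tors_le (leq_maxr t1 t2) h2.
rewrite (cactE u k1) (cactE u k2) (cactE u (t := maxn t1 t2)); first exact: scalerDr.
by move=> c hc; rewrite scalerDr k1 // k2 // addr0.
Qed.
Fact cactDl x : {morph cact^~ x : a b / a + b}.
Proof.
move=> a b; have [u ->] := cpi_surj a; have [v ->] := cpi_surj b.
have [t ht] := tors x; rewrite -cpiD (cactE u ht) (cactE v ht) (cactE (u + v) ht).
by rewrite seq_valD -scalerDl.
Qed.
HB.instance Definition _ := GRing.Zmodule_isLmodule.Build B Ehat
  cactA cact1 cactDr cactDl.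

Lemma chatE u t (e : Ehat) : (forall a : A, ipw t a -> a *: (e : E) = 0) ->
  cpi u *: e = seq_val u t *: (e : E).
Proof. exact: cactE. Qed.
Lemma iotaE a (e : Ehat) : iota a *: e = a *: (e : E).
Proof. by have [t ht] := tors e; rewrite /iota (chatE _ ht). Qed.
Lemma chat_ex (b : B) (e : Ehat) : exists a : A, b *: e = a *: (e : E).
Proof.
by have [t ht] := tors e; have [u ->] := cpi_surj b; exists (seq_val u t); apply: chatE.
Qed.

(** On a single element, the completion acts through elements of A. Hence lengths and [mul] do not
    change on passing to the completion. *)
Lemma submodule_hat (S : set E) : @submodule A E S <-> @submodule B Ehat S.
Proof.
split=> sS; split; try exact: sS.1.
  move=> b x y Sx Sy; have [a ->] := chat_ex b x.
  exact: sS.2.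
move=> a x y Sx Sy; have := sS.2 (iota a) x y Sx Sy.
by rewrite iotaE.
Qed.

Lemma len_hat (U W : set E) : @len A E U W = @len B Ehat U W.
Proof.
rewrite /len (_ : @chain A E U W = @chain B Ehat U W) //.
apply/funext => k; apply/propext; split=> -[c [h1 h2 h3 h4]]; exists c; split=> // i;
  exact/submodule_hat.
Qed.

Lemma mul_hat (s : seq A) (U W : set E) :
  mul s U W = @mul B Ehat (map iota s) U W.
Proof.
elim: s U W => [|x s IH] U W /=; first by rewrite len_hat.
rewrite !IH; congr (_ - _); congr mul.
  by apply/funext => e; rewrite /tor /= iotaE.
rewrite /simg; congr addm.
by apply/seteqP; split=> _ [e Ue <-]; exists e => //; rewrite iotaE.
Qed.

End Completion.

(** * Matlis duality over the completion *)

Section CompletionMatlis.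
Variables (A : comNzRingType) (m : idealr A).
Local Notation B := (completion m).
Local Notation n := (ideal_set m).
Hypotheses (lA : locring n) (nA : noeth A).
Variable E : lmodType A.
Hypothesis tE : ntorsion n E.
Hypothesis bE : baer [set: E].
Variable s0 : E.
Hypotheses (s0_neq0 : s0 <> 0) (s0_kill : forall a : A, n a -> a *: s0 = 0).
Hypothesis s0_gen : forall e : E, (forall a : A, n a -> a *: e = 0) -> exists a : A, e = a *: s0.
Local Notation Eh := (Ehat tE).
Local Notation ipw := (ipow m).
Local Notation iot := (@iota A m).

Let mE : matlis n E. Proof. by split=> //; exists s0. Qed.

(** The maximal ideal of the completion, described as the annihilator of the socle generator of
    E. *)
Definition nhat : set B^o := [set b : B^o | (b : B) *: (s0 : Eh) = 0].

Lemma s0_ipow1 (a : A) : ipw 1 a -> a *: s0 = 0.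
Proof. by move=> /(@ideal_pow1 A m) /s0_kill. Qed.

Lemma s0_mem (a : A) : a *: s0 = 0 -> n a.
Proof.
move=> h; apply: contrapT => na; have [_ _ hn] := lA; have [y e] := hn _ na.
by apply: s0_neq0; rewrite -[s0]scale1r -e -scalerA h scaler0.
Qed.

Lemma nhat_iota (a : A) : n a -> nhat (iot a).
Proof. by move=> /s0_kill h; rewrite /nhat /= iotaE. Qed.

Lemma nhatP (u : coherent_seq m) t : nhat (cpi u) -> (0 < t)%N -> n (seq_val u t).
Proof.
rewrite /nhat /= (chatE _ s0_ipow1) => /s0_mem h t0; have [sn _ _] := lA.
apply: (submod_subl sn _ h); have := seq_coh_le u t0.
by rewrite /ipow /= => /ideal_pow1.
Qed.

Lemma locring_nhat : locring nhat.
Proof.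
have [sn n1 hn] := lA; split.
- split; first by rewrite /nhat /= scale0r.
  by move=> a x y hx hy; rewrite /nhat /= scalerDl -scalerA hx hy scaler0 addr0.
- by rewrite /nhat /= scale1r.
move=> b; have [u ->] := cpi_surj b; rewrite /nhat /= (chatE _ s0_ipow1) => nu.
have ut t : (0 < t)%N -> ~ n (seq_val u t).
  move=> t0 h; apply: nu; apply: s0_kill; apply: (submod_subr sn _ h).
  by have := seq_coh_le u t0; rewrite /ipow /= => /ideal_pow1.
(* Inverses are taken componentwise; component 0 lives in A / m^0 = 0 and is arbitrary. *)
have ex t : exists v : A, (0 < t)%N -> v * seq_val u t = 1.
  case: t => [|t]; first by exists 0.
  by have [v e] := hn _ (ut t.+1 isT); exists v.
have [v hv] := choice ex.
have vc : v \in @coherent A m.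
  apply/asboolP => -[//|t].
  have -> : v t.+2 - v t.+1 = (- (v t.+1 * v t.+2)) * (seq_val u t.+2 - seq_val u t.+1).
    rewrite mulrBr !mulNr opprK -[v t.+1 * v t.+2 * _]mulrA hv // mulr1.
    by rewrite [v t.+1 * v t.+2]mulrC -mulrA hv // mulr1 addrC.
  by apply: ideal_powM; exact: (seq_coh u t.+1).
exists (cpi (CoherentSeq vc)); rewrite -cpiM -cpi1; apply/cpi_eq => t.
rewrite seq_valM seq_val1 /=; case: t => // t.
by rewrite hv // subrr; apply: ideal_pow0.
Qed.

Lemma hat_faithful (b : B) : (forall e : Eh, b *: e = 0) -> b = 0.
Proof.
have [u ->] := cpi_surj b => h; rewrite -(iota0 m); apply/cpi_eq => t.
rewrite subr0; apply: contrapT => nu.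
have [e Ie [s e1 [e2 _ _]]] := Eann_sep lA mE (ipow_submod m t) nu.
by apply: e2; rewrite -e1 -[LHS](@chatE _ _ _ tE u t e Ie).
Qed.

(** The multipliers representing f on the submodules E[m^t] are coherent because E[m^t] has
    annihilator m^t. *)
Lemma end_hat (f : E -> E) : linear f -> exists b : B, forall e : Eh, f e = b *: e.
Proof.
move=> fl.
have [a ha] := choice (fun t => end_mult lA nA mE fl (ipow_submod m t) (@prim_ipow A m t)).
have ac : a \in @coherent A m.
  apply/asboolP => t; apply: contrapT => na.
  have [e Ie [s e1 [e2 _ _]]] := Eann_sep lA mE (ipow_submod m t) na.
  apply: e2; rewrite -e1 scalerBl -(ha t.+1) -?(ha t) ?subrr //.
  by apply: Eann_mono Ie; apply: ipowS.
exists (cpi (CoherentSeq ac)) => e; have [t ht] := tors tE e.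
by rewrite (chatE _ ht) /=; exact: (ha t).
Qed.

Lemma hat_prod (l : seq B) t (e : Eh) : (0 < t)%N ->
  (forall a : A, ipw t a -> a *: (e : E) = 0) -> (forall b, b \in l -> nhat b) ->
  exists a : A, ipw (size l) a /\ (\prod_(b <- l) b) *: e = a *: (e : E).
Proof.
move=> t0 ht; elim: l => [|b l IH] nl.
  by exists 1; rewrite big_nil !scale1r.
have [|a [Ia ea]] := IH; first by move=> c cl; apply: nl; rewrite inE cl orbT.
have [u bu] := cpi_surj b; have nu : nhat (cpi u) by rewrite -bu; apply: nl; rewrite mem_head.
exists (seq_val u t * a); split.
  exists 1%N, (fun=> seq_val u t), (fun=> a); rewrite big_ord1; split=> // _.
  exact: nhatP.
rewrite big_cons -scalerA ea bu (chatE _ (t := t)) ?scalerA //.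
by move=> c hc; rewrite scalerA mulrC -scalerA ht // scaler0.
Qed.

Lemma ntorsion_hat : ntorsion nhat Eh.
Proof.
move=> e; have [t ht] := tors tE e; exists t.+1 => l sl nl.
have [//||a [Ia ->]] := @hat_prod l t.+1 e _ _ nl.
  exact: tors_le ht.
by apply: ht; apply: ipowS; rewrite -sl.
Qed.

Definition klist (js : seq B) : set E := [set e | forall b, b \in js -> b *: (e : Eh) = 0].

Lemma klist_submod js : submodule (klist js).
Proof.
split=> [b _|a x y hx hy b bj]; first by rewrite (scaler0 Eh).
have sB := @submodule_hat A m E tE [set z : E | b *: (z : Eh) = 0].
have [_] : @submodule A E [set z : E | b *: (z : Eh) = 0].
  apply/sB; split; first by rewrite /= scaler0.
  by move=> c z w /= hz hw; rewrite scalerDr scalerA mulrC -scalerA hz hw scaler0 addr0.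
by apply; [apply: hx|apply: hy].
Qed.

Lemma hat_linear (b : B) : linear (fun e : E => b *: (e : Eh) : E).
Proof.
move=> a x y; have := scalerDr b (iot a *: (x : Eh)) (y : Eh).
rewrite !iotaE => ->; congr (_ + _).
by rewrite -(iotaE a (x : Eh)) scalerA mulrC -scalerA iotaE.
Qed.

(** The double annihilator property of finitely generated ideals of the completion. On the common
    kernel of the tail, f factors through b0; injectivity extends the factor to an endomorphism c,
    and f - c b0 kills that kernel. *)
Lemma klist_span js (f : E -> E) : linear f -> (forall e, klist js e -> f e = 0) ->
  exists b : B, wspan ([set 0] : set B^o) js b /\ forall e : Eh, f e = b *: e.
Proof.
elim: js f => [|b0 js IH] f fl hf.
  exists 0; split=> // e; rewrite scale0r; apply: hf => b.
  by rewrite in_nil.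
have hl := hat_linear b0.
have [||h [hlin _ hh]] := @baer_ext A E E setT
    (fun v y => exists e, [/\ klist js e, v = b0 *: (e : Eh) & y = f e]) (submoduleT E) bE.
- split.
  + exists 0; split; first exact: (klist_submod js).1.
      exact: esym (linfun0 hl).
    exact: esym (linfun0 fl).
  + move=> a _ _ _ _ [x [kx -> ->]] [y [ky -> ->]]; exists (a *: x + y).
    by rewrite fl hl; split=> //; apply: (klist_submod js).2.
  + move=> _ [e [ke e0 ->]]; apply: hf => b; rewrite inE => /orP[/eqP->|/ke//].
    by rewrite -e0.
- by [].
have [c hc] := end_hat hlin.
have [||b' [hb' eb']] := IH (fun e => f e - c *: (b0 *: (e : Eh))).
- move=> a x y; rewrite fl hl (hat_linear c) scalerBr opprD.
  by rewrite addrACA.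
- move=> e ke; rewrite -hc -(hh _ (f e)) ?subrr //; by exists e.
exists (b' + c * b0); split.
  by exists c; rewrite /GRing.scale /= addrK.
move=> e; rewrite scalerDl -eb' -scalerA; apply/esym.
exact: subrK.
Qed.

(** Since E is Artinian, some E[js] with js in J is smallest; every element of J kills it and so
    lies in the ideal generated by js. *)
Lemma noeth_hat : noeth B.
Proof.
move=> J sJ _ _.
have [||X [[js [jJ ->]] mX]] := art_min (F := [set X | exists js, (forall b, b \in js -> J b) /\ X = klist js])
   (X0 := setT) (matlis_art lA nA mE).
- exists [::]; split=> //; apply/seteqP; split=> // e _ b; by rewrite in_nil.
- move=> _ [js [_ ->]]; split=> //; first exact: klist_submod.
  by move=> _ ->; apply: (klist_submod js).1.
exists js; split=> // j Jj.
have [||b [hb eb]] := @klist_span js (fun e => j *: (e : Eh)).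
- exact: hat_linear.
- move=> e ke; have : klist (j :: js) e; last by apply; rewrite mem_head.
  apply: mX ke; last by move=> x kx b bj; apply: kx; rewrite inE bj orbT.
  by exists (j :: js); split=> // b; rewrite inE => /orP[/eqP->|/jJ].
suff -> : j = b by [].
apply/eqP; rewrite -subr_eq0; apply/eqP/hat_faithful => e.
by rewrite scalerBl eb subrr.
Qed.

Lemma separate (S : set E) (y : E) : submodule S -> ~ S y ->
  exists f : E -> E, [/\ linear f, forall x, S x -> f x = 0 & f y <> 0].
Proof.
move=> sS nSy.
pose c : set A^o := [set a | S ((a : A) *: y)].
have sc : submodule c.
  split; first by rewrite /c /= scale0r; apply: submod0.
  by move=> a u v cu cv; rewrite /c /= scalerDl -scalerA; apply: sS.2.
have [|e ce [t e1 [e2 _ _]]] := @Eann_sep A n lA E mE c 1 sc.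
  by rewrite /c /= scale1r.
have [||h [hl _ hh]] := @baer_ext A E E setT
    (fun v z => exists x (a : A), [/\ S x, v = x + a *: y & z = a *: e]) (submoduleT E) bE.
- split.
  + by exists 0, 0; rewrite !scale0r addr0; split=> //; apply: submod0.
  + move=> a _ _ _ _ [x [b [Sx -> ->]]] [x' [b' [Sx' -> ->]]].
    exists (a *: x + x'), (a * b + b'); split; first exact: sS.2.
      by rewrite scalerDr scalerDl scalerA addrACA.
    by rewrite scalerDl scalerA.
  + move=> _ [x [a [Sx e0 ->]]]; apply: ce; rewrite /c /=.
    have -> : a *: y = - x by apply/eqP; rewrite -addr_eq0 addrC -e0.
    exact: submodN.
- by [].
exists h; split=> //.
  by move=> x Sx; apply/esym/hh; exists x, 0; rewrite !scale0r addr0.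
rewrite -(hh y e); first by move: e1; rewrite scale1r => ->.
by exists 0, 1; rewrite !scale1r add0r; split=> //; apply: submod0.
Qed.

(** J is finitely generated, so it suffices to solve the equations b e = y for finitely many
    generators, adding one equation at a time. *)
Lemma baer_hat : baer [set: Eh].
Proof.
move=> G lG _; have [g0 g1 g2] := lG.
pose J : set B^o := [set b | exists y, G b y].
have sJ : submodule J.
  by split; [exists 0|move=> a b c [y hy] [z hz]; exists (a *: y + z); apply: g1].
pose X (e : Eh) : set B^o := [set b | G b ((b : B) *: e)].
have sX e : submodule (X e).
  split; first by rewrite /X /= scale0r.
  move=> a b c hb hc; rewrite /X /= scalerDl -scalerA; exact: g1.
suff claim (js : seq B) : (forall b, b \in js -> J b) ->
    exists e : Eh, forall b, b \in js -> X e b.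
  have [js [jJ Jj]] := noeth_fg noeth_hat sJ.
  have [e he] := claim js jJ; exists e; split=> // b y Gby.
  apply: (linrel_eq lG Gby); have : J b by exists y.
  by move=> /Jj; apply: (wspan_min (sX e)) => // _ ->; apply: (sX e).1.
elim: js => [|b js IH] jJ; first by exists 0.
have [|e' he'] := IH; first by move=> c cj; apply: jJ; rewrite inE cj orbT.
have [y Gby] : J b by apply: jJ; rewrite mem_head.
have hl := hat_linear b.
pose S : set E := (fun e : E => b *: (e : Eh)) @` klist js.
have sS : submodule S by apply: submodule_im => //; apply: klist_submod.
have [[k kk ek]|nS] := pselect (S (y - b *: e')).
  exists ((e' : Eh) + (k : Eh)) => c; rewrite inE => /orP[/eqP->|cj]; rewrite /X /= scalerDr.
    by rewrite ek addrC subrK.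
  by rewrite (kk c cj) addr0; apply: he'.
(* If the new equation has no solution, some c kills b E[js] but not y - b e'. Then c b is in the
   ideal of js, and the value of G at c b is both c y and c b e', a contradiction. *)
have [f [fl fS fy]] := separate sS nS; exfalso.
have [c hc] := end_hat fl.
have [||d [hd ed]] := @klist_span js (fun e => c *: (b *: (e : Eh))).
- move=> a u v; rewrite hl; exact: hat_linear.
- by move=> e ke; rewrite -hc; apply: fS; exists e.
have cb : c * b = d.
  apply/eqP; rewrite -subr_eq0; apply/eqP/hat_faithful => e.
  by rewrite scalerBl -scalerA ed subrr.
have Xd : X e' d by apply: (wspan_min (sX e') _ he' hd) => _ ->; apply: (sX e').1.
apply: fy; rewrite hc scalerBr scalerA cb; apply/eqP; rewrite subr_eq0; apply/eqP.
apply: (linrel_eq lG _ Xd); rewrite -cb.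
have := g1 c b 0 y 0 Gby g0; rewrite !addr0; exact.
Qed.

Lemma matlis_hat : matlis nhat Eh.
Proof.
split; [exact: baer_hat|exact: ntorsion_hat|].
exists s0; split=> // e he.
have [a na|a ->] := s0_gen (e := e); last by exists (iot a); rewrite iotaE.
by rewrite -(@iotaE A m E tE); apply: he; apply: nhat_iota.
Qed.

Lemma prim_kill (c : set A^o) (k : nat) (e : E) : (forall l : seq A, size l = k -> (forall x, x \in l -> n x) ->
   c (\prod_(x <- l) x : A)) -> @Eann A E c e -> forall a, ipw k a -> a *: e = 0.
Proof.
move=> hk ce; apply: (@ipow_min _ _ k [set a : A^o | (a : A) *: e = 0]).
  split; first by rewrite /= scale0r.
  by move=> b x y /= hx hy; rewrite scalerDl -scalerA hx hy scaler0 addr0.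
by move=> l sl nl /=; apply: ce; apply: hk.
Qed.

Lemma span_ann (R : comNzRingType) (V : lmodType R) (s : seq R^o) (e : V) :
  (forall x, x \in s -> (x : R) *: e = 0) -> @Eann R V (wspan ([set 0] : set R^o) s) e.
Proof.
move=> h; apply: (@wspan_min R R^o [set 0] s [set a : R^o | (a : R) *: e = 0]) => //.
  split; first by rewrite /= scale0r.
  by move=> b x y /= hx hy; rewrite scalerDl -scalerA hx hy scaler0 addr0.
by move=> _ ->; rewrite /= scale0r.
Qed.

Lemma prim_hat (s : seq A) : prim n (wspan ([set 0] : set A^o) s) ->
  prim nhat (wspan ([set 0] : set B^o) (map iot s)).
Proof.
move=> [k hk]; exists k.+1 => l sl nl.
have [||b [hb eb]] := @klist_span (map iot s) (fun e => (\prod_(x <- l) x) *: (e : Eh)).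
- exact: hat_linear.
- move=> e ke; have ann := span_ann (s := s) (e := e).
  have ke' : forall a, ipw k a -> a *: e = 0.
    apply: prim_kill hk _; apply: ann => x xs.
    by rewrite -(@iotaE A m E tE); apply: ke; apply: map_f.
  have [//||a [Ia ->]] := @hat_prod l k.+1 e _ _ nl; first exact: (tors_le (leqnSn k) ke').
  by apply: ke'; apply: ipowS; rewrite -sl.
suff -> : \prod_(x <- l) x = b by [].
apply/eqP; rewrite -subr_eq0; apply/eqP/hat_faithful => e.
by rewrite scalerBl eb subrr.
Qed.

(** If k-fold products lie in (t), approximating t modulo m^(k+1) suffices: on elements killed by
    m^(k+1) both sequences act alike. So E[s] is killed by m^k, first where m^(k+1) acts as zero and
    then everywhere by descent from the torsion exponent. *)
Lemma prim_approx (t : seq B) : (forall b, b \in t -> nhat b) ->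
  prim nhat (wspan ([set 0] : set B^o) t) ->
  exists s : seq A, [/\ size s = size t, forall x, x \in s -> n x &
    prim n (wspan ([set 0] : set A^o) s)].
Proof.
move=> nt [k hk].
have ap b : exists a : A, (nhat b -> n a) /\
    forall e : Eh, (forall a : A, ipw k.+1 a -> a *: (e : E) = 0) -> b *: e = a *: (e : E).
  have [u ->] := cpi_surj b; exists (seq_val u k.+1); split; first by move=> h; apply: nhatP.
  by move=> e he; apply: chatE.
have [f hf] := choice ap.
exists (map f t); split; first by rewrite size_map.
  by move=> _ /mapP[b bt ->]; apply: (hf b).1; apply: nt.
pose K j (e : E) := forall l : seq A, size l = j -> (forall x, x \in l -> n x) ->
  \prod_(x <- l) x *: e = 0.
have sc := @submodule_wspan A A^o [set 0] (map f t) (@submodule0 _ _).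
have step1 e : (forall x, x \in map f t -> x *: e = 0) -> K k.+1 e -> K k e.
  move=> he Ke l sl nl.
  have Ie : forall a, ipw k.+1 a -> a *: e = 0.
    apply: (@ipow_min _ _ k.+1 [set a : A^o | (a : A) *: e = 0]) => //.
    split; first by rewrite /= scale0r.
    by move=> b x y /= hx hy; rewrite scalerDl -scalerA hx hy scaler0 addr0.
  have ann : @Eann B Eh (wspan ([set 0] : set B^o) t) e.
    by apply: span_ann => b bt; rewrite (hf b).2 //; apply: he; apply: map_f.
  rewrite -(@iotaE A m E tE) (_ : iot _ = \prod_(b <- map iot l) b); last first.
    by rewrite big_map (big_morph iot (@iotaM A m) (iota1 m)).
  apply: ann; apply: hk; first by rewrite size_map.
  by move=> _ /mapP[x xl ->]; apply: nhat_iota; apply: nl.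
have step2 e j : (forall x, x \in map f t -> x *: e = 0) -> K (j + k)%N e -> K k e.
  elim: j => // j IH he Ke; apply: IH => // l sl nl.
  rewrite -(cat_take_drop j l) big_cat /= mulrC -scalerA.
  apply: step1.
  - by move=> x xt; rewrite scalerA mulrC -scalerA he // scaler0.
  - move=> l' sl' nl'; rewrite scalerA mulrC -big_cat; apply: Ke.
      by rewrite size_cat size_take_min sl sl'; lia.
    by move=> x; rewrite mem_cat => /orP[/mem_take/nl|/nl'].
  - by rewrite size_drop sl addKn.
  - by move=> x /mem_drop/nl.
exists k => l sl nl; apply: contrapT => nc.
have [e ce [s e1 [e2 _ _]]] := Eann_sep lA mE sc nc.
have he x : x \in map f t -> x *: e = 0.
  by move=> xt; apply: ce; apply: wspan_mem => //; apply: submodule0.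
have [j hj] := tE e; apply: e2; rewrite -e1; apply: (step2 e j) => // l' sl' nl'.
rewrite -(cat_take_drop j l') big_cat /= mulrC -scalerA hj ?scaler0 //.
  by rewrite size_take_min sl'; lia.
by move=> x /mem_take/nl'.
Qed.

(** If the completion had smaller dimension, it would have a system of parameters shorter than d;
    approximated in A, this contradicts the bound of [chain_mul] for a chain of length d. *)
Lemma hat_dim d : pchain d ([set 0] : set A^o) -> pchain d ([set 0] : set B^o).
Proof.
move=> [Q [pQ _ hQ]]; apply: contrapT => nc.
have lB := locring_nhat.
case: d hQ nc => [|d] hQ nc.
  apply: nc; exists (fun=> nhat); split=> //; first by move=> _; apply: locring_prime.
  by move=> _ ->; have [sn _ _] := lB; apply: sn.1.
have [|t [st nt pt]] := sop_exists noeth_hat lB (@submodule0 B B^o) _ nc.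
  by move=> _ ->; have [sn _ _] := lB; apply: sn.1.
have [s [ss ns ps]] := prim_approx nt pt.
have [|] := chain_mul lA nA mE pQ hQ ns; last by rewrite ss st ltnn.
apply: prim_mono ps; apply: wspan_mono => _ ->.
by have [sQ _ _] := pQ 0%N; apply: sQ.1.
Qed.

(* An endomorphism f of E is the multiplication by an element y of the
   completion. If y <> 0, then some multiple w of y has a prime annihilator Q,
   and w E = E[Q] is a quotient of f E. *)
Lemma range_mul_gt0 (s : seq A) (f : E -> E) : prim n (wspan ([set 0] : set A^o) s) ->
  (forall x, x \in s -> n x) ->
  (forall (Q : set B^o) (w : B), is_prime Q -> (forall b, Q b <-> b * w = 0) -> pchain (size s) Q) ->
  linear f -> (exists e, f e <> 0) -> 0 < mul s (range f) [set 0].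
Proof.
move=> ps ns hQ fl [e1 fe1]; have [y hy] := end_hat fl.
have y0 : y <> 0 by move=> y0; apply: fe1; rewrite hy y0 scale0r.
have mB := matlis_hat; have lB := locring_nhat; have nB := noeth_hat.
pose an (w : B) : set B^o := [set b | (b : B) * w = 0].
have san w : submodule (an w).
  split; first by rewrite /an /= mul0r.
  by move=> a b c hb hc; rewrite /an /= mulrDl -[a *: b * w]mulrA hb hc mulr0 addr0.
(* A largest annihilator among the nonzero multiples of y is prime. *)
have [||X [[z zy ->] mX]] := noe_max (F := [set X | exists2 z, z * y <> 0 & X = an (z * y)])
   (X0 := an (1 * y)) (@submodule0 B B^o) nB.
- by exists 1; rewrite ?mul1r.
- by move=> _ [z _ ->]; split=> // _ ->; apply: (san _).1.
set w := z * y in zy *.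
have pw : is_prime (an w).
  split=> //; first by rewrite /an /= mul1r.
  move=> a b abw; apply: contrapT => /not_orP[na nb].
  apply: na; have /(_ (an (b * z * y))) := mX; apply.
  - by exists (b * z) => //; rewrite -mulrA.
  - by move=> c cw; rewrite /an /= -mulrA mulrCA cw mulr0.
  by rewrite /an /= -mulrA mulrA.
have [P [pP QP hP]] := hQ _ w pw (fun b => iff_refl _).
have ns' b : b \in map iot s -> nhat b.
  by move=> /mapP[x /ns nx ->]; apply: nhat_iota.
have ps' : prim nhat (wspan (P 0%N) (map iot s)).
  apply: prim_mono (prim_hat ps); apply: wspan_mono => _ ->.
  by have [sP _ _] := pP 0%N; apply: sP.1.
have [_] := chain_mul lB nB mB pP hP ns' ps'; rewrite size_map => /(_ erefl) pos.
have aE : @artP A E setT [set 0] by apply: (matlis_art lA nA mE).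
have gE : @good A E s setT [set 0].
  by apply: (good_art lA (c := [set 0])) => // b u -> _; rewrite scale0r.
have sz := @submodule0 A E.
have sP : submodule (@Eann B Eh (P 0%N) : set E) by apply: (@submodule_hat A m E tE _).2; exact: Eann_submod.
have wl : linear (fun e : E => w *: (e : Eh) : E) by apply: hat_linear.
have sw : submodule (range (fun e : E => w *: (e : Eh) : E)) by apply: submodule_im.
have sf : submodule (range f) by apply: submodule_im.
apply: (@lt_le_trans _ _ (mul s (@Eann B Eh (P 0%N) : set E) [set 0])); first by rewrite (mul_hat tE).
(* Q is contained in P 0, so E[P 0] lies in E[Q] = w E. *)
apply: (@le_trans _ _ (mul s (range (fun e : E => w *: (e : Eh) : E)) [set 0])).
  apply: (mul_mono lA nA mE) => //; last by apply: good_sub gE.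
  move=> e he; have [|v [wv _]] := @Eann_surj B nhat Eh mB [set 0] w e (@submodule0 _ _).
    by move=> b /= bw; apply: he; apply: QP.
  by exists v.
have zl := hat_linear z.
pose K := range f `&` [set v : E | z *: (v : Eh) = 0].
have sK : submodule K.
  by apply: submoduleI => //; exact: (submodule_preim zl sz).
have zK : [set 0] `<=` K by move=> _ ->; apply: submod0.
have Kf : K `<=` range f by move=> v [].
rewrite (mul_add sf sK sz zK Kf); last by apply: good_sub gE.
have -> : mul s (range f) K = mul s (range (fun e : E => w *: (e : Eh) : E)) [set 0].
  apply: (mul_iso zl) => //; first by split=> // _ ->; apply: submod0.
  split.
  - by move=> _ [_ [e _ <-] <-]; exists e => //; rewrite hy scalerA.
  - by move=> _ [v [_ /= vz] <-].
  - by move=> v fv /= vz; split.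
  by move=> _ [e _ <-]; exists (f e); [exists e|rewrite /= hy scalerA subrr].
rewrite lerDl; apply: art_mul_ge0 => //; first by apply: artP_sub aE.
by apply: good_sub gE.
Qed.
End CompletionMatlis.

(** * Local cohomology *)

Lemma pair_eq (T U : Type) (p q : T * U) : p.1 = q.1 -> p.2 = q.2 -> p = q.
Proof. by case: p q => a b [c d] /= -> ->. Qed.

Section GammaList.
Variables (R : comNzRingType) (nR : noeth R).

(** Torsion for the ideal generated by s, built one element at a time so that injectivity follows
    from [baer_gam]. *)
Fixpoint Gam (V : lmodType R) (s : seq R) : set V :=
  if s is x :: s' then gam x (@Gam V s') else setT.
Arguments Gam : clear implicits.

Lemma Gam_submod (V : lmodType R) s : submodule (Gam V s).
Proof. by elim: s => [|x s IH] /=; [exact: submoduleT|exact: submodule_gam]. Qed.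

Lemma Gam_baer (V : lmodType R) s : baer [set: V] -> baer (Gam V s).
Proof. by move=> bV; elim: s => [|x s IH] //=; apply: baer_gam => //; apply: Gam_submod. Qed.

Lemma GamP (V : lmodType R) s v : Gam V s v <->
  exists k, forall x, x \in s -> x ^+ k *: v = 0.
Proof.
elim: s => [|x s IH] /=; first by split=> // _; exists 0%N.
split=> [[/IH[k hk] [l hl]]|[k hk]].
  exists (k + l)%N => y; rewrite inE exprD => /orP[/eqP->|/hk e].
    by rewrite -scalerA hl scaler0.
  by rewrite mulrC -scalerA e scaler0.
split; last by exists k; apply: hk; rewrite mem_head.
by apply/IH; exists k => y ys; apply: hk; rewrite inE ys orbT.
Qed.

Lemma Gam_lin (V W : lmodType R) (f : V -> W) s v : linear f -> Gam V s v -> Gam W s (f v).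
Proof.
move=> fl /GamP[k hk]; apply/GamP; exists k => x xs.
by rewrite -linfunZ // hk // linfun0.
Qed.

Lemma Gam_pair (V W : lmodType R) s (p : (V * W)%type) :
  Gam (V * W)%type s p <-> Gam V s p.1 /\ Gam W s p.2.
Proof.
split=> [h|[/GamP[k hk] /GamP[l hl]]].
  by split; [apply: (Gam_lin (f := fst)) h|apply: (Gam_lin (f := snd)) h].
apply/GamP; exists (k + l)%N => x xs; case: p hk hl => a b /= hk hl.
apply: pair_eq => /=; rewrite exprD /=; last by rewrite -scalerA hl // scaler0.
by rewrite mulrC -scalerA hk // scaler0.
Qed.

Lemma baer_pair (V W : lmodType R) : baer [set: V] -> baer [set: W] ->
  baer [set: (V * W)%type].
Proof.
move=> bV bW G [g0 g1 g2] _.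
have [||v [_ hv]] := bV (fun a y => exists z, G a (y, z)).
- split; first by exists 0.
    by move=> a x y x' y' [z hz] [z' hz']; exists (a *: z + z'); exact: g1 hz hz'.
  by move=> y [z /g2[]].
- by [].
have [||w [_ hw]] := bW (fun a y => exists z, G a (z, y)).
- split; first by exists 0.
    by move=> a x y x' y' [z hz] [z' hz']; exists (a *: z + z'); exact: g1 hz hz'.
  by move=> y [z /g2[]].
- by [].
exists (v, w); split=> // a [y z] h; apply: pair_eq => /=.
  by apply: hv; exists z.
by apply: hw; exists y.
Qed.
End GammaList.
Arguments Gam {R} V s _.

(** * Complexes, cones and cohomology with supports *)

Record cplx (R : comNzRingType) := Cplx {
  cx :> nat -> lmodType R;
  cd : forall i, cx i -> cx i.+1;
  cd_lin : forall i, linear (@cd i);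
  cd_cd : forall i x, cd (@cd i x) = 0 }.
Arguments cd {R c i} _.

Section Cone.
Variables (R : comNzRingType) (x : R) (X : cplx R).

(* The degrees are shifted by one: index i of the cone of x on X is
   X (i + 1) * X i, so that no module in degree -1 is needed. *)
Definition cone_cx (i : nat) : lmodType R := (X i.+1 * X i)%type.
Definition cone_d i (p : cone_cx i) : cone_cx i.+1 := (cd p.1, x *: p.1 - cd p.2).
Fact cone_lin i : linear (@cone_d i).
Proof.
move=> a [p q] [p' q']; rewrite /cone_d /=; apply: pair_eq => /=; first exact: cd_lin.
rewrite cd_lin scalerDr scalerBr opprD addrACA; congr (_ - _ + _).
by rewrite !scalerA mulrC.
Qed.
Fact cone_dd i p : cone_d (@cone_d i p) = 0.
Proof.
rewrite /cone_d /= cd_cd; apply: pair_eq => //=.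
by rewrite (linfunB (@cd_lin _ X i.+1)) cd_cd subr0 (linfunZ (@cd_lin _ X i.+1)) subrr.
Qed.
Definition cone : cplx R := Cplx cone_lin cone_dd.
End Cone.

Section Cohomology.
Variables (R : comNzRingType) (nR : noeth R).
Implicit Types (s : seq R) (X : cplx R).

(** For [s = [::]] these are the cycles of X itself. As [bnd X s i] lies in degree i + 1, the index
    i used for cohomology, vanishing included, refers to degree i + 1. *)
Definition cyc X s i : set (X i) := [set v | Gam (X i) s v /\ cd v = 0].
Definition bnd X s i : set (X i.+1) := (fun v : X i => cd v) @` Gam (X i) s.
Arguments cyc : clear implicits.
Arguments bnd : clear implicits.

Lemma cyc_submod X s i : submodule (cyc X s i).
Proof.
have sG := Gam_submod (X i) s; split.
  by split; [exact: sG.1|exact: (linfun0 (@cd_lin _ X i))].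
move=> a u v [h1 h2] [h3 h4]; split; first exact: sG.2.
by rewrite cd_lin h2 h4 scaler0 addr0.
Qed.
Lemma bnd_submod X s i : submodule (bnd X s i).
Proof. by apply: (submodule_im (@cd_lin _ X i)); apply: Gam_submod. Qed.
Lemma Hpair X s i : pair (cyc X s i.+1) (bnd X s i).
Proof.
split; [exact: cyc_submod|exact: bnd_submod|].
move=> _ [v Gv <-]; split; last exact: cd_cd.
exact: (Gam_lin (@cd_lin _ X i)).
Qed.

Definition vanish X s i := cyc X s i.+1 `<=` bnd X s i.
Arguments vanish : clear implicits.
Definition injective_cplx X := forall i, baer [set: X i].

Lemma cone_injective x X : injective_cplx X -> injective_cplx (cone x X).
Proof. by move=> bX i; apply: baer_pair. Qed.

Lemma gam_div X s x i k e : injective_cplx X -> Gam (X i) s e ->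
  exists y, Gam (X i) s y /\ Gam (X i) (x :: s) (x ^+ k *: y - e).
Proof.
move=> bX Ge; apply: (baer_gam_div nR x k _ _ Ge); first exact: Gam_submod.
by apply: Gam_baer.
Qed.

(** Write z = dw. A power of x makes w a cycle and then a boundary dv; dividing v by that power up
    to x-torsion gives v', and w - dv' is x-torsion with the same boundary. *)
Lemma Gam_bnd X s x i z : injective_cplx X ->
  (forall v, cyc X s i.+1 v -> exists k, bnd X s i (x ^+ k *: v)) ->
  bnd X s i.+1 z -> Gam _ (x :: s) z -> bnd X (x :: s) i.+1 z.
Proof.
move=> bX tH [w Gw <-] [_ [k hk]].
have l1 := @cd_lin _ X i.+1; have l0 := @cd_lin _ X i.
have [|l [v Gv ev]] := tH (x ^+ k *: w).
  by split; [apply: submodZ => //; exact: Gam_submod|rewrite (linfunZ l1)].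
have [v' [Gv' [Gg [q hq]]]] := gam_div x (l + k) bX Gv.
exists (w - cd v'); last by rewrite (linfunB l1) cd_cd subr0.
split.
  by apply: submodB; [exact: Gam_submod| |exact: (Gam_lin l0)].
exists (q + (l + k))%N; rewrite exprD -scalerA.
rewrite (_ : _ *: (w - _) = - cd (x ^+ (l + k) *: v' - v)); last first.
  by rewrite (linfunB l0) (linfunZ l0) ev scalerBr opprB scalerA -exprD.
by rewrite scalerN -(linfunZ l0) hq (linfun0 l0) oppr0.
Qed.

Lemma Gam_bnd0 X s x z : (forall v : X 0%N, v = 0) ->
  bnd X s 0 z -> bnd X (x :: s) 0 z.
Proof.
move=> X0 [w _ <-]; exists w => //; rewrite (X0 w); apply: (submod0 (Gam_submod _ _)).
Qed.

(** If x^k z = dv, divisibility modulo torsion gives v' with x^k v' = v up to x-torsion, so z - dv'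
    is x-torsion. *)
Lemma Gam_cyc X s x i k z : injective_cplx X -> cyc X s i.+1 z ->
  bnd X s i (x ^+ k *: z) -> exists v, Gam (X i) s v /\ cyc X (x :: s) i.+1 (z - cd v).
Proof.
move=> bX [Gz dz] [v Gv ev]; have l0 := @cd_lin _ X i.
have l1 := @cd_lin _ X i.+1.
have [v' [Gv' [Gg [q hq]]]] := gam_div x k bX Gv.
exists v'; split=> //; split; last by rewrite (linfunB l1) cd_cd dz subr0.
split; first by apply: submodB => //; [exact: Gam_submod|exact: (Gam_lin l0)].
exists (q + k)%N; rewrite exprD -scalerA.
rewrite (_ : _ *: (z - _) = - cd (x ^+ k *: v' - v)); last first.
  by rewrite (linfunB l0) (linfunZ l0) ev scalerBr opprB.
by rewrite scalerN -(linfunZ l0) hq (linfun0 l0) oppr0.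
Qed.

Lemma vanish_gam X s x i : injective_cplx X -> vanish X s i -> vanish X s i.+1 ->
  vanish X (x :: s) i.+1.
Proof.
move=> bX v1 v2 z [Gz dz]; apply: Gam_bnd => //.
  by move=> v /v1 h; exists 0%N; rewrite expr0 scale1r.
by apply: v2; split=> //; have [] := Gz.
Qed.

Lemma vanish_all X s p : injective_cplx X ->
  (forall i, (p < i)%N -> vanish X [::] i) ->
  forall i, (p + size s < i)%N -> vanish X s i.
Proof.
move=> bX h; elim: s => [|x s IH] i /=; first by rewrite addn0; apply: h.
by case: i => // i hi; apply: vanish_gam => //; apply: IH; lia.
Qed.

Section ConeExact.
Variables (x : R) (X : cplx R) (s : seq R).
Local Notation C := (cone x X).

Let fst_lin i : linear (fun p : C i => p.1). Proof. by []. Qed.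
Let inj_lin i : linear (fun b : X i => (0, b) : C i).
Proof.
move=> a u v; apply: pair_eq => //=.
by rewrite -[RHS]/(a *: (0 : X i.+1) + 0) scaler0 addr0.
Qed.

(** The middle of the exact sequence 0 -> H^i / x -> H^i(cone) -> H^(i+1)[x] -> 0 (indices as for
    [bnd]): the cycles whose class maps to zero on the right. *)
Definition cone_mid i : set (C i.+1) := [set p | cyc C s i.+1 p /\ bnd X s i.+1 p.1].
Arguments cone_mid : clear implicits.

Lemma cone_cycP i (p : C i.+1) : cyc C s i.+1 p <->
  [/\ Gam _ s p.1, Gam _ s p.2, cd p.1 = 0 & x *: p.1 = cd p.2].
Proof.
split=> [[/Gam_pair[h1 h2] dp]|[h1 h2 h3 h4]].
  have e1 : cd p.1 = 0 := congr1 fst dp.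
  have e2 : x *: p.1 - cd p.2 = 0 := congr1 snd dp.
  by split=> //; apply/eqP; rewrite -subr_eq0 e2.
split; first exact/Gam_pair.
by apply: pair_eq; rewrite /= ?h3 // h4 subrr.
Qed.

Lemma cone_mid_submod i : submodule (cone_mid i).
Proof.
apply: submoduleI; first exact: cyc_submod.
exact: (submodule_preim (@fst_lin i.+1) (@bnd_submod X s i.+1)).
Qed.

Lemma cone_mid_pair i : pair (cyc C s i.+1) (cone_mid i).
Proof. by split; [exact: cyc_submod|exact: cone_mid_submod|move=> p []]. Qed.

Lemma cone_mid_pair' i : pair (cone_mid i) (bnd C s i).
Proof.
split; [exact: cone_mid_submod|exact: bnd_submod|].
move=> p h; split; first by have [_ _] := @Hpair C s i; apply.
by case: h => -[c e] /Gam_pair[Gc Ge] <-; exists c.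
Qed.

Lemma cone_qiso1 i : qiso (fun p : C i.+1 => p.1) (cyc C s i.+1) (cone_mid i)
  (tor x (cyc X s i.+2) (bnd X s i.+1)) (bnd X s i.+1).
Proof.
split.
- move=> _ [p /cone_cycP[h1 h2 h3 h4] <-]; split; first by [].
  by rewrite h4; exists p.2.
- by move=> _ [p [_ ?] <-].
- by move=> p.
move=> a [[Ga da] [b Gb eb]]; exists (a, b); last first.
  by rewrite subrr; apply: submod0; apply: bnd_submod.
by apply/cone_cycP.
Qed.

Lemma cone_qiso2 i : qiso (fun b : X i.+1 => (0, b) : C i.+1) (cyc X s i.+1)
  (simg x (cyc X s i.+1) (bnd X s i)) (cone_mid i) (bnd C s i).
Proof.
have l1 := @cd_lin _ X i.+1; have l0 := @cd_lin _ X i.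
split.
- move=> _ [b [Gb db] <-]; split; last by apply: submod0; apply: bnd_submod.
  apply/cone_cycP; split=> //=; first exact: (submod0 (Gam_submod _ _)).
    exact: (linfun0 (@cd_lin _ X i.+2)).
  by rewrite scaler0 db.
- move=> _ [_ /simgP[u [_ [[Gu du] [w Gw <-] ->]]] <-]; exists (u, - w).
    by apply/Gam_pair; split=> //; apply: (submodN (Gam_submod _ _)).
  by rewrite /= /cone_d /= du (linfunN l0) opprK.
- move=> b [Gb db] [[c e] /Gam_pair[/= Gc Ge] ep].
  have dc : cd c = 0 := congr1 fst ep.
  have eb : x *: c - cd e = b := congr1 snd ep.
  apply/simgP; exists c, (- cd e); split; [by []| |exact: esym eb].
  by apply: (submodN (bnd_submod _ _ _)); exists e.
move=> [a b] [/cone_cycP[/= h1 h2 h3 h4] [c Gc ec]].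
exists (b - x *: c).
  split; first by apply: submodB => //; [exact: Gam_submod|apply: submodZ => //; exact: Gam_submod].
  by rewrite (linfunB l1) (linfunZ l1) ec h4 subrr.
exists (c, 0); first by apply/Gam_pair; split=> //; apply: (submod0 (Gam_submod _ _)).
rewrite /= /cone_d /= ec (linfun0 l0) subr0; apply: pair_eq => /=; first by rewrite subr0.
by rewrite opprB addrC subrK.
Qed.

Lemma cone_ext (P : forall V : lmodType R, set V -> set V -> Prop) i :
  (forall (V V' : lmodType R) (f : V -> V') U W U' W', linear f -> pair U W ->
     pair U' W' -> qiso f U W U' W' -> P V U W <-> P V' U' W') ->
  (forall (V : lmodType R) U Y W, submodule U -> submodule Y -> submodule W ->
     W `<=` Y -> Y `<=` U -> P V U Y -> P V Y W -> P V U W) ->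
  P _ (tor x (cyc X s i.+2) (bnd X s i.+1)) (bnd X s i.+1) ->
  P _ (cyc X s i.+1) (simg x (cyc X s i.+1) (bnd X s i)) ->
  P _ (cyc C s i.+1) (bnd C s i).
Proof.
move=> Piso Pext h1 h2; have [s1 s2 s3] := cone_mid_pair i.
have [_ t2 t3] := cone_mid_pair' i; apply: (Pext _ _ (cone_mid i)) => //.
  apply: (Piso _ _ _ _ _ _ _ (@fst_lin i.+1) _ _ _).2 h1; last exact: cone_qiso1.
    exact: cone_mid_pair.
  by apply: pair_tor; apply: Hpair.
apply: (Piso _ _ _ _ _ _ _ (@inj_lin i.+1) _ _ _).1 h2; last exact: cone_qiso2.
  by apply: pair_simg; apply: Hpair.
exact: cone_mid_pair'.
Qed.

Lemma cone_mul t i : good t (cyc C s i.+1) (bnd C s i) ->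
  mul t (cyc C s i.+1) (bnd C s i) =
  mul t (tor x (cyc X s i.+2) (bnd X s i.+1)) (bnd X s i.+1) +
  mul t (cyc X s i.+1) (simg x (cyc X s i.+1) (bnd X s i)).
Proof.
move=> g; have [s1 s2 s3] := cone_mid_pair i.
have [_ t2 t3] := cone_mid_pair' i; rewrite (mul_add s1 s2 t2 t3 s3 g).
congr (_ + _); first apply: (mul_iso (@fst_lin i.+1)).
- exact: cone_mid_pair.
- by apply: pair_tor; apply: Hpair.
- exact: cone_qiso1.
apply/esym/(mul_iso (@inj_lin i.+1)).
- by apply: pair_simg; apply: Hpair.
- exact: cone_mid_pair'.
exact: cone_qiso2.
Qed.
End ConeExact.

(** On the cone, multiplication by x is homotopic to zero; passing to x-torsion therefore leaves its
    cohomology unchanged. *)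
Lemma cone_gam x X s i : injective_cplx X ->
  qiso id (cyc (cone x X) (x :: s) i.+1) (bnd (cone x X) (x :: s) i)
    (cyc (cone x X) s i.+1) (bnd (cone x X) s i).
Proof.
move=> bX; have l1 := @cd_lin _ X i.+1; have l0 := @cd_lin _ X i.
split.
- by move=> _ [p [[Gp _] dp] <-].
- by move=> _ [_ [p [Gp _] <-] <-]; exists p.
- move=> p /cone_cycP[h1 h2 h3 h4] [[c e] /Gam_pair[/= Gc Ge] ep].
  have [e' [Ge' [Gg [q hq]]]] := gam_div x 1 bX Ge; rewrite expr1 in hq Gg.
  have ecp : cd c = p.1 by rewrite -ep.
  have eep : x *: c - cd e = p.2 by rewrite -ep.
  exists (c - cd e', e - x *: e').
    apply/Gam_pair; split; last first.
      rewrite /= -opprB; apply: (submodN (Gam_submod _ (x :: s))).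
      by split=> //; exists q.
    split; first by apply: submodB => //; [exact: Gam_submod|exact: (Gam_lin l0)].
    have [_ [k hk]] := h2; exists (k + q).+1.
    rewrite exprSr -scalerA scalerBr -(linfunZ l0).
    rewrite (_ : x *: c - _ = p.2 - cd (x *: e' - e)); last first.
      by rewrite -eep (linfunB l0) opprB addrA subrK.
    rewrite scalerBr [(k + q)%N]addnC exprD -scalerA hk scaler0 sub0r.
    by rewrite mulrC -scalerA -(linfunZ l0) hq (linfun0 l0) scaler0 oppr0.
  rewrite /= /cone_d /= (linfunB l1) cd_cd subr0 (linfunB l0) (linfunZ l0).
  by rewrite scalerBr opprB addrA subrK -ep.
move=> [a b] /cone_cycP[/= h1 h2 h3 h4].
have [b' [Gb' Gg]] := gam_div x 1 bX h2; rewrite expr1 in Gg.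
exists (a - cd b', b - x *: b').
  have Gb : Gam (X i.+1) (x :: s) (b - x *: b').
    by rewrite -opprB; apply: (submodN (Gam_submod _ _)).
  have ex : x *: (a - cd b') = cd (b - x *: b').
    by rewrite (linfunB l1) (linfunZ l1) scalerBr h4.
  apply/cone_cycP; split=> //=; last by rewrite (linfunB (@cd_lin _ X i.+2)) cd_cd h3 subr0.
  split; first by apply: submodB => //; [exact: Gam_submod|exact: (Gam_lin l1)].
  have [_ [k hk]] := Gb; exists k.+1.
  by rewrite exprSr -scalerA ex -(linfunZ l1) hk (linfun0 l1).
exists (b', 0); first by apply/Gam_pair; split=> //; apply: (submod0 (Gam_submod _ _)).
rewrite /= /cone_d /= (linfun0 l0) subr0.
by apply: pair_eq => /=; rewrite opprB addrC subrK.
Qed.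

End Cohomology.
Arguments cyc {R} X s i _.
Arguments bnd {R} X s i _.
Arguments vanish {R} X s i.

(** * Nilpotent subquotients and filter-regular sequences *)

Section Nilpotent.
Variables (R : comNzRingType) (n : set R).

Definition pnil (V : lmodType R) (U W : set V) :=
  forall y, n y -> exists k, forall u, U u -> W (y ^+ k *: u).

(* a filter-regular sequence on U / W *)
Fixpoint freg (s : seq R) (V : lmodType R) (U W : set V) :=
  if s is x :: s' then pnil (tor x U W) W /\ freg s' U (simg x U W) else True.

Lemma pnil_iso (V V' : lmodType R) (f : V -> V') U W (U' W' : set V') : linear f ->
  pair U W -> pair U' W' -> qiso f U W U' W' -> pnil U W <-> pnil U' W'.
Proof.
move=> fl [sU sW WU] [sU' sW' WU'] [q1 q2 q3 q4]; split=> h y ny; have [k hk] := h y ny; exists k.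
  move=> u' /q4[u Uu hu]; rewrite -(subrK (f u) u') scalerDr -(linfunZ fl).
  apply: submodD => //; first exact: submodZ.
  by apply: q2; exists (y ^+ k *: u) => //; apply: hk.
move=> u Uu; apply: q3; first exact: submodZ.
by rewrite (linfunZ fl); apply: hk => //; apply: q1; exists u.
Qed.

Lemma pnil_ext (V : lmodType R) (U Y W : set V) : submodule U -> submodule Y ->
  submodule W -> W `<=` Y -> Y `<=` U -> pnil U Y -> pnil Y W -> pnil U W.
Proof.
move=> sU sY sW WY YU h1 h2 y ny; have [k hk] := h1 y ny; have [l hl] := h2 y ny.
exists (l + k)%N => u Uu; by rewrite exprD -scalerA; apply: hl => //; apply: hk.
Qed.

Lemma pnil_sub (V : lmodType R) (U W U' W' : set V) : W `<=` W' -> U' `<=` U ->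
  pnil U W -> pnil U' W'.
Proof. by move=> h1 h2 h y /h[k hk]; exists k => u /h2 Uu; apply/h1/hk. Qed.

Lemma freg_iso s (V V' : lmodType R) (f : V -> V') U W (U' W' : set V') : linear f ->
  pair U W -> pair U' W' -> qiso f U W U' W' -> freg s U W -> freg s U' W'.
Proof.
move=> fl; elim: s U W U' W' => //= x s IH U W U' W' p p' q [h1 h2]; split.
  apply: (pnil_iso fl (pair_tor x p) (pair_tor x p') (qiso_tor fl x p p' q)).1 h1.
exact: IH (pair_simg x p) (pair_simg x p') (qiso_simg fl x p p' q) h2.
Qed.

Lemma mul_nil (V : lmodType R) s (U W : set V) : pair U W -> good s U W ->
  (0 < size s)%N -> (forall x, x \in s -> n x) -> pnil U W -> mul s U W = 0.
Proof.
case: s => // x s p g _ ns /(_ x (ns x (mem_head _ _)))[k hk].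
exact: (mul_kill_pow p g hk).
Qed.

Lemma mul_triv (V : lmodType R) s (U W : set V) : pair U W -> U `<=` W -> mul s U W = 0.
Proof.
move=> [sU sW WU] h; have -> : W = U by apply/seteqP.
exact: mulxx.
Qed.
End Nilpotent.

Lemma artP_iso_rev (R : comNzRingType) (V V' : lmodType R) (f : V -> V') U W (U' W' : set V') :
  linear f -> pair U W -> pair U' W' -> qiso f U W U' W' -> artP U' W' -> artP U W.
Proof.
move=> fl [sU sW WU] [sU' sW' WU'] [q1 q2 q3 q4] a c hc dc.
have [j|j|N hN] := a (fun j => addm (f @` c j) W').
- have [c1 c2 c3] := hc j; have si := submodule_im fl c1; split.
  + exact: submodule_add.
  + exact: addmr.
  apply: addm_sub => // _ [v cv <-]; apply: q1; exists v => //; exact: c3.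
- have [c1 c2 c3] := hc j; have si := submodule_im fl c1.
  have [d1 d2 d3] := hc j.+1.
  apply: addm_sub; [exact: submodule_add| |exact: addmr].
  by move=> _ [v /dc cv <-]; apply: addml => //; exists v.
exists N => j Nj u cu; have [c1 c2 c3] := hc N; have [d1 d2 d3] := hc j.
have /(hN j Nj)[_ [w [[v cv <-] Ww e]]] : addm (f @` c N) W' (f u).
  by apply: addml => //; exists u.
rewrite -(subrK v u); apply: submodD => //; apply/d2/q3.
  by apply: submodB => //; [apply: c3|apply: d3].
by rewrite (linfunB fl) e addrC addKr.
Qed.

Section LocalCohomology.
Variables (R : comNzRingType) (nR : noeth R) (n : set R).
Implicit Types (s : seq R) (X : cplx R).

(** The cohomology at index q plays the role of M. The cone of x replaces M by M / xM but leaves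
    M[x] at index q - 1; filter-regularity makes this nilpotent, which is why lower cohomology is
    nilpotent rather than zero. The zero modules of [lc_low] absorb the degree shift of the
    cones. *)
Record lc_data X s q : Prop := LcData {
  lc_inj : injective_cplx X;
  lc_size : (0 < size s)%N;
  lc_n : forall x, x \in s -> n x;
  lc_low : forall i, (i < size s)%N -> forall v : X i, v = 0;
  lc_nil : forall i, (i < q)%N -> pnil n (cyc X [::] i.+1) (bnd X [::] i);
  lc_high : forall i, (q < i)%N -> vanish X [::] i;
  lc_noe : noeP (cyc X [::] q.+1) (bnd X [::] q);
  lc_good : good s (cyc X [::] q.+1) (bnd X [::] q);
  lc_freg : freg n s (cyc X [::] q.+1) (bnd X [::] q);
  lc_art : forall i, artP (cyc X s i.+1) (bnd X s i);
  lc_agood : forall i, good s (cyc X s i.+1) (bnd X s i) }.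

Lemma vanish_cone x X s i : vanish X s i -> vanish X s i.+1 -> vanish (cone x X) s i.
Proof.
move=> v1 v2; apply: (@cone_ext _ x X s (fun V U W => U `<=` W)).
- move=> V V' f U W U' W' fl [sU sW WU] [sU' sW' WU'] [q1 q2 q3 q4]; split=> h.
    move=> u' /q4[u Uu hu]; rewrite -(subrK (f u) u'); apply: submodD => //.
    by apply: q2; exists u => //; apply: h.
  by move=> u Uu; apply: q3 => //; apply: h; apply: q1; exists u.
- by move=> V U Y W _ _ _ WY YU h1 h2 u /h1/h2.
- by move=> u [/v2].
- by apply: subset_trans v1 _; apply: sub_simg; apply: Hpair.
Qed.

Lemma lc_cone x s X q : (0 < size s)%N -> lc_data X (x :: s) q ->
  lc_data (cone x X) s q /\
  mul s (cyc (cone x X) [::] q.+1) (bnd (cone x X) [::] q) =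
  mul s (cyc X [::] q.+1) (simg x (cyc X [::] q.+1) (bnd X [::] q)).
Proof.
move=> s0 [l1 l2 l3 l4 l5 l6 l7 l8 [l9 l9'] l10 l11].
have p := Hpair X [::] q; have pc := cone_mid_pair' x X [::] q.
have qi := @cone_qiso2 _ x X [::] q; have ps := pair_simg x p.
have inj_lin : linear (fun b : X q.+1 => (0, b) : cone x X q.+1).
  move=> a u v; apply: pair_eq => //=.
  by rewrite -[RHS]/(a *: (0 : X q.+2) + 0) scaler0 addr0.
have emid : @cone_mid _ x X [::] q = cyc (cone x X) [::] q.+1.
  apply/seteqP; split; first by move=> u [].
  move=> u cu; split=> //; apply: (l6 q.+1) => //.
  by have [h1 h2 h3 h4] := (cone_cycP [::] u).1 cu.
rewrite emid in pc qi; split; last exact/esym/(mul_iso inj_lin).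
split=> //.
- exact: cone_injective.
- by move=> y ys; apply: l3; rewrite inE ys orbT.
- by move=> i hi [a b]; apply: pair_eq; apply: l4 => /=; lia.
- move=> i iq; apply: (@cone_ext _ x X [::] (@pnil _ n)).
  + by move=> *; apply: pnil_iso; eauto.
  + exact: pnil_ext.
  + have [e|ne] := eqVneq i.+1 q; first by rewrite e.
    apply: pnil_sub (l5 i.+1 _) => //; first by move=> u [].
    by rewrite ltn_neqAle ne iq.
  by apply: pnil_sub (l5 i _) => //; apply: sub_simg; apply: Hpair.
- by move=> i iq; apply: vanish_cone; apply: l6 => //; lia.
- apply: (noeP_iso inj_lin ps pc qi); apply: noeP_sub l7 => //.
  exact: sub_simg.
- by apply: (good_iso inj_lin s ps pc qi).1; apply: good_simg.
- exact: (freg_iso inj_lin ps) pc qi l9'.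
- move=> i; apply: (artP_iso (@id_linear _ _) _ _ (cone_gam nR x s i l1)); try exact: Hpair.
  apply: (@cone_ext _ x X (x :: s) (@artP _)).
  + by move=> *; split; [apply: artP_iso|apply: artP_iso_rev]; eauto.
  + exact: artP_ext.
  + by apply: artP_sub (l10 i.+1) => //; apply: tor_sub.
  by apply: artP_sub (l10 i) => //; apply: sub_simg; apply: Hpair.
move=> i; apply: (good_iso (@id_linear _ _) s _ _ (cone_gam nR x s i l1)).1; try exact: Hpair.
apply: (@cone_ext _ x X (x :: s) (@good _ ^~ s)).
- by move=> *; apply: good_iso; eauto.
- by move=> V U Y W sU sY sW WY YU; apply: good_ext.
- by apply: good_tor => //; apply: Hpair.
by apply: good_simg => //; apply: Hpair.
Qed.

Lemma gam_torsion x X i : injective_cplx X -> (forall v : X 0%N, v = 0) -> n x ->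
  (forall j, (j < i)%N -> pnil n (cyc X [::] j.+1) (bnd X [::] j)) ->
  forall z, bnd X [::] i z -> Gam _ [:: x] z -> bnd X [:: x] i z.
Proof.
move=> bX X0 nx; case: i => [|i] h z; first by move=> hz _; apply: Gam_bnd0.
have [k hk] := h i (ltnSn i) x nx; apply: Gam_bnd => // v hv.
by exists k; apply: hk.
Qed.

(** A separate case, because for an empty remaining sequence [mul] is the length and the torsion
    M[x] does not disappear. It reappears as the kernel of x on the cohomology of the torsion
    complex at index q, whose [mul] for x is zero. *)
Lemma lc_base x X q : lc_data X [:: x] q ->
  (forall i, (i < q.+1)%N -> mul [:: x] (cyc X [:: x] i.+1) (bnd X [:: x] i) = 0) /\
  mul [:: x] (cyc X [:: x] q.+2) (bnd X [:: x] q.+1) =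
    - mul [:: x] (cyc X [::] q.+1) (bnd X [::] q).
Proof.
move=> [l1 _ l3 l4 l5 l6 l7 l8 _ l10 l11].
have X0 : forall v : X 0%N, v = 0 by apply: l4.
have nx : n x by apply: l3; rewrite mem_head.
have pq := Hpair X [::] q; have [sU sW WU] := pq.
have low i : (i < q.+1)%N -> mul [:: x] (cyc X [:: x] i.+1) (bnd X [:: x] i) = 0.
  move=> iq; have := gam_torsion l1 X0 nx (i := i) => /(_ _) gt.
  have {}gt := gt (fun j ji => l5 j (leq_trans ji iq)).
  (* A uniform exponent: by nilpotency below q, and at q because the x-power torsion of a Noetherian
     module is killed by one power of x. *)
  have [K hK] : exists K, forall z, cyc X [:: x] i.+1 z -> bnd X [::] i (x ^+ K *: z).
    have [iq'|iq'] := ltnP i q.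
      by have [k hk] := l5 i iq' x nx; exists k => z [[_ _] dz]; apply: hk.
    have ei : i = q by lia.
    subst i; have [|j u [Uu hu]|K hK] :=
      noeP_stab (c := fun k => tor (x ^+ k) (cyc X [::] q.+1) (bnd X [::] q)) sW l7.
    - by move=> k; split; [exact: submodule_tor|exact: sub_tor|exact: tor_sub].
    - by split=> //; rewrite exprS -scalerA; apply: submodZ.
    exists K => z [[_ [k hk]] dz]; have [|_ //] := hK k z.
    by split=> //; rewrite hk; apply: submod0.
  apply: (mul_kill_pow (N := K)); [exact: Hpair|exact: l11|].
  move=> z hz; apply: gt; first exact: hK.
  by have [h _] := hz; exact: (submodZ (x ^+ K) (Gam_submod (X i.+1) [:: x]) h).
split=> // ; have q1 : (q < q.+1)%N by [].
have e0 := low q q1; rewrite /= in e0.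
have gC i : good [::] (cyc (cone x X) [:: x] i.+1) (bnd (cone x X) [:: x] i).
  apply: (@cone_ext _ x X [:: x] (@good _ ^~ [::])).
  - by move=> *; apply: good_iso; eauto.
  - by move=> V U Y W sU' sY sW' WY YU; apply: good_ext.
  - by apply: good_tor => //; apply: Hpair.
  by apply: good_simg => //; apply: Hpair.
have mC i : mul [::] (cyc (cone x X) [::] i.+1) (bnd (cone x X) [::] i) =
    mul [::] (tor x (cyc X [:: x] i.+2) (bnd X [:: x] i.+1)) (bnd X [:: x] i.+1) +
    mul [::] (cyc X [:: x] i.+1) (simg x (cyc X [:: x] i.+1) (bnd X [:: x] i)).
  rewrite -(cone_mul (gC i)); apply/esym/(mul_iso (@id_linear _ _)); try exact: Hpair.
  exact: cone_gam.
have m1 := mC q; have m2 := mC q.+1.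
rewrite [LHS]mul_triv in m2; [|exact: Hpair|]; last first.
  by apply: vanish_cone; apply: l6.
have pc := cone_mid_pair' x X [::] q.
have qi := @cone_qiso2 _ x X [::] q; have ps := pair_simg x pq.
have inj_lin : linear (fun b : X q.+1 => (0, b) : cone x X q.+1).
  move=> a u v; apply: pair_eq => //=.
  by rewrite -[RHS]/(a *: (0 : X q.+2) + 0) scaler0 addr0.
have emid : @cone_mid _ x X [::] q = cyc (cone x X) [::] q.+1.
  apply/seteqP; split; first by move=> u [].
  move=> u cu; split=> //; apply: (l6 q.+1) => //.
  by have [h1 h2 h3 h4] := (cone_cycP [::] u).1 cu.
rewrite emid in pc qi; rewrite -(mul_iso inj_lin [::] ps pc qi) in m1.
have gt := gam_torsion l1 X0 nx l5.
have m3 : mul [::] (tor x (cyc X [:: x] q.+1) (bnd X [:: x] q)) (bnd X [:: x] q) =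
    mul [::] (tor x (cyc X [::] q.+1) (bnd X [::] q)) (bnd X [::] q).
  apply: (mul_iso (@id_linear _ _)); try by apply: pair_tor; apply: Hpair.
  split.
  - by move=> _ [z [[_ dz] [w Gw ew]] <-]; split=> //; exists w.
  - by move=> _ [_ [w Gw <-] <-]; exists w.
  - by move=> z [[Gz dz] _] hz; apply: gt.
  move=> z [cz xz]; have xz1 : bnd X [::] q (x ^+ 1 *: z) by rewrite expr1.
  have [v [Gv [cv dv]]] := Gam_cyc nR l1 cz xz1.
  exists (z - cd v); last by rewrite opprB addrC subrK; exists v.
  split; first by split.
  apply: gt; last exact: (submodZ x (Gam_submod (X q.+1) [:: x]) cv).
  rewrite scalerBr -(linfunZ (@cd_lin _ X q)).
  by apply: submodB => //; exists (x *: v).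
(* The terms are lengths, so the two summands of [m2] vanish; [m1], [m3] and [e0] then give the
   value. *)
rewrite /= in m1 m2 m3 *; lia.
Qed.

(* Nonnegativity of mul on Artinian subquotients turns the exact sequences of the cone
   of x, whose outer terms are H[x] and H / x, into the vanishing of both terms. *)
Lemma lc_mul s X q : lc_data X s q ->
  (forall i, (i < q + size s)%N -> mul s (cyc X s i.+1) (bnd X s i) = 0) /\
  mul s (cyc X s (q + size s).+1) (bnd X s (q + size s)) =
    (-1) ^+ size s * mul s (cyc X [::] q.+1) (bnd X [::] q).
Proof.
elim: s X => [|x s IH] X h; first by have := lc_size h.
have [e|s0] := posnP (size s).
  move: h; rewrite (size0nil e) => /lc_base[h1 h2]; rewrite [size _]/= addn1.
  by split=> //; rewrite h2 expr1 mulN1r.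
have [hC eN] := lc_cone s0 h; have [m1 m2] := IH _ hC.
have [l1 l2 l3 l4 l5 l6 l7 l8 [l9 l9'] l10 l11] := h.
have hp i := Hpair X (x :: s) i.
have A0 i : 0 <= mul s (tor x (cyc X (x :: s) i.+1) (bnd X (x :: s) i)) (bnd X (x :: s) i).
  apply: art_mul_ge0; first exact: pair_tor.
    by apply: artP_sub (l10 i) => //; apply: tor_sub.
  exact: good_tor.
have B0 i : 0 <= mul s (cyc X (x :: s) i.+1) (simg x (cyc X (x :: s) i.+1) (bnd X (x :: s) i)).
  apply: art_mul_ge0; first exact: pair_simg.
    by apply: artP_sub (l10 i) => //; apply: sub_simg.
  exact: good_simg.
have AB0 i : 0 <= mul (x :: s) (cyc X (x :: s) i.+1) (bnd X (x :: s) i).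
  exact: art_mul_ge0.
have a0 : mul s (tor x (cyc X (x :: s) 1) (bnd X (x :: s) 0)) (bnd X (x :: s) 0) = 0.
  apply: mul_triv; first exact: pair_tor.
  by move=> u _; rewrite (l4 1%N _ u) //; apply: submod0; apply: bnd_submod.
have gC i : good s (cyc (cone x X) (x :: s) i.+1) (bnd (cone x X) (x :: s) i).
  apply: (good_iso (@id_linear _ _) s _ _ (cone_gam nR x s i l1)).2; try exact: Hpair.
  exact: lc_agood hC i.
have mC i : mul s (cyc (cone x X) s i.+1) (bnd (cone x X) s i) =
    mul s (tor x (cyc X (x :: s) i.+2) (bnd X (x :: s) i.+1)) (bnd X (x :: s) i.+1) +
    mul s (cyc X (x :: s) i.+1) (simg x (cyc X (x :: s) i.+1) (bnd X (x :: s) i)).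
  rewrite -(cone_mul (gC i)); apply/esym/(mul_iso (@id_linear _ _)); try exact: Hpair.
  exact: cone_gam.
have m3 : mul s (cyc (cone x X) s (q + size s).+2) (bnd (cone x X) s (q + size s).+1) = 0.
  apply: mul_triv; first exact: Hpair.
  by apply: (vanish_all nR (lc_inj hC) (lc_high hC)).
(* M[x] is nilpotent and s is nonempty, so the kernel term in [mul (x :: s)] of M drops out. *)
have t0 : mul s (tor x (cyc X [::] q.+1) (bnd X [::] q)) (bnd X [::] q) = 0.
  apply: (mul_nil (n := n)) => //; first by apply: pair_tor; apply: Hpair.
    by apply: good_tor => //; apply: Hpair.
  by move=> y ys; apply: l3; rewrite inE ys orbT.
rewrite eN mC in m2; rewrite mC in m3.
move: (m1) => m1'.
have {}m1 i : (i < q + size s)%N ->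
    mul s (tor x (cyc X (x :: s) i.+2) (bnd X (x :: s) i.+1)) (bnd X (x :: s) i.+1) = 0 /\
    mul s (cyc X (x :: s) i.+1) (simg x (cyc X (x :: s) i.+1) (bnd X (x :: s) i)) = 0.
  by move=> /m1; rewrite mC; have := A0 i.+1; have := B0 i; lia.
have az i : (i <= q + size s)%N ->
    mul s (tor x (cyc X (x :: s) i.+1) (bnd X (x :: s) i)) (bnd X (x :: s) i) = 0.
  by case: i => // i /m1[].
(* The nonnegative number [mul (x :: s)] in this degree is minus the term in question, which is
   itself nonnegative. *)
have bz : mul s (cyc X (x :: s) (q + size s).+1) (simg x (cyc X (x :: s) (q + size s).+1)
    (bnd X (x :: s) (q + size s))) = 0.
  have := AB0 (q + size s)%N; have := B0 (q + size s)%N; rewrite /= az //; lia.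
rewrite [size (_ :: _)]/= addnS; split.
  move=> i; rewrite ltnS leq_eqVlt => /orP[/eqP->|hi] /=; first by rewrite az // bz subrr.
  by rewrite az ?(m1 i hi).2 ?subrr // ltnW.
rewrite /= t0 sub0r exprS mulN1r mulrNN -m2 bz addr0.
have := A0 (q + size s).+2; have := B0 (q + size s).+1; lia.
Qed.
End LocalCohomology.

(** * Minimal injective resolutions *)

Section MinimalResolution.
Variables (R : comNzRingType) (nR : noeth R).

Lemma Eann_sub (V : lmodType R) (c c' : set R^o) (v : V) : c `<=` c' -> Eann c' v -> Eann c v.
Proof. by move=> h e a /h; apply: e. Qed.

Lemma Eann_sm (V : lmodType R) (c : set R^o) : submodule (@Eann R V c).
Proof.
split=> [a _|a u v hu hv b cb]; first exact: scaler0.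
by rewrite scalerDr hv // addr0 scalerA mulrC -scalerA hu // scaler0.
Qed.

Lemma Eann_lin (V W : lmodType R) (f : V -> W) c v : linear f -> Eann c v -> Eann c (f v).
Proof. by move=> fl h a ca; rewrite -(linfunZ fl) h // (linfun0 fl). Qed.

Lemma Eann_add (V : lmodType R) (c : set R^o) (x : R) (v : V) : Eann c v -> x *: v = 0 ->
  Eann (wspan c [:: x : R^o]) v.
Proof.
move=> h e a [b /h]; rewrite scalerBl => /eqP.
by rewrite subr_eq0 => /eqP->; rewrite -scalerA e scaler0.
Qed.

Lemma Eann_mem (V : lmodType R) (c : set R^o) (x : R) (v : V) : submodule c ->
  Eann (wspan c [:: x : R^o]) v -> Eann c v /\ x *: v = 0.
Proof.
move=> sc h; split; first by apply: Eann_sub h; apply: wspan_sub.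
by apply: h; apply: wspan_mem => //; rewrite mem_head.
Qed.

Section ShortExact.
Variables (V I C : lmodType R) (i : V -> I) (p : I -> C).
Hypotheses (il : linear i) (pl : linear p) (bI : baer [set: I]).

(* [Ext^1 (R / c, V) = 0] for the exact sequence V -> I -> C, read off the
   elements annihilated by [c] *)
Definition lift_ann (c : set R^o) := forall y : C, Eann c y -> exists w : I, Eann c w /\ p w = y.

(** The exact sequence 0 -> R/(c : x) -> R/c -> R/(c + (x)) -> 0: if Ext^1 vanishes on both ends, it
    vanishes in the middle. *)
Lemma lift_ann_ext (c : set R^o) (x : R) : submodule c -> lift_ann [set b : R^o | c (b * x : R)] ->
  lift_ann (wspan c [:: x : R^o]) -> lift_ann c.
Proof.
move=> sc h1 h2 y cy.
have [|w [cw ew]] := h1 (x *: y); first by move=> b cb; rewrite scalerA cy.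
have [w' [_ xw' cw']] := baer_solve (submoduleT _) bI sc Logic.I cw.
have [|w2 [cw2 ew2]] := h2 (y - p w').
  apply: Eann_add; first by apply: (submodB (Eann_sm _ _)) => //; apply: (Eann_lin pl).
  by rewrite scalerBr -(linfunZ pl) xw' ew subrr.
exists (w' + w2); split; last by rewrite (linfunD pl) ew2 addrC subrK.
apply: (submodD (Eann_sm _ _)) => //; exact: (Eann_mem sc cw2).1.
Qed.

Hypotheses (ii : forall v, i v = 0 -> v = 0) (pi0 : forall x, p x = 0 <-> exists v, i v = x).

Lemma lift_ann_baer : (forall c, submodule c -> lift_ann c) -> baer [set: V].
Proof.
move=> h G lG _; have [G0 G1 G2] := lG.
have [|//|z [_ hz]] := bI (G := fun a y => exists2 v, G a v & y = i v).
  split; first by exists 0; rewrite ?(linfun0 il).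
    move=> a x x' _ _ [v Gv ->] [v' Gv' ->]; exists (a *: v + v'); first exact: G1.
    by rewrite il.
  by move=> _ [v /G2-> ->]; rewrite (linfun0 il).
have sc : submodule ([set a | exists v, G a v] : set R^o).
  split; first by exists 0.
  by move=> a x x' [v Gv] [v' Gv']; exists (a *: v + v'); apply: G1.
have cz : Eann [set a | exists v, G a v] (p z).
  move=> a [v Gv]; rewrite -(linfunZ pl) -(hz a (i v)); last by exists v.
  by apply/pi0; exists v.
have [w [cw ew]] := h _ sc _ cz.
have [v ev] : exists v, i v = z - w by apply/pi0; rewrite (linfunB pl) ew subrr.
exists v; split=> // a y Gay; apply/eqP; rewrite -subr_eq0; apply/eqP/ii.
rewrite (linfunB il) (linfunZ il) ev scalerBr cw ?subr0; last by exists y.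
by rewrite -(hz a (i y)) ?subrr //; exists y.
Qed.
End ShortExact.

Section Hull.
Variable V : lmodType R.
Lemma hull_lin : linear (@hull_in R V). Proof. by have [] := hullP V. Qed.
Lemma hull_inj v : hull_in v = 0 -> v = 0 :> V. Proof. by have [_ h _ _] := hullP V; apply: h. Qed.
Lemma hull_baer : baer [set: hullT V]. Proof. by have [] := hullP V. Qed.
Definition hull_im : set (hullT V) := range (@hull_in R V).
Lemma hull_im_submod : submodule hull_im.
Proof. exact: (submodule_im hull_lin (@submoduleT _ _)). Qed.
Definition cosyz : lmodType R := quoT hull_im_submod.
Definition hpi (x : hullT V) : cosyz := quo_pi hull_im_submod x.
Lemma hpi_lin : linear hpi. Proof. exact: quo_pi_lin. Qed.
Lemma hpi_surj y : exists x, hpi x = y.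
Proof. by have [x ->] := quo_pi_surj y; exists x. Qed.
Lemma hpi0 x : hpi x = 0 <-> exists v, hull_in v = x.
Proof.
apply: iff_trans (quo_pi0 _ _) _; split=> [[v _ <-]|[v <-]]; last by exists v.
by exists v.
Qed.
Lemma hpi_in v : hpi (hull_in v) = 0. Proof. by apply/hpi0; exists v. Qed.

(** Ext^1(R/c, V) = 0; for the i-th cosyzygy of M in place of V, this is Ext^(i+1)(R/c, M) = 0. *)
Definition lifts := lift_ann hpi.
End Hull.

Lemma lifts_ext V (c : set R^o) (x : R) : submodule c -> @lifts V [set b : R^o | c (b * x : R)] ->
  @lifts V (wspan c [:: x : R^o]) -> @lifts V c.
Proof. exact: (lift_ann_ext (@hpi_lin V) (@hull_baer V)). Qed.

Lemma lifts_div V (c : set R^o) (x : R) : submodule c ->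
  (forall b, c (b * x : R) -> c b) -> @lifts V (wspan c [:: x : R^o]) ->
  forall y : V, Eann c y -> exists y' : V, Eann c y' /\ y = x *: y'.
Proof.
move=> sc hc h y cy; have hl := @hull_lin V.
have hcy (b : R) : c (b * x : R) -> b *: hull_in y = 0 by move=> /hc; apply: (Eann_lin hl cy).
have [z [_ xz cz]] := baer_solve (submoduleT _) (@hull_baer V) sc I hcy.
have [|w [cw ew]] := h (hpi z).
  apply: Eann_add; first exact: (Eann_lin (@hpi_lin V)).
  by rewrite -(linfunZ (@hpi_lin V)) xz hpi_in.
have [cw' xw] := Eann_mem sc cw.
have [v ev] : exists v, hull_in v = z - w.
  by apply/hpi0; rewrite (linfunB (@hpi_lin V)) ew subrr.
have inj u : hull_in u = 0 -> u = 0 := @hull_inj V u.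
exists v; split.
  move=> a ca; apply: inj; rewrite (linfunZ hl) ev scalerBr cw' // cz //.
  exact: subrr.
apply/eqP; rewrite -subr_eq0; apply/eqP/inj.
by rewrite (linfunB hl) (linfunZ hl) ev scalerBr xw xz subr0 subrr.
Qed.

Lemma nakayama n (lR : locring n) (V : lmodType R) (U W : set V) x vs : n x -> submodule W ->
  (forall v, v \in vs -> U v) -> U `<=` wspan W vs ->
  (forall u, U u -> exists2 u', U u' & W (u - x *: u')) -> U `<=` W.
Proof.
move=> nx sW hvs hU hx; elim: vs hvs hU => // v vs IH hvs hU.
apply: IH => [w ws|]; first by apply: hvs; rewrite inE ws orbT.
have sp := submodule_wspan vs sW.
suff hv : wspan W vs v.
  by move=> u /hU[a h]; apply: (submod_subl sp h); apply: submodZ.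
have [u' /hU[a ha] hw] := hx v (hvs v (mem_head _ _)).
have nxa : n (x * a : R) by have [sn _ _] := lR; apply: idealMl.
have [y ey] := locring1 lR nxa.
rewrite -[v]scale1r -ey -scalerA; apply: submodZ => //.
rewrite (_ : (1 - x * a) *: v = (v - x *: u') + x *: (u' - a *: v)).
  by apply: (submodD sp); [apply: wspan_sub|apply: submodZ].
by rewrite scalerBl scale1r scalerBr scalerA addrA subrK.
Qed.

(** Finite generation of Ext^1(R/c, V), represented by elements of the cosyzygy killed by c modulo
    those that lift. *)
Definition fg_ext V (c : set R^o) := exists vs : seq (cosyz V), (forall v, v \in vs -> Eann c v) /\
  @Eann R (cosyz V) c `<=` wspan (@hpi V @` Eann c) vs.

(** For x regular on R/c, vanishing of Ext^2(R/(c + (x)), V) makes x surjective on the finitely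
    generated module Ext^1(R/c, V), which is zero by Nakayama. *)
Lemma lifts_nak n (lR : locring n) V (c : set R^o) (x : R) : submodule c -> n x ->
  (forall b, c (b * x : R) -> c b) -> fg_ext V c ->
  @lifts (cosyz V) (wspan c [:: x : R^o]) -> @lifts V c.
Proof.
move=> sc nx hc [vs [v1 v2]] h y cy.
suff /(_ y cy)[w cw <-] : @Eann R (cosyz V) c `<=` (@hpi V @` Eann c) by exists w.
have sW : submodule (@hpi V @` Eann c) by apply: (submodule_im (@hpi_lin V)); apply: Eann_sm.
apply: (nakayama lR nx sW v1 v2) => u cu.
have [u' [cu' ->]] := lifts_div sc hc h cu.
by exists u' => //; rewrite subrr; apply: submod0.
Qed.

(* Ext vanishes on all cyclic modules as soon as it vanishes on the residue field. *)
Lemma lifts_all n (lR : locring n) (C : nat -> lmodType R) :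
  (forall i, C i.+1 = cosyz (C i)) -> (forall i c, submodule c -> fg_ext (C i) c) ->
  (forall i, @lifts (C i) n) -> forall c, submodule c -> forall i, @lifts (C i) c.
Proof.
move=> eC fg hn; apply: (noeth_ind nR) => c sc IH i; have [sn n1 _] := lR.
have [c1|c1] := pselect (c 1).
  move=> y cy; exists 0; split; first by move=> a _; exact: scaler0.
  by rewrite (linfun0 (@hpi_lin _)) -[y]scale1r cy.
have cn := proper_sub lR sc c1.
have [nc|] := pselect (n `<=` c).
  by have -> : c = n by apply/seteqP.
move=> /existsNP[x /not_implyP[nx cx]].
have sx := submodule_wspan [:: x : R^o] sc.
have hx j : @lifts (C j) (wspan c [:: x : R^o]).
  apply: IH => //; first exact: wspan_sub.
  by move=> h; apply/cx/h/wspan_mem; rewrite ?mem_head.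
(* If x is regular on R/c, the vanishing one degree higher is used, which is why the induction
   covers all degrees at once. Otherwise c : x is strictly larger than c. *)
have [h|/existsNP[b /not_implyP[cbx cb]]] := pselect (forall b : R, c (b * x : R) -> c b).
  by apply: (lifts_nak lR sc nx h (fg i c sc)); rewrite -eC.
apply: (lifts_ext sc _ (hx i)); apply: IH; first exact: colon_submod.
  by move=> a ca; apply: idealMl.
by move=> h; apply/cb/h.
Qed.

(* If [Ext^1 (-, V)] vanishes on cyclic modules then V is its own injective hull. *)
Lemma lifts_hull V : (forall c, submodule c -> @lifts V c) -> forall x : cosyz V, x = 0.
Proof.
move=> h; have hl := @hull_lin V; have pl := @hpi_lin V.
have bV : baer [set: V] := lift_ann_baer hl pl (@hull_baer V) (@hull_inj V) (@hpi0 V) h.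
have [||g [gl _ hg]] := @baer_ext R (hullT V) V [set: V] (fun x v => x = hull_in v) (submoduleT _) bV.
- split; first by rewrite (linfun0 hl).
    by move=> a x y x' y' -> ->; rewrite hl.
  by move=> y e; apply: (@hull_inj V).
- by [].
have [_ _ _ eV] := hullP V.
move=> y; have [x <-] := hpi_surj y; apply/hpi0; exists (g x).
apply/eqP; rewrite -subr_eq0; apply/eqP; apply: contrapT => ne.
have [a [[v _ ev] na]] := eV _ I ne; apply: na; rewrite -ev.
suff -> : v = 0 by exact: (linfun0 hl).
rewrite (hg _ v erefl) ev (linfunZ gl) (linfunB gl) -(hg _ (g x) erefl) subrr.
exact: scaler0.
Qed.
End MinimalResolution.

(** * Dimension shifting and finite generation of Ext *)

Section Shift.
Variable R : comNzRingType.

Definition projective (F : lmodType R) := forall (U W : lmodType R) (h : U -> W) (f : F -> W),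
  linear h -> linear f -> (forall w, exists u, h u = w) ->
  exists g : F -> U, linear g /\ forall x, h (g x) = f x.

Lemma comb_lin (V W : lmodType R) a (f g : V -> W) : linear f -> linear g ->
  linear (fun x => a *: f x + g x).
Proof.
move=> fl gl b x y; rewrite fl gl !scalerDr !scalerA addrACA.
by rewrite [b * a]mulrC.
Qed.

Lemma comp_lin (U V W : lmodType R) (f : V -> W) (g : U -> V) : linear f -> linear g ->
  linear (fun x => f (g x)).
Proof. by move=> fl gl a x y; rewrite gl fl. Qed.

Lemma wspan_im (V V' : lmodType R) (f : V -> V') W (W' : set V') vs v : linear f ->
  (forall w, W w -> W' (f w)) -> wspan W vs v -> wspan W' (map f vs) (f v).
Proof.
move=> fl h; elim: vs v => [|w vs IH] v; first exact: h.
by move=> [a /IH]; rewrite (linfunB fl) (linfunZ fl); exists a.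
Qed.

Section OneStep.
Variables (V N K F : lmodType R) (i : K -> F) (p : F -> N).
Hypotheses (il : linear i) (pl : linear p) (ii : injective i).
Hypothesis p_surj : forall y, exists x, p x = y.
Hypothesis p_ker : forall x, p x = 0 <-> exists k, i k = x.
Hypothesis pF : projective F.

(** For 0 -> K -> F -> N -> 0 with F projective, Ext^1(N, V) is Hom(K, V) modulo [triv_ext] and also
    Hom(N, cosyz V) modulo [triv_lift]. *)
Definition triv_ext : set (K -> V) := [set f | exists2 v : F -> V, linear v & f = v \o i].
Definition triv_lift (L : lmodType R) : set (L -> cosyz V) :=
  [set f | exists2 w : L -> hullT V, linear w & f = @hpi R V \o w].

Lemma descend (W : lmodType R) (g : F -> W) : linear g -> (forall k, g (i k) = 0) ->
  exists w : N -> W, linear w /\ forall x, g x = w (p x).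
Proof.
move=> gl h; have [s hs] := choice p_surj; exists (g \o s).
have e x : g x = g (s (p x)).
  apply/eqP; rewrite -subr_eq0 -(linfunB gl); apply/eqP.
  have /p_ker[k <-] // : p (x - s (p x)) = 0 by rewrite (linfunB pl) hs subrr.
split=> // a x y /=; rewrite -gl; apply/eqP; rewrite -subr_eq0 -(linfunB gl); apply/eqP.
have /p_ker[k <-] // : p (s (a *: x + y) - (a *: s x + s y)) = 0.
by rewrite (linfunB pl) pl !hs subrr.
Qed.

Lemma extend (W : lmodType R) (f : K -> W) : baer [set: W] -> linear f ->
  exists g : F -> W, linear g /\ forall k, g (i k) = f k.
Proof.
move=> bW fl.
have [||g [gl _ hg]] := @baer_ext R F W [set: W] (fun x y => exists2 k, x = i k & y = f k)
  (submoduleT _) bW.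
- split.
  + by exists 0; rewrite ?(linfun0 il) ?(linfun0 fl).
  + by move=> a x y _ _ [k -> ->] [k' -> ->]; exists (a *: k + k'); rewrite ?il ?fl.
  by move=> _ [k e ->]; rewrite -(linfun0 il) in e; rewrite -(ii e) (linfun0 fl).
- by [].
by exists g; split=> // k; apply/esym/hg; exists k.
Qed.

(* dimension shifting, keeping track of the number of generators *)
Lemma shift (us : seq (K -> V)) : (forall u, u \in us -> linear u) ->
  (forall f : K -> V, linear f -> wspan triv_ext us f) ->
  exists us' : seq (N -> cosyz V), [/\ size us' = size us,
    forall u, u \in us' -> linear u &
    forall f : N -> cosyz V, linear f -> wspan (@triv_lift N) us' f].
Proof.
move=> ul ug; have hl := @hull_lin R V; have pil := @hpi_lin R V.
(* The correspondence is a map g from F to the hull that restricts to psi on K and induces phi on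
   N. *)
suff [us' [h1 h2 h3]] : exists us' : seq (N -> cosyz V), [/\ size us' = size us,
    forall u, u \in us' -> linear u &
    forall (psi : K -> V) (g : F -> hullT V) (phi : N -> cosyz V), linear g -> linear phi ->
      (forall k, g (i k) = hull_in (psi k)) -> (forall x, phi (p x) = hpi (g x)) ->
      wspan triv_ext us psi -> wspan (@triv_lift N) us' phi].
  exists us'; split=> // f fl.
  have [g [gl hg]] := pF pil (comp_lin fl pl) (@hpi_surj R V).
  have hk k : exists v, hull_in v = g (i k) :> hullT V.
    apply: (hpi0 _).1; rewrite hg (_ : p (i k) = 0); first exact: (linfun0 fl).
    by apply: (p_ker _).2; exists k.
  have [psi hpsi] := choice hk.
  have psil : linear psi.
    move=> a x y; apply/eqP; rewrite -subr_eq0; apply/eqP/(@hull_inj R V).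
    by rewrite (linfunB hl) hl !hpsi il gl subrr.
  by apply: (h3 psi g f) => //; apply: ug.
elim: us ul {ug} => [|u us IH] ul.
  exists [::]; split=> // psi g phi gl phil hg hphi /= [v vl ev].
  have [||w [wl hw]] := @descend _ (fun x => g x - hull_in (v x)).
  - move=> a x y; rewrite gl vl hl scalerBr opprD addrACA; congr (_ - _ + _).
  - by move=> k; rewrite hg ev subrr.
  exists w => //; apply/funext => y; have [x <-] := p_surj y.
  by rewrite /= -hw (linfunB pil) hpi_in subr0.
have [|us' [h1 h2 h3]] := IH; first by move=> w ws; apply: ul; rewrite inE ws orbT.
have {}ul : linear u by apply: ul; rewrite mem_head.
have [gu [gul hgu]] := extend (@hull_baer R V) (comp_lin hl ul).
have [|u' [u'l hu']] := descend (comp_lin pil gul); first by move=> k; rewrite hgu hpi_in.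
exists (u' :: us'); split=> [|w|psi g phi gl phil hg hphi [a ha]]; first by rewrite /= h1.
  by rewrite inE => /orP[/eqP->|/h2].
exists a; apply: (h3 _ (fun x => g x - a *: gu x)) ha.
- have := comb_lin (- a) gul gl; congr (linear _).
  by apply/funext => x; rewrite scaleNr addrC.
- have := comb_lin (- a) u'l phil; congr (linear _).
  by apply/funext => x; rewrite scaleNr addrC.
- by move=> k; rewrite hg hgu -(linfunZ hl) -(linfunB hl).
by move=> x; rewrite (linfunB pil) (linfunZ pil) -hphi hu'.
Qed.
End OneStep.

(** A map that factors through the injective hull extends from K to F; this lets the output of one
    shift be the input of the next. *)
Lemma lift_ext (V K F : lmodType R) (i : K -> F) : linear i -> injective i ->
  @triv_lift V K `<=` @triv_ext (cosyz V) K F i.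
Proof.
move=> il ii f [w wl ->]; have [g [gl hg]] := extend il ii (@hull_baer R V) wl.
exists (@hpi R V \o g); first exact: (comp_lin (@hpi_lin R V) gl).
by apply/funext => k /=; rewrite hg.
Qed.

Lemma rV_projective k : projective 'rV[R]_k.
Proof.
move=> U W h f hl fl hs; have [s e] := choice (fun j => hs (f (delta_mx 0 j))).
exists (fun x : 'rV[R]_k => \sum_j x 0 j *: s j); split.
  move=> a x y; rewrite scaler_sumr -big_split /=; apply: eq_bigr => j _.
  by rewrite !mxE scalerDl scalerA.
move=> x; rewrite (linfun_sum hl) {2}[x]row_sum_delta (linfun_sum fl).
by apply: eq_bigr => j _; rewrite (linfunZ hl) e (linfunZ fl).
Qed.

Hypothesis nR : noeth R.

Lemma noeP_span (V : lmodType R) (W : set V) (vs : seq V) : submodule W ->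
  noeP (wspan W vs) W.
Proof.
move=> sW; elim: vs => [|v vs IH] /=.
  by move=> X sX WX XW; exists [::].
have sp := submodule_wspan vs sW; have sp' := submodule_wspan (v :: vs) sW.
apply: (@noeP_ext _ _ _ (wspan W vs)) => //; first exact: wspan_sub.
  by move=> x hx; exists 0; rewrite scale0r subr0.
pose c : set R^o := [set a : R^o | wspan W vs (a *: v)].
have sc : submodule c.
  split; first by rewrite /c /= scale0r; apply: submod0.
  move=> a x y hx hy; rewrite /c /= scalerDl; apply: (submodD sp) => //.
  by rewrite -[a *: x]/(a * x) -scalerA; apply: (submodZ _ sp).
apply: (@noeP_iso _ R^o V (fun a => a *: v) _ [set: R^o] c).
- by move=> a x y; rewrite scalerDl scalerA.
- by split.
- by split=> // x hx; exists 0; rewrite scale0r subr0.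
- split.
  + move=> _ [a _ <-]; exists a; rewrite subrr; exact: submod0.
  + by move=> _ [a ca <-].
  + by move=> a _.
  by move=> u [a ha]; exists a.
by apply: noeP_sub nR => // _ ->; apply: submod0 sc.
Qed.

Lemma noeP_fg (V : lmodType R) : fin_gen V -> noeP [set: V] [set 0].
Proof.
move=> [k [v hv]]; have := noeP_span (vs := [seq v j | j <- enum 'I_k]) (@submodule0 R V).
apply: noeP_sub => // x _; apply: (wspan_sum _ _ (@submodule0 R V)).2.
by have [c ->] := hv x; exists c; rewrite subrr.
Qed.

Lemma noeP_ker (V V' : lmodType R) (f : V -> V') (U : set V) : linear f -> submodule U ->
  noeP [set: V'] [set 0] -> noeP U (U `&` [set v | f v = 0]).
Proof.
move=> fl sU nV X sX WX XU.
have [||//|vs [v1 v2]] := nV (f @` X); first exact: (submodule_im fl).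
  by move=> _ ->; exists 0; [apply: submod0|apply: linfun0].
have [xs hx ev] : exists2 xs, forall x, x \in xs -> X x & map f xs = vs.
  elim: vs v2 {v1} => [|v vs IH] h; first by exists [::].
  have [|xs h1 h2] := IH; first by move=> w ws; apply: h; rewrite inE ws orbT.
  have [x Xx ex] := h v (mem_head _ _); exists (x :: xs); last by rewrite /= ex h2.
  by move=> y; rewrite inE => /orP[/eqP->|/h1].
exists xs; split=> // x Xx.
have : wspan [set 0] (map f xs) (f x) by rewrite ev; apply: v1; exists x.
elim: (xs) hx x Xx {ev v1 v2} => [|y ys IH] hys x Xx /=.
  by move=> fx; split=> //; apply: XU.
move=> [a ha]; exists a; have Xy : X y by apply: hys; rewrite mem_head.
apply: IH; rewrite ?(linfunB fl) ?(linfunZ fl) //.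
  by move=> z zs; apply: hys; rewrite inE zs orbT.
by apply: (submodB sX) => //; apply: (submodZ _ sX).
Qed.

(** Values at the generators of K filter Hom(K, M) with quotients inside M. *)
Lemma hom_noe (K M : lmodType R) : fin_gen K -> fin_gen M ->
  exists us : seq (K -> M), (forall u, u \in us -> linear u) /\
  forall f : K -> M, linear f -> wspan [set 0] us f.
Proof.
move=> [k [v hv]] fM; pose L := [set f : K -> M | linear f].
have sL : submodule L.
  split; first by move=> a x y; rewrite /= scaler0 addr0.
  by move=> a f g fl gl; apply: comb_lin.
pose Z (l : seq 'I_k) := L `&` [set f | forall j, j \in l -> f (v j) = 0].
have sZ l : submodule (Z l).
  apply: submoduleI => //; split=> // a f g hf hg j jl.
  by rewrite -[LHS]/(a *: f (v j) + g (v j)) hf // hg // scaler0 addr0.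
have nZ l : noeP L (Z l).
  elim: l => [|j l IH].
    by move=> X sX _ XL; exists [::]; split=> // f /XL.
  apply: (@noeP_ext _ _ _ (Z l)) => //.
  - by move=> f [h1 h2]; split=> // t tl; apply: h2; rewrite inE tl orbT.
  - by move=> f [].
  have -> : Z (j :: l) = Z l `&` [set f | f (v j) = 0].
    apply/seteqP; split=> [f [fl hf]|f [[fl hf] fj]].
      split; last by apply: hf; rewrite mem_head.
      by split=> // t tl; apply: hf; rewrite inE tl orbT.
    by split=> // t; rewrite inE => /orP[/eqP->|/hf].
  by apply: (@noeP_ker _ _ (fun f : K -> M => f (v j))) => //; apply: noeP_fg.
have [||//|us [u1 u2]] := nZ (enum 'I_k) L; [by []|by move=> f []|].
exists us; split=> // f fl; apply: wspan_mono (u1 f fl) => g [gl hg].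
apply/funext => x; have [c ->] := hv x; rewrite (linfun_sum gl) big1 // => j _.
by rewrite (linfunZ gl) hg ?scaler0 // mem_enum.
Qed.

Section Resolve.
Variables (N : lmodType R) (k : nat) (v : 'I_k -> N).
Hypothesis hv : forall x, spans v x.

Definition pres (x : 'rV[R]_k) : N := \sum_j x 0 j *: v j.
Lemma pres_lin : linear pres.
Proof.
move=> a x y; rewrite /pres scaler_sumr -big_split /=; apply: eq_bigr => j _.
by rewrite !mxE scalerDl scalerA.
Qed.
Definition pres_ker : set 'rV[R]_k := [set x | pres x = 0].
Lemma pres_ker_submod : submodule pres_ker.
Proof. exact: (submodule_preim pres_lin (@submodule0 R N)). Qed.
Definition presK : lmodType R := subT pres_ker_submod.

Lemma pres_surj y : exists x, pres x = y.
Proof.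
have [c ->] := hv y; exists (\row_j c j); apply: eq_bigr => j _; by rewrite mxE.
Qed.

Lemma presK_ker x : pres x = 0 <-> exists k : presK, sub_val k = x.
Proof. by split=> [h|[u <-]]; [exists (sub_in pres_ker_submod h)|apply: sub_valP u]. Qed.

Lemma fin_gen_of (V : lmodType R) (S : set V) (sS : submodule S) :
  noeP [set: V] [set 0] -> fin_gen (subT sS).
Proof.
move=> nV; have [|//|vs [v1 v2]] := nV S sS; first by move=> _ ->; apply: submod0.
pose u (j : 'I_(size vs)) : subT sS := sub_in sS (v2 _ (mem_nth 0 (ltn_ord j))).
exists (size vs), u => x.
have : wspan [set 0] [seq sub_val (u j) | j <- enum 'I_(size vs)] (sub_val x).
  suff -> : [seq sub_val (u j) | j <- enum 'I_(size vs)] = vs by apply: v1; apply: sub_valP.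
  apply: (@eq_from_nth _ 0) => [|j]; rewrite size_map size_enum_ord // => hj.
  by rewrite (nth_map (Ordinal hj)) ?size_enum_ord //= nth_enum_ord.
move=> /(wspan_sum _ _ (@submodule0 R V))[c hc]; exists c; apply: (@sub_val_inj _ _ _ sS).
have sl := @sub_val_lin _ _ _ sS; rewrite (linfun_sum sl) -[LHS](subrK (\sum_i c i *: sub_val (u i))) hc.
by rewrite add0r; apply: eq_bigr => j _; rewrite (linfunZ sl).
Qed.

Lemma fin_gen_presK : fin_gen presK.
Proof.
apply: fin_gen_of; apply: noeP_fg; exists k, (delta_mx 0) => x.
by exists (x 0); rewrite {1}[x]row_sum_delta.
Qed.
End Resolve.

(** Ext^(i+1)(N, M) is finitely generated: each shift replaces N by a finitely generated syzygy
    until a Hom module is reached. *)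
Lemma gens_fg (M : lmodType R) i (N : lmodType R) : fin_gen M -> fin_gen N ->
  exists us : seq (N -> cosyz (iter i (@cosyz R) M)), (forall u, u \in us -> linear u) /\
  forall f : N -> cosyz (iter i (@cosyz R) M), linear f -> wspan (@triv_lift _ N) us f.
Proof.
move=> fM; elim: i N => [|i IH] N [k [v hv]]; have fK := fin_gen_presK v.
  have [us [u1 u2]] := hom_noe fK fM.
  have [|us' [_ ? ?]] := shift (sub_val_lin (H := pres_ker_submod v)) (pres_lin v)
    (@sub_val_inj _ _ _ _) (pres_surj hv) (presK_ker v) (@rV_projective k) u1.
    move=> f /u2; apply: wspan_mono => _ ->; exists 0 => //.
    by move=> a x y; rewrite /= scaler0 addr0.
  by exists us'.
have [us [u1 u2]] := IH _ fK.
have [|us' [_ ? ?]] := shift (sub_val_lin (H := pres_ker_submod v)) (pres_lin v)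
    (@sub_val_inj _ _ _ _) (pres_surj hv) (presK_ker v) (@rV_projective k) u1.
  move=> f /u2; apply: wspan_mono; apply: lift_ext; [exact: sub_val_lin|exact: sub_val_inj].
by exists us'.
Qed.

(** Evaluation at the class of 1 identifies maps from R/c with elements killed by c. *)
Lemma fg_ext_iter (M : lmodType R) i (c : set R^o) : fin_gen M -> submodule c ->
  fg_ext (iter i (@cosyz R) M) c.
Proof.
move=> fM sc.
have fN : fin_gen (quoT sc).
  exists 1%N, (fun=> quo_pi sc 1) => x; have [a ->] := quo_pi_surj x.
  exists (fun=> a); rewrite big_ord1 -(linfunZ (@quo_pi_lin _ _ _ sc)).
  by rewrite -[a *: 1]/(a * 1) mulr1.
have [us [u1 u2]] := gens_fg i fM fN.
set C := cosyz _ in us u1 u2; pose ev (f : quoT sc -> C) := f (quo_pi sc 1).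
have evl : linear ev by [].
have e0 u a : linear u -> c a -> a *: u (quo_pi sc 1) = 0 :> C.
  move=> ul ca; rewrite -(linfunZ ul) -(linfunZ (@quo_pi_lin _ _ _ sc)).
  have -> : quo_pi sc (a *: 1 : R^o) = 0 by apply/quo_pi0; rewrite -[_ *: _]/(a * 1) mulr1.
  exact: linfun0.
exists (map ev us); split.
  by move=> _ /mapP[u /u1 ul ->] a ca; apply: e0.
move=> y cy.
have [f [fl hf]] : exists f : quoT sc -> C, linear f /\ f (quo_pi sc 1) = y.
  have [s hs] := choice (@quo_pi_surj _ _ _ sc).
  have hy (a b : R) : quo_pi sc (a : R^o) = quo_pi sc b -> a *: y = b *: y.
    by move=> /quo_piE/cy; rewrite scalerBl => /eqP; rewrite subr_eq0 => /eqP.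
  exists (fun x => (s x : R) *: y); split; last first.
    by rewrite -[RHS]scale1r; apply: hy; rewrite -hs.
  move=> a x x'; rewrite scalerA -scalerDl; apply: hy.
  by rewrite -hs [RHS](@quo_pi_lin _ _ _ sc) -!hs.
rewrite -hf; apply: (wspan_im (W := @triv_lift _ (quoT sc)) evl); last exact: u2.
move=> _ [w wl ->]; exists (w (quo_pi sc 1)) => // a ca.
rewrite -(linfunZ wl) -(linfunZ (@quo_pi_lin _ _ _ sc)).
have -> : quo_pi sc (a *: 1 : R^o) = 0 by apply/quo_pi0; rewrite -[_ *: _]/(a * 1) mulr1.
exact: linfun0.
Qed.
End Shift.

(** * Bass numbers *)

Section FreeLift.
Variables (A : comNzRingType) (N W : lmodType A) (g : N -> W).
Definition flift (x : freemod N) : W := fglift g x.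
Fact flift_additive : zmod_morphism flift. Proof. exact: lift_is_additive. Qed.
HB.instance Definition _ :=
  GRing.isZmodMorphism.Build (freemod N) W flift flift_additive.
Fact flift_scalable : scalable flift.
Proof.
move=> a x; rewrite -[in RHS](freeg_sumE x) -[a *: x]/(fgscale a x) /fgscale.
rewrite !raddf_sum /=.
by apply: eq_bigr => k _; rewrite /flift !liftU scalerA.
Qed.
HB.instance Definition _ :=
  GRing.isScalable.Build A (freemod N) W *:%R flift flift_scalable.
Lemma flift_lin : linear flift. Proof. exact: linearP. Qed.
Lemma flift_gen (k : N) : flift << k >> = g k.
Proof. by rewrite /flift liftU scale1r. Qed.
End FreeLift.

Lemma free_ext (A : comNzRingType) (N W : lmodType A) (f g : freemod N -> W) : linear f ->
  linear g -> (forall k : N, f << k >> = g << k >>) -> forall x, f x = g x.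
Proof.
move=> fl gl h x; rewrite -(freeg_sumE x) (linfun_sum fl) (linfun_sum gl).
apply: eq_bigr => k _; have -> : << coeff k x *g k >> = coeff k x *: (<< k >> : freemod N).
  rewrite -[RHS]/(fgscale _ _) /fgscale.
  by rewrite domU1 big_seq1 coeffU eqxx mulr1 mulr1.
by rewrite (linfunZ fl) (linfunZ gl) h.
Qed.

Lemma free_projective (A : comNzRingType) (N : lmodType A) : projective (freemod N).
Proof.
move=> U W h f hl fl hs; have [s e] := choice (fun k : N => hs (f << k >>)).
exists (flift s); split; first exact: flift_lin.
apply: free_ext => //; first exact: comp_lin (flift_lin s).
by move=> k; rewrite flift_gen e.
Qed.

Section BassNumbers.
Variables (A : comNzRingType) (m : idealr A).
Local Notation n := (ideal_set m).
Hypothesis lA : locring n.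

(** By essentiality some nonzero a u lies in V; a is outside n, hence a unit. Minimality of the
    resolution enters through this fact. *)
Lemma soc_hull (V : lmodType A) (u : hullT V) : Eann n u -> exists v, hull_in v = u.
Proof.
move=> hu; have [u0|u0] := eqVneq u 0.
  by exists 0; rewrite u0; apply: (linfun0 (@hull_lin _ V)).
have [_ _ _ eV] := hullP V; have [a [[v _ ev] na]] := eV u I (elimN eqP u0).
have [_ _ hn] := lA; have [y ya] : exists y, y * a = 1 :> A.
  by apply: hn => /hu.
by exists (y *: v); rewrite (linfunZ (@hull_lin _ V)) ev scalerA ya scale1r.
Qed.

Definition soc_span (V : lmodType A) t := exists vs : seq V, [/\ size vs = t,
  forall v, v \in vs -> Eann n v & Eann n `<=` wspan [set 0] vs].

Local Notation N := (residue_module m).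
Local Notation S := (syzygy N).
Definition syz_in j (x : S j.+1) : freemod (S j) := submod_val x.
Lemma syz_in_lin j : linear (@syz_in j).
Proof. by []. Qed.
Lemma syz_in_inj j : injective (@syz_in j). Proof. exact: val_inj. Qed.
Lemma aug_lin (V : lmodType A) : linear (@augmentation A V). Proof. exact: linearP. Qed.
Lemma aug_gen (V : lmodType A) (x : V) : augmentation << x >> = x.
Proof. by rewrite /augmentation liftU scale1r. Qed.
Lemma aug_surj (V : lmodType A) (y : V) : exists x, augmentation x = y.
Proof. by exists << y >>; apply: aug_gen. Qed.
Lemma aug_ker j (x : freemod (S j)) : augmentation x = 0 <-> exists k, @syz_in j k = x.
Proof.
split=> [/eqP h|[k <-]]; first by exists (Submod (h : x \in kernel _)).
by apply/eqP; apply: (submod_valP k).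
Qed.

Definition one_res : N := pi_quot _ (1 : A^o).
Lemma res_pi (a : A) : a *: one_res = pi_quot _ (a : A^o).
Proof.
rewrite -[LHS]/(quotmod_scale a one_res) quotmod_scale_pi.
by rewrite -[a *: (1 : A^o)]/(a * 1) mulr1.
Qed.
Lemma res_gen (x : N) : x = (repr x : A) *: one_res.
Proof. by rewrite res_pi -[LHS]pi_quot_repr. Qed.
Lemma res_eq (a b : A) : a *: one_res = b *: one_res <-> n (a - b).
Proof. by rewrite !res_pi; apply: pi_quot_eq. Qed.
Lemma res_kill (x : N) : Eann n x.
Proof.
move=> a na; rewrite [x]res_gen scalerA -[RHS](scale0r one_res); apply/res_eq.
by rewrite subr0; apply: (idealMl _ (ideal_set_submod m) na).
Qed.
Lemma res_map (V : lmodType A) (y : V) : Eann n y ->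
  exists f : N -> V, linear f /\ f one_res = y.
Proof.
move=> hy; have e (a b : A) : a *: one_res = b *: one_res -> a *: y = b *: y.
  by move=> /res_eq/hy; rewrite scalerBl => /eqP; rewrite subr_eq0 => /eqP.
exists (fun x => (repr x : A) *: y); split=> [a x x'|].
  rewrite scalerA -scalerDl; apply: e.
  by rewrite -res_gen scalerDl -scalerA -!res_gen.
by rewrite -[RHS]scale1r; apply: e; rewrite -res_gen scale1r.
Qed.

(** Shifting j + 1 times trades syzygies of the residue field k for cosyzygies of C and ends in
    Hom(k, cosyzygy) modulo liftable maps. Liftable maps are zero by [soc_hull], so the socle
    remains. *)
Lemma bass_shift j (C : lmodType A) (us : seq (S j.+1 -> C)) :
  (forall u : S j.+1 -> C, u \in us -> linear u) ->
  (forall f : S j.+1 -> C, linear f -> wspan (triv_ext (@syz_in j)) us f) ->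
  soc_span (iter j.+1 (@cosyz A) C) (size us).
Proof.
elim: j C us => [|j IH] C us ul ug.
  have [us' [h1 h2 h3]] := shift (@syz_in_lin 0) (@aug_lin N) (@syz_in_inj 0) (@aug_surj N)
    (@aug_ker 0) (@free_projective A N) ul ug.
  have evl : linear (fun f : N -> cosyz C => f one_res) by [].
  exists [seq (u : N -> cosyz C) one_res | u <- us']; split; first by rewrite size_map.
    by move=> _ /mapP[u /h2 u_lin ->]; apply: (Eann_lin u_lin); apply: res_kill.
  move=> y /res_map[f [fl <-]].
  apply: (wspan_im (W := @triv_lift _ C N) evl); last exact: h3.
  move=> _ [w wl ->] /=; apply/hpi0/soc_hull; apply: Eann_lin => //; exact: res_kill.
have [us' [h1 h2 h3]] := shift (@syz_in_lin j.+1) (@aug_lin (S j.+1)) (@syz_in_inj j.+1)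
  (@aug_surj (S j.+1)) (@aug_ker j.+1) (@free_projective A (S j.+1)) ul ug.
rewrite -h1 iterSr; apply: IH => // f fl; apply: wspan_mono (h3 f fl).
by apply: lift_ext; [exact: syz_in_lin|exact: syz_in_inj].
Qed.

(** Connects Ext of the standard free resolution with the minimal injective resolution: a spanning
    family of Ext^j yields equally many generators of the socle of the j-th cosyzygy. *)
Lemma bass_soc (M : lmodType A) j t : bass_number m M j t ->
  soc_span (iter j (@cosyz A) M) t.
Proof.
move=> [e [he _]].
pose F l : resol N j -> M := submod_val (repr (e l)).
have hF l : linear (F l) /\ F l \o @resol_diff A N j = 0.
  by have := submod_valP (repr (e l)); rewrite unfold_in => /asboolP.
(* A cocycle vanishes on the next syzygy and so descends along the augmentation. *)
have hu l : exists u : S j -> M, linear u /\ forall x, F l x = u (augmentation x).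
  have [fl f0] := hF l; apply: (descend (@aug_lin _) (@aug_surj _) (@aug_ker j) fl) => k.
  have /(congr1 (@^~ (<< k >> : resol N j.+1))) := f0.
  by rewrite /= /resol_diff aug_gen.
have [u {}hu] := choice hu.
have key (f : S j -> M) : linear f -> exists c : 'I_t -> A, exists2 z : submod (@cocycle A N M j),
    z \in @coboundary A N M j &
    forall x, submod_val z x = f (augmentation x) - \sum_l c l *: u l (augmentation x).
  move=> fl; have fc : (f \o @augmentation A (S j)) \in @cocycle A N M j.
    rewrite unfold_in; apply/asboolP; split; first exact: (comp_lin fl (@aug_lin _)).
    apply/funext => x /=; have := aug_ker (resol_diff x) => -[_ ->]; last by exists (augmentation x).
    exact: linfun0.
  have [c hc] := he (pi_quot _ (Submod fc)); exists c.
  exists (Submod fc - \sum_l c l *: repr (e l)); last first.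
    move=> x; have vl : linear (@submod_val _ _ (@cocycle A N M j)) by [].
    rewrite (linfunB vl) (linfun_sum vl) -[LHS]/(f (augmentation x) - _); congr (_ - _).
    have appl : {morph (fun g : resol N j -> M => g x) : g g' / g + g'} by [].
    rewrite (big_morph (fun g : resol N j -> M => g x) appl (erefl : (0 : resol N j -> M) x = 0)).
    by apply: eq_bigr => l _; rewrite (linfunZ vl) -(hu l).2.
  have q0 : pi_quot (@coboundary A N M j) 0 = 0 by rewrite /pi_quot raddf0.
  apply/pi_quot_eq; rewrite hc.
  rewrite (big_morph _ (@pi_quotD _ _ (@coboundary A N M j)) q0).
  apply: eq_bigr => l _; rewrite -{1}[e l]pi_quot_repr.
  exact: (@quotmod_scale_pi _ _ (@coboundary A N M j)).
have evl : forall l, l \in [seq u l | l <- enum 'I_t] -> linear (l : S j -> M).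
  by move=> _ /mapP[l _ ->]; apply: (hu l).1.
have sz : size [seq u l | l <- enum 'I_t] = t by rewrite size_map size_enum_ord.
have sumE (c : 'I_t -> A) x : (\sum_l c l *: u l) x = \sum_l c l *: u l x.
  have appl : {morph (fun g : S j -> M => g x) : g g' / g + g'} by [].
  by rewrite (big_morph (fun g : S j -> M => g x) appl (erefl : (0 : S j -> M) x = 0)).
rewrite -sz; clear hF; case: j => [|j] in e he F u hu key evl sz sumE *.
  exists [seq (u : N -> M) one_res | u <- [seq u l | l <- enum 'I_t]].
  split; first by rewrite [LHS]size_map.
    by move=> _ /mapP[w /evl wl ->]; apply: (Eann_lin wl); apply: res_kill.
  move=> y /res_map[f [fl <-]].
  have el : linear (fun f : N -> M => f one_res) by [].
  apply: (wspan_im (W := [set 0]) el); first by move=> _ ->.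
  apply/wspan_sum; first exact: submodule0.
  have [c [z hz ez]] := key f fl; exists c; apply/funext => x.
  have [w <-] := aug_surj x; rewrite -[LHS]/(f _ - (\sum_l c l *: u l) _) sumE.
  by rewrite -(ez w); move: hz; rewrite unfold_in => /eqP->.
apply: bass_shift => // f fl; apply/wspan_sum.
  split; first by exists (fun=> 0); [move=> a x y; rewrite scaler0 addr0|].
  move=> a _ _ [v vl ->] [v' vl' ->]; exists (a *: v + v') => //; exact: comb_lin.
have [c [z hz ez]] := key f fl; exists c.
move: hz; rewrite unfold_in => /asboolP[g hg]; exists g; first exact: linearP.
apply/funext => x; rewrite -[LHS]/(f _ - (\sum_l c l *: u l) _) sumE.
by rewrite -{1 2}[x]aug_gen -ez hg /= /resol_diff aug_gen.
Qed.
End BassNumbers.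

(** * Sums of copies of the injective hull of the residue field *)

Section ImageMul.
Variables (R : comNzRingType) (V W : lmodType R) (g : V -> W) (U : set V).
Hypotheses (gl : linear g) (sU : submodule U).

Let pk : pair U (U `&` [set v | g v = 0]).
Proof.
by split=> //; exact: (submoduleI sU (submodule_preim gl (@submodule0 R W))).
Qed.
Let pi : pair (g @` U) [set 0].
Proof.
split; [exact: (submodule_im gl)|exact: submodule0|].
by move=> _ ->; exists 0; [apply: submod0|apply: (linfun0 gl)].
Qed.
Let qi : qiso g U (U `&` [set v | g v = 0]) (g @` U) [set 0].
Proof.
split=> //; first by move=> _ [v [_ e] <-].
by move=> _ [u Uu <-]; exists u => //=; rewrite subrr.
Qed.

Lemma art_im : artP U [set 0] -> artP (g @` U) [set 0].
Proof.
move=> a; apply: (artP_iso gl pk pi qi); apply: artP_sub a => // _ ->.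
by split; [apply: submod0|apply: (linfun0 gl)].
Qed.

Lemma mul_im_le (s : seq R) : artP U [set 0] -> good s U [set 0] ->
  mul s (g @` U) [set 0] <= mul s U [set 0].
Proof.
move=> a gd; have [_ sK KU] := pk; have s0 := @submodule0 R V.
have z0 : [set 0] `<=` U `&` [set v | g v = 0].
  by move=> _ ->; split; [apply: submod0|apply: (linfun0 gl)].
rewrite -(mul_iso gl s pk pi qi) (mul_add sU sK s0 z0 KU gd) lerDl.
have KU' : U `&` [set v | g v = 0] `<=` U by move=> u [].
apply: art_mul_ge0; [exact: (And3 sK s0 z0)|exact: artP_sub a|exact: good_sub gd].
Qed.
End ImageMul.

Lemma mul_sub_le (R : comNzRingType) (V : lmodType R) (s : seq R) (Y U : set V) :
  submodule Y -> submodule U -> Y `<=` U -> artP U [set 0] -> good s U [set 0] ->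
  mul s Y [set 0] <= mul s U [set 0].
Proof.
move=> sY sU YU a gd; have s0 := @submodule0 R V.
have zY : [set 0] `<=` Y by move=> _ ->; apply: submod0.
rewrite (mul_add sU sY s0 zY YU gd) lerDr; apply: art_mul_ge0; first by split.
  exact: artP_sub a.
exact: good_sub gd.
Qed.

Section MatlisSums.
Variables (R : comNzRingType) (n : set R^o).
Hypotheses (lR : locring n) (nR : noeth R).
Variable E : lmodType R.
Hypothesis mE : matlis n E.

Definition ntor (V : lmodType R) (u : V) := exists k, forall l : seq R, size l = k ->
  (forall x, x \in l -> n x) -> \prod_(x <- l) x *: u = 0.

Lemma ntor_soc (V : lmodType R) (u : V) : ntor u -> u <> 0 ->
  exists a : R, a *: u <> 0 /\ Eann n (a *: u).
Proof.
move=> [k hk] u0; pose c : set R^o := [set a : R^o | (a : R) *: u = 0].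
have sc : submodule c.
  split; first exact: scale0r.
  by move=> a x y hx hy; rewrite /c /= scalerDl -scalerA hx hy scaler0 addr0.
have [||y [cy hy]] := prim_soc (n := n) sc; first by rewrite /c /= scale1r.
  by exists k.
by exists y; split=> // a na; rewrite scalerA; apply: hy.
Qed.

Lemma ntor_lin (V W : lmodType R) (f : V -> W) v : linear f -> ntor v -> ntor (f v).
Proof.
move=> fl [k hk]; exists k => l lk hl.
by rewrite -(linfunZ fl) hk // (linfun0 fl).
Qed.

Lemma ntor_detect (V : lmodType R) (x : V) : ntor x -> x <> 0 ->
  exists g : V -> E, linear g /\ g x <> 0.
Proof.
move=> tx x0; have [bE _ [s0 [s1 s2 s3]]] := mE.
have [a [ax nax]] := ntor_soc tx x0.
have [sn n1 hn] := lR.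
have [||g [gl _ hg]] := @baer_ext R V E [set: E] (fun v e => exists b : R, v = b *: (a *: x) /\ e = b *: s0)
  (submoduleT _) bE.
- split.
  + by exists 0; rewrite !scale0r.
  + move=> b _ _ _ _ [c [-> ->]] [c' [-> ->]]; exists (b * c + c').
    by rewrite !scalerDl -!scalerA.
  move=> _ [b [e ->]]; apply: s2; apply: contrapT => /hn[y yb]; apply: ax.
  by rewrite -[LHS]scale1r -yb -scalerA -e scaler0.
- by [].
exists g; split=> // gx; apply: s1.
by rewrite (hg (a *: x) s0) ?(linfunZ gl) ?gx ?scaler0 //; exists 1; rewrite !scale1r.
Qed.

Lemma soc_embed (V : lmodType R) (U : set V) (v : V) : submodule U -> baer U -> U v ->
  v <> 0 -> Eann n v ->
  exists (psi : E -> V) (rho : V -> E), [/\ linear psi, linear rho, forall e, U (psi e),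
    forall e, rho (psi e) = e & exists e, psi e = v].
Proof.
move=> sU bU Uv v0 nv; have [bE tE [s0 [s1 s2 s3]]] := mE; have [sn n1 hn] := lR.
have [||psi [pl Up hp]] := @baer_ext R E V U (fun e w => exists b : R, e = b *: s0 /\ w = b *: v) sU bU.
- split.
  + by exists 0; rewrite !scale0r.
  + move=> b _ _ _ _ [c [-> ->]] [c' [-> ->]]; exists (b * c + c').
    by rewrite !scalerDl -!scalerA.
  move=> _ [b [e ->]]; apply: nv; apply: contrapT => /hn[y yb]; apply: s1.
  by rewrite -[LHS]scale1r -yb -scalerA -e scaler0.
- by move=> _ _ [b [_ ->]]; apply: submodZ.
have pinj e : psi e = 0 -> e = 0.
  move=> pe; apply: contrapT => e0; have [a [ae nae]] := ntor_soc (tE e) e0.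
  have [b eb] := s3 _ nae; apply: ae; rewrite eb; apply: s2.
  apply: contrapT => /hn[y yb]; apply: v0.
  rewrite -[LHS]scale1r -yb -scalerA (_ : b *: v = psi (a *: e)).
    by rewrite (linfunZ pl) pe !scaler0.
  by apply: hp; exists b.
have [||rho [rl _ hr]] := @baer_ext R V E [set: E] (fun w e => w = psi e) (submoduleT _) bE.
- split; first by rewrite (linfun0 pl).
    by move=> b x y x' y' -> ->; rewrite pl.
  by move=> e /esym/pinj.
- by [].
exists psi, rho; split=> //; first by move=> e; rewrite -(hr _ e).
by exists s0; rewrite -(hp s0 v) //; exists 1; rewrite !scale1r.
Qed.

(** Each nonzero socle generator splits off a copy of E. The decomposition is recorded by embeddings
    [ps] such that a linear map vanishing on all their images vanishes on U. *)
Lemma matlis_sum (V : lmodType R) (U : set V) (vs : seq V) : submodule U -> baer U ->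
  (forall u, U u -> ntor u) -> (forall v, v \in vs -> U v /\ Eann n v) ->
  U `&` Eann n `<=` wspan [set 0] vs ->
  exists ps : seq (E -> V), [/\ (size ps <= size vs)%N,
    forall p : E -> V, p \in ps -> linear p /\ forall e, U (p e),
    forall (W : lmodType R) (g : V -> W), linear g ->
      (forall p : E -> V, p \in ps -> forall e, g (p e) = 0) -> forall u, U u -> g u = 0,
    artP U [set 0] &
    forall s : seq R, prim n (wspan ([set 0] : set R^o) (s : seq R^o)) ->
      mul s U [set 0] = (size ps)%:Z * mul s [set: E] [set 0]].
Proof.
move: {2}(size vs) (erefl (size vs)) => k; elim: k U vs => [|k IH] U vs.
  move=> /size0nil-> sU bU tU _ hs; exists [::].
  have U0 u : U u -> u = 0.
    move=> Uu; apply: contrapT => u0; have [a [au nau]] := ntor_soc (tU u Uu) u0.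
    by apply/au/hs; split=> //; apply: submodZ.
  have eU : U = [set 0] by apply/seteqP; split=> [u /U0|_ ->] //; apply: submod0.
  split=> // [W g gl _ u /U0->||s _]; first exact: linfun0.
    rewrite eU => c hc _; exists 0%N => i _ u cu; have [h _ h'] := hc 0%N; have [h1 _ _] := hc i.
    by rewrite (h' _ cu); apply: submod0.
  by rewrite eU mulxx ?mul0r //; apply: submodule0.
case: vs => // v vs [sk] sU bU tU vsU hs.
have [v0|/eqP v0] := eqVneq v 0.
  have [||ps [p1 p2 p3 p4 p5]] := IH U vs sk sU bU tU.
  - by move=> w ws; apply: vsU; rewrite inE ws orbT.
  - by move=> u /hs[a]; rewrite v0 scaler0 subr0.
  by exists ps; split=> //; apply: leq_trans p1 _.
have [Uv nv] := vsU v (mem_head _ _).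
have [psi [rho [pl rl Up rp [ev pev]]]] := soc_embed sU bU Uv v0 nv.
(* The projection onto the complement [U2] of the copy of E; it kills v, so one generator fewer is
   left. *)
pose sig u := u - psi (rho u).
have sl : linear sig.
  move=> a x y; rewrite /sig rl pl scalerBr opprD addrACA; congr (_ + _).
pose U2 := U `&` [set u | rho u = 0].
have sU2 : submodule U2 by exact: (submoduleI sU (submodule_preim rl (@submodule0 R E))).
have sigU u : U u -> U2 (sig u).
  by move=> Uu; split; [apply: submodB|rewrite /= /sig (linfunB rl) rp subrr].
have sigE u : U2 u -> sig u = u by move=> [_ e]; rewrite /sig e (linfun0 pl) subr0.
have bU2 : baer U2.
  by apply: (baer_retract sl (@id_linear _ _) bU) => // u [].
have [||||ps [p1 p2 p3 p4 p5]] := IH U2 (map sig vs) _ sU2 bU2.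
- by rewrite size_map.
- by move=> u [/tU].
- move=> _ /mapP[w ws ->]; have [Uw nw] := vsU w (mem_behead (s := v :: vs) ws).
  by split; [apply: sigU|apply: Eann_lin].
- move=> u [U2u nu]; have [a ha] : wspan [set 0] (v :: vs) u.
    by apply: hs; split=> //; case: U2u.
  have := wspan_im (W' := [set 0]) sl _ ha.
  rewrite (linfunB sl) (linfunZ sl) (sigE u) // (_ : sig v = 0) ?scaler0 ?subr0.
    by apply=> _ ->; apply: (linfun0 sl).
  by rewrite -pev /sig rp subrr.
have qr : qiso rho U U2 [set: E] [set 0].
  split=> //; first by move=> _ [u [_ e] <-].
  by move=> e _; exists (psi e) => //=; rewrite rp subrr.
have pU2 : pair U U2 by split=> // u [].
have pE : pair [set: E] [set 0] by split=> //; apply: submodule0.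
have s0V := @submodule0 R V; have z2 : [set 0] `<=` U2 by move=> _ ->; apply: submod0.
have aU : artP U [set 0].
  apply: (@artP_ext _ _ _ U2) => //; first by move=> u [].
  by apply: (artP_iso_rev rl pU2 pE qr); apply: (matlis_art lR nR mE).
exists (psi :: ps); split=> //.
- by move: p1; rewrite /= size_map.
- move=> p; rewrite inE => /orP[/eqP->|/p2[h1 h2]] //.
  by split=> // e; have [] := h2 e.
- move=> W g gl hg u Uu; rewrite -(subrK (psi (rho u)) u) (linfunD gl).
  rewrite hg ?mem_head // addr0; apply: p3 => //; last exact: sigU.
  by move=> p pps e; apply: hg; rewrite inE pps orbT.
move=> s ps0; have gU : good s U [set 0].
  by apply: (good_art lR aU ps0) => b u -> _; rewrite scale0r.
rewrite (mul_add sU sU2 s0V z2 _ gU); last by move=> u [].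
rewrite p5 // (mul_iso rl s pU2 pE qr) /= -addn1 PoszD mulrDl mul1r addrC //.
Qed.

(** If d were nonzero on some copy of E, a map back to E would give a nonzero endomorphism of E,
    whose image has positive [mul] bounded by that of the image of d. *)
Lemma mul_detect (s : seq R) (V W : lmodType R) (U : set V) (d : V -> W) (ps : seq (E -> V)) :
  prim n (wspan ([set 0] : set R^o) (s : seq R^o)) ->
  (forall f : E -> E, linear f -> (exists e, f e <> 0) -> 0 < mul s (range f) [set 0]) ->
  submodule U -> (forall u, U u -> ntor u) -> linear d -> artP U [set 0] ->
  (forall p : E -> V, p \in ps -> linear p /\ forall e, U (p e)) ->
  (forall g : V -> W, linear g ->
      (forall p : E -> V, p \in ps -> forall e, g (p e) = 0) -> forall u, U u -> g u = 0) ->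
  mul s (d @` U) [set 0] <= 0 -> forall u, U u -> d u = 0.
Proof.
move=> ps0 pos sU tU dl aU hp det le0; apply: det => // p pps e; apply: contrapT => ne.
have [pl Up] := hp p pps.
have [g [gl ge]] := ntor_detect (ntor_lin dl (tU _ (Up e))) ne.
have dpl := comp_lin dl pl; have fl := comp_lin gl dpl.
have gd (V' : lmodType R) (X : set V') : artP X [set 0] -> good s X [set 0].
  by move=> aX; apply: (good_art lR aX ps0) => b u -> _; rewrite scale0r.
have aD := art_im dl sU aU; have sD := submodule_im dl sU.
have sR := submodule_im dpl (@submoduleT R E).
have RD : (fun e => d (p e)) @` [set: E] `<=` d @` U by move=> _ [e' _ <-]; exists (p e').
have aR : artP ((fun e => d (p e)) @` [set: E]) [set 0] by apply: artP_sub aD.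
have h1 := mul_im_le gl sR aR (gd _ _ aR).
have h2 := mul_sub_le sR sD RD aD (gd _ _ aD).
have eR : g @` ((fun e => d (p e)) @` [set: E]) = range (fun e => g (d (p e))).
  by apply/seteqP; split=> [_ [_ [e' _ <-] <-]|_ [e' _ <-]]; [exists e'|exists (d (p e')) => //; exists e'].
rewrite eR in h1; have := pos _ fl (ex_intro _ e ge); rewrite ltNge => /negP; apply.
exact: le_trans h1 (le_trans h2 le0).
Qed.
End MatlisSums.

(** * Local cohomology of the minimal injective resolution *)

Section Padding.
Variable R : comNzRingType.

(* [lc_data] asks for zero modules in low degrees. *)
Definition pad_cx (X : cplx R) (i : nat) : lmodType R := if i is j.+1 then X j else 'rV[R]_0.
Definition pad_cd (X : cplx R) i : pad_cx X i -> pad_cx X i.+1 :=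
  if i is j.+1 then fun x : X j => cd x else fun=> 0.
Fact pad_lin X i : linear (@pad_cd X i).
Proof. by case: i => [|i] a x y; [rewrite /= scaler0 addr0|apply: (@cd_lin _ X i)]. Qed.
Fact pad_dd X i x : pad_cd (@pad_cd X i x) = 0.
Proof. by case: i x => [|i] x; [apply: (linfun0 (@cd_lin _ X 0))|apply: (@cd_cd _ X i)]. Qed.
Definition pad X : cplx R := Cplx (@pad_lin X) (@pad_dd X).
Definition padn k X := iter k pad X.

Lemma triv0 (v : 'rV[R]_0) : v = 0. Proof. by apply/rowP => -[]. Qed.

Lemma pad_low k X i : (i < k)%N -> forall v : padn k X i, v = 0.
Proof.
elim: k i => // k IH [|i] ik v; first exact: triv0.
exact: (IH i).
Qed.

Lemma pad_injective k X : injective_cplx X -> injective_cplx (padn k X).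
Proof.
move=> bX; elim: k => // k IH [|i]; last exact: IH.
by move=> G _ _; exists 0; split=> // a y _; rewrite [y]triv0 [RHS]triv0.
Qed.

Variables (s : seq R) (X : cplx R) (Q : forall V : lmodType R, set V -> set V -> Prop).

Lemma pad_at0 k : Q (cyc X s 0) [set 0] ->
  Q (cyc (padn k.+1 X) s k.+1) (bnd (padn k.+1 X) s k).
Proof.
elim: k => // q; congr (Q _ _): q; apply/seteqP; split=> [_ ->|_ [v _ <-]] //.
by exists 0 => //; apply: (submod0 (Gam_submod _ _)).
Qed.
Lemma pad_at k i : Q (cyc X s i.+1) (bnd X s i) ->
  Q (cyc (padn k X) s (k + i).+1) (bnd (padn k X) s (k + i)).
Proof. by elim: k. Qed.

Lemma pad_all k : (forall (V : lmodType R) (U W : set V), (forall v : V, v = 0) -> W 0 -> Q U W) ->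
  Q (cyc X s 0) [set 0] -> (forall i, Q (cyc X s i.+1) (bnd X s i)) ->
  forall i, Q (cyc (padn k.+1 X) s i.+1) (bnd (padn k.+1 X) s i).
Proof.
move=> q0 q1 q2 i; have [ik|ik|->] := ltngtP i k; last exact: pad_at0.
  by apply: q0; [apply: pad_low|apply: submod0; apply: bnd_submod].
have [j ->] : exists j, i = (k.+1 + j)%N by exists (i - k.+1)%N; rewrite subnKC.
exact: (@pad_at k.+1).
Qed.
End Padding.

Section Resolution.
Variables (A : comNzRingType) (m : idealr A).
Local Notation n := (ideal_set m).
Hypotheses (lA : locring n) (nA : noeth A).
Variable M : lmodType A.

Notation Cs i := (iter i (@cosyz A) M).
Definition res_cd i (x : hullT (Cs i)) : hullT (Cs i.+1) := hull_in (hpi x).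
Lemma res_lin i : linear (@res_cd i).
Proof. by apply: comp_lin; [exact: hull_lin|exact: hpi_lin]. Qed.
Lemma res_dd i x : res_cd (@res_cd i x) = 0.
Proof. by rewrite /res_cd hpi_in (linfun0 (@hull_lin _ _)). Qed.
Definition res : cplx A := Cplx res_lin res_dd.

Lemma res_cd0 i (x : res i) : cd x = 0 <-> exists v : Cs i, hull_in v = x.
Proof.
apply: iff_trans _ (hpi0 x); split=> [/hull_inj //|e].
by rewrite /= /res_cd e (linfun0 (@hull_lin _ _)).
Qed.
Lemma res_injective : injective_cplx res.
Proof. by move=> i; apply: hull_baer. Qed.
Lemma res_exact i : vanish res [::] i.
Proof.
move=> x [_ /res_cd0[v <-]]; have [w <-] := hpi_surj v.
by exists w.
Qed.

Hypothesis fM : fin_gen M.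

(** For a cosyzygy the socle is Ext from the residue field, since liftable elements killed by n are
    zero by [soc_hull]. *)
Lemma soc_fin i : exists t, soc_span m (Cs i) t.
Proof.
case: i => [|i].
  have [||//|vs [v1 v2]] := noeP_fg nA fM (X := Eann n); first exact: Eann_sm.
    by move=> _ ->; apply: (submod0 (Eann_sm _ _)).
  by exists (size vs), vs.
have [sn _ _] := lA; have [vs [v1 v2]] := fg_ext_iter nA i fM sn.
exists (size vs), vs; split=> // y /v2; apply: wspan_mono => _ [w nw <-].
by apply/hpi0/(soc_hull lA).
Qed.

Lemma qiso_M : qiso (@hull_in _ M) setT [set 0] (cyc res [::] 0) [set 0].
Proof.
have hl := @hull_lin _ M; split.
- by move=> _ [v _ <-]; split=> //; apply/res_cd0; exists v.
- by move=> _ [_ -> <-]; apply: (linfun0 hl).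
- by move=> v _ /hull_inj.
by move=> u [_ /res_cd0[v <-]]; exists v => //=; rewrite subrr.
Qed.

Variable s : seq A.
Hypotheses (sn : forall x, x \in s -> n x) (ps : prim n (wspan ([set 0] : set A^o) (s : seq A^o))).

Lemma Gam_ntor (V : lmodType A) (u : V) : Gam V s u -> ntor n u.
Proof.
move=> /GamP[k hk]; pose c : set A^o := [set a : A^o | (a : A) *: u = 0].
have sc : submodule c.
  split; first exact: scale0r.
  by move=> a x y hx hy; rewrite /c /= scalerDl -scalerA hx hy scaler0 addr0.
apply: (prim_of_primes nA sc) => P pP cP x nx; have [j hj] := ps.
have [sP _ _] := pP; apply: (prime_exp (k := j) pP).
have : wspan ([set 0] : set A^o) (s : seq A^o) (x ^+ j : A).
  by rewrite -prod_nseq; apply: hj; [rewrite size_nseq|move=> y /nseqP[->]].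
apply: wspan_min => //; first by move=> _ ->; apply: submod0.
by move=> y ys; apply: (prime_exp (k := k) pP); apply: cP; apply: hk.
Qed.

Lemma soc_Gam (V : lmodType A) (u : V) : Eann n u -> Gam V s u.
Proof. by move=> h; apply/GamP; exists 1%N => x /sn nx; rewrite expr1; apply: h. Qed.

Hypothesis fr : @freg A n s M [set: M] [set 0].

(** The multiplicity of the i-th local cohomology module of M. *)
Definition hcoh i : int := if i is j.+1 then mul s (cyc res s j.+1) (bnd res s j)
  else mul s (cyc res s 0) [set 0].

Lemma pairT (V : lmodType A) : pair [set: V] [set 0].
Proof. by split=> //; [exact: submodule0]. Qed.
Lemma cyc0_pair t : pair (cyc res t 0) [set 0].
Proof.
split; [exact: cyc_submod|exact: submodule0|move=> _ ->].
exact: (submod0 (cyc_submod res t 0)).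
Qed.

Lemma res_hcoh : (forall i, artP (Gam (res i) s) [set 0]) ->
  [/\ forall i, (i < size s)%N -> hcoh i = 0,
    hcoh (size s) = (-1) ^+ size s * mul s [set: M] [set 0] &
    forall i, (size s <= i)%N -> vanish res s i].
Proof.
move=> aJ; have hl := @hull_lin _ M; have nM := noeP_fg nA fM.
have [s0|s0] := posnP (size s).
  have es : s = [::] by apply: size0nil.
  rewrite es; split=> // [|i _]; last exact: res_exact.
  rewrite expr0 mul1r /hcoh /= es; apply: esym; exact: (mul_iso hl [::] (@pairT _) (cyc0_pair _) qiso_M).
(* After d + 1 zero modules M is the cohomology in degree d + 1, that is at index q = d; local
   cohomology of degree j then has index d + j. *)
pose d := size s; pose Y := padn d.+1 res.
have gA (V : lmodType A) (U : set V) : artP U [set 0] -> good s U [set 0].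
  by move=> a; apply: (good_art lA a ps) => b u -> _; rewrite scale0r.
have cG i : cyc res s i `<=` Gam (res i) s by move=> u [].
have z0 i : [set 0] `<=` bnd res s i by move=> _ ->; apply: submod0; apply: bnd_submod.
have high i : (d < i)%N -> vanish Y [::] i.
  move=> di; have [j ->] : exists j, i = (d.+1 + j)%N by exists (i - d.+1)%N; rewrite subnKC.
  by apply: (@pad_at _ _ res (fun V U W => U `<=` W)); apply: res_exact.
have L : @lc_data A n Y s d.
  split=> //.
  - by apply: pad_injective; apply: res_injective.
  - by move=> i di; apply: pad_low; apply: leq_trans di _.
  - move=> i di y _; exists 0%N => u _; rewrite (pad_low (X := res) (k := d.+1) _ u) //.
    by rewrite scaler0; apply: submod0; apply: bnd_submod.
  - by apply: (@pad_at0 _ _ res (@noeP A)); apply: (noeP_iso hl (@pairT _) (cyc0_pair _) qiso_M nM).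
  - apply: (@pad_at0 _ _ res (@good A ^~ s)).
    apply: (good_iso hl s (@pairT _) (cyc0_pair _) qiso_M).1.
    by apply: (good_noe lA nM ps) => b u -> _; rewrite scale0r.
  - apply: (@pad_at0 _ _ res (fun V => @freg A n s V)).
    exact: (freg_iso hl (@pairT _) (cyc0_pair _) qiso_M fr).
  - apply: (@pad_all _ _ res (@artP A)).
    + move=> V U W tV W0 c hc dc; exists 0%N => i _ u _; rewrite (tV u).
      by have [h _ _] := hc i; apply: submod0.
    + exact: (artP_sub _ (cG 0%N) (aJ 0%N)).
    by move=> i; exact: (artP_sub (z0 i) (cG i.+1) (aJ i.+1)).
  apply: (@pad_all _ _ res (@good A ^~ s)).
  + move=> V U W tV W0 U' W' p _ _ _; have -> : U' = W'.
      have [sU sW _] := p; apply/seteqP.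
      by split=> u _; rewrite (tV u); [apply: submod0|apply: submod0].
    have [_ sW _] := p; by apply: (goodxx (s := s) sW (pairxx sW)) => // x u _; apply: submodZ.
  + exact: (good_sub _ (cG 0%N) (gA _ _ (aJ 0%N))).
  by move=> i; exact: (good_sub (z0 i) (cG i.+1) (gA _ _ (aJ i.+1))).
have [m1 m2] := lc_mul nA L.
have hY j : mul s (cyc Y s (d + j).+1) (bnd Y s (d + j)) = hcoh j.
  case: j => [|j].
    by rewrite addn0; apply: (@pad_at0 _ _ res (fun V U W => mul s U W = hcoh 0)).
  by rewrite addnS -addSn; apply: (@pad_at _ _ res (fun V U W => mul s U W = hcoh j.+1)).
split.
- by move=> i di; rewrite -hY m1 // ltn_add2l.
- rewrite -hY m2 -/d; congr (_ * _).
  apply: (@pad_at0 _ [::] res (fun V U W => mul s U W = mul s [set: M] [set 0])).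
  exact/esym/(mul_iso hl s (@pairT _) (cyc0_pair _) qiso_M).
move=> i di; have hv : vanish Y s (d.+1 + i).
  apply: (vanish_all nA (pad_injective (k := d.+1) res_injective) high).
  by rewrite addSn ltnS leq_add2l.
move: hv; exact: (@pad_at A s res (fun V U W => U `<=` W -> vanish res s i) d.+1 i id).
Qed.
End Resolution.

Section MatlisExists.
Variables (A : comNzRingType) (m : idealr A).
Local Notation n := (ideal_set m).
Hypotheses (lA : locring n) (nA : noeth A).

Lemma baer_subT (V : lmodType A) (U : set V) (sU : submodule U) : baer U ->
  baer [set: subT sU].
Proof.
move=> bU G [g0 g1 g2] _; have vl := @sub_val_lin _ _ _ sU.
have [||v [Uv hv]] := bU (fun a y => exists2 z, G a z & y = sub_val z).
- split; first by exists 0; rewrite ?(linfun0 vl).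
    by move=> a x y _ _ [z Gz ->] [z' Gz' ->]; exists (a *: z + z'); [apply: g1|rewrite vl].
  by move=> _ [z /g2-> ->]; rewrite (linfun0 vl).
- by move=> a _ [z _ ->]; apply: sub_valP.
exists (sub_in sU Uv); split=> // a y Gay; apply: (@sub_val_inj _ _ _ sU).
by rewrite (linfunZ vl) -(hv a (sub_val y)) //; exists y.
Qed.

(** The n-torsion of the hull of A / n: torsion by construction, injective by [Gam_baer], and with
    the socle of A / n by [soc_hull]. *)
Lemma matlis_exists : exists E : lmodType A, matlis n E.
Proof.
have [sn n1 hn] := lA; have [vs [v1 v2]] := noeth_fg nA sn.
have ps : prim n (wspan ([set 0] : set A^o) (vs : seq A^o)).
  exists 1%N => -[|x [|]] // _ h; rewrite big_seq1; apply: v2; apply: h.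
  by rewrite mem_head.
pose V := hullT (quoT sn); pose U := Gam V (vs : seq A); have sU : submodule U := Gam_submod _ _.
have bU : baer U by apply: (Gam_baer nA); apply: hull_baer.
have vl := @sub_val_lin _ _ _ sU; exists (subT sU); split; first exact: baer_subT.
  move=> e; have [k hk] := Gam_ntor nA ps (sub_valP e); exists k => l lk hl.
  by apply: (@sub_val_inj _ _ _ sU); rewrite (linfunZ vl) hk // (linfun0 vl).
have ql := @quo_pi_lin _ _ _ sn; have hl := @hull_lin _ (quoT sn).
have k1 : Eann n (quo_pi sn (1 : A^o)).
  move=> a na; rewrite -(linfunZ ql); apply/quo_pi0.
  by rewrite -[a *: _]/(a * 1) mulr1.
have Uo : U (hull_in (quo_pi sn (1 : A^o))).
  by apply: (soc_Gam v1); apply: Eann_lin.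
exists (sub_in sU Uo); split.
- move=> /(congr1 (@sub_val _ _ _ sU)); rewrite sub_inK (linfun0 vl) => /hull_inj/quo_pi0.
  exact: n1.
- move=> a na; apply: (@sub_val_inj _ _ _ sU); rewrite (linfunZ vl) sub_inK (linfun0 vl).
  by rewrite -(linfunZ hl) k1 // (linfun0 hl).
move=> e he; have [|v ev] := soc_hull lA (u := sub_val e).
  by move=> a na; rewrite -(linfunZ vl) he // (linfun0 vl).
have [a ea] := quo_pi_surj v; exists a; apply: (@sub_val_inj _ _ _ sU).
rewrite (linfunZ vl) sub_inK -ev ea -(linfunZ hl) -(linfunZ ql).
by rewrite -[a *: _]/(a * 1) mulr1.
Qed.
End MatlisExists.

(** * The numerical argument on the torsion of the minimal resolution *)

Section Numerics.
Variables (A : comNzRingType) (m : idealr A).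
Local Notation n := (ideal_set m).
Hypotheses (lA : locring n) (nA : noeth A).
Variable E : lmodType A.
Hypothesis mE : matlis n E.
Variables (M : lmodType A) (s : seq A) (r : nat).
Hypotheses (fM : fin_gen M) (sn : forall x, x \in s -> n x).
Hypothesis ps : prim n (wspan ([set 0] : set A^o) (s : seq A^o)).
Hypothesis fr : @freg A n s M [set: M] [set 0].
Hypothesis pos : forall f : E -> E, linear f -> (exists e, f e <> 0) ->
  0 < mul s (range f) [set 0].
Hypothesis r0 : (0 < r)%N.
Hypothesis rM : mul s [set: M] [set 0] = r%:Z * @mul A A^o s [set: A^o] [set 0].
Local Notation X := (res M).
Local Notation e' := (mul s [set: E] [set 0]).

Let z0 (V : lmodType A) := @submodule0 A V.
Let gA (V : lmodType A) (U : set V) : artP U [set 0] -> good s U [set 0].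
Proof. by move=> a; apply: (good_art lA a ps) => b u -> _; rewrite scale0r. Qed.

Lemma e'_gt0 : 0 < e'.
Proof.
have -> : [set: E] = range (@id E) by apply/seteqP; split=> // x _; exists x.
apply: pos => //; have [_ _ [s0 [h _ _]]] := mE; by exists s0.
Qed.

(** E = E[0] is the Matlis dual of A. *)
Lemma e'_dual : e' = (-1) ^+ size s * @mul A A^o s [set: A^o] [set 0].
Proof.
have p : pair [set: A^o] ([set 0] : set A^o) by split=> //; apply: submodule0.
have g : @good A A^o s [set: A^o] [set 0].
  by apply: (good_noe lA nA ps) => b u -> _; rewrite scale0r.
rewrite -(dual_mul lA mE p g); congr (mul s _ _); apply/seteqP; split.
- by move=> e _ a ->; rewrite scale0r.
- by [].
- by move=> _ -> a _; rewrite scaler0.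
by move=> e h; rewrite -[e]scale1r; apply: h.
Qed.

Lemma J_data i t : soc_span m (iter i (@cosyz A) M) t ->
  exists qs : seq (E -> X i), [/\ (size qs <= t)%N,
    forall p : E -> X i, p \in qs -> linear p /\ forall e, Gam (X i) s (p e),
    forall (W : lmodType A) (g : X i -> W), linear g ->
      (forall p : E -> X i, p \in qs -> forall e, g (p e) = 0) -> forall u, Gam (X i) s u -> g u = 0,
    artP (Gam (X i) s) [set 0] &
    mul s (Gam (X i) s) [set 0] = (size qs)%:Z * e'].
Proof.
move=> [vs [<- v1 v2]]; have hl := @hull_lin _ (iter i (@cosyz A) M).
have [||||qs [q1 q2 q3 q4 q5]] := matlis_sum lA nA mE (U := Gam (X i) s)
  (vs := map (@hull_in _ _) vs) (Gam_submod _ _).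
- by apply: (Gam_baer nA); apply: hull_baer.
- by move=> u; apply: (Gam_ntor nA ps).
- move=> _ /mapP[v /v1 hv ->]; have h := Eann_lin hl hv.
  by split=> //; apply: (soc_Gam sn).
- move=> u [_ hu]; have [v ev] := soc_hull lA hu; rewrite -ev.
  apply: (wspan_im (W := [set 0]) hl); first by move=> _ ->; apply: (linfun0 hl).
  apply: v2 => a na; apply: hull_inj; rewrite (linfunZ hl) ev; exact: hu.
exists qs; split=> //; first by rewrite size_map in q1.
exact: q5.
Qed.

Let aJ i : artP (Gam (X i) s) [set 0].
Proof. by have [t /J_data[qs []]] := soc_fin lA nA fM i. Qed.

(** With J^i the torsion of [X i], [Z i] measures its cycles and [B i] the image of J^i in degree i
    + 1; thus [B i] is b_(i+1) of the overview. *)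
Local Notation h := (hcoh M s).
Local Notation Z i := (mul s (cyc X s i) [set 0]).
Local Notation B i := (mul s (bnd X s i) [set 0]).

Lemma B_ge0 i : 0 <= B i.
Proof.
have a : artP (bnd X s i) [set 0] := art_im (@cd_lin _ X i) (Gam_submod _ _) (@aJ i).
apply: art_mul_ge0 => //; last exact: gA.
by split=> //; [apply: bnd_submod|move=> _ ->; apply: submod0; apply: bnd_submod].
Qed.

Lemma J_split i : mul s (Gam (X i) s) [set 0] = Z i + B i.
Proof.
have sG := Gam_submod (X i) s; have sc := cyc_submod X s i.
have cG : cyc X s i `<=` Gam (X i) s by move=> u [].
have zc : [set 0] `<=` cyc X s i by move=> _ ->; apply: submod0.
rewrite (mul_add sG sc (@z0 _) zc cG (gA (@aJ i))) addrC; congr (_ + _).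
apply: (mul_iso (@cd_lin _ X i)).
- by [].
- by split=> //; [apply: bnd_submod|move=> _ ->; apply: submod0; apply: bnd_submod].
split=> //; first by move=> _ [u [_ e] <-].
by move=> _ [u Gu <-]; exists u => //; rewrite subrr.
Qed.

Lemma Z_split i : Z i.+1 = h i.+1 + B i.
Proof.
have [sc sb bc] := Hpair X s i; have zb : [set 0] `<=` bnd X s i.
  by move=> _ ->; apply: submod0.
apply: mul_add => //; apply: (good_sub _ _ (gA (@aJ i.+1))) => //.
by move=> u [].
Qed.

Let hres := res_hcoh lA nA fM sn ps fr (@aJ).

Lemma h_d : h (size s) = r%:Z * e'.
Proof. by have [_ -> _] := hres; rewrite rM e'_dual mulrCA. Qed.

Lemma h_high i : (size s < i)%N -> h i = 0.
Proof.
case: i => // i di; apply: mul_triv; first exact: Hpair.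
by have [_ _] := hres; apply.
Qed.

Lemma h_dvd i : exists k : int, h i = k * e'.
Proof.
have [di|di|->] := ltngtP i (size s).
- by exists 0; have [hl _ _] := hres; rewrite hl // mul0r.
- by exists 0; rewrite h_high // mul0r.
by exists r%:Z; apply: h_d.
Qed.

(** [Z] and [B] are obtained recursively from the multiplicities of the J^i and of local cohomology,
    all of which are multiples of e'. *)
Lemma ZB_dvd i : (exists k : int, Z i = k * e') /\ (exists k : int, B i = k * e').
Proof.
have HB j : (exists k : int, Z j = k * e') -> exists k : int, B j = k * e'.
  move=> [k hk]; have [t ht] := soc_fin lA nA fM j; have [qs [_ _ _ _ e]] := J_data ht.
  exists ((size qs)%:Z - k); rewrite mulrBl -hk -e J_split addrC; lia.
elim: i => [|i [_ [k hk]]]; last first.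
  have h1 : exists k : int, Z i.+1 = k * e'.
    have [l hl] := h_dvd i.+1; exists (l + k); by rewrite Z_split hl hk mulrDl.
  by split=> //; apply: HB.
by have h0 := h_dvd 0%N; split=> //; apply: HB.
Qed.

Lemma B0_cd i : B i = 0 -> forall u, Gam (X i) s u -> cd u = 0.
Proof.
have [t ht] := soc_fin lA nA fM i; have [qs [_ q2 q3 q4 _]] := J_data ht => e.
have tG u : Gam (X i) s u -> ntor n u by apply: (Gam_ntor nA ps).
apply: (mul_detect lA mE ps pos (Gam_submod _ _) tG (@cd_lin _ X i) (@q4) q2 (q3 _)).
by rewrite -[mul _ _ _]/(B i) e.
Qed.

Lemma soc_cyc i (v : iter i (@cosyz A) M) : Eann n v -> cyc X s i (hull_in v).
Proof.
move=> nv; split; last by apply/res_cd0; exists v.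
by apply: (soc_Gam sn); apply: (Eann_lin (@hull_lin _ _)).
Qed.

(** Beyond degree d cycles are boundaries, here zero; socle elements are cycles, and a torsion
    module with zero socle is zero. *)
Lemma J_next i : (size s <= i)%N -> (forall u, Gam (X i) s u -> cd u = 0) ->
  (forall v : iter i.+1 (@cosyz A) M, Eann n v -> v = 0) /\
  forall u, Gam (X i.+1) s u -> cd u = 0.
Proof.
move=> di hb; have [_ _ /(_ i di) hv] := hres.
have c0 u : cyc X s i.+1 u -> u = 0 by move=> /hv[w /hb e <-].
split; first by move=> v /soc_cyc/c0/hull_inj.
move=> u Gu; suff -> : u = 0 by apply: (linfun0 (@cd_lin _ X i.+1)).
apply: contrapT => u0; have [a [au nau]] := ntor_soc (Gam_ntor nA ps Gu) u0.
have [v ev] := soc_hull lA nau; apply: au; rewrite -ev; apply: c0.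
by rewrite ev; split; [apply: submodZ => //; apply: Gam_submod|apply/res_cd0; exists v].
Qed.

(* Both [B N] and [B N.-1] are nonnegative multiples of e', and their sum is less
   than 2 e', so that one of them is zero. *)
Lemma soc_later N t : (size s <= N)%N -> soc_span m (iter N (@cosyz A) M) t -> (t <= 1)%N ->
  forall i, (N < i)%N -> forall v : iter i (@cosyz A) M, Eann n v -> v = 0.
Proof.
move=> dN hN t1; have ep := e'_gt0.
have [qs [q1 _ _ _ q5]] := J_data hN; rewrite J_split in q5.
have qe : Z N + B N <= e'.
  rewrite q5; have : (size qs <= 1)%N by apply: leq_trans q1 t1.
  by case: (size qs) => [|[|]] // _; rewrite ?mul0r ?mul1r // ltW.
have [_ [b hb]] := ZB_dvd N; have bN := B_ge0 N.
have small k : k * e' < e' -> 0 <= k * e' -> k = 0 by nia.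
have base : forall u, Gam (X N) s u -> cd u = 0.
  (* For N = d the cycles already account for r e' >= e', which leaves nothing for [B N]. *)
  move: (dN); rewrite leq_eqVlt => /orP[/eqP eN|dN'].
    apply: B0_cd; rewrite hb (_ : b = 0) ?mul0r //.
    have hz : r%:Z * e' <= Z N.
      rewrite -h_d eN; case: (N) => [|N']; first by [].
      by rewrite Z_split; have := B_ge0 N'; lia.
    rewrite hb in bN qe; apply: small => //; nia.
  (* For N > d, [Z N] equals [B] one degree lower because H^N has multiplicity 0. If [B N] is not
     zero, then that one is, and [J_next] carries the vanishing up. *)
  case: N => // N in dN dN' hN qs q1 q5 qe b hb bN *.
  rewrite Z_split h_high // add0r in qe; have [_ [c hc]] := ZB_dvd N; have cN := B_ge0 N.
  have [b0|b0] := eqVneq b 0; first by apply: B0_cd; rewrite hb b0 mul0r.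
  have c0 : c = 0 by rewrite hc hb in qe; rewrite hc in cN; rewrite hb in bN; nia.
  have := J_next (i := N); rewrite ltnS in dN' => /(_ dN') [|_ //].
  by apply: B0_cd; rewrite hc c0 mul0r.
have step k : (forall v : iter (N + k).+1 (@cosyz A) M, Eann n v -> v = 0) /\
    forall u, Gam (X (N + k).+1) s u -> cd u = 0.
  elim: k => [|k [_ IH]]; first by rewrite addn0; apply: J_next.
  by rewrite addnS; apply: J_next IH; apply: leq_trans dN _; lia.
move=> i Ni; have [k ->] : exists k, i = (N + k).+1 by exists (i - N.+1)%N; lia.
by have [] := step k.
Qed.

(** With zero socle there would be no nonzero cycles in degree d, whereas H^d has multiplicity r e'
    > 0. *)
Lemma soc_dim : exists v : iter (size s) (@cosyz A) M, Eann n v /\ v <> 0.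
Proof.
apply: contrapT => hs; have := e'_gt0; have := h_d.
rewrite (_ : h (size s) = 0); first by nia.
have c0 : cyc X s (size s) `<=` [set 0].
  move=> u [Gu _]; apply: contrapT => u0; have [a [au nau]] := ntor_soc (Gam_ntor nA ps Gu) u0.
  have [v ev] := soc_hull lA nau; apply: au; apply: contrapT => au; apply: hs; exists v.
  have hl := @hull_lin _ (iter (size s) (@cosyz A) M); split.
    by move=> b nb; apply: hull_inj; rewrite (linfunZ hl) ev; apply: nau.
  by move=> v0; apply: au; rewrite -ev v0 (linfun0 hl).
case: (size s) c0 => [|d] c0; apply: mul_triv => //; first exact: cyc0_pair.
  exact: Hpair.
by move=> u /c0 ->; apply: submod0; apply: bnd_submod.
Qed.
End Numerics.

(** * Associated primes *)

Section AssociatedPrimes.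
Variables (R : comNzRingType) (nR : noeth R) (V : lmodType R) (U W : set V).
Hypotheses (pUW : pair U W) (nUW : noeP U W).

Definition colon (y : V) : set R^o := [set a : R^o | W ((a : R) *: y)].
Lemma colon_sm y : submodule (colon y).
Proof.
have [_ sW _] := pUW; split; first by rewrite /colon /= scale0r; apply: submod0.
move=> a b c hb hc; rewrite /colon /= scalerDl -[a *: b]/(a * b) -scalerA.
by apply: submodD => //; apply: submodZ.
Qed.

Definition maxann y := [/\ U y, ~ W y &
  forall z, U z -> ~ W z -> colon y `<=` colon z -> colon z `<=` colon y].

Lemma maxann_exists u : U u -> ~ W u -> exists2 y, maxann y & colon u `<=` colon y.
Proof.
move=> Uu Wu.
have [||X [[y [Uy Wy uy ->]] mX]] := noe_max (F := [set c | exists y, [/\ U y, ~ W y,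
    colon u `<=` colon y & c = colon y]]) (X0 := colon u) (@submodule0 R R^o) nR.
- by exists u; split.
- move=> X [y [_ _ _ ->]]; split=> //; first exact: colon_sm.
  by move=> _ ->; apply: submod0; apply: colon_sm.
exists y => //; split=> // z Uz Wz yz'; apply: (mX _ _ yz'); exists z; split=> //.
exact: subset_trans uy yz'.
Qed.

Lemma maxann_prime y : maxann y -> is_prime (colon y).
Proof.
move=> [Uy Wy my]; have [sU sW WU] := pUW; split; first exact: colon_sm.
  by rewrite /colon /= scale1r.
move=> a b hab; have [|nb] := pselect (colon y b); [by right|left].
apply: (my (b *: y)) => //; first exact: submodZ.
- by move=> c hc; rewrite /colon /= scalerA mulrC -scalerA; apply: submodZ.
by rewrite /colon /= scalerA.
Qed.

Lemma colon_inter (P : set R^o) (ys : seq V) : is_prime P ->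
  (forall a, (forall y, y \in ys -> colon y a) -> P a) -> exists2 y, y \in ys & colon y `<=` P.
Proof.
move=> [sP P1 hP]; elim: ys => [|y ys IH] h; first by case: P1; apply: h.
have [|] := pselect (colon y `<=` P); first by exists y; rewrite ?mem_head.
move=> /existsNP[b /not_implyP[yb Pb]].
have [|z zs hz] := IH; last by exists z => //; rewrite inE zs orbT.
move=> a ha; suff /hP[//|] : P (a * b : R) by [].
apply: h => z; rewrite inE => /orP[/eqP->|/ha hz].
  exact: (idealM _ (colon_sm y)).
exact: (idealMl _ (colon_sm z)).
Qed.

(** The submodule spanned by all elements with maximal annihilator is generated by finitely many of
    them. The intersection of their annihilators lies in the prime annihilator of any other such y,
    so one of them does, and maximality gives equality. *)
Lemma assoc_primes : exists ys : seq V, (forall y, y \in ys -> maxann y) /\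
  forall u, U u -> ~ W u -> exists2 y, y \in ys & colon u `<=` colon y.
Proof.
have [sU sW WU] := pUW.
pose X : set V := [set x | exists2 ys, forall y, y \in ys -> maxann y & wspan W ys x].
have sX : submodule X.
  split; first by exists [::] => //=; apply: submod0.
  move=> a x y [ys h1 h2] [zs h3 h4]; exists (ys ++ zs).
    by move=> z; rewrite mem_cat => /orP[/h1|/h3].
  rewrite wspan_cat; have sz := submodule_wspan zs sW; have syz := submodule_wspan ys sz.
  by apply: syz.2; [apply: wspan_mono h2; apply: wspan_sub|apply: wspan_sub].
have [//|||vs [v1 v2]] := nUW (X := X).
- by move=> w Ww; exists [::].
- by move=> x [ys h1]; apply: wspan_min => // y /h1[].
have [ys hys hv] : exists2 ys, forall y, y \in ys -> maxann y &
    forall v, v \in vs -> wspan W ys v.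
  elim: vs v2 {v1} => [|v vs IH] h; first by exists [::].
  have [|zs h3 h4] := IH; first by move=> w ws; apply: h; rewrite inE ws orbT.
  have [ys h1 h2] := h v (mem_head _ _); exists (ys ++ zs).
    by move=> z; rewrite mem_cat => /orP[/h1|/h3].
  move=> w; rewrite wspan_cat inE => /orP[/eqP->|/h4]; last exact: wspan_sub.
  by apply: wspan_mono h2; apply: wspan_sub.
exists ys; split=> // u Uu Wu; have [y my uy] := maxann_exists Uu Wu.
have sys := submodule_wspan ys sW.
have hy : wspan W ys y.
  apply: (wspan_min sys (@wspan_sub _ _ _ _) hv); apply: v1; exists [:: y].
    by move=> z; rewrite inE => /eqP->.
  by apply: wspan_mem => //; rewrite mem_head.
have [|z zs hz] := colon_inter (ys := ys) (maxann_prime my).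
  move=> a ha; have sa : submodule [set v : V | W (a *: v)].
    split=> [|b v w hv' hw]; first by rewrite /= scaler0; apply: submod0.
    rewrite /= scalerDr scalerA mulrC -scalerA; apply: submodD => //.
    exact: submodZ.
  by apply: (wspan_min sa _ ha hy) => w Ww; apply: submodZ.
exists z => //; apply: subset_trans uy _; have [Uy Wy _] := my.
by have [_ _ h] := hys z zs; apply: h.
Qed.
End AssociatedPrimes.

Section FilterRegular.
Variables (R : comNzRingType) (n : set R^o) (nR : noeth R) (lR : locring n).

(** T is the n-power torsion of U / W. No annihilator prime of U / T contains n, and an x outside
    these primes has its kernel inside T, which is nilpotent by Noetherianity. *)
Lemma freg_step (V : lmodType R) (U W : set V) : pair U W -> noeP U W ->
  exists Ts, (forall P, ins P Ts -> is_prime P /\ ~ n `<=` P) /\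
    forall x, n x -> (forall P, ins P Ts -> ~ P x) -> @pnil R n V (tor x U W) W.
Proof.
move=> pUW nUW; have [sU sW WU] := pUW; have [sn n1 hn] := lR.
pose T := [set u | U u /\ forall x, n x -> exists k, W (x ^+ k *: u)].
have sT : submodule T.
  split; first by split; [exact: submod0|move=> x _; exists 0%N; rewrite scaler0; apply: submod0].
  move=> a u v [Uu hu] [Uv hv]; split; first exact: sU.2.
  move=> x nx; have [k hk] := hu x nx; have [l hl] := hv x nx; exists (k + l)%N.
  rewrite scalerDr scalerA mulrC -scalerA; apply: sW.2.
    by rewrite addnC exprD -scalerA; apply: submodZ.
  by rewrite exprD -scalerA; apply: submodZ.
have pUT : pair U T by split=> // u [].
have WT : W `<=` T.
  by move=> w Ww; split=> [|x _]; [apply: WU|exists 0%N; apply: submodZ].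
have [ys [h1 h2]] := assoc_primes nR pUT (noeP_sub WT (@subset_refl _ _) nUW).
exists (map (colon T) ys); split.
  move=> P hP; have [y yys ->] : exists2 y, y \in ys & P = colon T y.
    elim: (ys) hP => //= y zs IH [->|/IH[z zzs ->]]; first by exists y; rewrite ?mem_head.
    by exists z; rewrite // inE zzs orbT.
  have my := h1 y yys; split; first exact: maxann_prime pUT _ my.
  have [Uy Ty _] := my; move=> hn'; apply: Ty; split=> // x nx.
  have [_ /(_ x nx)[k hk]] := hn' x nx; exists (k + 1)%N.
  by rewrite exprD expr1 -scalerA.
move=> x nx xP y ny.
have TxT : tor x U W `<=` T.
  move=> u [Uu hu]; apply: contrapT => Tu; have [z zys uz] := h2 u Uu Tu.
  apply: (xP (colon T z)); last by apply: uz; apply: WT.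
  elim: (ys) zys => //= z' zs IH; rewrite inE => /orP[/eqP->|/IH]; by [left|right].
have [|i u [Uu hu]|K hK] := noeP_stab (c := fun k => tor (y ^+ k) U W) sW nUW.
- by move=> k; split; [exact: submodule_tor|exact: sub_tor|exact: tor_sub].
- by split=> //; rewrite exprS -scalerA; apply: submodZ.
exists K => u /TxT[Uu hu]; have [k hk] := hu y ny.
by have [] := hK k u (conj Uu hk).
Qed.

Lemma sop_freg j (V : lmodType R) (a : set R^o) (U W : set V) : submodule a -> a `<=` n ->
  ~ pchain j.+1 a -> pair U W -> noeP U W ->
  exists s : seq R, [/\ size s = j, forall x, x \in s -> n x,
    prim n (wspan a (s : seq R^o)) & @freg R n s V U W].
Proof.
have [sn n1 hn] := lR.
elim: j a W => [|j IH] a W sa an nc pUW nUW.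
  by exists [::]; split=> //; apply: sop_base.
have [Ts [hT hx]] := freg_step pUW nUW.
have [|x [nx xT nc']] := sop_step nR lR (Ts := Ts) sa nc; first by move=> P /hT[].
have sx : submodule (wspan a [:: (x : R^o)]) by apply: submodule_wspan.
have xn : wspan a [:: (x : R^o)] `<=` n.
  by apply: wspan_min => // t; rewrite inE => /eqP->.
have [|s [sz ns ps fs]] := IH _ (simg x U W) sx xn nc' (pair_simg x pUW).
  by apply: noeP_sub nUW => //; apply: sub_simg.
exists (x :: s); split.
- by rewrite /= sz.
- by move=> z; rewrite inE => /orP[/eqP->|/ns].
- apply: prim_mono ps; rewrite -wspan_cat.
  have sp := submodule_wspan (x :: s : seq R^o) sa.
  apply: (wspan_min sp (@wspan_sub _ _ _ _)) => z; rewrite mem_cat inE => zs.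
  by apply: wspan_mem => //; rewrite inE orbC.
by split=> //; apply: hx => // P PT; have [_ nP] := hT P PT; apply: xT.
Qed.
End FilterRegular.

(** * Modules with rank *)

Section Ideals.
Variables (R : comNzRingType).

Section Pack.
Variables (I : set R^o) (sI : submodule I) (I1 : ~ I 1).
Definition ideal_pred : {pred R} := fun x => `[< I x >].
Fact ideal_pred_closed : idealr_closed ideal_pred.
Proof.
split=> [||a x y]; rewrite !unfold_in.
- by apply/asboolP; apply: (submod0 sI).
- by apply/negP => /asboolP.
by move=> /asboolP Ix /asboolP Iy; apply/asboolP; apply: sI.2.
Qed.
HB.instance Definition _ := isIdealr.Build R ideal_pred ideal_pred_closed.
Definition mk_ideal : idealr R := ideal_pred.
Lemma mem_ideal x : x \in mk_ideal <-> I x.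
Proof. by split=> [/asboolP|h]; [|apply/asboolP]. Qed.
End Pack.

Section PackPrime.
Variables (P : set R^o) (pP : is_prime P).
Definition prime_pred : {pred R} := fun x => `[< P x >].
Fact prime_pred_ideal : idealr_closed prime_pred.
Proof. by have [sP P1 _] := pP; exact: ideal_pred_closed. Qed.
Fact prime_pred_closed : prime_idealr_closed prime_pred.
Proof.
have [_ _ hP] := pP; move=> u v; rewrite !unfold_in => /asboolP/hP h.
by apply/orP; case: h => h; [left|right]; apply/asboolP.
Qed.
HB.instance Definition _ := isIdealr.Build R prime_pred prime_pred_ideal.
HB.instance Definition _ := isPrimeIdealrClosed.Build R prime_pred prime_pred_closed.
Definition mk_prime : prime_idealr R := prime_pred.
Lemma mem_prime x : x \in mk_prime <-> P x.
Proof. by split=> [/asboolP|h]; [|apply/asboolP]. Qed.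
End PackPrime.

Definition pset (P : prime_idealr R) : set R^o := [set x : R^o | (x : R) \in P].
Lemma pset_prime (P : prime_idealr R) : is_prime (pset P).
Proof.
split; first exact: (ideal_set_submod P).
  by rewrite /pset /= idealr1.
by move=> x y; rewrite /pset /= prime_idealrM => /orP.
Qed.
End Ideals.

Section LocalBasis.
Variables (R : comNzRingType) (M : lmodType R) (r : nat).
Implicit Types (P : set R^o) (e : 'I_r -> M).

Definition comb e (b : 'rV[R]_r) : M := \sum_l b 0 l *: e l.
Lemma comb_linear e : linear (comb e).
Proof.
move=> a x y; rewrite /comb scaler_sumr -big_split /=; apply: eq_bigr => l _.
by rewrite !mxE scalerDl scalerA.
Qed.

(* e becomes a basis of M after localizing at P *)
Definition loc_basis P e :=
  (forall b, comb e b = 0 -> exists2 u : R, ~ P u & u *: b = 0) /\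
  forall y, exists2 u : R, ~ P u & exists b, u *: y = comb e b.

Lemma prime_common P (I : finType) (Q : R -> I -> Prop) : is_prime P ->
  (forall u v i, Q u i -> Q (v * u) i) -> (forall i, exists u, ~ P u /\ Q u i) ->
  exists2 u, ~ P u & forall i, Q u i.
Proof.
move=> pP hQ /choice[f hf]; exists (\prod_i f i).
  by apply: prime_prod => // i; have [] := hf i.
move=> i; rewrite (bigD1 i) //= mulrC; apply: hQ; by have [] := hf i.
Qed.

Lemma comb_delta e (c : R) l : comb e (c *: delta_mx 0 l) = c *: e l.
Proof.
rewrite /comb (bigD1 l) //= !mxE !eqxx mulr1 big1 ?addr0 // => k kl.
by rewrite !mxE (negbTE kl) andbF mulr0 scale0r.
Qed.

Section Fractions.
Variables (P : prime_idealr R).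
Local Notation fr1 x := (frac x (denom1 P)).
Lemma fr1D (V : lmodType R) (x y : V) : fr1 (x + y) = fr1 x + fr1 y.
Proof. by rewrite fracD; apply: frac_ext; rewrite denomME /= !scale1r mulr1 scale1r. Qed.
Lemma fr10 (V : lmodType R) : fr1 (0 : V) = 0. Proof. by []. Qed.
Lemma fracE (V : lmodType R) (x : V) (s : denom P) :
  frac x s = (frac (1 : R^o) s : loc_ring P) *: fr1 x.
Proof.
rewrite -[RHS]/(loc_scale _ _) loc_scaleE scale1r; apply: frac_ext.
by rewrite denomME /= mulr1.
Qed.
Lemma fr1Z (V : lmodType R) (c : R) (x : V) :
  (fr1 (c : R^o) : loc_ring P) *: fr1 x = fr1 (c *: x).
Proof.
by rewrite -[LHS]/(loc_scale _ _) loc_scaleE; apply: frac_ext; rewrite denomME /= mulr1.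
Qed.
Lemma frac0P (V : lmodType R) (x : V) (s : denom P) :
  frac x s = 0 <-> exists2 u : R, ~ pset P u & u *: x = 0.
Proof.
split=> [|[u uP ux]].
  move=> /(frac_eqP x s 0 (denom1 P))[u]; rewrite /= !scaler0 scale1r => h.
  by exists (denom_val u) => //; apply/negP/(denomP u).
apply/(frac_eqP x s 0 (denom1 P)); have /negP u' := uP; exists (Denom u').
by rewrite /= !scaler0 scale1r.
Qed.
End Fractions.

(** The numerators of the preimages of the standard basis work, as denominators are units at P. *)
Lemma has_rank_basis (P : prime_idealr R) : has_rank M r -> associated_prime P ->
  exists e, loc_basis (pset P) e.
Proof.
move=> hr aP; have [f fbij] := hr P aP; have [g fK gK] := fbij.
have pP := pset_prime P; have [sP P1 hP] := pP.
have gl : linear g.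
  by move=> a x y; apply: (can_inj fK); rewrite gK linearP !gK.
pose q l := fracP (g (delta_mx 0 l)).
pose e l := (sval (q l)).1; pose s l := (sval (q l)).2.
have ge l : g (delta_mx 0 l) = frac (e l) (s l) by rewrite (svalP (q l)).
have sn (t : denom P) : ~ pset P (denom_val t) by apply/negP/(denomP t).
exists e; split.
  move=> b b0.
  pose c l : loc_ring P := frac (b 0 l * denom_val (s l) : R^o) (denom1 P).
  have z : \sum_l c l *: g (delta_mx 0 l) = 0.
    transitivity (frac (comb e b) (denom1 P)); last by rewrite b0.
    rewrite /comb (big_morph (fun x => frac x (denom1 P)) (@fr1D P M) (fr10 P M)).
    apply: eq_bigr => l _; rewrite ge -[LHS]/(loc_scale _ _) loc_scaleE; apply: frac_ext.
    by rewrite denomME /= mul1r scale1r scalerA mulrC.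
  have {}z : \row_l c l = 0.
    transitivity (f (\sum_l c l *: g (delta_mx 0 l))); last by rewrite z linear0.
    rewrite [LHS]row_sum_delta linear_sum; apply: eq_bigr => l _.
    by rewrite linearZ /= gK mxE.
  have hc l : exists u, ~ pset P u /\ u * b 0 l = 0.
    move/rowP: z => /(_ l); rewrite !mxE => /frac0P[u uP ub].
    exists (u * denom_val (s l)); split; first by move=> /hP[|/sn].
    by rewrite -mulrA [X in u * X]mulrC.
  have [|u uP hu] := prime_common (Q := fun u l => u * b 0 l = 0) pP _ hc.
    by move=> u v l h; rewrite -mulrA h mulr0.
  by exists u => //; apply/rowP => l; rewrite !mxE hu.
move=> y; pose T (z : loc_module P M) := exists b t, z = frac (comb e b) t.
have T0 : T 0 by exists 0, (denom1 P); rewrite (linfun0 (@comb_linear e)).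
have TD z z' : T z -> T z' -> T (z + z').
  move=> [b [t ->]] [b' [t' ->]]; exists (denom_val t' *: b + denom_val t *: b'), (denomM t t').
  by rewrite fracD (linfunD (@comb_linear e)) !(linfunZ (@comb_linear e)).
have : T (frac y (denom1 P)).
  rewrite -[frac y _]fK [f _]row_sum_delta (linfun_sum gl); elim/big_ind: _ => // l _.
  rewrite (linfunZ gl) ge; have [[c t] ->] := fracP (f (frac y (denom1 P)) 0 l).
  exists (c *: delta_mx 0 l), (denomM t (s l)).
  by rewrite -[LHS]/(loc_scale _ _) loc_scaleE comb_delta.
move=> [b [t /frac_eqP[u]]]; rewrite /= scale1r => h.
exists (denom_val u * denom_val t); first by move=> /hP[/sn|/sn].
by exists (denom_val u *: b); rewrite (linfunZ (@comb_linear e)) -h scalerA.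
Qed.

Lemma det_cong (P : set R^o) (X Y : 'M[R]_r) : is_prime P ->
  (forall i j, P (X i j - Y i j : R)) -> P (\det X - \det Y : R).
Proof.
move=> [sP _ _] h.
have PD (a b a' b' : R) : P (a - b : R) -> P (a' - b' : R) -> P (a + a' - (b + b') : R).
  by move=> h1 h2; rewrite opprD addrACA; apply: (submodD sP).
have PM (a b a' b' : R) : P (a - b : R) -> P (a' - b' : R) -> P (a * a' - b * b' : R).
  move=> h1 h2; rewrite (_ : _ - _ = a' * (a - b) + b * (a' - b')); last by ring.
  by apply: (submodD sP); apply: idealM.
have PR (a : R) : P (a - a : R) by rewrite subrr; apply: sP.1.
apply: (big_ind2 (fun a b : R => P (a - b : R))) => // p _; apply: (PM _ _ _ _) => //.
apply: (big_ind2 (fun a b : R => P (a - b : R))); [exact: PR|exact: PM|].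
by move=> i _; apply: h.
Qed.

(** After clearing a denominator t, the new vectors are expressed through e by a matrix congruent to
    t u times the identity modulo P, whose determinant is outside P. *)
Lemma loc_basis_perturb (P : set R^o) e e' (u w : R) : is_prime P -> loc_basis P e ->
  ~ P u -> P w -> loc_basis P (fun l => u *: e l + w *: e' l).
Proof.
move=> pP [e1 e2] uP wP; have [sP P1 hP] := pP.
have [|t tP ht] := prime_common (Q := fun t l => exists b, t *: e' l = comb e b) pP _
    (fun l => let: ex_intro2 t h1 h2 := e2 (e' l) in ex_intro _ t (conj h1 h2)).
  by move=> a v l [b hb]; exists (v *: b); rewrite -scalerA hb (linfunZ (@comb_linear e)).
have [T hT] := choice ht.
pose B : 'M[R]_r := \matrix_l ((t * u) *: delta_mx 0 l + w *: T l).
set e2' := fun l => _.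
have eB b : t *: comb e2' b = comb e (b *m B).
  rewrite mulmx_sum_row (linfun_sum (@comb_linear e)) {1}/comb scaler_sumr.
  apply: eq_bigr => l _; rewrite rowK (linfunZ (@comb_linear e)) (linfunD (@comb_linear e)).
  rewrite comb_delta (linfunZ (@comb_linear e)) -hT /e2' !scalerDr !scalerA.
  by congr (_ *: _ + _ *: _); ring.
have dB : ~ P (\det B : R).
  move=> h; have := det_cong (X := B) (Y := (t * u)%:M) pP.
  rewrite det_scalar => hc; have /(prime_exp pP)/hP[] // : P ((t * u) ^+ r : R).
  apply: (submod_subr sP (hc _) h) => i j; rewrite !mxE.
  rewrite (_ : _ - _ = w * T i 0 j); first exact: idealMl.
  rewrite eqxx /= [j == i]eq_sym.
  by case: (i == j); rewrite /= !(mulr1n, mulr0n, mulr1, mulr0, subr0, add0r) //; ring.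
split.
  move=> b hb; have [|v vP hv] := e1 (b *m B); first by rewrite -eB hb scaler0.
  exists (v * \det B); first by move=> /hP[].
  have e3 : \det B *: b = (b *m B) *m \adj B by rewrite -mulmxA mul_mx_adj mul_mx_scalar.
  by rewrite -scalerA e3 scalemxAl hv mul0mx.
move=> y; have [v vP [b hb]] := e2 y.
exists (v * \det B); first by move=> /hP[].
exists (t *: (b *m \adj B)).
rewrite (linfunZ (@comb_linear e2')) eB -mulmxA mul_adj_mx mul_mx_scalar (linfunZ (@comb_linear e)).
by rewrite -hb !scalerA; congr (_ *: _); ring.
Qed.

Lemma loc_basis_eq (P Q : set R^o) e : P `<=` Q -> Q `<=` P -> loc_basis P e -> loc_basis Q e.
Proof. by move=> PQ QP; have -> : P = Q by apply/seteqP. Qed.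

(* Bases at finitely many pairwise incomparable primes are glued by prime avoidance. *)
Lemma loc_basis_glue (Ps : seq (set R^o)) :
  (forall P, ins P Ps -> is_prime P /\ exists e, loc_basis P e) ->
  (forall P Q, ins P Ps -> ins Q Ps -> P `<=` Q -> Q `<=` P) ->
  exists e, forall P, ins P Ps -> loc_basis P e.
Proof.
elim: Ps => [|P Ps IH] hP hmax; first by exists (fun=> 0).
have [||e he] := IH; [by move=> Q h; apply: hP; right| |].
  by move=> Q Q' h h'; apply: hmax; right.
have [pP [e' he']] := hP P (or_introl erefl); have [sP P1 mP] := pP.
have [[Q [hQ PQ]]|nQ] := pselect (exists Q, ins Q Ps /\ P `<=` Q).
  have QP : Q `<=` P by apply: hmax PQ; [left|right].
  by exists e => P' [->|h]; [apply: loc_basis_eq QP PQ (he Q hQ)|apply: he].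
(* w lies in P and outside the other primes, u below in the other primes and outside P: at each
   prime one summand of u e' + w e is the basis and the other a perturbation. *)
have [|w [wP hw]] := prime_avoid (Ps := Ps) sP; first by move=> Q h; have [] := hP Q (or_intror h).
have [u uP hu] : exists2 u : R, ~ P u & forall Q, ins Q Ps -> Q u.
  have : forall Q, ins Q Ps -> ~ Q `<=` P.
    move=> Q h QP; apply: nQ; exists Q; split=> //; apply: hmax QP; [by right|by left].
  have : forall Q, ins Q Ps -> is_prime Q by move=> Q h; have [] := hP Q (or_intror h).
  elim: (Ps) => [|Q Qs IHQ] h1 h2; first by exists 1.
  have [||u uP hu] := IHQ; [by move=> Q' h; apply: h1; right|by move=> Q' h; apply: h2; right|].
  have /existsNP[v /not_implyP[Qv Pv]] := h2 Q (or_introl erefl).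
  exists (u * v); first by move=> /mP[].
  move=> Q' [->|h]; first by have [sQ _ _] := h1 Q (or_introl erefl); apply: idealM.
  by have [sQ _ _] := h1 Q' (or_intror h); apply: idealMl => //; apply: hu.
exists (fun l => u *: e' l + w *: e l) => Q [->|h].
  exact: loc_basis_perturb.
have -> : (fun l => u *: e' l + w *: e l) = (fun l => w *: e l + u *: e' l).
  by apply/funext => l; rewrite addrC.
have [pQ _] := hP Q (or_intror h).
apply: (loc_basis_perturb _ pQ (he Q h)); last exact: hu.
by apply: hw => // PQ; apply: nQ; exists Q.
Qed.
End LocalBasis.

Section RankMul.
Variables (A : comNzRingType) (nA : noeth A) (n : set A^o) (lA : locring n).
Variables (M : lmodType A) (r : nat).
Hypotheses (fM : fin_gen M) (rM : has_rank M r).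

Lemma assoc_of_maxann (y : A) : @maxann A A^o [set: A^o] [set 0] y ->
  exists e : 'I_r -> M, loc_basis (colon [set 0] (y : A^o)) e.
Proof.
move=> my; have p0 : pair [set: A^o] ([set 0] : set A^o) := pairT A^o.
have pP := maxann_prime p0 my.
have [|e he] := has_rank_basis (P := mk_prime pP) rM.
  by exists y => a; apply: mem_prime.
exists e; apply: loc_basis_eq he => a; [exact: (mem_prime pP a).1|exact: (mem_prime pP a).2].
Qed.

(** Bases at the maximal annihilator primes are glued. An element vanishing at all of these primes
    is zero, whence independence. The ideal multiplying M into the span lies in none of them, so by
    avoidance it contains a nonzerodivisor c. *)
Lemma rank_embed : exists (e : 'I_r -> M) (c : A), [/\ forall b, comb e b = 0 -> b = 0,
  forall a : A, c * a = 0 -> a = 0 & forall y, exists b, c *: y = comb e b].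
Proof.
have p0 : pair [set: A^o] ([set 0] : set A^o) := pairT A^o.
have [ys [h1 h2]] := assoc_primes nA p0 nA.
pose Ps := map (fun y : A^o => colon [set 0] y) ys.
have insP P : ins P Ps -> exists2 y, y \in ys & P = colon [set 0] y.
  rewrite /Ps; elim: (ys) => //= y zs IH [->|/IH[z zzs ->]]; first by exists y; rewrite ?mem_head.
  by exists z; rewrite // inE zzs orbT.
have Pins y : y \in ys -> ins (colon [set 0] y) Ps.
  by rewrite /Ps; elim: (ys) => //= z zs IH; rewrite inE => /orP[/eqP->|/IH]; [left|right].
have [||e he] := @loc_basis_glue A M r Ps.
- move=> P /insP[y /h1 my ->]; split; first exact: (maxann_prime p0 my).
  exact: assoc_of_maxann.
- move=> P Q /insP[y /h1[_ _ my] ->] /insP[z /h1[_ nz _] ->] h.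
  exact: my.
have ass (a : A) : a <> 0 -> exists2 P, ins P Ps & forall u : A, u * a = 0 -> P u.
  move=> a0; have [y yys hy] := h2 (a : A^o) I a0.
  by exists (colon [set 0] y); [exact: Pins|exact: hy].
have cl := @comb_linear A M r e.
pose J : set A^o := [set t : A^o | forall y, exists b, (t : A) *: y = comb e b].
have sJ : submodule J.
  split; first by move=> y; exists 0; rewrite scale0r (linfun0 cl).
  move=> a x y hx hy z; have [b hb] := hx z; have [b' hb'] := hy z; exists (a *: b + b').
  by rewrite (linfunD cl) (linfunZ cl) -hb -hb' scalerDl scalerA.
have hP P : ins P Ps -> is_prime P by move=> /insP[y /h1 my ->]; exact: (maxann_prime p0 my).
have [c [Jc hc]] := prime_avoid sJ hP; exists e, c; split=> //.
  move=> b hb; apply/rowP => l; rewrite mxE; apply: contrapT => bl.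
  have [P hPs hu] := ass _ bl; have [e1 _] := he P hPs; have [u uP ub] := e1 b hb.
  by apply: uP; apply: hu; move/rowP: ub => /(_ l); rewrite !mxE.
move=> a ca; apply: contrapT => a0; have [P hPs hu] := ass a a0.
apply: (hc P hPs) (hu c ca) => JP; have pP := hP P hPs; have [sP P1 mP] := pP.
have [k [v hv]] := fM; have [_ e2] := he P hPs.
have [|u uP ub] := prime_common (Q := fun t (j : 'I_k) => exists b, t *: v j = comb e b) pP _
    (fun j => let: ex_intro2 t h1 h2 := e2 (v j) in ex_intro _ t (conj h1 h2)).
  by move=> x y j [b hb]; exists (y *: b); rewrite -scalerA hb (linfunZ cl).
apply: uP; apply: JP => y; have [x ->] := hv y; have [b hb] := choice ub.
exists (\sum_j x j *: b j); rewrite (linfun_sum cl) scaler_sumr; apply: eq_bigr => j _.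
by rewrite (linfunZ cl) -hb scalerA mulrC scalerA.
Qed.

Variable s : seq A.
Hypothesis ps : prim n (wspan ([set 0] : set A^o) (s : seq A^o)).
Notation mulA := (@mul A A^o s).

Lemma mul_cyclic_step (V : lmodType A) (W : set V) (v : V) : submodule W ->
  mul s (wspan W [:: v]) W = mulA [set: A^o] [set a : A^o | W ((a : A) *: v)].
Proof.
move=> sW; apply/esym/(mul_iso (f := fun a : A^o => (a : A) *: v)).
- by move=> a x y; rewrite scalerDl scalerA.
- split=> //; have p : pair (wspan W [:: v]) W.
    by split=> //; [exact: submodule_wspan|exact: wspan_sub].
  exact: (colon_sm p).
- by split=> //; [exact: submodule_wspan|exact: wspan_sub].
split.
- move=> _ [a _ <-]; exists a; rewrite subrr; exact: submod0.
- by move=> _ [a ca <-].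
- by move=> a _.
by move=> u [a ha]; exists a.
Qed.

(** A / cA has [mul] zero because cA is isomorphic to A. It splits into A / I and I / cA, whose
    multiplicities have the same sign, so both vanish. *)
Lemma mul_faithful0 (c : A) (I : set A^o) : (forall a : A, c * a = 0 -> a = 0) ->
  submodule I -> I c -> mulA [set: A^o] I = 0.
Proof.
move=> hc sI Ic.
have sc : submodule [set a : A^o | exists b : A, a = b * c].
  split; first by exists 0; rewrite mul0r.
  by move=> a _ _ [b ->] [b' ->]; exists (a * b + b'); rewrite mulrDl -mulrA.
set C := [set a | _] in sc; have s0 := @submodule0 A A^o; have sT := @submoduleT A A^o.
have zC : [set 0] `<=` C by move=> _ ->; exists 0; rewrite mul0r.
have CI : C `<=` I by move=> _ [b ->]; apply: idealM.
have gT : @good A A^o s [set: A^o] [set 0].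
  by apply: (good_noe lA nA ps) => b u -> _; rewrite scale0r.
have eC : mulA [set: A^o] C = 0.
  have := mul_add sT sc s0 zC (@subsetT _ _) gT.
  suff -> : mulA C [set 0] = mulA [set: A^o] [set 0].
    by move=> h; apply: (addIr (mulA [set: A^o] [set 0])); rewrite add0r -h.
  apply/esym/(mul_iso (f := fun a : A^o => (a : A) * c : A^o)).
  - by move=> a x y; rewrite mulrDl -[a *: x]/(a * x) -mulrA.
  - exact: pairT.
  - by split.
  split=> //.
  - by move=> _ [a _ <-]; exists a.
  - by move=> _ [_ -> <-]; rewrite mul0r.
  - by move=> a _ h; apply: hc; rewrite mulrC.
  by move=> _ [b ->]; exists b => //; rewrite subrr.
have nT : @noeP A A^o [set: A^o] [set 0] := nA.
have g1 : @good A A^o s [set: A^o] C by apply: good_sub gT.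
have h0 := mul_add sT sI sc CI (@subsetT _ _) g1; rewrite eC in h0.
have zI : [set 0] `<=` I by apply: subset_trans CI.
have h1 := noe_mul_ge0 (s := s) (And3 sT sI (@subsetT _ I)) (noeP_sub zI (@subset_refl _ _) nT) (good_sub zI (@subset_refl _ _) gT).
have h2 := noe_mul_ge0 (s := s) (And3 sI sc CI) (noeP_sub zC (@subsetT _ I) nT) (good_sub zC (@subsetT _ I) gT).
have gen (x y : int) : 0 = x + y -> 0 <= (-1) ^+ size s * x -> 0 <= (-1) ^+ size s * y -> x = 0.
  by rewrite -signr_odd; case: odd; rewrite ?expr1 ?expr0 ?mulN1r ?mul1r; lia.
exact: gen h0 h1 h2.
Qed.

(** M modulo the free submodule F is filtered by cyclic modules killed by the nonzerodivisor c, and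
    F by r copies of A. *)
Lemma rank_mul : mul s [set: M] [set 0] = r%:Z * mulA [set: A^o] [set 0].
Proof.
have [e [c [h1 h2 h3]]] := rank_embed; have cl := @comb_linear A M r e.
have s0 := @submodule0 A M; have sT := @submoduleT A M.
pose F := wspan [set 0] [seq e l | l <- enum 'I_r]; have sF : submodule F by apply: submodule_wspan.
have gT : good s [set: M] [set 0].
  by apply: (good_noe lA (noeP_fg nA fM) ps) => b u -> _; rewrite scale0r.
have zF : [set 0] `<=` F by apply: wspan_sub.
have FP x : F x <-> exists b, x = comb e b.
  apply: iff_trans (wspan_sum _ _ s0) _; split=> -[b hb].
    exists (\row_l b l); apply/eqP; rewrite -subr_eq0; apply/eqP; rewrite -[RHS]hb; congr (_ - _).
    by apply: eq_bigr => l _; rewrite mxE.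
  by exists (b 0); rewrite hb; apply: subrr.
have q0 : mul s [set: M] F = 0.
  have [k [v hv]] := fM; have eT : [set: M] = wspan F [seq v j | j <- enum 'I_k].
    apply/seteqP; split=> // x _; apply: (wspan_sum _ _ sF).2.
    by have [b ->] := hv x; exists b; rewrite subrr; apply: submod0.
  have gF : good s (wspan F [seq v j | j <- enum 'I_k]) F by apply: good_sub gT.
  rewrite eT; elim: {eT}[seq v j | j <- _] gF => [|x xs IH] gF; first exact: mulxx.
  have sx := submodule_wspan xs sF; have sxx := submodule_wspan (x :: xs) sF.
  have sub : wspan F xs `<=` wspan F (x :: xs) by move=> u hu; exists 0; rewrite scale0r subr0.
  rewrite (mul_add sxx sx sF (@wspan_sub _ _ _ _) sub gF) IH ?addr0; last exact: good_sub gF.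
  rewrite -[wspan F _]/(wspan (wspan F xs) [:: x]) mul_cyclic_step //.
  apply: (mul_faithful0 h2); last by apply: wspan_sub; apply/FP; apply: h3.
  by have p : pair [set: M] (wspan F xs) by []; exact: (colon_sm p).
rewrite (mul_add sT sF s0 zF (@subsetT _ F) gT) q0 add0r /F.
have supp (l : seq 'I_r) x : wspan [set 0] [seq e j | j <- l] x ->
    exists b, x = comb e b /\ forall j, j \notin l -> b 0 j = 0.
  elim: l x => [|j l IH] x; first by move=> ->; exists 0; rewrite (linfun0 cl); split=> // j; rewrite mxE.
  move=> [a /IH[b [hb b0]]]; exists (b + a *: delta_mx 0 j); split.
    by rewrite (linfunD cl) comb_delta -hb subrK.
  move=> k; rewrite inE negb_or => /andP[kj kl].
  by rewrite !mxE b0 // eqxx /= (negbTE kj) mulr0 addr0.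
suff gen (l : seq 'I_r) : uniq l -> mul s (wspan [set 0] [seq e j | j <- l]) [set 0] =
    (size l)%:Z * mulA [set: A^o] [set 0].
  by rewrite gen ?enum_uniq // size_enum_ord.
elim: l => [|j l IH] /=; first by rewrite mulxx // mul0r.
move=> /andP[jl ul]; have sl := submodule_wspan [seq e j | j <- l] s0.
have sjl := submodule_wspan [seq e j | j <- j :: l] s0.
have sub : wspan [set 0] [seq e j | j <- l] `<=` wspan [set 0] [seq e j | j <- j :: l].
  by move=> u hu; exists 0; rewrite scale0r subr0.
rewrite (mul_add sjl sl s0 (@wspan_sub _ _ _ _) sub); last exact: good_sub gT.
rewrite IH // -[wspan _ [seq _ | _ <- _ :: _]]/(wspan (wspan [set 0] [seq e j | j <- l]) [:: e j]).
rewrite mul_cyclic_step // -addn1 PoszD mulrDl mul1r addrC; congr (_ + mulA _ _).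
apply/seteqP; split=> [a /supp[b [hb b0]]|_ ->]; last by rewrite /= scale0r; apply: submod0.
have : comb e (b - a *: delta_mx 0 j) = 0 by rewrite (linfunB cl) -hb comb_delta subrr.
move=> /h1/rowP/(_ j); rewrite !mxE !eqxx b0 // mulr1 sub0r => /eqP.
by rewrite oppr_eq0 => /eqP.
Qed.
End RankMul.

(** * Dimension *)

Section Conversions.

Lemma noeth_of (R : comNzRingType) : noetherian R -> noeth R.
Proof.
move=> nR X sX _ _; have [X1|X1] := pselect (X 1).
  exists [:: 1]; split=> [x Xx|v]; last by rewrite inE => /eqP->.
  by exists x; rewrite -[x *: 1]/(x * 1) mulr1 subrr.
have [k [v hv]] := nR (mk_ideal sX X1).
exists [seq v i | i <- enum 'I_k]; split.
  move=> x /(mem_ideal sX X1)/hv[c ->]; apply: (wspan_sum _ _ (@submodule0 R R^o)).2.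
  by exists c; rewrite subrr.
move=> _ /mapP[i _ ->]; apply/(mem_ideal sX X1)/hv; exists (fun j => (j == i)%:R).
rewrite (bigD1 i) //= eqxx scale1r big1 ?addr0 // => j /negbTE->.
by rewrite scale0r.
Qed.

Lemma locring_of (R : comNzRingType) (m : idealr R) : noeth R -> local_ring m ->
  locring (ideal_set m).
Proof.
move=> nR lR; split; [exact: ideal_set_submod|by rewrite /ideal_set /= idealr1|].
move=> x mx; apply: contrapT => hx.
pose X0 : set R^o := [set a : R^o | exists b : R, a = b * x].
have [||X [[sX X1 Xx] mX]] := noe_max (F := [set X : set R^o | [/\ submodule X, ~ X 1 & X x]]) (X0 := X0)
  (@submodule0 R R^o) nR.
- split; [split| |by exists 1; rewrite mul1r].
  + by exists 0; rewrite mul0r.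
  + by move=> a _ _ [b ->] [b' ->]; exists (a * b + b'); rewrite mulrDl -mulrA.
  + by move=> [b e]; apply: hx; exists b.
- by move=> X [sX _ _]; split=> // _ ->; apply: submod0.
apply: mx; suff /lR h : maximal_ideal (mk_ideal sX X1).
  by rewrite /ideal_set /= -h; apply/(mem_ideal sX X1).
move=> J XJ; have sJ := ideal_set_submod J.
have JX : ideal_set J `<=` X.
  apply: mX; first split=> //.
  - by rewrite /ideal_set /= idealr1.
  - by apply: XJ; apply/(mem_ideal sX X1).
  by move=> y Xy; apply: XJ; apply/(mem_ideal sX X1).
by move=> y /JX Xy; apply/(mem_ideal sX X1).
Qed.

Lemma local_of (R : comNzRingType) (m : idealr R) : locring (ideal_set m) -> local_ring m.
Proof.
move=> lR; have [sm m1 hm] := lR; have sub (I : idealr R) : {subset I <= m}.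
  move=> x Ix; apply: (proper_sub lR (ideal_set_submod I)) Ix.
  by rewrite /ideal_set /= idealr1.
move=> I; split=> [hI x|e J IJ x Jx]; last by rewrite e; apply: (sub J x).
by apply/idP/idP; [exact: (sub I x)|exact: (hI m (sub I) x)].
Qed.

Lemma pchain_prime_chain (R : comNzRingType) k : pchain k ([set 0] : set R^o) <-> prime_chain R k.
Proof.
split=> [[Q [pQ _ hQ]]|[P hP]].
  exists (fun i => mk_prime (pQ i)) => i /hQ[h1 h2]; split.
    by move=> x /mem_prime/h1 h; apply/mem_prime.
  by move=> h; apply: h2 => x Qx; apply/(mem_prime (pQ i)); apply: h; apply/mem_prime.
exists (fun i => pset (P i)); split=> [i|_ ->|i /hP[h1 h2]]; first exact: pset_prime.
  exact: (idealr0 (P 0%N)).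
by split.
Qed.

Lemma pchain_le (R : comNzRingType) k l (a : set R^o) : (k <= l)%N -> pchain l a -> pchain k a.
Proof. by move=> kl [Q [h1 h2 h3]]; exists Q; split=> // i ik; apply: h3; apply: leq_trans ik kl. Qed.

Section Quotients.
Variables (R : comNzRingType) (Q : prime_idealr R).
Definition qpi (x : R) : {ideal_quot Q} := \pi_({ideal_quot Q})%qT x.
Lemma qpi_rmorph : [/\ forall x y, qpi (x - y) = qpi x - qpi y,
  forall x y, qpi (x * y) = qpi x * qpi y & qpi 1 = 1].
Proof. by split=> [x y|x y|]; rewrite /qpi ?rmorphB ?rmorphM ?rmorph1. Qed.
Lemma qpi0 x : qpi x = 0 <-> x \in Q.
Proof.
have <- : qpi 0 = 0 by have [h _ _] := qpi_rmorph; rewrite -[in LHS](subrr 0) h subrr.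
have -> : (x \in Q) = (x - 0 \in Q) by rewrite subr0.
by rewrite /qpi Quotient.idealrBE; split=> /eqP.
Qed.

Lemma quo_prime_chain k : prime_chain {ideal_quot Q} k -> pchain k (pset Q).
Proof.
have [hB hM h1] := qpi_rmorph.
move=> [P hP]; exists (fun i => [set x : R^o | qpi x \in P i]).
have surj (y : {ideal_quot Q}) : exists x, qpi x = y by exists (repr y); exact: reprK.
split=> [i|x Qx|i /hP[s1 s2]].
- split; [split| |].
  + by rewrite /= (qpi0 0).2 ?idealr0.
  + move=> a x y /= hx hy; rewrite -[a *: x]/(a * x) -[X in _ + X]opprK hB -[- y]sub0r hB hM.
    rewrite (qpi0 0).2 ?idealr0 // sub0r opprK; apply: (rpredD (S := P i)) => //.
    exact: idealMr.
  + by rewrite /= h1 idealr1.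
  by move=> x y; rewrite /= hM prime_idealrM => /orP.
- by rewrite /= (qpi0 x).2 ?idealr0.
split; first by move=> x; apply: s1.
by move=> h; apply: s2 => y; have [x <-] := surj y; apply: h.
Qed.

Lemma quo_prime_chain0 : prime_chain {ideal_quot Q} 0.
Proof.
apply/pchain_prime_chain; exists (fun=> [set 0]); split=> // _; split.
- exact: submodule0.
- by move=> /eqP; rewrite oner_eq0.
by move=> x y /Quotient.rquot_IdomainAxiom/orP[]/eqP; [left|right].
Qed.
End Quotients.

Lemma prime_chain_le (R : comNzRingType) k l : (k <= l)%N -> prime_chain R l -> prime_chain R k.
Proof. by move=> kl /pchain_prime_chain/(pchain_le kl)/pchain_prime_chain. Qed.

Lemma nat_supP (S : set nat) k : nat_sup S = Some k -> is_greatest S k.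
Proof. by rewrite /nat_sup; case: pselect => // ex; case: (cid ex) => l hl /= [<-]. Qed.

(** The equation may also say that both suprema are infinite: if [S'] missed k it would be bounded,
    its supremum finite, and S would be bounded by an element of [S']. *)
Lemma nat_sup_transfer (S S' : set nat) k : (forall i j, (i <= j)%N -> S j -> S i) ->
  (forall i j, (i <= j)%N -> S' j -> S' i) -> S' 0%N -> nat_sup S' = nat_sup S -> S k -> S' k.
Proof.
move=> dS dS' S0 e Sk; apply: contrapT => nk.
have [l hl] : exists l, is_greatest S' l.
  apply: (greatest_exists (n := k)) => // i Si; apply: contrapT => ik.
  by apply: nk; apply: dS' Si; lia.
have [Sl' _] := hl.
have [Sl gl] : is_greatest S l by apply: nat_supP; rewrite -e; apply: nat_supE.
by apply: nk; apply: (dS' _ l) => //; exact: gl.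
Qed.

Lemma krull_dim_pchain (R : comNzRingType) d : krull_dim R = Some d ->
  pchain d ([set 0] : set R^o) /\ ~ pchain d.+1 ([set 0] : set R^o).
Proof.
move=> /nat_supP[h1 h2]; split; first exact/pchain_prime_chain.
by move=> /pchain_prime_chain/h2; rewrite ltnn.
Qed.

Lemma unmixed_pchain (A : comNzRingType) (m : idealr A) d : unmixed m ->
  pchain d ([set 0] : set (completion m)^o) ->
  forall (Q : set (completion m)^o) (w : completion m), is_prime Q ->
  (forall b, Q b <-> b * w = 0) -> pchain d Q.
Proof.
move=> um hd Q w pQ hQ.
have /um e : associated_prime (mk_prime pQ).
  by exists w => b; apply: iff_trans (hQ b); apply: mem_prime.
have eQ : pset (mk_prime pQ) = Q.
  by apply/seteqP; split=> b; [move=> /(mem_prime pQ)|move=> h; apply/(mem_prime pQ)].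
rewrite -eQ; apply: quo_prime_chain.
apply: (nat_sup_transfer (@prime_chain_le _) (@prime_chain_le _) _ e).
  exact: quo_prime_chain0.
exact/pchain_prime_chain.
Qed.
End Conversions.

(** * Finite injective dimension and the Cohen-Macaulay property *)

Section Vanishing.
Variables (A : comNzRingType) (m : idealr A).
Local Notation n := (ideal_set m).
Hypotheses (lA : locring n) (nA : noeth A).

Section Module.
Variables (M : lmodType A) (N : nat).
Hypothesis fM : fin_gen M.
Local Notation Cs i := (iter i (@cosyz A) M).
Hypothesis socN : forall i, (N < i)%N -> forall v : Cs i, Eann n v -> v = 0.

Lemma res_vanish i : (N < i)%N -> forall v : Cs i, v = 0.
Proof.
have hC : forall c, submodule c -> forall i, @lifts A (Cs (i + N)) c.
  (* From degree N + 1 on the socles are zero, so for the residue field there is nothing to lift. *)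
  apply: (lifts_all nA lA (C := fun i => Cs (i + N))) => // [j c|j y hy].
    exact: fg_ext_iter.
  exists 0; split; first by move=> a _; exact: scaler0.
  rewrite (linfun0 (@hpi_lin _ _)); apply/esym/(socN (i := (j + N).+1)) => //.
  by rewrite ltnS leq_addl.
move=> Ni; have [j ->] : exists j, i = (j + N).+1 by exists (i - N.+1)%N; lia.
exact: (lifts_hull (fun c sc => hC c sc j)).
Qed.

Lemma hull_triv (V : lmodType A) : (forall v : V, v = 0) -> forall x : hullT V, x = 0.
Proof.
move=> V0 x; apply: contrapT => x0; have [hl _ _ eV] := hullP V.
have [a [[v _ ev] na]] := eV x I x0; apply: na.
by rewrite -ev (V0 v) (linfun0 hl).
Qed.

Lemma res_injdim : finite_injdim M.
Proof.
exists N, (fun i => hullT (Cs i)), (fun i => mk_linear (@res_lin A M i)),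
  (mk_linear (@hull_lin A M)); split.
- by move=> i; apply: baer_injective; apply: hull_baer.
- by move=> i Ni; apply: hull_triv; apply: res_vanish.
- move=> x y e; apply/eqP; rewrite -subr_eq0; apply/eqP; apply: hull_inj.
  by rewrite (linfunB (@hull_lin A M)); move: e => /= ->; rewrite subrr.
- move=> x; apply: iff_trans (@res_cd0 A M 0 x) _.
  by split=> -[v e]; exists v.
move=> i x; apply: iff_trans (@res_cd0 A M i.+1 x) _; split=> [[v <-]|[y ->]].
  by have [w <-] := hpi_surj v; exists w.
by exists (hpi y).
Qed.
End Module.

(** The long exact sequence of multiplication by x on A / c: if Ext^1 and Ext^2 vanish on A / c,
    then Ext^2 vanishes on A / (c + (x)). *)
Lemma lifts_reg (V : lmodType A) (c : set A^o) (x : A) : submodule c ->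
  (forall b, c (b * x : A) -> c b) -> lifts V c -> lifts (cosyz V) c ->
  lifts (cosyz V) (wspan c [:: x : A^o]).
Proof.
move=> sc hc h1 h2 y hy; have [cy xy] := Eann_mem sc hy.
have hl := @hull_lin A (cosyz V); have pl := @hpi_lin A (cosyz V); have pl' := @hpi_lin A V.
have [w [cw ew]] := h2 y cy.
have [u eu] : exists u, hull_in u = x *: w by apply/hpi0; rewrite (linfunZ pl) ew.
have cu : Eann c u.
  move=> a ca; apply: hull_inj; rewrite (linfunZ hl) eu scalerA mulrC -scalerA cw //.
  exact: scaler0.
have [v [cv ev]] := h1 u cu.
have hv (b : A) : c (b * x : A) -> b *: v = 0 by move=> /hc; apply: cv.
have [v' [_ xv cv']] := baer_solve (submoduleT _) (@hull_baer A V) sc I hv.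
exists (w - hull_in (hpi v')); split; last by rewrite (linfunB pl) hpi_in subr0.
apply: Eann_add.
  apply: (submodB (Eann_sm _ _)) => //; apply: (Eann_lin hl).
  exact: (Eann_lin pl').
by rewrite scalerBr -(linfunZ hl) -(linfunZ pl') xv ev eu subrr.
Qed.

(** The residue field k embeds in A / c through y0. As V has injective dimension at most 1,
    Ext^1(A/c, V) maps onto Ext^1(k, V), which is the socle of the cosyzygy. *)
Lemma lifts_top (V : lmodType A) (c : set A^o) (y0 : A) : submodule c -> ~ c y0 ->
  (forall t, n t -> c (t * y0 : A)) -> lifts V c -> (forall v : cosyz (cosyz V), v = 0) ->
  forall v : cosyz V, Eann n v -> v = 0.
Proof.
move=> sc cy0 hy0 h top v nv; have [sn n1 hn] := lA.
have hl := @hull_lin A (cosyz V); have pl := @hpi_lin A V.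
have hv (b : A) : c (b * y0 : A) -> b *: hull_in v = 0.
  move=> cb; apply: (Eann_lin hl nv); apply: contrapT => /hn[y yb]; apply: cy0.
  by rewrite -[y0]mul1r -yb -mulrA; apply: idealM.
have [z [_ yz cz]] := baer_solve (submoduleT _) (@hull_baer A (cosyz V)) sc I hv.
have [z' ez] : exists z', hull_in z' = z by apply/hpi0; apply: top.
have [w [cw ew]] : exists w : hullT V, Eann c w /\ hpi w = z'.
  by apply: h => a ca; apply: hull_inj; rewrite (linfunZ hl) ez; apply: cz.
have ev : y0 *: z' = v.
  by apply/eqP; rewrite -subr_eq0; apply/eqP; apply: hull_inj; rewrite (linfunB hl) (linfunZ hl) ez yz subrr.
rewrite -ev -ew -(linfunZ pl); apply/hpi0/(soc_hull lA) => t nt.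
by rewrite scalerA; apply: cw; apply: hy0.
Qed.

(** An ideal maximal among those above c that avoid the multiplicative set of the x^i u with u
    outside Q is prime. *)
Lemma prime_between (c Q : set A^o) (x : A) : submodule c -> is_prime Q ->
  (forall i (u : A), ~ Q u -> ~ c (x ^+ i * u : A)) ->
  exists P, [/\ is_prime P, c `<=` P, P `<=` Q & ~ P x].
Proof.
move=> sc [sQ Q1 mQ] hc.
have [||P [[sP cP hP] mP]] := noe_max (F := [set X : set A^o | [/\ submodule X, c `<=` X &
    forall i (u : A), ~ Q u -> ~ X (x ^+ i * u : A)]]) (X0 := c) (@submodule0 A A^o) nA.
- by split.
- by move=> X [sX _ _]; split=> // _ ->; apply: submod0.
have big (a : A) : ~ P a -> exists i (u b : A), ~ Q u /\ P (x ^+ i * u - b * a : A).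
  move=> Pa; apply: contrapT => no; apply: Pa.
  apply: (mP (wspan P [:: a : A^o])); [split| |by apply: wspan_mem; rewrite ?mem_head].
  - exact: submodule_wspan.
  - by apply: subset_trans cP _; apply: wspan_sub.
  - by move=> i u Qu [b hb]; apply: no; exists i, u, b.
  exact: wspan_sub.
exists P; split=> //; last 1 first.
- by move=> Px; apply: (hP 1%N 1 Q1); rewrite expr1 mulr1.
- split=> // [P1|a b Pab]; first by apply: (hP 0%N 1 Q1); rewrite expr0 mulr1.
  apply: contrapT => /not_orP[/big[i [u [a' [Qu hu]]]] /big[j [v [b' [Qv hv]]]]].
  apply: (hP (i + j)%N (u * v)); first by move=> /mQ[].
  rewrite (_ : _ * _ = x ^+ j * v * (x ^+ i * u - a' * a) + a' * a * (x ^+ j * v - b' * b) + a' * b' * (a * b)).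
    by apply: (submodD sP); [apply: (submodD sP)|]; apply: idealM.
  by rewrite exprD; ring.
by move=> u Pu; apply: contrapT => Qu; apply: (hP 0%N u Qu); rewrite expr0 mul1r.
Qed.

Section RegularSequences.
Variable a : nat -> A.
Definition reg_ideal i : set A^o := [set x : A^o | spans (fun j : 'I_i => a j : A^o) x].

Lemma reg_ideal0 : reg_ideal 0 = [set 0].
Proof.
apply/seteqP; split=> [x [c ->]|_ ->]; first by rewrite big_ord0.
by exists (fun=> 0); rewrite big_ord0.
Qed.
Lemma reg_idealS i : reg_ideal i.+1 = wspan (reg_ideal i) [:: a i : A^o].
Proof.
apply/seteqP; split=> [x [c ->]|x [b [c hc]]].
  by exists (c ord_max), (fun j => c (widen_ord (leqnSn i) j)); rewrite big_ord_recr /= addrK.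
exists (fun j : 'I_i.+1 => if unlift ord_max j is Some k then c k else b).
rewrite big_ord_recr /= unlift_none; move/eqP: hc; rewrite subr_eq => /eqP->; congr (_ + _).
apply: eq_bigr => j _; have -> : widen_ord (leqnSn i) j = fintype.lift ord_max j.
  by apply: val_inj; rewrite /= /bump leqNgt ltn_ord.
by rewrite liftK.
Qed.
Lemma reg_ideal_submod i : submodule (reg_ideal i).
Proof.
elim: i => [|i IH]; first by rewrite reg_ideal0; apply: submodule0.
by rewrite reg_idealS; apply: submodule_wspan.
Qed.

Variable k : nat.
Hypothesis ra : regular_sequence m k a.

Lemma reg_idealP i : (i < k)%N -> forall b, reg_ideal i (b * a i : A) -> reg_ideal i b.
Proof. by move=> /ra[_ h] b; rewrite mulrC; apply: h. Qed.

Lemma reg_ideal_sub i : (i <= k)%N -> reg_ideal i `<=` n.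
Proof.
have [sn n1 _] := lA; elim: i => [|i IH] ik.
  by rewrite reg_ideal0 => _ ->; apply: submod0.
rewrite reg_idealS; apply: wspan_min => //; first by apply: IH; apply: ltnW.
by move=> x; rewrite inE => /eqP->; have [] := ra ik.
Qed.

(** A chain of primes over a regular sequence is lengthened downwards: dropping the last element,
    which is regular modulo the others, [prime_between] supplies a prime below Q 0 without that
    element. *)
Lemma reg_pchain j : (j <= k)%N -> pchain j (reg_ideal (k - j)).
Proof.
elim: j => [|j IH] jk.
  exists (fun=> n); split=> //; first by move=> _; apply: locring_prime.
  by apply: reg_ideal_sub; rewrite subn0.
have [Q [pQ cQ hQ]] := IH (ltnW jk).
have ek : (k - j = (k - j.+1).+1)%N by lia.
have ik : (k - j.+1 < k)%N by lia.
rewrite ek reg_idealS in cQ; have sc := reg_ideal_submod (k - j.+1).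
have cQ' : reg_ideal (k - j.+1) `<=` Q 0%N by apply: subset_trans cQ; apply: wspan_sub.
have [|P [pP cP PQ Px]] := prime_between (x := a (k - j.+1)) sc (pQ 0%N).
  move=> i u Qu; elim: i => [|i IHi]; first by rewrite expr0 mul1r => /cQ'.
  by rewrite exprS -mulrA mulrC => /(reg_idealP ik).
apply: (pchain_cons pP cP pQ PQ _ hQ) => h; apply/Px/h/cQ.
by apply: wspan_mem => //; rewrite mem_head.
Qed.

Lemma reg_lifts (M : lmodType A) i j : (j <= k)%N -> (j <= i)%N ->
  lifts (iter i (@cosyz A) M) (reg_ideal j).
Proof.
elim: j i => [|j IH] i jk ji.
  move=> y _; have [x <-] := hpi_surj y; exists x; split=> //.
  by rewrite reg_ideal0 => _ ->; exact: scale0r.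
case: i ji => // i ji; rewrite reg_idealS.
apply: (lifts_reg (reg_ideal_submod j) (reg_idealP jk)); first by apply: IH => //; apply: ltnW.
by apply: (IH i.+1); [apply: ltnW|apply: leqW].
Qed.
End RegularSequences.

(** If n contained no socle element modulo the sequence, prime avoidance over the annihilator primes
    would give one more regular element of n. *)
Lemma reg_extend (a : nat -> A) k : regular_sequence m k a ->
  ~ (exists b, regular_sequence m k.+1 b) ->
  exists y0, ~ reg_ideal a k y0 /\ forall t, n t -> reg_ideal a k (t * y0 : A).
Proof.
move=> ra max; have sc := reg_ideal_submod a k; have [sn n1 _] := lA.
have pc : pair [set: A^o] (reg_ideal a k) by split.
have nc : @noeP A A^o [set: A^o] (reg_ideal a k).
  by apply: noeP_sub nA => // _ ->; apply: submod0.
have [ys [h1 h2]] := assoc_primes nA pc nc.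
apply: contrapT => no; apply: max.
have hP P : ins P (map (colon (reg_ideal a k)) ys) -> is_prime P /\ ~ n `<=` P.
  move=> hP; have [y yys ->] : exists2 y, y \in ys & P = colon (reg_ideal a k) y.
    elim: (ys) hP => //= y zs IH [->|/IH[z zzs ->]]; first by exists y; rewrite ?mem_head.
    by exists z; rewrite // inE zzs orbT.
  have my := h1 y yys; split; first exact: (maxann_prime pc my).
  move=> nP; apply: no; exists y; split; first by have [] := my.
  by move=> t /nP.
have [|x [nx hx]] := prime_avoid (Ps := map (colon (reg_ideal a k)) ys) sn.
  by move=> P /hP[].
pose b j := if (j < k)%N then a j else x.
have eb i : (i <= k)%N -> (fun j : 'I_i => b j : A^o) = (fun j : 'I_i => a j : A^o).
  by move=> ik; apply/funext => j; rewrite /b (leq_trans (ltn_ord j) ik).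
exists b => i; rewrite ltnS => ik; rewrite eb //; move: ik; rewrite leq_eqVlt => /orP[/eqP->|ik].
  rewrite /b ltnn; split=> // u hu; apply: contrapT => nu.
  have [y yys hy] := h2 (u : A^o) I nu; have Py : ins (colon (reg_ideal a k) y) (map (colon (reg_ideal a k)) ys).
    elim: (ys) yys => //= z zs IH; rewrite inE => /orP[/eqP->|/IH]; by [left|right].
  by apply: (hx _ Py); [have [] := hP _ Py|apply: hy].
by rewrite /b ik; apply: ra.
Qed.
End Vanishing.

Section FirstHalf.
Variables (A : comNzRingType) (m : idealr A) (d : nat) (M : lmodType A) (r : nat).
Hypotheses (A_noetherian : noetherian A) (A_local : local_ring m)
  (A_unmixed : unmixed m) (dim_A : krull_dim A = Some d)
  (M_fin_gen : fin_gen M) (rank_M : has_rank M r) (r_ge1 : (1 <= r)%N).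
Variables (N mu : nat).
Hypotheses (dN : (d <= N)%N) (bass : bass_number m M N mu) (mu1 : (mu <= 1)%N).
Local Notation n := (ideal_set m).
Local Notation Cs i := (iter i (@cosyz A) M).

Let nA := noeth_of A_noetherian.
Let lA := locring_of nA A_local.

Lemma socle_facts : (forall i, (N < i)%N -> forall v : Cs i, Eann n v -> v = 0) /\
  exists v : Cs d, Eann n v /\ v <> 0.
Proof.
have [E mE] := matlis_exists lA nA; have [bE tE [s0 [s1 s2 s3]]] := mE.
have [pd npd] := krull_dim_pchain dim_A.
have [sn n1 _] := lA.
have zn : [set 0] `<=` n by move=> _ ->; apply: submod0.
have [s [sz ns ps fr]] := sop_freg nA lA (@submodule0 A A^o) zn npd (pairT M) (noeP_fg nA M_fin_gen).
have pos (f : E -> E) : linear f -> (exists e, f e <> 0) -> 0 < mul s (range f) [set 0].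
  move=> fl fe; apply: (range_mul_gt0 lA nA tE bE s1 s2 s3 ps ns _ fl fe).
  rewrite sz; apply: unmixed_pchain => //.
  exact: (hat_dim lA nA tE bE s1 s2 s3 pd).
have rM := rank_mul nA lA M_fin_gen rank_M ps.
have dN' : (size s <= N)%N by rewrite sz.
split; first exact: (soc_later lA nA mE M_fin_gen ns ps fr pos r_ge1 rM dN' (bass_soc lA bass) mu1).
have := soc_dim lA nA mE M_fin_gen ns ps fr pos r_ge1 rM; by rewrite sz.
Qed.

(** The last degree e with nonzero socle is the injective dimension of M; depth is compared with e,
    and e >= d. *)
Lemma top_socle : exists e, [/\ (d <= e)%N, forall i, (e < i)%N -> forall v : Cs i, v = 0 &
  exists v : Cs e, Eann n v /\ v <> 0].
Proof.
have [h1 h2] := socle_facts.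
pose S : set nat := [set i | exists j, (i <= j)%N /\ exists v : Cs j, Eann n v /\ v <> 0].
have [e [[j [ej hj]] max]] : exists e, is_greatest S e.
  apply: (greatest_exists (n := N)); first by exists d.
  move=> i [j [ij [v [nv v0]]]]; apply: leq_trans ij _; rewrite leqNgt; apply/negP => Nj.
  by apply: v0; apply: h1.
have je : (j <= e)%N by apply: max; exists j.
have {je ej} ej : e = j by lia.
subst j; exists e; split=> //; first by apply: max; exists d.
apply: (res_vanish lA nA M_fin_gen) => i ei v nv; apply: contrapT => v0.
suff : (i <= e)%N by rewrite leqNgt ei.
by apply: max; exists i; split=> //; exists v.
Qed.

Lemma injdim_finite : finite_injdim M.
Proof. by have [h _] := socle_facts; apply: (res_injdim lA nA M_fin_gen h). Qed.

Lemma cm : cohen_macaulay A.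
Proof.
exists m; split=> //; rewrite dim_A; apply: nat_supE.
have bound k : (exists a, regular_sequence m k a) -> (k <= d)%N.
  move=> [a ra]; have [_ npd] := krull_dim_pchain dim_A.
  rewrite leqNgt; apply/negP => dk; apply: npd; apply: (pchain_le dk).
  by have := reg_pchain lA nA ra (leqnn k); rewrite subnn reg_ideal0.
have [k [[a ra] max]] : exists k, is_greatest [set k | exists a, regular_sequence m k a] k.
  by apply: greatest_exists bound; exists (fun=> 0).
suff dk : (d <= k)%N.
  have ek : k = d by apply/eqP; rewrite eqn_leq dk bound //; exists a.
  by rewrite -ek; split=> //; exists a.
have [e [de top [v [nv v0]]]] := top_socle.
(* If k < e, Ext^e(A/(a), M) vanishes by [reg_lifts]. As the residue field embeds in A/(a), right
   exactness in the top degree e would kill the socle there. *)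
apply: leq_trans de _; rewrite leqNgt; apply/negP; case: e top v nv v0 => // e top v nv v0 ke.
have [|y0 [cy0 hy0]] := reg_extend lA nA ra.
  by move=> /max; rewrite ltnn.
apply: v0; apply: (lifts_top lA (reg_ideal_submod a k) cy0 hy0 _ _ nv).
  by apply: (reg_lifts ra).
exact: (top e.+2).
Qed.
End FirstHalf.

(** * Localization at a minimal prime *)

Section MinimalPrimes.
Variables (A : comNzRingType) (nA : noeth A) (P : set A^o).
Hypotheses (pP : is_prime P).
Hypothesis minP : forall Q : set A^o, is_prime Q -> Q `<=` P -> P `<=` Q.

Lemma min_prime_nil (x : A) : P x -> exists k (u : A), ~ P u /\ u * x ^+ k = 0.
Proof.
move=> Px; apply: contrapT => no.
have [|Q [pQ _ QP Qx]] := prime_between nA (x := x) (@submodule0 A A^o) pP.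
  by move=> k u Pu e; apply: no; exists k, u; rewrite mulrC.
by apply: Qx; apply: (minP pQ QP).
Qed.

(** A minimal prime is associated. Its generators are nilpotent at P, so treating them in turn gives
    w nonzero at P and killed by each up to an element outside P; a common factor u makes the
    annihilator exact. *)
Lemma min_prime_ann : exists w : A, forall a : A, P a <-> a * w = 0.
Proof.
have [sP P1 mP] := pP; have [vs [v1 v2]] := noeth_fg nA sP.
(* The highest power of x that keeps w nonzero at P. *)
have one (x : A) k (w : A) : (forall a : A, a * w = 0 -> P a) ->
    (exists u : A, ~ P u /\ u * x ^+ k * w = 0) ->
    exists j, (forall a : A, a * (x ^+ j * w) = 0 -> P a) /\
      exists u : A, ~ P u /\ u * x * (x ^+ j * w) = 0.
  elim: k w => [|k IH] w hw [u [Pu hu]].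
    by case: Pu; apply: hw; move: hu; rewrite expr0 mulr1.
  have [h|/existsNP[a /not_implyP[axw Pa]]] := pselect (forall a : A, a * (x * w) = 0 -> P a).
    have [|j [h1 h2]] := IH (x * w) h.
      by exists u; split=> //; rewrite -hu exprSr !mulrA.
    by exists j.+1; rewrite exprSr -mulrA.
  exists 0%N; rewrite expr0 mul1r; split=> //; exists a; split=> //.
  by rewrite -mulrA.
have [w [hw hv]] : exists w : A, (forall a : A, a * w = 0 -> P a) /\
    forall x : A, x \in (vs : seq A) -> exists u : A, ~ P u /\ u * x * w = 0.
  elim: vs v1 {v2} => [|x vs IH] h.
    by exists 1; split=> // a; rewrite mulr1 => ->; exact: (submod0 sP).
  have [|w [hw hv]] := IH; first by move=> y ys; apply: h; rewrite inE ys orbT.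
  have [k [u [Pu hu]]] := min_prime_nil (h x (mem_head _ _)).
  have [|j [h1 h2]] := one x k w hw; first by exists u; rewrite hu mul0r.
  exists (x ^+ j * w); split=> // y; rewrite inE => /orP[/eqP->|/hv[u' [Pu' hu']]] //.
  by exists u'; split=> //; rewrite mulrCA hu' mulr0.
have [u Pu hu] : exists2 u : A, ~ P u & forall x : A, x \in (vs : seq A) -> u * x * w = 0.
  elim: (vs : seq A) hv => [|x xs IH] h; first by exists 1.
  have [|u Pu hu] := IH; first by move=> y ys; apply: h; rewrite inE ys orbT.
  have [v [Pv hx]] := h x (mem_head _ _); exists (u * v); first by move=> /mP[].
  move=> y; rewrite inE => /orP[/eqP->|/hu e]; first by rewrite -!mulrA mulrA in hx *; rewrite -[RHS](mulr0 u) -hx !mulrA.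
  by rewrite -[RHS](mulr0 v) -e; ring.
exists (u * w) => a; split=> [/v2|].
  have sX : submodule ([set a : A^o | (a : A) * (u * w) = 0] : set A^o).
    split=> [|b x y hx hy]; first by rewrite /= mul0r.
    by rewrite /= mulrDl hy addr0 -[b *: x]/(b * x) -mulrA hx mulr0.
  apply: (wspan_min sX) => [_ ->|x /hu e]; first by rewrite /= mul0r.
  by rewrite /= -[RHS]e; ring.
by rewrite mulrA => /hw/mP[].
Qed.
End MinimalPrimes.

Section ZeroDimensional.
Variables (R : comNzRingType) (nR : noeth R) (n : set R^o) (lR : locring n) (y0 : R).
Hypotheses (nil_n : forall x : R, n x -> exists k, x ^+ k = 0).
Hypotheses (y0_neq0 : y0 <> 0) (y0_kill : forall t : R, n t -> t * y0 = 0).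
Variables (V I C : lmodType R) (i : V -> I) (p : I -> C).
Hypotheses (il : linear i) (pl : linear p) (bI : baer [set: I]) (bC : baer [set: C]).
Hypotheses (ii : forall v, i v = 0 -> v = 0) (pi0 : forall x, p x = 0 <-> exists v, i v = x).
Hypothesis p_surj : forall y, exists x, p x = y.

(* Over a ring of depth 0, a module of finite injective dimension is injective. *)
Lemma baer_kernel : baer [set: V].
Proof.
have [sn n1 hn] := lR.
apply: (lift_ann_baer il pl bI ii pi0); apply: (noeth_ind nR) => c sc IH.
have [c1|c1] := pselect (c 1).
  move=> y cy; exists 0; split; first by move=> a _; exact: scaler0.
  by rewrite (linfun0 pl) -[y]scale1r cy.
have cn := proper_sub lR sc c1.
have [nc|/existsNP[x /not_implyP[nx cx]]] := pselect (n `<=` c).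
  (* For c = n the residue field embeds in R by 1 -> y0. Injectivity of C gives z with y0 z = y, and
     y0 w lifts y when w lifts z. *)
  move=> y cy.
  have hy (b : R) : ([set 0] : set R^o) (b * y0 : R) -> b *: y = 0.
    move=> b0; apply: cy; apply: nc; apply: contrapT => /hn[z zb]; apply: y0_neq0.
    by rewrite -[y0]mul1r -zb -mulrA b0 mulr0.
  have [z [_ yz _]] := baer_solve (submoduleT _) bC (@submodule0 R R^o) Logic.I hy.
  have [w ew] := p_surj z; exists (y0 *: w); split; last by rewrite (linfunZ pl) ew.
  by move=> t /cn nt; rewrite scalerA y0_kill // scale0r.
have sx := submodule_wspan [:: x : R^o] sc.
(* c : x is strictly larger than c because x is nilpotent and c is proper. *)
apply: (lift_ann_ext pl bI (x := x) sc); apply: IH => //.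
- exact: colon_submod.
- by move=> a ca; apply: idealMl.
- move=> h; have [k xk] := nil_n nx; apply: c1.
  have : c (x ^+ k : R) by rewrite xk; exact: (submod0 sc).
  elim: k {xk} => // k IHk; rewrite exprSr => /h; exact: IHk.
- exact: wspan_sub.
by move=> h; apply/cx/h/wspan_mem; rewrite ?mem_head.
Qed.
End ZeroDimensional.

(** * Localizations of injective modules *)

Section LocalizedModules.
Variables (A : comNzRingType) (nA : noeth A) (P : prime_idealr A).
Local Notation L := (loc_ring P).

Section Map.
Variables (V W : lmodType A) (f : V -> W) (fl : linear f).
Definition loc_map (z : loc_module P V) : loc_module P W := frac (f (repr z).1) (repr z).2.
Lemma loc_mapE x s : loc_map (frac x s) = frac (f x) s.
Proof.
rewrite /loc_map; case E: (repr (frac x s)) => [x' s'] /=.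
have /frac_eqP[u e] : frac x s = frac x' s' by rewrite -[LHS]reprK E.
by apply/frac_eqP; exists u; rewrite -!(linfunZ fl) e.
Qed.
Lemma loc_map_lin : linear loc_map.
Proof.
move=> a z z'; have [[c t] ->] := fracP a; have [[x s] ->] := fracP z.
have [[y s'] ->] := fracP z'.
rewrite -[_ *: frac x s]/(loc_scale _ _) loc_scaleE fracD !loc_mapE.
rewrite -[_ *: frac (f x) s]/(loc_scale _ _) loc_scaleE fracD.
by rewrite (linfunD fl) !(linfunZ fl).
Qed.
End Map.

Definition ptor (V : lmodType A) : set V := [set v | exists2 u : A, ~ pset P u & u *: v = 0].
Arguments ptor : clear implicits.
Lemma ptor_submod V : submodule (ptor V).
Proof.
have [_ P1 mP] := pset_prime P; split; first by exists 1; rewrite ?scaler0.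
move=> a x y [u Pu ux] [v Pv vy]; exists (u * v); first by move=> /mP[].
have -> : (u * v) *: (a *: x + y) = (v * a) *: (u *: x) + u *: (v *: y).
  by rewrite scalerDr !scalerA; congr (_ *: _ + _); ring.
by rewrite ux vy !scaler0 addr0.
Qed.

(** The domain is finitely generated, so one u outside P kills all values, and the statement reduces
    to [baer_gam] for u. *)
Lemma ptor_baer (I : lmodType A) : baer [set: I] -> baer (ptor I).
Proof.
move=> bI G lG GT; have [G0 G1 G2] := lG; have [_ P1 mP] := pset_prime P.
pose D : set A^o := [set a | exists y, G a y].
have sD : submodule D.
  split; first by exists 0.
  by move=> a x x' [y Gy] [y' Gy']; exists (a *: y + y'); apply: G1.
have [vs [v1 v2]] := noeth_fg nA sD.
have [u Pu hu] : exists2 u : A, ~ pset P u & forall a, a \in vs -> exists2 y, G a y & u *: y = 0.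
  elim: vs v1 {v2} => [|a vs IH] h; first by exists 1.
  have [|u Pu hu] := IH; first by move=> b bs; apply: h; rewrite inE bs orbT.
  have [y Gy] := h a (mem_head _ _); have [v Pv vy] := GT _ _ Gy.
  exists (u * v) => [/mP[]//|b]; rewrite inE => /orP[/eqP->|/hu[z Gz uz]].
    by exists y; rewrite // -scalerA vy scaler0.
  by exists z; rewrite // mulrC -scalerA uz scaler0.
have Gu a y : G a y -> u *: y = 0.
  move=> Gay; have sX : submodule ([set a | exists2 y, G a y & u *: y = 0] : set A^o).
    split; first by exists 0; rewrite ?scaler0.
    move=> b x x' [z Gz uz] [z' Gz' uz']; exists (b *: z + z'); first exact: G1.
    by rewrite scalerDr scalerA mulrC -scalerA uz uz' scaler0 addr0.
  have [z Gz uz] : exists2 z, G a z & u *: z = 0.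
    have Da : D a by exists y.
    by apply: (wspan_min sX _ hu (v2 a Da)) => _ ->; exists 0; rewrite ?scaler0.
  by move: uz; rewrite (linrel_eq lG Gz Gay).
have [|w [[_ [k uw]] hw]] := baer_gam nA (x := u) (submoduleT I) bI lG.
  by move=> a y /Gu e; split=> //; exists 1%N; rewrite expr1.
exists w; split=> //; exists (u ^+ k) => //.
by move=> /(prime_exp (pset_prime P)).
Qed.

(** The kernel of I -> I_P is an injective summand with retraction [rho]. Every fraction has the
    same value on v and on v - rho v, and the kernel of [rho] injects into I_P; restricting to such
    representatives turns a partial map over A_P into a single-valued one over A. *)
Lemma loc_baer (I : lmodType A) : baer [set: I] -> @baer L (loc_module P I) setT.
Proof.
move=> bI G lG _; have [G0 G1 G2] := lG; have sT := ptor_submod I.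
have [||rho [rl rT hr]] := @baer_ext A I I (ptor I) (fun x y => ptor I x /\ y = x) sT (ptor_baer bI).
- split; first by split=> //; apply: submod0.
    by move=> a x y _ _ [Tx ->] [Ty ->]; split=> //; apply: sT.2.
  by move=> y [].
- by move=> x _ [Tx ->].
have rE v : ptor I v -> rho v = v by move=> Tv; rewrite -(hr v v).
have kill v : frac v (denom1 P) = 0 -> ptor I v by move=> /frac0P.
have sub v : frac (v - rho v) (denom1 P) = frac v (denom1 P).
  apply/frac_eqP; have [u Pu hu] := rT v; have /negP u' := Pu; exists (Denom u').
  by rewrite /= !scale1r scalerBr hu subr0.
have G1' (c a b : A) x y : G (frac (a : A^o) (denom1 P) : L) (frac x (denom1 P)) ->
    G (frac (b : A^o) (denom1 P) : L) (frac y (denom1 P)) ->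
    G (frac (c * a + b : A^o) (denom1 P) : L) (frac (c *: x + y) (denom1 P)).
  move=> h h'; have := G1 (frac (c : A^o) (denom1 P)) _ _ _ _ h h'.
  rewrite (fr1Z P c x) -fr1D.
  have -> : (frac (c : A^o) (denom1 P) : L) *: (frac (a : A^o) (denom1 P) : L^o) =
    frac (c * a : A^o) (denom1 P) by apply: (fr1Z P c (a : A^o)).
  by have -> // := @fr1D A P A^o (c * a) b.
have lG' : @linrel A A^o I (fun a v => G (frac (a : A^o) (denom1 P) : L) (frac v (denom1 P)) /\ rho v = 0).
  split; first by split; [exact: G0|exact: linfun0].
    move=> c a b x y [h e] [h' e']; split; first exact: G1'.
    by rewrite rl e e' scaler0 addr0.
  by move=> v [/G2/kill Tv e]; rewrite -(rE v Tv).
have [//|w [_ hw]] := bI _ lG'.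
exists (frac w (denom1 P)); split=> // z y; have [[a s] ->] := fracP z; have [[v t] ->] := fracP y.
move=> h /=.
have h1 : G (frac (denom_val t * a : A^o) (denom1 P) : L) (frac (denom_val s *: v) (denom1 P)).
  have := G1 (frac (denom_val s * denom_val t : A^o) (denom1 P)) _ _ _ _ h G0.
  rewrite !addr0 -[_ *: frac v t]/(loc_scale _ _) loc_scaleE.
  have -> : (frac (denom_val s * denom_val t : A^o) (denom1 P) : L) *: (frac a s : L^o) =
      frac (denom_val t * a : A^o) (denom1 P).
    rewrite -[LHS]/(loc_scale _ _) loc_scaleE; apply: frac_ext.
    rewrite denomME /= mul1r scale1r -[_ *: a]/(_ * _) -[denom_val s *: _]/(_ * _).
    by rewrite mulrA.
  congr (G _ _); apply: frac_ext.
  by rewrite denomME /= mul1r scale1r scalerA mulrC.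
have e1 : denom_val s *: v - rho (denom_val s *: v) = (denom_val t * a) *: w.
  apply: hw; rewrite sub; split=> //.
  by rewrite (linfunB rl) (rE (rho _)) ?subrr.
have [u Pu hu] := rT (denom_val s *: v); have /negP u' := Pu.
rewrite -[RHS]/(loc_scale _ _) loc_scaleE; apply/frac_eqP; exists (Denom u').
rewrite denomME /= mulr1 -[denom_val s *: v](subrK (rho (denom_val s *: v))) e1.
by rewrite scalerDr hu addr0 -scalerA.
Qed.
End LocalizedModules.

Section Gorenstein.
Variables (A : comNzRingType) (nA : noeth A) (A_noetherian : noetherian A).
Variable P : prime_idealr A.
Hypothesis minP : minimal_prime P.
Local Notation L := (loc_ring P).
Local Notation fr1 x := (frac x (denom1 P)).

Definition loc_max : set L^o := [set z : L^o | exists (x : A) (s : denom P), x \in P /\ z = frac (x : A^o) s].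

Lemma denomNP (t : denom P) : denom_val t \in P -> False.
Proof. by move=> h; have := denomP t; rewrite h. Qed.

Lemma loc_maxE (x : A) (s : denom P) : loc_max (frac (x : A^o) s) -> x \in P.
Proof.
move=> [y [t [yP /frac_eqP[u h]]]].
have e : denom_val u * (denom_val t * x) = denom_val u * (denom_val s * y) := h.
have : denom_val u * (denom_val t * x) \in P by rewrite e; apply: idealMr; apply: idealMr.
by rewrite !prime_idealrM => /orP[/denomNP|/orP[/denomNP|]].
Qed.

Lemma loc_locring : locring loc_max.
Proof.
have mulE (c x : A) (s t : denom P) : (frac (c : A^o) s : L) * (frac (x : A^o) t : L) = frac (c * x : A^o) (denomM s t).
  exact: loc_scaleE.
split.
- split; first by exists 0, (denom1 P); split=> //; apply: idealr0.
  move=> a _ _ [x [s [xP ->]]] [y [t [yP ->]]]; have [[c v] ->] := fracP a.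
  exists (denom_val t * (c * x) + denom_val (denomM v s) * y), (denomM (denomM v s) t); split.
    by apply: (rpredD (S := P)); do ?apply: idealMr.
  by rewrite -[_ *: _]/(_ * _) mulE -[RHS]/(frac (_ : A^o) _) -fracDr.
- by move=> /loc_maxE; rewrite idealr1.
move=> z; have [[x s] ->] := fracP z => hz.
have xP : x \notin P by apply/negP => xP; apply: hz; exists x, s.
exists (frac (denom_val s : A^o) (@Denom A P x xP)); rewrite mulE; apply: frac_ext.
by rewrite denomME /= scale1r mulrC -[RHS]/(_ * _) mulr1 mulrC.
Qed.
Lemma min_pset (Q : set A^o) : is_prime Q -> Q `<=` pset P -> pset P `<=` Q.
Proof.
move=> pQ QP x Px; apply/(mem_prime pQ); apply: (minP (Q := mk_prime pQ)) => //.
by move=> y /(mem_prime pQ)/QP.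
Qed.

Lemma loc_noetherian : noetherian L.
Proof.
move=> J; pose c : set A^o := [set x : A^o | (fr1 x : L) \in J].
have fM (a x : A) : (fr1 (a * x : A^o) : L) = (fr1 (a : A^o) : L) * (fr1 (x : A^o) : L).
  by apply/esym; exact: (fr1Z P a (x : A^o)).
have sc : submodule c.
  split; first exact: idealr0.
  move=> a x y hx hy; rewrite /c /= (@fr1D A P A^o) fM.
  by apply: (rpredD (S := J)) => //; apply: idealMr.
have c1 : ~ c 1 by move=> h; have := idealr1 J; rewrite -[1 \in J]/(_ : bool) h.
have [k [v hv]] := A_noetherian (mk_ideal sc c1).
exists k, (fun j => fr1 (v j) : L^o) => z; split; last first.
  move=> [b ->]; apply: (rpred_sum (S := J)) => j _; apply: idealMr.
  have /(mem_ideal sc c1) // : (v j : A) \in mk_ideal sc c1.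
  apply/hv; exists (fun l => (l == j)%:R); rewrite (bigD1 j) //= eqxx scale1r big1 ?addr0 //.
  by move=> l /negbTE->; rewrite scale0r.
have [[x s] ->] := fracP z => /= hz.
have : (x : A) \in mk_ideal sc c1.
  apply/(mem_ideal sc c1); rewrite /c /=.
  have -> : (fr1 x : L) = (fr1 (denom_val s : A^o) : L) * frac x s.
    rewrite -[RHS]/(loc_scale _ _) loc_scaleE; apply: frac_ext.
    by rewrite denomME /= mul1r scale1r.
  exact: idealMr.
move=> /hv[b ->]; exists (fun j => (frac (1 : A^o) s : L) * (fr1 (b j : A^o) : L)).
rewrite fracE (big_morph (fun x : A^o => fr1 x : L) (@fr1D A P A^o) (fr10 P A^o)).
rewrite scaler_sumr; apply: eq_bigr => j _.
by rewrite -scalerA; congr (_ *: _); exact: (esym (fr1Z P (b j) (v j))).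
Qed.

Lemma loc_max_nil (z : L) : loc_max z -> exists k, z ^+ k = 0.
Proof.
move=> [x [s [xP ->]]]; have [k [u [Pu hu]]] := min_prime_nil nA (pset_prime P) min_pset xP.
exists k; have e j : (fr1 (x : A^o) : L) ^+ j = fr1 (x ^+ j : A^o).
  elim: j => // j IH; rewrite exprS IH exprS; exact: (fr1Z P x (x ^+ j : A^o)).
have -> : (frac (x : A^o) s : L) = (frac (1 : A^o) s : L) * fr1 (x : A^o) by exact: fracE.
by rewrite exprMn e (_ : fr1 _ = 0) ?mulr0 //; apply/frac0P; exists u.
Qed.

(** Localizing the sequence of V, its hull and its cosyzygy meets the conditions of [baer_kernel]: P
    A_P is nil, and the image of w spans a copy of the residue field in A_P. *)
Lemma loc_hull_step (V : lmodType A) : @baer L (loc_module P (cosyz V)) setT ->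
  @baer L (loc_module P V) setT.
Proof.
move=> bC; have [w hw] := min_prime_ann nA (pset_prime P) min_pset.
have hl := @hull_lin A V; have pl := @hpi_lin A V.
apply: (@baer_kernel L (noeth_of loc_noetherian) loc_max loc_locring (fr1 (w : A^o) : L)
  loc_max_nil _ _ (loc_module P V) (loc_module P (hullT V)) (loc_module P (cosyz V))
  (loc_map (@hull_in A V)) (loc_map (@hpi A V))) => //.
- move=> /frac0P[u Pu uw]; apply: Pu; exact: (hw u).2.
- move=> _ [x [s [/hw xw ->]]]; rewrite -[LHS]/(loc_scale _ _) loc_scaleE.
  by rewrite -[x *: _]/(x * w) xw; apply/frac0P; exists 1; rewrite ?scaler0 // /pset /= idealr1.
- exact: loc_map_lin.
- exact: loc_map_lin.
- exact: (loc_baer nA (@hull_baer A V)).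
- move=> v; have [[x s] ->] := fracP v; rewrite loc_mapE // => /frac0P[u Pu ux].
  by apply/frac0P; exists u => //; apply: hull_inj; rewrite (linfunZ hl).
- move=> z; have [[x s] ->] := fracP z; rewrite loc_mapE //; split.
    move=> /frac0P[u Pu]; rewrite -(linfunZ pl) => /hpi0[v ev]; have /negP u' := Pu.
    exists (frac v (denomM (Denom u') s)); rewrite loc_mapE // ev; apply: frac_ext.
    by rewrite denomME /= scalerA mulrC.
  move=> [v]; have [[y t] ->] := fracP v; rewrite loc_mapE // => /frac_eqP[u /= e].
  apply/frac0P; exists (denom_val u * denom_val t).
    by rewrite /pset /= prime_idealrM => /orP[/denomNP|/denomNP].
  have : hpi (denom_val u *: (denom_val t *: x)) = 0 by rewrite -e !(linfunZ pl) hpi_in !scaler0.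
  by rewrite !(linfunZ pl) scalerA.
move=> z; have [[x s] ->] := fracP z; have [y <-] := hpi_surj x.
by exists (frac y s); rewrite loc_mapE.
Qed.

Variables (M : lmodType A) (N r : nat).
Hypotheses (top : forall i, (N < i)%N -> forall v : iter i (@cosyz A) M, v = 0).
Hypotheses (rank_M : has_rank M r) (r_ge1 : (1 <= r)%N).

Lemma loc_ring_baer : @baer L L^o setT.
Proof.
have bM j : @baer L (loc_module P (iter (N.+1 - j) (@cosyz A) M)) setT.
  elim: j => [|j IH].
    rewrite subn0 => G _ _; exists 0; split=> // a y _; rewrite scaler0.
    have [[x s] ->] := fracP y; rewrite (top (ltnSn N) x).
    by apply/frac0P; exists 1; rewrite ?scaler0 // /pset /= idealr1.
  (* The subtraction is truncated: for j > N both indices are 0. *)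
  have [jN|jN] := ltnP N j.
    by rewrite (_ : (N.+1 - j.+1 = N.+1 - j)%N) //; lia.
  apply: loc_hull_step; move: IH.
  by rewrite (_ : (N.+1 - j = (N.+1 - j.+1).+1)%N) //; lia.
have aP : associated_prime P.
  by have [w hw] := min_prime_ann nA (pset_prime P) min_pset; exists w.
have [f [g fK gK]] := rank_M aP; have := bM N.+1; rewrite subnn => b0.
have gl : linear g by move=> a x y; apply: (can_inj fK); rewrite gK linearP !gK.
pose i0 := Ordinal r_ge1.
(* A_P is a direct summand of M_P = A_P^r through the coordinate [i0], available since r >= 1. *)
apply: (@baer_retract L (loc_module P M) L^o setT setT (fun z => f z 0 i0) (fun a => g (a *: delta_mx 0 i0))) => //.
- by move=> a x y; rewrite linearP !mxE.
- by move=> a x y; rewrite -gl scalerA -scalerDl.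
by move=> a _; rewrite gK !mxE !eqxx mulr1.
Qed.

Lemma loc_gorenstein : gorenstein L.
Proof.
have [sm m1 hm] := loc_locring.
have lm : locring (ideal_set (mk_ideal sm m1)).
  suff -> : ideal_set (mk_ideal sm m1) = loc_max by exact: loc_locring.
  by apply/seteqP; split=> z; [move=> /(mem_ideal sm m1)|move=> h; apply/(mem_ideal sm m1)].
exists (mk_ideal sm m1); split; [exact: loc_noetherian|exact: local_of|].
pose Z : lmodType L := 'rV[L]_0.
have z0 (v : Z) : v = 0 by exact: triv0.
pose E i : lmodType L := if i is j.+1 then Z else L^o.
have zl i : linear (fun _ : E i => 0 : Z) by move=> a x y; rewrite scaler0 addr0.
exists 0%N, E, (fun i => mk_linear (zl i)), (mk_linear (@id_linear _ L^o)); split.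
- case=> [|i]; apply: baer_injective; first exact: loc_ring_baer.
  by move=> G _ _; exists 0; split=> // a y _; rewrite [y]z0 [RHS]z0.
- by case=> // i _ x; apply: z0.
- by move=> x y.
- by move=> x; split=> // _; exists x.
by move=> i x; split=> // _; exists 0; rewrite [x]z0 [RHS]z0.
Qed.
End Gorenstein.

Theorem theorem1p4 (A : comNzRingType) (m : idealr A) (d : nat)
    (M : lmodType A) (r : nat)
    (A_noetherian : noetherian A) (A_local : local_ring m)
    (A_unmixed : unmixed m) (dim_A : krull_dim A = Some d)
    (M_fin_gen : fin_gen M) (rank_M : has_rank M r) (r_ge1 : (1 <= r)%N)
    (bass_le1 : exists n, (d <= n)%N /\
       exists2 mu, bass_number m M n mu & (mu <= 1)%N) :
  [/\ finite_injdim M, cohen_macaulay A &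
    forall P : prime_idealr A, minimal_prime P -> gorenstein (loc_ring P)].
Proof.
have [N [dN [mu bass mu1]]] := bass_le1.
split.
- exact: (injdim_finite A_noetherian A_local A_unmixed dim_A M_fin_gen rank_M r_ge1 dN bass mu1).
- exact: (cm A_noetherian A_local A_unmixed dim_A M_fin_gen rank_M r_ge1 dN bass mu1).
move=> P minP.
have [e [_ top _]] := top_socle A_noetherian A_local A_unmixed dim_A M_fin_gen rank_M r_ge1 dN bass mu1.
exact: (loc_gorenstein (noeth_of A_noetherian) A_noetherian minP top rank_M r_ge1).
Qed.
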